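(* The family of sets of equilibria $\{\mathcal{E}_\varepsilon:\varepsilon\in[0,\varepsilon_0]\}$ is upper semicontinuous at $\varepsilon=0$; that is, $$\sup_{w_\varepsilon\in\mathcal{E}_\varepsilon}\ \inf_{w\in\mathcal{E}_0}\|w_\varepsilon-w\|_X\to0\quad\text{as }\varepsilon\to0.$$
   Context: Domain. $\Omega\subset\mathbb{R}^5$ is a bounded open set with smooth boundary $\Gamma=\partial\Omega$ and outward unit normal $\vec n$. For $0<\varepsilon\le\varepsilon_0$ ($\varepsilon_0>0$ fixed and sufficiently small), $\omega_\varepsilon=\{x-\sigma\vec n(x): x\in\Gamma,\ \sigma\in[0,\varepsilon)\}$ and $\chi_{\omega_\varepsilon}$ is its characteristic function. Hypotheses on $f,g$. $f,g:\mathbb{R}\to\mathbb{R}$ are $\mathcal{C}^2$ and there is $K>0$ such that, for $j=f$ and $j=g$, $|j(s)|+|j'(s)|+|j''(s)|\le K$ for all $s\in\mathbb{R}$, and $\limsup_{|s|\to\infty} j(s)/s\le 0$. Spaces. $Y=L^2(\Omega)$; $\varLambda u=\Delta^2u$ with domain $D(\varLambda)=\{u\in H^4(\Omega):\partial u/\partial\vec n=\partial(\Delta u)/\partial\vec n=0\text{ on }\Gamma\}$, a nonnegative self-adjoint operator in $Y$. For $\alpha\ge0$, $Y^\alpha=D(\varLambda^\alpha)$ with norm $\|\varLambda^\alpha\cdot\|_Y+\|\cdot\|_Y$, and $Y^{-\alpha}=(Y^\alpha)'$. In particular $Y^{1/2}=\{u\in H^2(\Omega):\partial u/\partial\vec n=0\text{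 on }\Gamma\}$ (its norm is equivalent to the $H^2$ norm) and $\varLambda^{1/2}=-\Delta$ on $Y^{1/2}$. Fix $s\in(\tfrac12,1]$, $H^{-s}(\Omega)=(H^s(\Omega))'$. Put $X=Y^{1/2}\times Y\times Y$, $\mathcal{H}=H^2(\Omega)\times H^{-s}(\Omega)\times L^2(\Omega)$, $X_{-1}=Y\times Y^{-1/2}\times Y^{-1/2}$. Linear operator. $\mathbb{A}(u,v,\theta)=(v,\,-\varLambda u-u+\varLambda^{1/2}\theta+\theta,\,-\varLambda^{1/2}v-v-\varLambda^{1/2}\theta-\theta)$ with domain $Y^1\times Y^{1/2}\times Y^{1/2}$ in $X$; the same symbol denotes its closed extension to $X_{-1}$ with domain $X$, where $\varLambda:Y^{1/2}\to Y^{-1/2}$ is $\langle\varLambda u,v\rangle=\int_\Omega\Delta u\,\Delta v\,dx$ and $\varLambda^{1/2}:Y\to Y^{-1/2}$ is $\langle\varLambda^{1/2}u,v\rangle=-\int_\Omega u\,\Delta v\,dx$. Nonlinearities. For $w=(u,v,\theta)\in X$: $F_\varepsilon(w)=(0,\ f_\Omega(u)+\tfrac1\varepsilon\chi_{\omega_\varepsilon}g_\Omega(u),\ 0)$ for $\varepsilon\in(0,\varepsilon_0]$ and $F_0(w)=(0,\ f_\Omega(u)+g_\Gamma(u),\ 0)$, as maps $X\to\mathcal{H}\subset X_{-1}$, where for $\varphi\in H^s(\Omega)$: $\langle f_\Omega(u),\varphi\rangle=\int_\Omega f(u)\varphi\,dx$, $\langle\tfrac1\varepsilon\chi_{\omega_\varepsilon}g_\Omega(u),\varphi\rangle=\tfrac1\varepsilon\int_{\omega_\varepsilon}g(u)\varphi\,dx$,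 $\langle g_\Gamma(u),\varphi\rangle=\int_\Gamma\gamma(g(u))\gamma(\varphi)\,dS$, with $\gamma$ the trace operator. Equilibria. For $\varepsilon\in[0,\varepsilon_0]$, $\mathcal{E}_\varepsilon=\{w\in X:\mathbb{A}w+F_\varepsilon(w)=0\}$, the equation being understood in $X_{-1}$. (Such $w$ have the form $(u,0,0)$, with $u$ a weak solution of $\Delta^2u+u=f(u)+\tfrac1\varepsilon\chi_{\omega_\varepsilon}g(u)$, $\partial_{\vec n}u=\partial_{\vec n}\Delta u=0$ if $\varepsilon>0$, and of $\Delta^2u+u=f(u)$, $\partial_{\vec n}u=0$, $\partial_{\vec n}\Delta u=-g(u)$ if $\varepsilon=0$.) *)

(* Defs.v *)
From HB Require Import structures.
From mathcomp Require Import all_boot all_order all_algebra.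
From mathcomp Require Import all_classical all_reals all_analysis.

Set Implicit Arguments.
Unset Strict Implicit.
Unset Printing Implicit Defensive.

Import Order.TTheory GRing.Theory Num.Theory.
Import numFieldNormedType.Exports.

Local Open Scope classical_set_scope.
Local Open Scope ring_scope.

Fact rV_display : measure_display. Proof. exact: default_measure_display. Qed.

(* The library puts no sigma-algebra on row vectors; the one generated by the
   coordinates is the Borel sigma-algebra. *)
Section measurable_rV.
Context {R : realType} (n : nat).

Let coor (i : 'I_n) (x : 'rV[R]_n) : R := x ord0 i.

Let rV_set0 : g_sigma_preimage coor set0.
Proof. exact: sigma_algebra0. Qed.

Let rV_setC A : g_sigma_preimage coor A -> g_sigma_preimage coor (~` A).
Proof. exact: sigma_algebraC. Qed.

Let rV_bigcup (F : (set 'rV[R]_n)^nat) :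
  (forall i, g_sigma_preimage coor (F i)) ->
  g_sigma_preimage coor (\bigcup_i (F i)).
Proof. exact: sigma_algebra_bigcup. Qed.

HB.instance Definition _ := @isMeasurable.Build rV_display
  'rV[R]_n (g_sigma_preimage coor) rV_set0 rV_setC rV_bigcup.

Lemma measurable_coord (i : 'I_n) :
  measurable_fun [set: 'rV[R]_n] (fun x : 'rV[R]_n => x ord0 i).
Proof.
move=> _ Y mY; rewrite setTI; apply: sub_sigma_algebra => /=.
rewrite -bigcup_seq/=; exists i => /=; first by rewrite mem_index_enum.
by exists Y => //; rewrite setTI.
Qed.

Lemma measurable_fun_rV d (T : measurableType d) (f : T -> 'rV[R]_n) :
  (forall i, measurable_fun [set: T] (fun t => f t ord0 i)) ->
  measurable_fun [set: T] f.
Proof.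
move=> mf.
suff H : g_sigma_preimage (fun i => coor i \o f) `<=` measurable.
  move=> _ A mA; apply: H; rewrite g_sigma_preimage_comp.
  by exists A.
apply: smallest_sub; first exact: sigma_algebra_measurable.
rewrite -bigcup_seq/=; apply: bigcup_sub => i _ A [B mB <-].
exact: mf.
Qed.

End measurable_rV.

(* The point of R^(n+1) whose i-th coordinate is t and whose other coordinates
   are, in order, those of y. *)
Definition insert_coord (R : realType) n (i : 'I_n.+1) (t : R) (y : 'rV[R]_n) :
  'rV[R]_n.+1 := \row_j oapp (y ord0) t (unlift i j).

Section lebesgue_rV.
Context {R : realType}.

Let ins n (p : R * 'rV[R]_n) : 'rV[R]_n.+1 := insert_coord ord0 p.1 p.2.

Let measurable_ins n : measurable_fun [set: R * 'rV[R]_n] (@ins n).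
Proof.
apply: measurable_fun_rV => j; rewrite /ins /insert_coord.
case: (unliftP ord0 j) => [k ->|->].
  under eq_fun do rewrite mxE liftK /=.
  by apply: (measurableT_comp (measurable_coord k)); exact: measurable_snd.
under eq_fun do rewrite mxE unlift_none /=.
exact: measurable_fst.
Qed.

Let ins_inv n (x : 'rV[R]_n.+1) : R * 'rV[R]_n :=
  (x ord0 ord0, \row_k x ord0 (lift ord0 k)).

Let insK n : cancel (@ins n) (@ins_inv n).
Proof.
move=> [t y]; rewrite /ins_inv /ins /insert_coord; congr (_, _).
  by rewrite mxE unlift_none.
by apply/rowP => k; rewrite !mxE liftK.
Qed.

Let measurable_ins_inv n : measurable_fun [set: 'rV[R]_n.+1] (@ins_inv n).
Proof.
apply/measurable_fun_pairP; split; first exact: measurable_coord.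
apply: measurable_fun_rV => k /=.
under eq_fun do rewrite mxE.
exact: measurable_coord.
Qed.

Section step.
Variables (n : nat) (m : {sigma_finite_measure set 'rV[R]_n -> \bar R}).

Let step : set 'rV[R]_n.+1 -> \bar R :=
  pushforward (lebesgue_measure \x m)%E (@ins n).

Let step0 : step set0 = 0%E.
Proof. by rewrite /step /pushforward preimage_set0 measure0. Qed.

Let step_ge0 A : (0 <= step A)%E.
Proof. exact: (measure_ge0 (lebesgue_measure \x m)%E). Qed.

Let step_sigma_additive : semi_sigma_additive step.
Proof.
have := @measure_semi_sigma_additive _ _ _
  (@measure_function_pushforward__canonical__measure_function_Measure
    _ _ _ _ _ (lebesgue_measure \x m)%E _ (@measurable_ins n)).
exact.
Qed.

HB.instance Definition _ := isMeasure.Build _ _ _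
  step step0 step_ge0 step_sigma_additive.

Let sigma_finite_step : sigma_finite setT step.
Proof.
have /sigma_finiteP[F [TF ndF Foo]] := sigma_finiteT (@lebesgue_measure R).
have /sigma_finiteP[G [TG ndG Goo]] := sigma_finiteT m.
exists (fun k => @ins_inv n @^-1` (F k `*` G k)).
  rewrite -preimage_bigcup (_ : \bigcup_k _ = setT) ?preimage_setT//.
  apply/seteqP; split => // -[t y] _.
  have : (\bigcup_i F i) t by rewrite -TF.
  have : (\bigcup_i G i) y by rewrite -TG.
  move=> [k _ Gky] [l _ Flt]; exists (maxn k l) => //; split => /=.
    by move: t Flt; exact/subsetPset/ndF/leq_maxr.
  by move: y Gky; exact/subsetPset/ndG/leq_maxl.
move=> k; have [mF Fk] := Foo k; have [mG Gk] := Goo k; split.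
  by rewrite -[X in measurable X]setTI; apply: measurable_ins_inv => //; exact: measurableX.
rewrite /step /pushforward -comp_preimage.
rewrite (_ : _ \o _ = id) ?preimage_id; last by apply/funext => p /=; rewrite insK.
by rewrite product_measure1E// lte_mul_pinfty// ge0_fin_numE.
Qed.

HB.instance Definition _ := Measure_isSigmaFinite.Build _ _ _
  step sigma_finite_step.

Definition lebesgue_rV_step : {sigma_finite_measure set 'rV[R]_n.+1 -> \bar R} :=
  step.
End step.

Fixpoint lebesgue_rV (n : nat) : {sigma_finite_measure set 'rV[R]_n -> \bar R} :=
  match n with
  | 0 => \d_(0 : 'rV[R]_0)
  | n'.+1 => lebesgue_rV_step (lebesgue_rV n')
  end.

End lebesgue_rV.

Section smooth.
Context {R : realType}.

Definition pderiv n (f : 'rV[R]_n -> R) (i : 'I_n) (x : 'rV[R]_n) : R :=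
  'D_(delta_mx ord0 i) f x.

Definition iter_pderiv n (al : seq 'I_n) (f : 'rV[R]_n -> R) : 'rV[R]_n -> R :=
  foldr (fun i h => pderiv h i) f al.

Definition smooth n (f : 'rV[R]_n -> R) : Prop :=
  forall (al : seq 'I_n) x, differentiable (iter_pderiv al f) x.

Definition C2 (j : R -> R) : Prop :=
  [/\ forall x, derivable j x 1, forall x, derivable (derive1 j) x 1
    & continuous (derive1n 2 j)].

End smooth.

Section domain.
Context {R : realType} (n : nat).
Implicit Types (Omega U : set 'rV[R]_n.+1) (h : 'rV[R]_n -> R).

Definition bdry Omega : set 'rV[R]_n.+1 := closure Omega `\` interior Omega.

(* In U, Omega is the part strictly above (b = false) or below (b = true) the
   graph x_i = h (x_j)_{j != i}. *)
Definition bdry_chart Omega (i : 'I_n.+1) (b : bool) U h : Prop :=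
  [/\ open U, smooth h &
      forall x, U x -> (Omega x <-> 0 < (-1) ^+ b * (x ord0 i - h (col' i x)))].

Definition smooth_bdry Omega : Prop :=
  forall x, bdry Omega x -> exists i b U h, bdry_chart Omega i b U h /\ U x.

Definition area_density h (y : 'rV[R]_n) : R :=
  Num.sqrt (1 + \sum_k pderiv h k y ^+ 2).

Definition outward_normal Omega (x : 'rV[R]_n.+1) : 'rV[R]_n.+1 :=
  xget 0 [set nu | exists i b U h, [/\ bdry_chart Omega i b U h, U x &
    nu = (- (-1) ^+ b / area_density h (col' i x)) *:
         insert_coord i 1 (\row_k - pderiv h k (col' i x))]].

(* In graph coordinates dS = sqrt (1 + |grad h|^2) dy; these
   identities determine S on the Borel subsets of the boundary. *)
Definition surface_measure Omega (S : {measure set 'rV[R]_n.+1 -> \bar R}) : Prop :=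
  forall i b U h, bdry_chart Omega i b U h ->
  forall B, measurable B -> B `<=` U ->
    S (B `&` bdry Omega) =
    (\int[lebesgue_rV n]_(y in [set y | B (insert_coord i (h y) y)])
       (area_density h y)%:E)%E.

Definition collar Omega (eps : R) : set 'rV[R]_n.+1 :=
  [set z | exists x sigma, [/\ bdry Omega x, 0 <= sigma < eps &
                               z = x - sigma *: outward_normal Omega x]].

End domain.

Section L2.
Context d (T : measurableType d) (R : realType).
Variables (mu : {measure set T -> \bar R}) (D : set T).
Implicit Types u v : T -> R.

Definition L2 u : Prop :=
  measurable_fun D u /\ mu.-integrable D (fun x => (u x ^+ 2)%:E).

Definition dotL2 u v : R := \int[mu]_(x in D) (u x * v x).

Definition normL2 u : R := Num.sqrt (dotL2 u u).

End L2.

(* Elements of function spaces on Omega are functions on the whole of R^n of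
   which only the restriction to Omega, up to null sets, matters. *)
Section sobolev.
Context {R : realType} (n : nat) (Omega : set 'rV[R]_n).
Implicit Types u v phi : 'rV[R]_n -> R.

Definition test_fun phi : Prop :=
  smooth phi /\ exists K, [/\ compact K, K `<=` Omega & forall x, ~ K x -> phi x = 0].

Definition is_wderiv (al : seq 'I_n) u v : Prop :=
  L2 (lebesgue_rV n) Omega v /\
  forall phi, test_fun phi ->
    dotL2 (lebesgue_rV n) Omega u (iter_pderiv al phi) =
    (-1) ^+ size al * dotL2 (lebesgue_rV n) Omega v phi.

Definition wderiv (al : seq 'I_n) u : 'rV[R]_n -> R :=
  xget (cst 0) [set v | is_wderiv al u v].

Definition Hk (k : nat) u : Prop :=
  L2 (lebesgue_rV n) Omega u /\
  forall al : seq 'I_n, (size al <= k)%N -> exists v, is_wderiv al u v.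

Definition normH1 u : R :=
  normL2 (lebesgue_rV n) Omega u +
  \sum_i normL2 (lebesgue_rV n) Omega (wderiv [:: i] u).

Definition laplacian u : 'rV[R]_n -> R :=
  fun x => \sum_i wderiv [:: i; i] u x.

End sobolev.

Section trace.
Context {R : realType} (n : nat) (Omega : set 'rV[R]_n.+1).
Variable S : {measure set 'rV[R]_n.+1 -> \bar R}.
Implicit Types u t phi : 'rV[R]_n.+1 -> R.

(* The trace operator is the extension by continuity, from H^1(Omega) to
   L^2(bdry Omega), of the restriction of smooth functions. *)
Definition is_trace u t : Prop :=
  [/\ Hk Omega 1 u, L2 S (bdry Omega) t &
      exists phi_ : nat -> 'rV[R]_n.+1 -> R,
      [/\ forall k, smooth (phi_ k),
          (fun k => normH1 Omega (u \- phi_ k)) @ \oo --> 0 &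
          (fun k => normL2 S (bdry Omega) (t \- phi_ k)) @ \oo --> 0]].

Definition trace u : 'rV[R]_n.+1 -> R := xget (cst 0) [set t | is_trace u t].

Definition normal_deriv u : 'rV[R]_n.+1 -> R :=
  fun x => \sum_i trace (wderiv Omega [:: i] u) x * outward_normal Omega x ord0 i.

End trace.

Section plate.
Context {R : realType} (n : nat) (Omega : set 'rV[R]_n.+1).
Variable S : {measure set 'rV[R]_n.+1 -> \bar R}.
Variables f g : R -> R.

Local Notation fn := ('rV[R]_n.+1 -> R).
Local Notation leb := (lebesgue_rV n.+1).
Local Notation dot := (dotL2 leb Omega).
Local Notation nrm := (normL2 leb Omega).

(* D(Lambda^(1/2)) for Lambda the bilaplacian with the boundary conditions
   d_n u = d_n (laplacian u) = 0. *)
Definition Y12 (u : fn) : Prop :=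
  Hk Omega 2 u /\ {ae S, forall x, bdry Omega x -> normal_deriv Omega S u x = 0}.

(* Lambda^(1/2) on Y^(1/2), then Lambda and Lambda^(1/2) with values in the
   dual Y^(-1/2). *)
Definition sqrtLambda (u : fn) : fn := \- laplacian Omega u.
Definition Lambda_dual (u phi : fn) : R :=
  dot (laplacian Omega u) (laplacian Omega phi).
Definition sqrtLambda_dual (u phi : fn) : R := - dot u (laplacian Omega phi).

Definition triple : Type := (fn * fn * fn)%type.

Definition inX (w : triple) : Prop :=
  let: (u, v, th) := w in
  [/\ Y12 u, L2 leb Omega v & L2 leb Omega th].

Definition normX (w : triple) : R :=
  let: (u, v, th) := w in
  (nrm (sqrtLambda u) + nrm u) + nrm v + nrm th.

Definition distX (w w' : triple) : R :=
  normX (w.1.1 \- w'.1.1, w.1.2 \- w'.1.2, w.2 \- w'.2).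

(* Representatives of elements of X_{-1} = Y * Y^(-1/2) * Y^(-1/2); the last two
   components are functionals, of which only the values on Y^(1/2) matter. *)
Definition dual_triple : Type := (fn * (fn -> R) * (fn -> R))%type.

Definition dual_add (a b : dual_triple) : dual_triple :=
  (a.1.1 \+ b.1.1, a.1.2 \+ b.1.2, a.2 \+ b.2).

Definition dual_eq0 (a : dual_triple) : Prop :=
  [/\ {ae leb, forall x, Omega x -> a.1.1 x = 0},
      forall phi, Y12 phi -> a.1.2 phi = 0
    & forall phi, Y12 phi -> a.2 phi = 0].

Definition opA (w : triple) : dual_triple :=
  let: (u, v, th) := w in
  (v,
   fun phi => - Lambda_dual u phi - dot u phi
              + sqrtLambda_dual th phi + dot th phi,
   fun phi => - sqrtLambda_dual v phi - dot v phi
              - sqrtLambda_dual th phi - dot th phi).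

Definition f_Omega (u phi : fn) : R := dot (f \o u) phi.

Definition g_collar (eps : R) (u phi : fn) : R :=
  eps^-1 * dotL2 leb (Omega `&` collar Omega eps) (g \o u) phi.

Definition g_bdry (u phi : fn) : R :=
  dotL2 S (bdry Omega) (trace Omega S (g \o u)) (trace Omega S phi).

(* As an element of X_{-1}, a functional on H^s(Omega), 1/2 < s <= 1, is only
   tested against Y^(1/2), hence the choice of s is immaterial. *)
Definition F_ (eps : R) (w : triple) : dual_triple :=
  (cst 0,
   fun phi => f_Omega w.1.1 phi +
     (if eps == 0 then g_bdry w.1.1 phi else g_collar eps w.1.1 phi),
   cst 0).

Definition equilibria (eps : R) : set triple :=
  [set w | inX w /\ dual_eq0 (dual_add (opA w) (F_ eps w))].

(* The supremum is taken in [0, +oo]. *)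
Definition semidistX (E E0 : set triple) : \bar R :=
  ereal_sup (0%E |` [set ereal_inf [set (distX w w0)%:E | w0 in E0] | w in E]).

End plate.

(* The filter of neighbourhoods of infinity, |s| -> oo. *)
Definition abs_infty (R : realType) : set_system R :=
  [set A | \forall M \near +oo, forall s, M < `|s| -> A s].

Definition admissible (R : realType) (K : R) (j : R -> R) : Prop :=
  [/\ C2 j,
      forall s, `|j s| + `|derive1 j s| + `|derive1n 2 j s| <= K
    & (limf_esup (fun s => (j s / s)%:E) (@abs_infty R) <= 0)%E].

(* Main.v *)
(* An equilibrium has zero velocity, and then the temperature drops out of the
   second equation, so u is a weak solution of the plate problem.  Testing with u and
   using (1/e) int_(collar e) psi^2 <= C |psi|_(H^1)^2 bounds |u| + |Lap u| uniformly
   in e.  By Rellich a sequence of equilibria with e -> 0 subconverges in L^2, and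
   testing the equation of a difference with that difference shows that the
   Laplacians converge as well.  For fields with zero normal component,
     |D^2 u|^2 <= C (|Lap u|^2 + |grad u|^2),
   because tr (Dv Dw) - div v div w is a divergence whose boundary flux involves no
   normal derivative when the fields are tangent; this upgrades the convergence to H^2.
   Finally (1/e) int_(collar e) -> int_Gamma identifies the limit as an equilibrium of
   the limit problem, with the same temperature component. *)
Require Import Defs.
From HB Require Import structures.
From mathcomp Require Import all_boot all_order all_algebra.
From mathcomp Require Import all_classical all_reals all_analysis.
From mathcomp Require Import measurable_realfun.
From mathcomp Require Import ring lra.
Import Order.TTheory GRing.Theory Num.Theory.
Import numFieldNormedType.Exports.
Set Implicit Arguments.
Unset Strict Implicit.
Unset Printing Implicit Defensive.
Local Open Scope classical_set_scope.
Local Open Scope ring_scope.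

(** * Smooth functions *)

Section differentiable_functions.
Context {R : realType} {n : nat}.
Implicit Types (f g : 'rV[R]_n -> R).

(** To force the temperature of an equilibrium to vanish one would have to solve a Neumann problem
    in [Y12], that is, to prove elliptic regularity. Keeping the velocity and the temperature of the
    approximating equilibrium in the limit makes their part of the distance zero and avoids this.
    The singular terms at two parameters are never compared with each other. Each is bounded by the
    H^1 norm of the difference w of the two solutions, and |grad w|^2 <= |Lap w| |w| interpolates
    that norm; so differences of equilibria are controlled by the square root of their L^2 distance.
    The obstacle in the H^2 estimate is that smooth fields approximating grad u in H^1 are tangent
    only in the limit, while nothing controls their derivatives on the boundary. They are split into
    a normal and a tangent part; pairings with the normal part vanish because the two limits are
    taken one after the other. Weak derivatives and traces are selected up to null sets, so
    gradients are carried as explicit families and compared through norms only. *)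

Lemma derive_pderiv f x v : differentiable f x ->
  'D_v f x = \sum_k v ord0 k * pderiv f k x.
Proof.
move=> df; rewrite deriveE// {1}(row_sum_delta v) linear_sum.
apply: eq_bigr => k _.
by rewrite /pderiv deriveE// linearZ.
Qed.

Lemma pderivD f g i x : differentiable f x -> differentiable g x ->
  pderiv (f \+ g) i x = pderiv f i x + pderiv g i x.
Proof. by move=> df dg; rewrite /pderiv deriveD//; exact: diff_derivable. Qed.

Lemma pderivM f g i x : differentiable f x -> differentiable g x ->
  pderiv (f \* g) i x = f x * pderiv g i x + g x * pderiv f i x.
Proof. by move=> df dg; rewrite /pderiv deriveM//; exact: diff_derivable. Qed.

Lemma pderiv_cst (c : R) i : pderiv (cst c : 'rV[R]_n -> R) i = cst 0.
Proof. by apply/funext => x; rewrite /pderiv derive_cst. Qed.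

Lemma is_derive_line f x v t : differentiable f (x + t *: v) ->
  is_derive t (1 : R) (fun s : R => f (x + s *: v))
    (\sum_k v ord0 k * pderiv f k (x + t *: v)).
Proof.
move=> df; rewrite -derive_pderiv//.
have -> : (fun s : R => f (x + s *: v)) = (fun h : R => f (h *: v + (x + t *: v))) \o shift (- t).
  by apply/funext => s /=; rewrite scalerBl addrCA subrK.
have d0 : is_derive (0 : R) 1 (fun h : R => f (h *: v + (x + t *: v))) ('D_v f (x + t *: v)).
  apply: DeriveDef; first by have /derivable1P := diff_derivable (v := v) df.
  rewrite /derive; set g1 := (X in lim (X @ _) = _); set g2 := (X in _ = lim (X @ _)); suff -> : g1 = g2 by [].
  by apply/funext => h; rewrite /g1 /g2 /= addr0 [_%:A]mulr1 scale0r add0r.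
rewrite -['D_v f _]mulr1; apply: is_derive1_comp; last exact: is_derive_shift.
by rewrite /= subrr.
Qed.

Lemma pderiv_comp (e : R -> R) f i x : differentiable f x ->
  derivable e (f x) 1 -> differentiable (e \o f) x /\
  pderiv (e \o f) i x = derive1 e (f x) * pderiv f i x.
Proof.
move=> df de; have de' : differentiable e (f x) by apply/derivable1_diffP.
split; first exact: differentiable_comp.
rewrite /pderiv !deriveE//; last exact: differentiable_comp.
by rewrite diff_comp//= deriv1E// [RHS]mulrC.
Qed.

(** Coinduction principle: [smooth] quantifies over all iterated derivatives, so smoothness is
    proved by exhibiting one class of differentiable functions that is stable under [pderiv]. *)
Lemma smooth_coind (A : set ('rV[R]_n -> R)) :
  (forall f, A f -> (forall x, differentiable f x) /\
     forall i, A (pderiv f i)) -> A `<=` @smooth R n.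
Proof.
move=> HA f Af al; suff : A (iter_pderiv al f) by move=> /HA[].
by elim: al => //= i al /HA[].
Qed.

Lemma smooth_differentiable f x : smooth f -> differentiable f x.
Proof. by move=> /(_ [::] x). Qed.

Lemma smooth_pderiv f i : smooth f -> smooth (pderiv f i).
Proof.
move=> sf al x; have := sf (rcons al i) x.
by rewrite /iter_pderiv foldr_rcons.
Qed.

Lemma smooth_continuous f : smooth f -> continuous f.
Proof. by move=> sf x; apply/differentiable_continuous/smooth_differentiable. Qed.

(** Derivatives of 1/f or sqrt f are not of the same form, but they are polynomials in the generator
    with smooth coefficients. This algebra is the stable class to which [smooth_coind] applies. *)
Inductive smooth_algebra (B : set ('rV[R]_n -> R)) : set ('rV[R]_n -> R) :=
| Salg_smooth f of smooth f : smooth_algebra B f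
| Salg_gen f of B f : smooth_algebra B f
| Salg_add f g of smooth_algebra B f & smooth_algebra B g :
    smooth_algebra B (f \+ g)
| Salg_mul f g of smooth_algebra B f & smooth_algebra B g :
    smooth_algebra B (f \* g).

Lemma smooth_algebraP (B : set ('rV[R]_n -> R)) :
  (forall f, B f -> (forall x, differentiable f x) /\
     forall i, smooth_algebra B (pderiv f i)) ->
  smooth_algebra B `<=` @smooth R n.
Proof.
move=> HB; apply: smooth_coind => f.
elim=> {f} [f sf|f /HB//|f g Bf [df pf] Bg [dg pg]|f g Bf [df pf] Bg [dg pg]].
- split=> [x|i]; first exact: smooth_differentiable.
  by apply: Salg_smooth; exact: smooth_pderiv.
- split=> [x|i]; first exact: differentiableD.
  rewrite (_ : pderiv _ i = pderiv f i \+ pderiv g i); first exact: Salg_add.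
  by apply/funext => x; rewrite pderivD.
- split=> [x|i]; first exact: differentiableM.
  rewrite (_ : pderiv _ i = (f \* pderiv g i) \+ (g \* pderiv f i)).
    by apply: Salg_add; exact: Salg_mul.
  by apply/funext => x; rewrite pderivM.
Qed.

Lemma smooth_cst (c : R) : smooth (cst c : 'rV[R]_n -> R).
Proof.
apply: (@smooth_coind [set f | exists c, f = cst c]); last by exists c.
move=> f [{}c ->]; split=> [x|i]; first exact: differentiable_cst.
by exists 0; rewrite pderiv_cst.
Qed.

Lemma smoothD f g : smooth f -> smooth g -> smooth (f \+ g).
Proof.
move=> sf sg; apply: (@smooth_algebraP set0) => //.
by apply: Salg_add; exact: Salg_smooth.
Qed.

Lemma smoothM f g : smooth f -> smooth g -> smooth (f \* g).
Proof.
move=> sf sg; apply: (@smooth_algebraP set0) => //.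
by apply: Salg_mul; exact: Salg_smooth.
Qed.

Lemma smooth_sum (I : Type) (r : seq I) (P : pred I) (F : I -> 'rV[R]_n -> R) :
  (forall i, P i -> smooth (F i)) -> smooth (fun x => \sum_(i <- r | P i) F i x).
Proof.
move=> sF; rewrite (_ : (fun _ => _) = \big[(fun f g => f \+ g)/cst 0]_(i <- r | P i) F i).
  by apply: big_ind => //; [exact: smooth_cst|exact: smoothD].
by apply/funext => x; elim/big_rec2: _ => //= i y1 y2 _ ->.
Qed.

Lemma smooth_prod (I : Type) (r : seq I) (P : pred I) (F : I -> 'rV[R]_n -> R) :
  (forall i, P i -> smooth (F i)) -> smooth (fun x => \prod_(i <- r | P i) F i x).
Proof.
move=> sF; rewrite (_ : (fun _ => _) = \big[(fun f g => f \* g)/cst 1]_(i <- r | P i) F i).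
  by apply: big_ind => //; [exact: smooth_cst|exact: smoothM].
by apply/funext => x; elim/big_rec2: _ => //= i y1 y2 _ ->.
Qed.

Lemma smoothZ (c : R) f : smooth f -> smooth (fun x => c * f x).
Proof. by move=> sf; apply: (smoothM _ sf); exact: smooth_cst. Qed.

Lemma smoothN f : smooth f -> smooth (fun x => - f x).
Proof.
move=> sf; rewrite (_ : (fun _ => _) = (fun x => -1 * f x)); first exact: smoothZ.
by apply/funext => x; rewrite mulN1r.
Qed.

Lemma smoothB f g : smooth f -> smooth g -> smooth (f \- g).
Proof. by move=> sf sg; apply: (smoothD sf); exact: smoothN. Qed.

Lemma pderiv_coord (k i : 'I_n) :
  pderiv (fun x : 'rV[R]_n => x ord0 k) i = cst (i == k)%:R.
Proof.
apply/funext => x; rewrite /pderiv deriveE; last exact: differentiable_coord.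
have cl : continuous (fun N : 'rV[R]_n => N ord0 k).
  by move=> y; apply: differentiable_continuous; exact: differentiable_coord.
have lin : linear (fun N : 'rV[R]_n => N ord0 k) by move=> a u v; rewrite !mxE.
pose l : {linear 'rV[R]_n -> R} := HB.pack (fun N : 'rV[R]_n => N ord0 k)
  (GRing.isLinear.Build _ _ _ _ (fun N : 'rV[R]_n => N ord0 k)
     lin).
have -> : (fun x0 : 'rV[R]_n => x0 ord0 k) = l by [].
by rewrite diff_lin//= mxE eqxx eq_sym.
Qed.

Lemma smooth_coord (k : 'I_n) : smooth (fun x : 'rV[R]_n => x ord0 k).
Proof.
apply: (@smooth_algebraP [set fun x : 'rV[R]_n => x ord0 k]); last exact: Salg_gen.
move=> _ ->; split=> [x|i]; first exact: differentiable_coord.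
by rewrite pderiv_coord; apply: Salg_smooth; exact: smooth_cst.
Qed.

Definition smooth1 (e : R -> R) := forall m t, derivable (derive1n m e) t 1.

Lemma smooth_comp (e : R -> R) f : smooth1 e -> smooth f -> smooth (e \o f).
Proof.
move=> se sf; apply: (@smooth_algebraP [set derive1n m e \o f | m in setT]); last first.
  by apply: Salg_gen; exists 0%N.
move=> _ [m _ <-]; split=> [x|i].
  apply: differentiable_comp; first exact: smooth_differentiable.
  by apply/derivable1_diffP.
rewrite (_ : pderiv _ _ = (derive1n m.+1 e \o f) \* pderiv f i).
  apply: Salg_mul; last by apply: Salg_smooth; exact: smooth_pderiv.
  by apply: Salg_gen; exists m.+1.
apply/funext => x; have [_ ->] := pderiv_comp i (smooth_differentiable x sf) (se m _).
by rewrite derive1nS.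
Qed.

Lemma smooth_inv f : smooth f -> (forall x, f x != 0) -> smooth (fun x => (f x)^-1).
Proof.
move=> sf f0; apply: (@smooth_algebraP [set fun x => (f x)^-1]); last exact: Salg_gen.
move=> _ ->; split=> [x|i].
  by apply: differentiableV => //; exact: smooth_differentiable.
rewrite (_ : pderiv _ _ = (cst (-1) \* ((fun x => (f x)^-1) \* (fun x => (f x)^-1))) \* pderiv f i).
  apply: Salg_mul; last by apply: Salg_smooth; exact: smooth_pderiv.
  apply: Salg_mul; first by apply: Salg_smooth; exact: smooth_cst.
  by apply: Salg_mul; exact: Salg_gen.
apply/funext => x; rewrite /pderiv deriveV//; last first.
  by apply: diff_derivable; exact: smooth_differentiable.
by rewrite /= -exprVn expr2 mulN1r.
Qed.

Lemma smooth_sqrt f : smooth f -> (forall x, 0 < f x) ->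
  smooth (fun x => Num.sqrt (f x)).
Proof.
move=> sf f0; apply: (@smooth_algebraP [set fun x => Num.sqrt (f x)]); last exact: Salg_gen.
move=> _ ->.
have H i x := @pderiv_comp Num.sqrt f i x (smooth_differentiable x sf)
  (@ex_derive _ _ _ _ _ _ _ (is_derive1_sqrt (f0 x))).
split=> [x|i].
  apply: differentiable_comp; first exact: smooth_differentiable.
  by apply/derivable1_diffP; exact: (@ex_derive _ _ _ _ _ _ _ (is_derive1_sqrt (f0 x))).
rewrite (_ : pderiv _ _ = (fun x => 2^-1 * pderiv f i x) \* ((fun x => (f x)^-1) \* (fun x => Num.sqrt (f x)))).
  apply: Salg_mul; first by apply/Salg_smooth/smoothZ; exact: smooth_pderiv.
  apply: Salg_mul; last exact: Salg_gen.
  by apply/Salg_smooth/smooth_inv => // x; rewrite gt_eqF.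
apply/funext => x; have [_] := H i x; rewrite /= => ->.
rewrite derive1E (@derive_val _ _ _ _ _ _ _ (is_derive1_sqrt (f0 x))).
have s0 : Num.sqrt (f x) != 0 by rewrite gt_eqF// sqrtr_gt0.
rewrite -{2}(sqr_sqrtr (ltW (f0 x))); field.
exact: s0.
Qed.

End differentiable_functions.

Section smooth_more.
Context {R : realType} {n : nat}.
Implicit Types (f g : 'rV[R]_n -> R).

Lemma rV_norm_le (v : 'rV[R]_n) r : 0 <= r -> (`|v| <= r) <-> forall k, `|v ord0 k| <= r.
Proof.
move=> r0; rewrite [in X in X <-> _]/Num.norm/= mx_normrE; split=> [/bigmax_leP[_ H] k|H].
  exact: (H (ord0, k)).
by apply/bigmax_leP; split=> // -[a k] _ /=; rewrite (ord1 a).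
Qed.

Lemma coord_le_norm (v : 'rV[R]_n) k : `|v ord0 k| <= `|v|.
Proof. by have /rV_norm_le : `|v| <= `|v| by []; apply. Qed.

Lemma differentiable_expansion f x : differentiable f x ->
  forall e : R, 0 < e -> exists2 d : R, 0 < d & forall h : 'rV[R]_n, `|h| < d ->
    `|f (x + h) - f x - \sum_k h ord0 k * pderiv f k x| <= e * `|h|.
Proof.
move=> df e e0; have /diff_locallyP[_ /eqaddoP/(_ e e0)] := df.
move=> /nbhs_ballP[d /= d0 Hd]; exists d => // h hd.
rewrite -derive_pderiv// deriveE//.
have := Hd h; rewrite -ball_normE /= sub0r normrN => /(_ hd).
rewrite -[(_ - _) h]/(f (h + x) - (f x + 'd f x h)).
by rewrite [h + x]addrC opprD addrA.
Qed.

(** A first order expansion with explicit coefficients yields differentiability and the partial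
    derivatives at once. Translations, shears and mollifications are differentiated this way,
    without a chain rule between row vector spaces. *)
Lemma differentiable_of_expansion f x (c : 'I_n -> R) :
  (forall e : R, 0 < e -> exists2 d : R, 0 < d & forall h : 'rV[R]_n, `|h| < d ->
    `|f (x + h) - f x - \sum_k h ord0 k * c k| <= e * `|h|) ->
  differentiable f x /\ forall k, pderiv f k x = c k.
Proof.
move=> H; pose l0 (h : 'rV[R]_n) := \sum_k h ord0 k * c k.
have lin : linear l0.
  move=> a u v; rewrite /l0 scaler_sumr -big_split/=; apply: eq_bigr => k _.
  by rewrite !mxE mulrDl -mulrA.
pose l : {linear 'rV[R]_n -> R} := HB.pack l0 (GRing.isLinear.Build _ _ _ _ l0 lin).
have cl : continuous l.
  move=> y; apply: differentiable_continuous.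
  rewrite /l/= (_ : l0 = \sum_k (fun h : 'rV[R]_n => h ord0 k * c k)).
    by apply: differentiable_sum => k; apply: differentiableM; [exact: differentiable_coord|exact: differentiable_cst].
  by apply/funext => h; rewrite /l0 fct_sumE.
have dxf : f \o shift x = cst (f x) + l +o_ (0 : 'rV[R]_n) id.
  apply/eqaddoP => e e0; have [d d0 Hd] := H _ e0; apply/nbhs_ballP; exists d => //= h.
  rewrite -ball_normE /= sub0r normrN => /Hd.
  rewrite -[(f \o _ - _) h]/(f (h + x) - (f x + l0 h)).
  by rewrite [h + x]addrC opprD addrA.
have df : differentiable f x.
  apply/diffP => /=.
  (* The differential is a chosen linear map; exhibiting [l] shows that the choice meets its
     specification. *)
  apply: (@getPex _ (fun (df : {linear 'rV[R]_n -> R}) => continuous df /\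
    forall y, f y = f (lim (nbhs x)) + df (y - lim (nbhs x))
                  +o_(y \near x) (y - lim (nbhs x)))).
  exists l; split=> //; apply: eqaddoEx => z.
  rewrite lim_id // -[in LHS](subrK x z) -[LHS]/((f \o shift x) (z - x)) dxf.
  rewrite -[LHS]/(f x + l (z - x) + _); congr (_ + _).
  rewrite -(comp_centerK x id) -[X in the_littleo _ _ _ X](comp_centerK x).
  by rewrite -[_ (z - x)]/((_ \o (center x)) z) -littleo_center0.
split=> // k; rewrite /pderiv deriveE// (diff_unique cl dxf)/= /l0.
rewrite (bigD1 k)//= mxE !eqxx mul1r big1 ?addr0// => j jk.
by rewrite mxE (negbTE jk) andbF mul0r.
Qed.

Lemma smooth_pderivC f i j : smooth f ->
  pderiv (pderiv f j) i = pderiv (pderiv f i) j.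
Proof.
move=> sf; apply/funext => x.
(* Both mixed derivatives approximate the same second difference, symmetric in i and j, divided by
   t^2. One bound for arbitrary i and j therefore suffices. *)
wlog suff H : i j / forall e : R, 0 < e -> exists2 d : R, 0 < d & forall t, 0 < t < d ->
    `|(f (x + t *: delta_mx ord0 i + t *: delta_mx ord0 j) - f (x + t *: delta_mx ord0 i)
     - f (x + t *: delta_mx ord0 j) + f x) - t ^+ 2 * pderiv (pderiv f i) j x| <= e * t ^+ 2.
  apply/eqP; rewrite -subr_eq0 -normr_le0; apply/ler_addgt0Pl => e e0; rewrite addr0.
  have e2 : 0 < e / 2 by rewrite divr_gt0.
  have [d1 d10 H1] := H i j _ e2; have [d2 d20 H2] := H j i _ e2.
  pose t := Num.min d1 d2 / 2.
  have m0 : 0 < Num.min d1 d2 by rewrite lt_min d10.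
  have t0 : 0 < t by rewrite divr_gt0.
  have tm : t < Num.min d1 d2 by rewrite /t ltr_pdivrMr// ltr_pMr// ltr1n.
  have td1 : 0 < t < d1 by rewrite t0 (lt_le_trans tm)// ge_min lexx.
  have td2 : 0 < t < d2 by rewrite t0 (lt_le_trans tm)// ge_min lexx orbT.
  have := H1 _ td1; have := H2 _ td2.
  rewrite (addrAC x (t *: delta_mx ord0 j)) (addrAC _ (- f (x + t *: delta_mx ord0 j))).
  set q := _ + f x => A B.
  have t2 : 0 < t ^+ 2 by rewrite exprn_gt0.
  rewrite -(ler_pM2l t2) -[in leLHS](gtr0_norm t2) -normrM mulrBr.
  rewrite (_ : t ^+ 2 * e = e / 2 * t ^+ 2 + e / 2 * t ^+ 2); last by field.
  apply: le_trans (lerD A B); rewrite [X in _ <= X + _]distrC.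
  exact: ler_distD.
move=> e e0; set ei : 'rV[R]_n := delta_mx ord0 i; set ej : 'rV[R]_n := delta_mx ord0 j.
set p := pderiv f i.
have dp : differentiable p x by apply: smooth_differentiable; exact: smooth_pderiv.
have delta_le (k : 'I_n) (s : R) : `|s *: (delta_mx ord0 k : 'rV[R]_n)| <= `|s|.
  rewrite normrZ -[leRHS]mulr1 ler_wpM2l//.
  by apply/rV_norm_le => // l; rewrite mxE; case: (_ && _); rewrite ?normr1 ?normr0.
(* The two increments used below have norm at most 2 t, so their expansion errors add up to at most
   (e / 4) (4 t) = e t. *)
have e4 : 0 < e / 4 by rewrite divr_gt0.
have [d d0 Hd] := differentiable_expansion dp e4.
exists (d / 2); first by rewrite divr_gt0.
move=> t /andP[t0 td].
pose G (s : R) := f (x + t *: ej + s *: ei) - f (x + s *: ei).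
have dG s : is_derive s (1 : R) G (p (x + t *: ej + s *: ei) - p (x + s *: ei)).
  have E y : \sum_k ei ord0 k * pderiv f k y = p y.
    rewrite (bigD1 i)//= mxE !eqxx mul1r big1 ?addr0// => k ki.
    by rewrite mxE (negbTE ki) andbF mul0r.
  by rewrite -!E; apply: is_deriveB; apply: is_derive_line; exact: smooth_differentiable.
have cG : {within `[0, t], continuous G}.
  apply: continuous_subspaceT => s; apply: differentiable_continuous.
  by apply/derivable1_diffP; have [] := dG s.
have [c /[!in_itv]/= /andP[c0 ct]] := MVT t0 (fun s _ => dG s) cG.
rewrite subr0 /G !scale0r !addr0 => Gt.
rewrite (addrAC x (t *: ei)) (_ : _ + f x = t * (p (x + t *: ej + c *: ei) - p (x + c *: ei))); last first.
  by rewrite mulrC -Gt; ring.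
have H1 := Hd (t *: ej + c *: ei); have H2 := Hd (c *: ei).
have nt : `|t *: ej + c *: ei| <= 2 * t.
  rewrite (le_trans (ler_normD _ _))// (le_trans (lerD (delta_le _ _) (delta_le _ _)))//.
  rewrite !gtr0_norm//; lra.
have nc : `|c *: ei| <= 2 * t.
  rewrite (le_trans (delta_le _ _))// gtr0_norm//; lra.
have {}H1 : `|t *: ej + c *: ei| < d by apply: le_lt_trans nt _; lra.
have {}H2 : `|c *: ei| < d by apply: le_lt_trans nc _; lra.
have := Hd _ H1; have := Hd _ H2; rewrite !(addrA x).
have S0 : \sum_k (t *: ej + c *: ei) ord0 k * pderiv p k x - \sum_k (c *: ei) ord0 k * pderiv p k x = t * pderiv p j x.
  rewrite -sumrB (bigD1 j)//= [X in _ + X]big1 => [|k kj]; rewrite !mxE ?(negbTE kj) !eqxx/=; ring.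
set a := p (x + t *: ej + c *: ei); set b := p (x + c *: ei); set px := p x; move: S0; set S1 := \sum_k _; set S2 := \sum_k _ => S0 Hb Ha.
rewrite expr2 -mulrA -mulrBr normrM gtr0_norm// mulrCA ler_pM2l//.
have -> : a - b - t * pderiv p j x = (a - px - S1) - (b - px - S2).
  by rewrite -S0; clear; move: px a b S1 S2 => px a b S1 S2; ring.
apply: (le_trans (ler_normB _ _)); apply: (le_trans (lerD Ha Hb)).
rewrite -mulrDr.
have : e / 4 * (`|t *: ej + c *: ei| + `|c *: ei|) <= e / 4 * (4 * t).
  by rewrite ler_wpM2l ?(ltW e4)//; lra.
by move=> /le_trans; apply; rewrite mulrA divfK.
Qed.

(** Mean value theorem twice along the segment. The factor c < 1 from the first application is
    dropped, and each of the two sums over coordinates costs a factor n. *)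
Lemma smooth_taylor f (C : R) : smooth f -> 0 <= C ->
  (forall i j x, `|pderiv (pderiv f i) j x| <= C) ->
  forall x v, `|f (x + v) - f x - \sum_k v ord0 k * pderiv f k x| <=
    n%:R ^+ 2 * C * `|v| ^+ 2.
Proof.
move=> sf C0 HC x v.
pose G1 t := \sum_k v ord0 k * pderiv f k (x + t *: v).
have d1 t : is_derive t (1 : R) (fun t => f (x + t *: v)) (G1 t).
  by apply: is_derive_line; exact: smooth_differentiable.
pose G2 t := \sum_k v ord0 k * \sum_l v ord0 l * pderiv (pderiv f k) l (x + t *: v).
have d2 t : is_derive t (1 : R) G1 (G2 t).
  rewrite /G1 /G2.
  rewrite (_ : (fun _ => _) = \sum_k (fun t => v ord0 k * pderiv f k (x + t *: v))); last first.
    by apply/funext => s; rewrite fct_sumE.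
  apply: is_derive_sum => k; apply: is_deriveZ; apply: is_derive_line.
  by apply: smooth_differentiable; exact: smooth_pderiv.
have cont (F F' : R -> R) (H : forall t, is_derive t (1 : R) F (F' t)) a b : {within `[a, b], continuous F}.
  apply: continuous_subspaceT => s; apply: differentiable_continuous.
  by apply/derivable1_diffP; have [] := H s.
have [c /[!in_itv]/= /andP[c0 c1]] := MVT (@ltr01 R) (fun s _ => d1 s) (cont _ _ d1 0 1).
rewrite subr0 mulr1 scale1r scale0r addr0 => ->.
have [c' _] := MVT c0 (fun s _ => d2 s) (cont _ _ d2 0 c).
rewrite {2}/G1 scale0r addr0 subr0 => ->.
have vk k : `|v ord0 k| <= `|v| by exact: coord_le_norm.
rewrite normrM (@gtr0_norm _ c)//.
apply: (@le_trans _ _ `|G2 c'|); first by rewrite ler_piMr// ltW.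
rewrite /G2 (le_trans (ler_norm_sum _ _ _))//.
rewrite (@le_trans _ _ (\sum_(k < n) `|v| * (\sum_(l < n) `|v| * C)))//.
  apply: ler_sum => k _; rewrite normrM ler_pM//.
  by rewrite (le_trans (ler_norm_sum _ _ _))// ler_sum// => l _; rewrite normrM ler_pM.
rewrite !sumr_const !card_ord le_eqVlt; apply/orP; left; apply/eqP.
by rewrite -[LHS]mulr_natl -[X in _ * (_ * X)]mulr_natl; move: (n%:R : R) `|v| => N a; ring.
Qed.

End smooth_more.

(** * Smooth bumps on cubes *)

Section box_bump.
Context {R : realType}.
Implicit Types (P : {poly R}) (t : R).

(** The family is closed under differentiation, P becoming X^2 (P - P'), so no explicit formula for
    higher derivatives is required. *)
Definition flat P t : R := if 0 < t then P.[t^-1] * expR (- t^-1) else 0.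

(** The term of order [size P + 2] in the exponential series absorbs the polynomial and leaves two
    powers of t, which makes the derivative at 0 vanish. *)
Lemma flat_le P : exists2 C : R, 0 <= C & forall t, t <= 1 -> `|flat P t| <= C * t ^+ 2.
Proof.
pose k := size P; pose C := (\sum_(i < k) `|P`_i|) * (k.+2)`!%:R.
exists C => [|t t1]; first by rewrite mulr_ge0// sumr_ge0.
rewrite /flat; case: ifPn => [t0|_]; last by rewrite normr0 mulr_ge0 ?sqr_ge0// mulr_ge0// sumr_ge0.
have s1 : 1 <= t^-1 by rewrite invf_ge1.
have s0 : 0 < t^-1 by rewrite invr_gt0.
rewrite normrM (gtr0_norm (expR_gt0 _)) expRN -[t in leRHS]invrK.
set s := t^-1 in s0 s1 *.
have H1 : `|P.[s]| <= (\sum_(i < k) `|P`_i|) * s ^+ k.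
  rewrite horner_coef mulr_suml (le_trans (ler_norm_sum _ _ _))// ler_sum// => i _.
  rewrite normrM ler_wpM2l// normrX gtr0_norm// ler_weXn2l//.
  exact/ltnW/ltn_ord.
have H2 : s ^+ k.+2 / (k.+2)`!%:R <= expR s.
  by apply: le_trans (expR_ge1Dxn k.+1 (ltW s0)); rewrite lerDr.
rewrite ler_pdivrMr ?expR_gt0// (le_trans H1)// /C -!mulrA ler_wpM2l ?sumr_ge0//.
move: H2; rewrite ler_pdivrMr ?ltr0n ?fact_gt0// => H2.
rewrite (_ : _ * _ = expR s * (k.+2)`!%:R / s ^+ 2).
  by rewrite ler_pdivlMr ?exprn_gt0// -exprD addn2.
rewrite !expr2 invfM; ring.
Qed.

Lemma is_derive_flat P t :
  is_derive t (1 : R) (flat P) (flat ('X^2 * (P - P^`())) t).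
Proof.
have [t0|t0|->] := ltgtP t 0.
- rewrite [X in is_derive _ _ _ X](_ : _ = 0); last by rewrite /flat ltNge (ltW t0).
  apply: (@near_eq_is_derive _ _ _ (cst 0) (flat P)).
  by near=> s; rewrite /flat ltNge ltW//=; near: s; exact: lt_nbhsl.
- pose F s := P.[s^-1] * expR (- s^-1).
  apply: (@near_eq_is_derive _ _ _ F (flat P)).
    by near=> s; rewrite /flat /F ifT//; near: s; exact: lt_nbhsr.
  have tn0 : t != 0 by rewrite gt_eqF.
  have dI : is_derive t (1 : R) (fun s : R => s^-1) (- t ^- 2).
    by apply: is_derive_eq; [exact: is_deriveV|rewrite scaler1].
  have dP : is_derive (t^-1) (1 : R) (horner P) (P^`().[t^-1]).
    apply: DeriveDef; first exact: derivable_horner.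
    by rewrite -derive1E -derivE.
  have d1 : is_derive t (1 : R) (fun s => P.[s^-1]) (P^`().[t^-1] * (- t ^- 2)).
    exact: (is_derive1_comp (f := horner P)).
  have d2 : is_derive t (1 : R) (fun s => expR (- s^-1)) (expR (- t^-1) * t ^- 2).
    apply: (is_derive1_comp (f := expR) (g := fun s => - s^-1)).
    by rewrite -[t ^- 2]opprK; exact: (is_deriveN (f := fun s : R => s^-1)).
  apply: (is_derive_eq (is_deriveM d1 d2)).
  rewrite /flat t0 !hornerE/= /GRing.scale/= exprVn.
  move: (expR _) (_.[_]) (_.[_]) (t ^- 2) => a b c d; ring.
- rewrite [X in is_derive _ _ _ X](_ : _ = 0); last by rewrite /flat ltxx.
  have [C C0 HC] := flat_le P.
  have H : h^-1 *: ((flat P \o shift 0) (h *: (1 : R)) - flat P 0) @[h --> 0^'] --> (0 : R).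
    apply/cvgrPdist_le => e e0; near=> h; rewrite sub0r normrN /= addr0 [flat P 0]/flat ltxx subr0 [h%:A]mulr1.
    have h0 : h != 0 by near: h; exact: nbhs_dnbhs_neq.
    rewrite normrM normfV ler_pdivrMl ?normr_gt0// (le_trans (HC _ _))//.
      by rewrite ltW//; near: h; apply: nbhs_dnbhs; exact: lt_nbhsl.
    rewrite -real_normK ?num_real// expr2 mulrCA ler_wpM2l//.
    rewrite (@le_trans _ _ ((C + 1) * `|h|)) ?ler_wpM2r ?lerDl// -ler_pdivlMl ?ltr_wpDl//.
    near: h; apply: nbhs_dnbhs; apply/nbhs_ballP; exists ((C + 1)^-1 * e) => /=.
      by rewrite mulr_gt0// invr_gt0 ltr_wpDl.
    by move=> h /=; rewrite -ball_normE/= sub0r normrN => /ltW.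
  by apply: DeriveDef; [apply/cvg_ex; exists 0|exact: cvg_lim].
Unshelve. all: by end_near. Qed.

Lemma smooth1_flat P : smooth1 (flat P).
Proof.
pose D (Q : {poly R}) := 'X^2 * (Q - Q^`()).
suff H m : derive1n m (flat P) = flat (iter m D P).
  by move=> m t; rewrite H; have [] := is_derive_flat (iter m D P) t.
elim: m => // m IH; rewrite derive1nS IH; apply/funext => t.
by rewrite derive1E; apply: (@derive_val _ _ _ _ _ _ _ (is_derive_flat _ t)).
Qed.

Lemma flat1_gt0 t : (0 < flat 1 t) = (0 < t).
Proof. by rewrite /flat; case: ifPn => // _; rewrite ?ltxx// hornerC mul1r expR_gt0. Qed.

Lemma flat1_ge0 t : 0 <= flat 1 t.
Proof. by rewrite /flat; case: ifPn => // _; rewrite hornerC mul1r expR_ge0. Qed.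

(** The product form fits the maximum norm: the bump is positive exactly on the open ball of that
    norm. *)
Definition box_bump n (a : 'rV[R]_n) (r : R) (x : 'rV[R]_n) : R :=
  \prod_k flat 1 (r ^+ 2 - (x ord0 k - a ord0 k) ^+ 2).

Lemma box_bump_smooth n (a : 'rV[R]_n) r : smooth (box_bump a r).
Proof.
apply: smooth_prod => k _; pose q (x : 'rV[R]_n) := r ^+ 2 - (x ord0 k - a ord0 k) ^+ 2.
suff : smooth q by move/(smooth_comp (@smooth1_flat 1)).
have s1 : smooth (fun x : 'rV[R]_n => x ord0 k - a ord0 k).
  by apply: (smoothB (smooth_coord k)); exact: smooth_cst.
apply: smoothB; first exact: smooth_cst.
exact: (smoothM s1 s1).
Qed.

Lemma box_bump_ge0 n (a : 'rV[R]_n) r x : 0 <= box_bump a r x.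
Proof. by apply: prodr_ge0 => k _; exact: flat1_ge0. Qed.

Lemma box_bump_gt0 n (a : 'rV[R]_n) r x : 0 < r -> (0 < box_bump a r x) = (`|x - a| < r).
Proof.
move=> r0; have E k : (0 < flat 1 (r ^+ 2 - (x ord0 k - a ord0 k) ^+ 2)) = (`|(x - a) ord0 k| < r).
  rewrite flat1_gt0 subr_gt0 -real_normK ?num_real// !mxE ltr_pXn2r ?nnegrE//.
  exact: ltW.
apply/idP/idP => [|xr]; last by apply: prodr_gt0 => k _; rewrite E (le_lt_trans (coord_le_norm _ _)).
move=> b0; have H k : `|(x - a) ord0 k| < r.
  rewrite -E lt_neqAle flat1_ge0 andbT eq_sym; apply: contraTN b0 => /eqP e0.
  by rewrite /box_bump (bigD1 k)//= e0 mul0r ltxx.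
rewrite [X in X < _]/Num.norm/= mx_normrE; apply/bigmax_ltP; split=> // -[i k] _ /=.
by rewrite (ord1 i).
Qed.

End box_bump.

(** * Lebesgue measure on row vectors *)

Section rectangles.
Context {R : realType}.

Definition rect n (A : 'I_n -> set R) : set 'rV[R]_n := [set x | forall i, A i (x ord0 i)].

Lemma measurable_rect n (A : 'I_n -> set R) :
  (forall i, measurable (A i)) -> measurable (rect A).
Proof.
move=> mA; rewrite (_ : rect A = \bigcap_(i in [set: 'I_n]) ((fun x : 'rV[R]_n => x ord0 i) @^-1` A i)).
  apply: fin_bigcap_measurable; first exact: finite_finset.
  by move=> i _; rewrite -[X in measurable X]setTI; apply: measurable_coord.
by apply/seteqP; split=> [x xA i _|x xA i]; [exact: xA|exact: (xA i I)].
Qed.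

Definition cube n (k : nat) : set 'rV[R]_n := rect (fun=> `[- k%:R, k%:R]%classic).

Let rects n : set (set 'rV[R]_n) :=
  [set B | exists2 A : 'I_n -> set R, (forall i, measurable (A i)) & B = rect A].

Let measurable_rects n : (@measurable _ 'rV[R]_n) = <<s @rects n>>.
Proof.
apply/seteqP; split; last first.
  apply: smallest_sub; first exact: sigma_algebra_measurable.
  by move=> _ [A mA ->]; exact: measurable_rect.
apply: smallest_sub; first exact: smallest_sigma_algebra.
rewrite -bigcup_seq/=; apply: bigcup_sub => i _ _ [B mB <-].
apply: sub_sigma_algebra; exists (fun j => if j == i then B else setT).
  by move=> j; case: ifP.
rewrite setTI; apply/seteqP; split=> [x Bx j|x /(_ i)]/=; last by rewrite eqxx.
by case: ifPn => // /eqP ->.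
Qed.

(** Measurable rectangles form a generating pi-system, and cubes of finite measure exhaust the
    space. *)
Lemma rV_measure_unique n (m1 m2 : {measure set 'rV[R]_n -> \bar R}) :
  (forall A : 'I_n -> set R, (forall i, measurable (A i)) -> m1 (rect A) = m2 (rect A)) ->
  (forall k : nat, (m1 (@cube n k) < +oo)%E) ->
  forall B, measurable B -> m1 B = m2 B.
Proof.
move=> m12 moo B mB.
apply: (measure_unique (@rects n) (@cube n)) => //.
- exact: measurable_rects.
- move=> _ _ [A mA ->] [A' mA' ->]; exists (fun i => A i `&` A' i).
    by move=> i; exact: measurableI.
  apply/seteqP; split=> [x [Ax A'x] i|x AA']; first by split; [exact: Ax|exact: A'x].
  by split=> i; have [] := AA' i.
- by move=> k; exists (fun=> [set` `[- (k%:R : R), k%:R]]).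
- apply/seteqP; split => // x _.
  exists (Num.truncn `|x|).+1 => // i /=; rewrite in_itv/= -ler_norml.
  by rewrite (le_trans (coord_le_norm _ _))// ltW// truncnS_gt.
- by move=> _ [A mA ->]; exact: m12.
Qed.

Lemma rect_insert n (i : 'I_n.+1) (A : 'I_n.+1 -> set R) (t : R) y :
  rect A (insert_coord i t y) <-> A i t /\ rect (fun k => A (lift i k)) y.
Proof.
split=> [H|[Ai Ay] j].
  split=> [|k]; first by have := H i; rewrite mxE unlift_none.
  by have := H (lift i k); rewrite mxE liftK.
rewrite mxE; case: unliftP => [k ->|->]//=; exact: Ay.
Qed.

Lemma measurable_insert n (i : 'I_n.+1) :
  measurable_fun [set: R * 'rV[R]_n] (fun p => insert_coord i p.1 p.2).
Proof.
apply: measurable_fun_rV => j; rewrite /insert_coord.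
case: (unliftP i j) => [k ->|->].
  under eq_fun do rewrite mxE liftK /=.
  by apply: (measurableT_comp (measurable_coord k)); exact: measurable_snd.
under eq_fun do rewrite mxE unlift_none /=.
exact: measurable_fst.
Qed.

Lemma lebesgue_rVS n (B : set 'rV[R]_n.+1) :
  lebesgue_rV n.+1 B = (lebesgue_measure \x lebesgue_rV n)%E ((fun p => insert_coord ord0 p.1 p.2) @^-1` B).
Proof. by []. Qed.

Lemma lebesgue_rV_rect n (A : 'I_n -> set R) : (forall i, measurable (A i)) ->
  lebesgue_rV n (rect A) = (\prod_i lebesgue_measure (A i))%E.
Proof.
elim: n A => [|n IH] A mA.
  by rewrite big_ord0 /= diracE mem_set// => -[].
rewrite lebesgue_rVS big_ord_recl -(IH (fun k => A (lift ord0 k)))// -product_measure1E; [|exact: mA|exact: measurable_rect].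
congr (_ _); apply/seteqP; split=> [[t y] /= /rect_insert[]//|[t y] /= H].
exact/rect_insert.
Qed.

Lemma lebesgue_rV_cube_fin n (k : nat) :
  (lebesgue_rV n (@cube n k) < +oo)%E.
Proof.
rewrite /cube lebesgue_rV_rect//.
rewrite (_ : \prod_(i < n) _ = ((k%:R - (- k%:R)) ^+ n)%:E)%E ?ltry//.
rewrite (eq_bigr (fun=> (k%:R - (- k%:R))%:E)).
  by rewrite prodEFin prodr_const card_ord.
move=> i _; rewrite lebesgue_measure_itv/= lte_fin.
case: ifPn => //; rewrite -leNgt => h; congr EFin.
by apply/eqP; rewrite eq_le subr_le0 h/= subr_ge0 (@le_trans _ _ 0)// oppr_le0.
Qed.

(** The measure is defined by splitting off coordinate 0. Agreement on rectangles allows any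
    coordinate to be split off, as charts are graphs over an arbitrary coordinate. *)
Lemma lebesgue_rV_insert n (i : 'I_n.+1) (B : set 'rV[R]_n.+1) : measurable B ->
  lebesgue_rV n.+1 B = pushforward (lebesgue_measure \x lebesgue_rV n)%E
    (fun p => insert_coord i p.1 p.2) B.
Proof.
move=> mB.
pose m2 : {measure set 'rV[R]_n.+1 -> \bar R} :=
  @measure_function_pushforward__canonical__measure_function_Measure
    _ _ _ _ _ (lebesgue_measure \x lebesgue_rV n)%E _ (@measurable_insert n i).
apply: (@rV_measure_unique _ (lebesgue_rV n.+1) m2) => //; last exact: lebesgue_rV_cube_fin.
move=> A mA; apply: (etrans (lebesgue_rV_rect mA)); rewrite /m2 /= /pushforward.
rewrite (_ : _ @^-1` _ = A i `*` rect (fun k => A (lift i k))).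
  rewrite product_measure1E; [|exact: mA|exact: measurable_rect].
  rewrite lebesgue_rV_rect//.
  by rewrite (bigD1_ord i).
by apply/seteqP; split=> [[t y] /= /rect_insert[]//|[t y] /= H]; exact/rect_insert.
Qed.

Lemma measurable_shift_rV n (c : 'rV[R]_n) : measurable_fun setT (fun x : 'rV[R]_n => x + c).
Proof.
apply: measurable_fun_rV => i; under eq_fun do rewrite mxE.
by apply: measurable_realfun.measurable_funD; [exact: measurable_coord|exact: measurable_cst].
Qed.

Lemma lebesgue_measure_shift (c : R) (A : set R) : measurable A ->
  lebesgue_measure ((fun t : measurableTypeR R => t + c) @^-1` A) = lebesgue_measure A.
Proof.
move=> mA.
have mf : measurable_fun [set: measurableTypeR R] (fun t : measurableTypeR R => (t + c) : measurableTypeR R).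
  by apply: measurable_realfun.measurable_funD; [exact: measurable_id|exact: measurable_cst].
pose m2 : {measure set (measurableTypeR R) -> \bar R} :=
  @measure_function_pushforward__canonical__measure_function_Measure
    _ _ _ _ _ (@lebesgue_measure R) _ mf.
rewrite -[LHS]/(m2 A); apply/esym/lebesgue_measure_unique => //= _ [[a b]] _ <-.
rewrite /m2/= /pushforward.
rewrite (_ : _ @^-1` _ = `]a - c, b - c]%classic); last first.
  by apply/seteqP; split=> x /=; rewrite !in_itv/= ltrBlDr lerBrDr.
rewrite !lebesgue_measure_itv/= !lte_fin ltrD2r; case: ifPn => // _.
by rewrite !EFinB; congr EFin; rewrite opprB addrA subrK.
Qed.

Lemma lebesgue_rV_shift n (c : 'rV[R]_n) (B : set 'rV[R]_n) : measurable B ->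
  lebesgue_rV n ((fun x => x + c) @^-1` B) = lebesgue_rV n B.
Proof.
move=> mB.
pose m2 : {measure set 'rV[R]_n -> \bar R} :=
  @measure_function_pushforward__canonical__measure_function_Measure
    _ _ _ _ _ (lebesgue_rV n) _ (measurable_shift_rV c).
apply/esym/(@rV_measure_unique _ (lebesgue_rV n) m2) => //; last exact: lebesgue_rV_cube_fin.
move=> A mA; apply: (etrans (lebesgue_rV_rect mA)); rewrite /m2 /= /pushforward.
rewrite (_ : _ @^-1` _ = rect (fun i => (fun t : measurableTypeR R => t + c ord0 i) @^-1` A i)).
  rewrite lebesgue_rV_rect => [|i].
    by apply: eq_bigr => i _; rewrite lebesgue_measure_shift.
  rewrite -[X in measurable X]setTI.
  have : measurable_fun [set: measurableTypeR R] (fun t : measurableTypeR R => (t + c ord0 i) : measurableTypeR R).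
    by apply: measurable_realfun.measurable_funD; [exact: measurable_id|exact: measurable_cst].
  by apply=> //; exact: mA.
by apply/seteqP; split=> [x /= H i|x /= H i]; have := H i; rewrite /= mxE.
Qed.

End rectangles.

Section borel_rV.
Context {R : realType} {n : nat}.

Lemma ball_rect (a : 'rV[R]_n) r : 0 < r -> ball a r = rect (fun i => ball (a ord0 i) r).
Proof.
move=> r0; apply/seteqP; split=> x.
  by move=> [_ H] i; exact: H.
by move=> H; split=> // i j; rewrite (ord1 i).
Qed.

Lemma open_measurable_rV (U : set 'rV[R]_n) : open U -> measurable U.
Proof.
move=> oU.
(* Containment of the rational ball in U is part of the set, so the union can run over all rational
   centres and radii. *)
pose Q (q : 'rV[rat]_n * rat) : set 'rV[R]_n :=
  [set x | 0 < q.2 /\ ball (map_mx ratr q.1 : 'rV[R]_n) (ratr q.2 : R) `<=` U /\ ball (map_mx ratr q.1 : 'rV[R]_n) (ratr q.2) x].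
have mQ q : measurable (Q q).
  have [q0|q0] := ltP 0 q.2; last first.
    by rewrite (_ : Q q = set0)// -subset0 => x [/lt_geF]; rewrite q0.
  have [sub|nsub] := pselect (ball (map_mx ratr q.1 : 'rV[R]_n) (ratr q.2 : R) `<=` U); last first.
    by rewrite (_ : Q q = set0)// -subset0 => x [_ []].
  rewrite (_ : Q q = ball (map_mx ratr q.1 : 'rV[R]_n) (ratr q.2 : R)).
    rewrite ball_rect ?ltr0q//; apply: measurable_rect => i.
    by apply: open_measurable; exact: ball_open.
  by apply/seteqP; split=> [x [_ []]|x] //.
rewrite (_ : U = \bigcup_q Q q); last first.
  apply/seteqP; split=> [x Ux|x [q _ [_ [H /H]]]]//.
  have /nbhs_ballP[e /= e0 He] := open_nbhs_nbhs (conj oU Ux).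
  have [r /andP[r0 re]] : exists r : rat, (0 : R) < ratr r < e / 2.
    by have [r] := rat_in_itvoo (divr_gt0 e0 (@ltr0Sn R 1)); rewrite in_itv/= => H; exists r.
  have H i : exists q : rat, `|x ord0 i - ratr q| < ratr r.
    have [q] := @rat_in_itvoo R (x ord0 i - ratr r) (x ord0 i + ratr r) ltac:(lra).
    by rewrite in_itv/= => H; exists q; rewrite distrC ltr_distlC; lra.
  have [q Hq] := choice H.
  exists (\row_i q i, r) => //=; have r0' : 0 < r by rewrite -(ltr0q R).
  have xq : ball (map_mx ratr (\row_i q i) : 'rV[R]_n) (ratr r : R) x.
    by rewrite ball_rect// => i; rewrite /= !mxE /ball/= distrC.
  split=> //; split=> // z qz; apply: He.
  have -> : e = e / 2 + e / 2 by field.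
  apply: (@ball_triangle _ _ (map_mx ratr (\row_i q i) : 'rV[R]_n)).
    by apply: le_ball (ltW re) _ _; exact: ball_sym.
  by apply: le_ball (ltW re) _ _.
apply: countable_bigcupT_measurable => //.
Qed.

Lemma closed_measurable_rV (U : set 'rV[R]_n) : closed U -> measurable U.
Proof.
by move=> cU; rewrite -(setCK U); apply: measurableC; apply: open_measurable_rV; exact: closed_openC.
Qed.

Lemma continuous_measurable_rV (f : 'rV[R]_n -> R) D : measurable D ->
  continuous f -> measurable_fun D f.
Proof.
move=> mD cf; apply: measurable_funTS.
apply: (measurability _ (RGenOpens.measurableE R)) => _ [_ [a [b ->] <-]].
rewrite setTI; apply: open_measurable_rV.
move/continuousP : cf; apply; exact: interval_open.
Qed.

Lemma bounded_lebesgue_fin (D : set 'rV[R]_n) : measurable D -> bounded_set D ->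
  (lebesgue_rV n D < +oo)%E.
Proof.
move=> mD [M [_ HM]]; pose k := (Num.truncn `|M + 1|).+1.
apply: le_lt_trans (lebesgue_rV_cube_fin n k).
apply: le_measure; rewrite ?inE//; first exact: measurable_rect.
move=> x Dx i /=; rewrite in_itv/= -ler_norml (le_trans (coord_le_norm _ _))//.
apply: (le_trans (HM (M + 1) _ _ Dx)); first by rewrite ltrDl.
by rewrite (le_trans (ler_norm _))// ltW// truncnS_gt.
Qed.

End borel_rV.

(** * Square-integrable functions *)

Section L2_theory.
Context {d} {T : measurableType d} {R : realType}.
Variables (mu : {measure set T -> \bar R}) (D : set T).
Hypothesis mD : measurable D.
Implicit Types u v w a : T -> R.
Local Notation L2 := (L2 mu D).
Local Notation dot := (dotL2 mu D).
Local Notation nrm := (normL2 mu D).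

Lemma L2_mul_integrable u v : L2 u -> L2 v -> mu.-integrable D (fun x => (u x * v x)%:E).
Proof.
move=> [mu1 iu] [mv iv]; have := integrableD mD iu iv; apply: le_integrable => //.
  by apply/measurable_EFinP; exact: measurable_funM.
move=> x Dx /=; rewrite lee_fin normrM (ger0_norm (addr_ge0 (sqr_ge0 _) (sqr_ge0 _))).
rewrite -(real_normK (num_real (u x))) -(real_normK (num_real (v x))).
have := sqr_ge0 (`|u x| - `|v x|); have := mulr_ge0 (normr_ge0 (u x)) (normr_ge0 (v x)).
move: `|u x| `|v x| => a b; nra.
Qed.

Lemma L2D u v : L2 u -> L2 v -> L2 (u \+ v).
Proof.
move=> Lu Lv; split; first exact: measurable_funD Lu.1 Lv.1.
have := integrableD mD (integrableD mD Lu.2 Lv.2)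
  (integrableD mD (L2_mul_integrable Lu Lv) (L2_mul_integrable Lu Lv)).
apply: eq_integrable => // x _ /=; rewrite -!EFinD; congr EFin; ring.
Qed.

Lemma L2Z c u : L2 u -> L2 (fun x => c * u x).
Proof.
move=> Lu; split; first by apply: measurable_funM => //; exact: Lu.1.
have := @integrableZl _ _ _ mu D mD (c ^+ 2) _ Lu.2.
by apply: eq_integrable => // x _ /=; rewrite -EFinM exprMn.
Qed.

Lemma L2N u : L2 u -> L2 (\- u).
Proof.
by move=> /(L2Z (-1)); rewrite (_ : (fun _ => _) = \- u)//; apply/funext => x; rewrite mulN1r.
Qed.

Lemma L2B u v : L2 u -> L2 v -> L2 (u \- v).
Proof. by move=> Lu /L2N Lv; exact: L2D. Qed.

Lemma L2_0 : L2 (cst 0).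
Proof.
split=> //; rewrite (_ : (fun _ => _) = cst 0%E); first exact: integrable0.
by apply/funext => x /=; rewrite expr0n.
Qed.

Lemma L2_sum (I : Type) (r : seq I) (P : pred I) (F : I -> T -> R) :
  (forall i, P i -> L2 (F i)) -> L2 (fun x => \sum_(i <- r | P i) F i x).
Proof.
move=> LF; rewrite (_ : (fun _ => _) = \big[(fun f g => f \+ g)/cst 0]_(i <- r | P i) F i).
  by apply: big_ind => //; [exact: L2_0|exact: L2D].
by apply/funext => x; elim/big_rec2: _ => //= i y1 y2 _ ->.
Qed.

Lemma eq_L2 u v : (forall x, D x -> u x = v x) -> L2 u -> L2 v.
Proof.
move=> uv [mu1 iu]; split.
  by apply: eq_measurable_fun mu1 => x /[!inE] /uv.
by apply: eq_integrable iu => // x /[!inE] /uv ->.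
Qed.

Lemma L2_bdd_mul (M : R) a u : measurable_fun D a -> (forall x, D x -> `|a x| <= M) ->
  L2 u -> L2 (fun x => a x * u x).
Proof.
move=> ma aM Lu; split; first exact: measurable_funM ma Lu.1.
have := @integrableZl _ _ _ mu D mD (M ^+ 2) _ Lu.2; apply: le_integrable => //.
  apply/measurable_EFinP; apply: measurable_funX; exact: measurable_funM ma Lu.1.
move=> x Dx; suff : `|(a x * u x) ^+ 2| <= `|M ^+ 2 * u x ^+ 2| by [].
rewrite normrX normrM normrM !normrX -exprMn lerXn2r ?nnegrE ?mulr_ge0// ler_wpM2r//.
by rewrite (le_trans (aM _ Dx))// ler_norm.
Qed.

Lemma L2_bounded (M : R) a : (mu D < +oo)%E -> measurable_fun D a ->
  (forall x, D x -> `|a x| <= M) -> L2 a.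
Proof.
move=> Dfin ma aM; split=> //.
apply: measurable_bounded_integrable => //; first exact: measurable_funX.
exists (M ^+ 2); split; first exact: num_real.
move=> y My x Dx /=; rewrite normrX (le_trans _ (ltW My))// lerXn2r ?nnegrE ?aM//.
by rewrite (le_trans _ (aM _ Dx)).
Qed.

Lemma dotL2C u v : dot u v = dot v u.
Proof. by apply: eq_Rintegral => x _; rewrite mulrC. Qed.

Lemma eq_dotL2 u u' v v' : (forall x, D x -> u x = u' x) -> (forall x, D x -> v x = v' x) ->
  dot u v = dot u' v'.
Proof. by move=> E F; apply: eq_Rintegral => x /[!inE] Dx; rewrite E// F. Qed.

Lemma eq_normL2 u u' : (forall x, D x -> u x = u' x) -> nrm u = nrm u'.
Proof. by move=> E; rewrite /normL2 (eq_dotL2 E E). Qed.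

Lemma dotL2Dl u v w : L2 u -> L2 v -> L2 w -> dot (u \+ v) w = dot u w + dot v w.
Proof.
move=> Lu Lv Lw; rewrite /dotL2 -RintegralD//; try exact: L2_mul_integrable.
by apply: eq_Rintegral => x _ /=; rewrite mulrDl.
Qed.

Lemma dotL2Dr u v w : L2 u -> L2 v -> L2 w -> dot w (u \+ v) = dot w u + dot w v.
Proof. by move=> Lu Lv Lw; rewrite !(dotL2C w) dotL2Dl. Qed.

Lemma dotL2Zl c u w : L2 u -> L2 w -> dot (fun x => c * u x) w = c * dot u w.
Proof.
move=> Lu Lw; rewrite /dotL2 -RintegralZl//; last exact: L2_mul_integrable.
by apply: eq_Rintegral => x _ /=; rewrite mulrA.
Qed.

Lemma dotL2Zr c u w : L2 u -> L2 w -> dot w (fun x => c * u x) = c * dot w u.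
Proof. by move=> Lu Lw; rewrite !(dotL2C w) dotL2Zl. Qed.

Lemma dotL2Nl u w : L2 u -> L2 w -> dot (\- u) w = - dot u w.
Proof.
move=> Lu Lw; rewrite -mulN1r -dotL2Zl//; apply: eq_Rintegral => x _.
by rewrite mulN1r.
Qed.

Lemma dotL2Bl u v w : L2 u -> L2 v -> L2 w -> dot (u \- v) w = dot u w - dot v w.
Proof. by move=> Lu Lv Lw; rewrite (dotL2Dl Lu (L2N Lv) Lw) dotL2Nl. Qed.

Lemma dotL2Br u v w : L2 u -> L2 v -> L2 w -> dot w (u \- v) = dot w u - dot w v.
Proof. by move=> Lu Lv Lw; rewrite !(dotL2C w) dotL2Bl. Qed.

Lemma dotL2_0l w : dot (cst 0) w = 0.
Proof.
rewrite /dotL2 (@eq_Rintegral _ _ _ _ _ (cst 0)) ?Rintegral_cst ?mul0r// => x _.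
by rewrite mul0r.
Qed.

Lemma dotL2_suml (I : Type) (r : seq I) (P : pred I) (F : I -> T -> R) w :
  (forall i, P i -> L2 (F i)) -> L2 w ->
  dot (fun x => \sum_(i <- r | P i) F i x) w = \sum_(i <- r | P i) dot (F i) w.
Proof.
move=> LF Lw; elim: r => [|i r IH].
  rewrite big_nil; transitivity (dot (cst 0) w); last exact: dotL2_0l.
  by apply: eq_dotL2 => // x _ /=; rewrite big_nil.
rewrite big_cons -IH; case: ifPn => Pi.
  rewrite -dotL2Dl//; [|exact: LF|exact: L2_sum].
  by apply: eq_dotL2 => // x _ /=; rewrite big_cons Pi.
by apply: eq_dotL2 => // x _ /=; rewrite big_cons (negbTE Pi).
Qed.

Lemma dotL2_sumr (I : Type) (r : seq I) (P : pred I) (F : I -> T -> R) w :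
  (forall i, P i -> L2 (F i)) -> L2 w ->
  dot w (fun x => \sum_(i <- r | P i) F i x) = \sum_(i <- r | P i) dot w (F i).
Proof.
by move=> LF Lw; rewrite dotL2C dotL2_suml//; apply: eq_bigr => i _; rewrite dotL2C.
Qed.

Lemma dotL2_ge0 u : 0 <= dot u u.
Proof. by apply: Rintegral_ge0 => x _; rewrite -expr2 sqr_ge0. Qed.

Lemma normL2_ge0 u : 0 <= nrm u. Proof. exact: sqrtr_ge0. Qed.

Lemma sqr_normL2 u : nrm u ^+ 2 = dot u u.
Proof. by rewrite sqr_sqrtr// dotL2_ge0. Qed.

Lemma cauchy_schwarzL2 u v : L2 u -> L2 v -> `|dot u v| <= nrm u * nrm v.
Proof.
move=> Lu Lv; rewrite -ler_sqr ?nnegrE ?mulr_ge0 ?normL2_ge0//.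
rewrite exprMn !sqr_normL2 real_normK ?num_real//.
have H t : 0 <= dot u u - 2 * t * dot u v + t ^+ 2 * dot v v.
  have := dotL2_ge0 (u \- (fun x => t * v x)); have Ltv := L2Z t Lv.
  rewrite dotL2Bl// ?(dotL2Br, dotL2Zl, dotL2Zr)//; try exact: L2B.
  by rewrite (dotL2C v u); congr (_ <= _); ring.
have [v0|v0] := eqVneq (dot v v) 0.
  rewrite v0 mulr0; have [->|b0] := eqVneq (dot u v) 0; first by rewrite expr0n.
  (* With [dot v v = 0] the polynomial is affine in t; at this t it equals -1. *)
  have := H ((dot u u + 1) / (2 * dot u v)); rewrite v0 mulr0 addr0.
  rewrite (_ : _ - _ = -1) ?ler0N1//.
  by field.
have vp : 0 < dot v v by rewrite lt_neqAle eq_sym v0 dotL2_ge0.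
have := H (dot u v / dot v v); rewrite (_ : _ + _ = (dot u u * dot v v - dot u v ^+ 2) / dot v v).
  by rewrite pmulr_lge0 ?invr_gt0// subr_ge0.
by field.
Qed.

Lemma dotL2_le u v : L2 u -> L2 v -> dot u v <= nrm u * nrm v.
Proof. by move=> Lu Lv; apply: le_trans (cauchy_schwarzL2 Lu Lv); exact: ler_norm. Qed.

Lemma normL2D u v : L2 u -> L2 v -> nrm (u \+ v) <= nrm u + nrm v.
Proof.
move=> Lu Lv; rewrite -ler_sqr ?nnegrE ?addr_ge0 ?normL2_ge0// sqr_normL2.
rewrite dotL2Dl// ?dotL2Dr//; try exact: L2D.
rewrite sqrrD !sqr_normL2 (dotL2C v u); have := dotL2_le Lu Lv.
move: (dot u u) (dot v v) (dot u v) (nrm u * nrm v) => a b c e; lra.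
Qed.

Lemma normL2Z c u : L2 u -> nrm (fun x => c * u x) = `|c| * nrm u.
Proof.
move=> Lu; rewrite /normL2 dotL2Zl ?dotL2Zr//; last exact: L2Z.
by rewrite mulrA -expr2 sqrtrM ?sqr_ge0// sqrtr_sqr.
Qed.

Lemma normL2N u : nrm (\- u) = nrm u.
Proof. by rewrite /normL2; congr Num.sqrt; apply: eq_Rintegral => x _; rewrite mulrNN. Qed.

Lemma normL2B u v : L2 u -> L2 v -> nrm (u \- v) <= nrm u + nrm v.
Proof. by move=> Lu Lv; rewrite -(normL2N v); apply: normL2D => //; exact: L2N. Qed.

Lemma normL2_distC u v : nrm (u \- v) = nrm (v \- u).
Proof. by rewrite -normL2N; apply: eq_normL2 => x _ /=; rewrite opprB. Qed.

Lemma normL2_triangle u v w : L2 u -> L2 v -> L2 w -> nrm (u \- w) <= nrm (u \- v) + nrm (v \- w).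
Proof.
move=> Lu Lv Lw; rewrite (@eq_normL2 _ ((u \- v) \+ (v \- w))).
  by apply: normL2D; exact: L2B.
by move=> x _ /=; rewrite addrA subrK.
Qed.

Lemma normL2_0 : nrm (cst 0) = 0.
Proof. by rewrite /normL2 dotL2_0l sqrtr0. Qed.

Lemma normL2_sum (I : Type) (r : seq I) (P : pred I) (F : I -> T -> R) :
  (forall i, P i -> L2 (F i)) ->
  nrm (fun x => \sum_(i <- r | P i) F i x) <= \sum_(i <- r | P i) nrm (F i).
Proof.
move=> LF; elim: r => [|i r IH].
  by rewrite big_nil (@eq_normL2 _ (cst 0)) ?normL2_0// => x _; rewrite big_nil.
rewrite big_cons; case: ifPn => Pi.
  rewrite (@eq_normL2 _ (F i \+ (fun x => \sum_(i <- r | P i) F i x))).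
    by apply: (le_trans (normL2D _ _)); [exact: LF|exact: L2_sum|rewrite lerD2l].
  by move=> x _ /=; rewrite big_cons Pi.
by rewrite (eq_normL2 (u' := fun x => \sum_(i <- r | P i) F i x))// => x _; rewrite big_cons (negbTE Pi).
Qed.

Lemma normL2_bdd_mul (M : R) a u : 0 <= M -> measurable_fun D a ->
  (forall x, D x -> `|a x| <= M) -> L2 u -> nrm (fun x => a x * u x) <= M * nrm u.
Proof.
move=> M0 ma aM Lu; have Lau := L2_bdd_mul ma aM Lu.
rewrite -ler_sqr ?nnegrE ?mulr_ge0 ?normL2_ge0// exprMn !sqr_normL2.
rewrite -dotL2Zl// /dotL2; apply: le_Rintegral => //; try exact: L2_mul_integrable.
  by apply: L2_mul_integrable => //; exact: L2Z.
move=> x Dx; rewrite mulrACA -[X in _ <= X]mulrA -!expr2 ler_wpM2r ?sqr_ge0//.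
by rewrite -real_normK ?num_real// lerXn2r ?nnegrE// aM.
Qed.

Lemma normL2_mono u v : L2 u -> L2 v -> (forall x, D x -> `|u x| <= `|v x|) -> nrm u <= nrm v.
Proof.
move=> Lu Lv uv; rewrite ler_sqrt ?dotL2_ge0//; apply: le_Rintegral => //; try exact: L2_mul_integrable.
move=> x Dx; rewrite -!expr2 -(real_normK (num_real (u x))) -(real_normK (num_real (v x))).
by rewrite lerXn2r ?nnegrE// uv.
Qed.

Lemma dotL2_EFin u v : L2 u -> L2 v -> (dot u v)%:E = (\int[mu]_(x in D) (u x * v x)%:E)%E.
Proof.
by move=> Lu Lv; rewrite /dotL2 /Rintegral fineK//; apply: integrable_fin_num => //; exact: L2_mul_integrable.
Qed.

Lemma normL2_eq0_ae u : L2 u -> nrm u = 0 -> {ae mu, forall x, D x -> u x = 0}.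
Proof.
move=> Lu u0; have : (\int[mu]_(x in D) `|(u x ^+ 2)%:E| = 0)%E.
  under eq_integral do rewrite abse_EFin normrX real_normK ?num_real// expr2.
  by rewrite -dotL2_EFin// -sqr_normL2 u0 expr0n.
move/(ae_eq_integral_abs mu mD) => /(_ _)[|N [mN N0 sub]].
  by apply/measurable_EFinP; apply: measurable_funX; exact: Lu.1.
exists N; split=> // x /= nux; apply: sub => /= H; apply: nux => Dx.
by have := H Dx => /= -[/eqP]; rewrite sqrf_eq0 => /eqP.
Qed.

Lemma ae_normL2_eq0 u : measurable_fun D u -> {ae mu, forall x, D x -> u x = 0} -> L2 u /\ nrm u = 0.
Proof.
move=> mu1 ae0; have ae0' : ae_eq mu D (fun x => (u x ^+ 2)%:E) (cst 0%E).
  by apply: filterS ae0 => x H Dx /=; rewrite H// expr0n.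
have m2 : measurable_fun D (fun x => (u x ^+ 2)%:E) by apply/measurable_EFinP; exact: measurable_funX.
have Lu : L2 u.
  split=> //; apply/integrableP; split => //.
  have [_ H] := ae_eq_integral_abs mu mD m2; rewrite H//; exact: ltry.
split=> //; apply/eqP; rewrite -sqrf_eq0 sqr_normL2 /dotL2 /Rintegral.
under eq_integral do rewrite -expr2.
by rewrite (@ae_eq_integral _ _ _ mu D (cst 0%E) _ mD m2 _ ae0')// integral0.
Qed.

Lemma normL2_dot0 u w : L2 u -> L2 w -> nrm u = 0 -> dot u w = 0.
Proof.
by move=> Lu Lw u0; apply/eqP; rewrite -normr_le0 (le_trans (cauchy_schwarzL2 Lu Lw))// u0 mul0r.
Qed.

Lemma normL2_dist0 u v : L2 u -> L2 v -> nrm (u \- v) = 0 -> nrm u = nrm v.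
Proof.
move=> Lu Lv uv; apply/eqP; rewrite eq_le; apply/andP; split.
  rewrite (@eq_normL2 _ ((u \- v) \+ v)) ?(le_trans (normL2D _ _))//; [exact: L2B|by rewrite uv add0r|].
  by move=> x _ /=; rewrite subrK.
rewrite (@eq_normL2 _ ((v \- u) \+ u)) ?(le_trans (normL2D _ _))//; [exact: L2B|by rewrite normL2_distC uv add0r|].
by move=> x _ /=; rewrite subrK.
Qed.

Lemma normL2_ler_dist u v : L2 u -> L2 v -> `|nrm u - nrm v| <= nrm (u \- v).
Proof.
move=> Lu Lv; have Luv := L2B Lu Lv; have Lvu := L2B Lv Lu.
rewrite ler_norml; apply/andP; split.
  rewrite lerNl opprB lerBlDr normL2_distC (@eq_normL2 v ((v \- u) \+ u)) ?normL2D//.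
  by move=> x _ /=; rewrite subrK.
rewrite lerBlDr (@eq_normL2 u ((u \- v) \+ v)) ?normL2D//.
by move=> x _ /=; rewrite subrK.
Qed.

Lemma cvg_normL2 (u_ : nat -> T -> R) u : (forall k, L2 (u_ k)) -> L2 u ->
  nrm (u \- u_ k) @[k --> \oo] --> 0 -> nrm (u_ k) @[k --> \oo] --> nrm u.
Proof.
move=> Lu_ Lu uk; apply: cvg_zero; apply: norm_cvg0 => /=.
apply: squeeze_cvgr uk; last exact: cvg_cst.
near=> k; rewrite normr_ge0/= normL2_distC; exact: normL2_ler_dist.
Unshelve. all: by end_near. Qed.

Lemma cvg_dotL2 (u_ v_ : nat -> T -> R) u v :
  (forall k, L2 (u_ k)) -> L2 u -> (forall k, L2 (v_ k)) -> L2 v ->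
  nrm (u \- u_ k) @[k --> \oo] --> 0 -> nrm (v \- v_ k) @[k --> \oo] --> 0 ->
  dot (u_ k) (v_ k) @[k --> \oo] --> dot u v.
Proof.
move=> Lu_ Lu Lv_ Lv uk vk; apply: cvg_zero; apply: norm_cvg0 => /=.
have : (nrm (u \- u_ k) * nrm (v_ k) + nrm u * nrm (v \- v_ k)) @[k --> \oo] --> (0 : R).
  rewrite [X in _ --> X](_ : 0 = 0 * nrm v + nrm u * 0); last by rewrite mul0r mulr0 addr0.
  by apply: cvgD; [apply: cvgM => //; exact: cvg_normL2|apply: cvgM => //; exact: cvg_cst].
apply: squeeze_cvgr; last exact: cvg_cst.
near=> k; rewrite normr_ge0/= distrC.
have -> : dot u v - dot (u_ k) (v_ k) = dot (u \- u_ k) (v_ k) + dot u (v \- v_ k).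
  by rewrite dotL2Bl// dotL2Br// [RHS]addrC [RHS]addrA subrK.
rewrite (le_trans (ler_normD _ _))// lerD// cauchy_schwarzL2//; exact: L2B.
Unshelve. all: by end_near. Qed.

(** Fatou's lemma for the squares. Square integrability of the limit is a by-product of the norm
    bound. *)
Lemma le_integral_sqr_lim (w_ : nat -> T -> R) u (c : R) : 0 <= c -> measurable_fun D u ->
  (forall k, L2 (w_ k)) -> (\forall k \near \oo, nrm (w_ k) <= c) ->
  {ae mu, forall x, D x -> w_ k x @[k --> \oo] --> u x} -> L2 u /\ nrm u <= c.
Proof.
move=> c0 mu1 Lw wc [N [mN N0 sub]].
have H : (\int[mu]_(x in D) (u x ^+ 2)%:E <= (c ^+ 2)%:E)%E.
  apply: (@le_trans _ _ (\int[mu]_(x in D) limn_einf (fun k => (w_ k x ^+ 2)%:E))%E).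
    have mlim : measurable_fun D (fun x => limn_einf (fun k => (w_ k x ^+ 2)%:E)).
      rewrite (_ : (fun x => _) = (fun x => - limn_esup (fun k => - (w_ k x ^+ 2)%:E))%E).
        apply: measurableT_comp => //; apply: measurable_fun_limn_esup => k.
        apply: measurableT_comp => //.
        by apply/measurable_EFinP; apply: measurable_funX; exact: (Lw k).1.
      apply/funext => x; rewrite -limn_einfN; congr limn_einf; apply/funext => k /=.
      by rewrite /= opprK.
    rewrite le_eqVlt; apply/orP; left; apply/eqP; apply: ae_eq_integral => //.
      by apply/measurable_EFinP; exact: measurable_funX.
    exists N; split=> // x /= nx; apply: sub => /= Hx; apply: nx => Dx.
    have Hk : (w_ k x ^+ 2)%:E @[k --> \oo] --> (u x ^+ 2)%:E.
      apply: cvg_EFin; first exact: nearW.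
      by rewrite expr2; under eq_fun do rewrite /= expr2; apply: cvgM; exact: Hx.
    by have [-> _] := cvg_limn_einf_sup Hk.
  apply: le_trans (fatou mu mD _ _) _.
  - by move=> k; apply/measurable_EFinP; apply: measurable_funX; exact: (Lw k).1.
  - by move=> k x _; rewrite lee_fin sqr_ge0.
  rewrite limn_einf_lim; apply: lime_le; first exact: is_cvg_einfs.
  case: wc => n0 _ Hn0; near=> m; apply: (@le_trans _ _ (\int[mu]_(x in D) (w_ (m + n0)%N x ^+ 2)%:E)%E).
    by apply: ereal_inf_lbound; exists (m + n0)%N => //=; rewrite leq_addr.
  under eq_integral do rewrite expr2.
  rewrite -dotL2_EFin// -sqr_normL2 lee_fin lerXn2r ?nnegrE ?normL2_ge0// Hn0//=.
  exact: leq_addl.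
have Lu : L2 u.
  split=> //; apply/integrableP; split; first by apply/measurable_EFinP; exact: measurable_funX.
  under eq_integral do rewrite gee0_abs ?lee_fin ?sqr_ge0//.
  by apply: le_lt_trans H _; rewrite ltry.
split=> //; rewrite -ler_sqr ?nnegrE ?normL2_ge0// sqr_normL2 -lee_fin dotL2_EFin//.
Unshelve. all: by end_near. Qed.

Lemma L2_complete (u_ : nat -> T -> R) : (forall k, L2 (u_ k)) ->
  (forall e : R, 0 < e -> \forall N \near \oo, forall m n, (N <= m)%N -> (N <= n)%N -> nrm (u_ m \- u_ n) <= e) ->
  exists2 u, L2 u & nrm (u \- u_ k) @[k --> \oo] --> 0.
Proof.
move=> Lu cau.
(* The rate 8^-k leaves room for the weight 4^k in the series below: the k-th term has integral at
   most 4^k 8^-k = 2^-k, and finiteness of the sum at x gives increments of order 2^-k. *)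
have H k : exists N : nat, forall m n, (N <= m)%N -> (N <= n)%N -> nrm (u_ m \- u_ n) <= 8^-1 ^+ k.
  have [|N _ HN] := cau (8^-1 ^+ k); first by rewrite exprn_gt0// invr_gt0.
  by exists N; apply: HN => /=.
have [N0 HN0] := choice H.
(* Summing makes the indices monotone and at least both [N0 k] and k. *)
pose N k := (\sum_(j < k.+1) (N0 j).+1)%N.
have N0N k : (N0 k <= N k)%N by rewrite /N big_ord_recr/= (leq_trans (leqnSn _))// leq_addl.
have kN k : (k <= N k)%N.
  elim: k => // k IH; rewrite /N big_ord_recr/= addnS ltnS (leq_trans IH)//; exact: leq_addr.
have NS k m : (N k <= N (m + k))%N.
  elim: m => // m IH; rewrite (leq_trans IH)// addSn /N [in leqRHS]big_ord_recr/=; exact: leq_addr.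
pose dd k := u_ (N k.+1) \- u_ (N k).
have Ld k : L2 (dd k) by exact: L2B.
have ndd k : nrm (dd k) <= 8^-1 ^+ k.
  by apply: HN0; [rewrite (leq_trans (N0N _))// (NS k 1%N)|exact: N0N].
pose s x := (\sum_(k <oo) (4 ^+ k * dd k x ^+ 2)%:E)%E.
have md k : measurable_fun D (fun x => (4 ^+ k * dd k x ^+ 2)%:E).
  by apply/measurable_EFinP; apply: measurable_funM => //; apply: measurable_funX; exact: (Ld k).1.
have d0 k x : (0 <= (4 ^+ k * dd k x ^+ 2)%:E)%E.
  by rewrite lee_fin; apply: mulr_ge0; [exact: exprn_ge0|exact: sqr_ge0].
have intd k : (\int[mu]_(x in D) (4 ^+ k * dd k x ^+ 2)%:E = (4 ^+ k * nrm (dd k) ^+ 2)%:E)%E.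
  under eq_integral do rewrite EFinM.
  rewrite ge0_integralZl//=.
  - by under eq_integral do rewrite expr2; rewrite -dotL2_EFin// -sqr_normL2.
  - by apply/measurable_EFinP; apply: measurable_funX; exact: (Ld k).1.
  - by move=> x _; rewrite lee_fin sqr_ge0.
have s0 x : (0 <= s x)%E by apply: nneseries_ge0 => *; exact: d0.
have ints : (\int[mu]_(x in D) s x < +oo)%E.
  rewrite integral_nneseries//.
  apply: (@le_lt_trans _ _ (\sum_(k <oo) (2^-1 ^+ k)%:E)%E).
    apply: lee_nneseries => [k *|k *]; first by apply: integral_ge0 => x Dx; exact: d0.
    rewrite intd lee_fin (@le_trans _ _ (4 ^+ k * (8^-1 ^+ k)))//.
      rewrite ler_wpM2l ?exprn_ge0//.
      have := ndd k; have : 8^-1 ^+ k <= (1 : R) by rewrite exprn_ile1//; lra.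
      have := normL2_ge0 (dd k); move: (nrm _) (8^-1 ^+ k) => a b; nra.
    by rewrite -exprMn (_ : 4 / 8 = 2^-1 :> R)//; field.
  apply: (@le_lt_trans _ _ 2%:E); last exact: ltry.
  apply: lime_le; first by apply: is_cvg_nneseries => k _ _; rewrite lee_fin exprn_ge0.
  near=> n; rewrite sumEFin lee_fin.
  have := @geometric_le_lim R n 1 2^-1 ler01; rewrite mul1r.
  rewrite (_ : (1 - 2^-1)^-1 = 2 :> R); last by field.
  rewrite /series/= => H'; apply: le_trans (H' _ _); first by under [leRHS]eq_bigr do rewrite mul1r.
    by rewrite invr_gt0.
  by rewrite ger0_norm ?invr_ge0// invf_lt1// ltr1n.
have [M [mM M0 Msub]] : {ae mu, forall x, D x -> s x \is a fin_num}.
  apply: integrable_ae => //; apply/integrableP; split.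
    by apply: ge0_emeasurable_sum => // *; exact: d0.
  by rewrite (eq_integral s)// => x _; rewrite gee0_abs.
(* The upper limit is defined at every point, hence measurable; it is the limit wherever the series
   [s] is finite. *)
pose u x := fine (limn_esup (fun k => (u_ (N k) x)%:E)).
have mu1 : measurable_fun D u.
  apply: measurableT_comp; first exact: fine_measurable.
  apply: measurable_fun_limn_esup => k; apply/measurable_EFinP; exact: (Lu _).1.
have cvu : {ae mu, forall x, D x -> u_ (N k) x @[k --> \oo] --> u x}.
  exists M; split=> // x /= nx; apply: Msub => /= Hx; apply: nx => Dx.
  have {}Hx := Hx Dx.
  suff cv : cvgn (fun k => u_ (N k) x).
    have cv' : (u_ (N k) x)%:E @[k --> \oo] --> (limn (fun k => u_ (N k) x))%:E.
      by apply: cvg_EFin => //; exact: nearW.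
    by rewrite /u; have [_ ->] := cvg_limn_einf_sup cv'.
  pose S := fine (s x).
  have dS k : `|dd k x| <= (S + 1) * 2^-1 ^+ k.
    have S0 : 0 <= S by rewrite fine_ge0// nneseries_ge0// => j _ _; exact: d0.
    have h : 4 ^+ k * dd k x ^+ 2 <= S.
      rewrite -lee_fin fineK//.
      apply: le_trans (nneseries_lim_ge k.+1 _) => [|j _ _]; last exact: d0.
      rewrite big_nat_recr//= leeDr// sume_ge0// => j _; exact: d0.
    have h2 : 0 < (2 : R) ^+ k by rewrite exprn_gt0.
    rewrite exprVn ler_pdivlMr//.
    rewrite -ler_sqr ?nnegrE ?mulr_ge0 ?addr_ge0 ?(ltW h2)//.
    rewrite exprMn real_normK ?num_real// -exprM mulnC exprM (_ : 2 ^+ 2 = 4 :> R); last by ring.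
    rewrite mulrC (le_trans h)//; nra.
  have cs : cvgn (series (fun k => dd k x)).
    apply: normed_cvg; apply: (@series_le_cvg _ _ (geometric (S + 1) 2^-1)) => //=.
    - move=> n; rewrite mulr_ge0// ?exprn_ge0 ?invr_ge0//.
      by rewrite addr_ge0// fine_ge0// nneseries_ge0// => j _ _; exact: d0.
    - apply: is_cvg_geometric_series.
      by rewrite ger0_norm ?invr_ge0// invf_lt1// ltr1n.
  rewrite (_ : (fun k => _) = (fun k => u_ (N 0%N) x + series (fun k => dd k x) k)).
    by apply: is_cvgD => //; exact: is_cvg_cst.
  apply/funext => k; rewrite /series /= /dd telescope_sumr//.
  by rewrite addrC subrK.
(* Fatou along the subsequence with n fixed gives convergence of the whole sequence. *)
have key e : 0 < e -> \forall n \near \oo, L2 (u \- u_ n) /\ nrm (u \- u_ n) <= e.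
  move=> e0; have [n0 _ Hn0] := cau _ e0; exists n0 => // n /= n0n.
  apply: (@le_integral_sqr_lim (fun k => u_ (N k) \- u_ n)).
  - exact: ltW.
  - by apply: measurable_funB => //; exact: (Lu _).1.
  - by move=> k; exact: L2B.
  - exists n0 => // k /= n0k; apply: (Hn0 n0) => //=.
    by rewrite (leq_trans n0k).
  - apply: filterS cvu => x Hx Dx; apply: cvgB; [exact: Hx|exact: cvg_cst].
have Lu' : L2 u.
  have [n1 _ Hn1] := key 1 ltr01; have [|Ln _] := Hn1 n1; first exact: leqnn.
  by apply: (eq_L2 _ (L2D Ln (Lu n1))) => x _ /=; rewrite subrK.
exists u => //; apply/cvgrPdist_le => e /key; apply: filterS => n [_].
by rewrite sub0r normrN ger0_norm// normL2_ge0.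
Unshelve. all: by end_near. Qed.

End L2_theory.

Section integral_rV.
Context {R : realType}.
Local Open Scope ereal_scope.

Lemma ge0_integral_rV_insert n (i : 'I_n.+1) (F : 'rV[R]_n.+1 -> \bar R) :
  measurable_fun setT F -> (forall x, 0 <= F x) ->
  \int[lebesgue_rV n.+1]_x F x =
  \int[lebesgue_rV n]_y \int[lebesgue_measure]_t F (insert_coord i t y).
Proof.
move=> mF F0.
pose m2 : {measure set 'rV[R]_n.+1 -> \bar R} :=
  @measure_function_pushforward__canonical__measure_function_Measure
    _ _ _ _ _ (lebesgue_measure \x lebesgue_rV n)%E _ (@measurable_insert R n i).
transitivity (\int[m2]_x F x).
  by apply: eq_measure_integral => B mB _; exact: (lebesgue_rV_insert i mB).
rewrite /m2 ge0_integral_pushforward//=; last exact: measurable_insert.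
rewrite preimage_setT fubini_tonelli2//.
by apply: measurableT_comp => //; exact: measurable_insert.
Qed.

Lemma integral_rV_insert n (i : 'I_n.+1) (F : 'rV[R]_n.+1 -> \bar R) :
  (lebesgue_rV n.+1).-integrable setT F ->
  \int[lebesgue_rV n.+1]_x F x =
  \int[lebesgue_rV n]_y \int[lebesgue_measure]_t F (insert_coord i t y).
Proof.
move=> iF; have mF := measurable_int _ iF.
pose m2 : {measure set 'rV[R]_n.+1 -> \bar R} :=
  @measure_function_pushforward__canonical__measure_function_Measure
    _ _ _ _ _ (lebesgue_measure \x lebesgue_rV n)%E _ (@measurable_insert R n i).
have iF' : (lebesgue_measure \x lebesgue_rV n).-integrable setT (F \o (fun p => insert_coord i p.1 p.2)).
  apply/integrable21ltyP.
    by apply: measurableT_comp => //; exact: measurable_insert.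
  move/integrableP : iF => [_]; rewrite (@ge0_integral_rV_insert _ i)//.
  exact: measurableT_comp.
transitivity (\int[m2]_x F x).
  by apply: eq_measure_integral => B mB _; exact: (lebesgue_rV_insert i mB).
rewrite /m2 integral_pushforward//=; last exact: measurable_insert.
by rewrite preimage_setT -integral21_prod_meas1.
Qed.

Lemma ge0_integral_rV_shift n (c : 'rV[R]_n) (F : 'rV[R]_n -> \bar R) :
  measurable_fun setT F -> (forall x, 0 <= F x) ->
  \int[lebesgue_rV n]_x F (x + c)%R = \int[lebesgue_rV n]_x F x.
Proof.
move=> mF F0.
pose m2 : {measure set 'rV[R]_n -> \bar R} :=
  @measure_function_pushforward__canonical__measure_function_Measure
    _ _ _ _ _ (lebesgue_rV n) _ (measurable_shift_rV c).
transitivity (\int[m2]_x F x).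
  by rewrite /m2 ge0_integral_pushforward//=; exact: measurable_shift_rV.
by apply: eq_measure_integral => B mB _; exact: lebesgue_rV_shift.
Qed.

End integral_rV.

Section L2_dominated.
Context {d} {T : measurableType d} {R : realType}.
Variables (mu : {measure set T -> \bar R}) (D : set T).
Hypothesis mD : measurable D.

Lemma cvg_normL2_dominated (w_ : nat -> T -> R) w v :
  (forall k, L2 mu D (w_ k)) -> L2 mu D w -> L2 mu D v ->
  (forall k x, D x -> `|w x - w_ k x| <= v x) ->
  (forall x, D x -> w_ k x @[k --> \oo] --> w x) ->
  normL2 mu D (w \- w_ k) @[k --> \oo] --> 0.
Proof.
move=> Lw_ Lw Lv wv cw.
have Lk k : L2 mu D (w \- w_ k) by exact: L2B.
have H : dotL2 mu D (w \- w_ k) (w \- w_ k) @[k --> \oo] --> (0 : R).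
  apply: fine_cvg.
  have [] := @dominated_convergence _ _ _ mu D mD
    (fun k x => ((w \- w_ k) x * (w \- w_ k) x)%:E) (cst 0%E) (fun x => (v x ^+ 2)%:E).
  - by move=> k; apply/measurable_EFinP; apply: measurable_funM; exact: (Lk k).1.
  - by [].
  - apply: aeW => x Dx /=; rewrite -[X in _ --> X]/((0 : R)%:E) -(mulr0 (0 : R)); apply: cvg_EFin; first exact: nearW.
    by apply: cvgM; rewrite -(subrr (w x)); apply: cvgB; [exact: cvg_cst|exact: cw|exact: cvg_cst|exact: cw].
  - exact: Lv.2.
  - apply: aeW => x k Dx /=; rewrite lee_fin -expr2 normrX lerXn2r ?nnegrE//; last exact: wv.
    by rewrite (le_trans _ (wv k _ Dx)).
  - by rewrite integral0.
apply/cvgrPdist_le => e e0; have e20 : 0 < e ^+ 2 by rewrite exprn_gt0.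
move/cvgrPdist_le : H => /(_ _ e20); apply: filterS => k.
by rewrite !sub0r !normrN -sqr_normL2 normrX ler_pXn2r ?nnegrE// ltW.
Qed.

End L2_dominated.

(** * Continuity of translations in L^2 *)

Section shift_L2.
Context {R : realType} {n : nat}.
Local Notation E := 'rV[R]_n.
Local Notation leb := (lebesgue_rV n).
Implicit Types (w : E -> R) (z : E).

Definition shiftf w z : E -> R := fun x => w (x + z).

Lemma measurable_shiftf w z : measurable_fun setT w -> measurable_fun setT (shiftf w z).
Proof. by move=> mw; apply: measurableT_comp => //; exact: measurable_shift_rV. Qed.

Lemma L2_shiftf w z : L2 leb setT w -> L2 leb setT (shiftf w z).
Proof.
move=> [mw /integrableP[_ iw]]; split; first exact: measurable_shiftf.
apply/integrableP; split.
  by apply/measurable_EFinP; apply: measurable_funX; exact: measurable_shiftf.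
rewrite (@ge0_integral_rV_shift _ _ z (fun x => `|(w x ^+ 2)%:E|%E))//.
by apply: measurableT_comp => //; apply/measurable_EFinP; exact: measurable_funX.
Qed.

Lemma normL2_shiftf w z : L2 leb setT w -> normL2 leb setT (shiftf w z) = normL2 leb setT w.
Proof.
move=> Lw; apply/eqP; rewrite -(eqrXn2 (ltn0Sn 1)) ?normL2_ge0// !sqr_normL2; apply/eqP.
apply: EFin_inj; rewrite !dotL2_EFin//; try exact: L2_shiftf.
rewrite -(@ge0_integral_rV_shift _ _ z (fun x => (w x * w x)%:E))//.
  by apply/measurable_EFinP; apply: measurable_funM; exact: Lw.1.
by move=> x; rewrite lee_fin -expr2 sqr_ge0.
Qed.

Definition L2_translation_cont w :=
  L2 leb setT w /\ forall e : R, 0 < e -> exists2 d : R, 0 < d &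
    forall z, `|z| < d -> normL2 leb setT (shiftf w z \- w) <= e.

Lemma translation_contD w1 w2 : L2_translation_cont w1 -> L2_translation_cont w2 ->
  L2_translation_cont (w1 \+ w2).
Proof.
move=> [L1 H1] [L2' H2]; split; first exact: L2D.
move=> e e0; have e2 : 0 < e / 2 by rewrite divr_gt0.
have [d1 d10 K1] := H1 _ e2; have [d2 d20 K2] := H2 _ e2.
exists (Num.min d1 d2); first by rewrite lt_min d10.
move=> z; rewrite lt_min => /andP[/K1 A /K2 B].
rewrite (@eq_normL2 _ _ _ _ _ _ ((shiftf w1 z \- w1) \+ (shiftf w2 z \- w2))); last first.
  by move=> x _; rewrite /shiftf /= opprD addrACA.
rewrite (le_trans (normL2D _ _ _))//; try by apply: L2B => //; exact: L2_shiftf.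
by rewrite [leRHS](splitr e) lerD.
Qed.

Lemma translation_contZ c w : L2_translation_cont w -> L2_translation_cont (fun x => c * w x).
Proof.
move=> [L1 H1]; split; first exact: L2Z.
move=> e e0; have ec : 0 < e / (`|c| + 1) by rewrite divr_gt0// ltr_wpDl.
have [d d0 K] := H1 _ ec; exists d => // z /K A.
rewrite (@eq_normL2 _ _ _ _ _ _ (fun x => c * (shiftf w z \- w) x)); last first.
  by move=> x _; rewrite /shiftf /= mulrBr.
rewrite normL2Z//; last by apply: L2B => //; exact: L2_shiftf.
apply: (@le_trans _ _ ((`|c| + 1) * (e / (`|c| + 1)))).
  by rewrite ler_pM// ?normL2_ge0// lerDl.
by rewrite mulrCA divff ?mulr1// gt_eqF// ltr_wpDl.
Qed.

Lemma translation_contB w1 w2 : L2_translation_cont w1 -> L2_translation_cont w2 ->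
  L2_translation_cont (w1 \- w2).
Proof.
move=> T1 /(translation_contZ (-1)) T2.
rewrite (_ : w1 \- w2 = w1 \+ (fun x => -1 * w2 x)); first exact: translation_contD.
by apply/funext => x /=; rewrite mulN1r.
Qed.

Lemma translation_cont0 : L2_translation_cont (cst 0).
Proof.
split=> [|e e0]; first exact: L2_0.
exists 1 => // z _; rewrite (@eq_normL2 _ _ _ _ _ _ (cst 0)) ?normL2_0 ?(ltW e0)//.
by move=> x _; rewrite /shiftf /= subrr.
Qed.

Lemma translation_cont_sum m (F : 'I_m -> E -> R) : (forall i, L2_translation_cont (F i)) ->
  L2_translation_cont (fun x => \sum_i F i x).
Proof.
move=> TF; rewrite (_ : (fun _ => _) = \big[(fun f g => f \+ g)/cst 0]_i F i).
  by apply: big_ind => //; [exact: translation_cont0|exact: translation_contD].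
by apply/funext => x; elim/big_rec2: _ => //= i y1 y2 _ ->.
Qed.

Lemma translation_cont_lim w : L2 leb setT w ->
  (forall e : R, 0 < e -> exists2 w', L2_translation_cont w' & normL2 leb setT (w \- w') <= e) ->
  L2_translation_cont w.
Proof.
move=> Lw H; split=> // e e0; have e3 : 0 < e / 3 by rewrite divr_gt0.
have [w' [L' K] ww'] := H _ e3; have [d d0 Kd] := K _ e3.
exists d => // z /Kd A.
have Ls := L2_shiftf z Lw; have Ls' := L2_shiftf z L'.
rewrite (le_trans (normL2_triangle _ Ls Ls' Lw))//.
rewrite (@le_trans _ _ (e / 3 + (e / 3 + e / 3)))//; last by rewrite le_eqVlt; apply/orP; left; apply/eqP; field.
apply: lerD.
  have -> : shiftf w z \- shiftf w' z = shiftf (w \- w') z by [].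
  by rewrite normL2_shiftf//; exact: L2B.
rewrite (le_trans (normL2_triangle _ Ls' L' Lw))// lerD//.
by rewrite normL2_distC.
Qed.

Lemma L2_indic (A : set E) : measurable A -> (leb A < +oo)%E -> L2 leb setT (\1_A).
Proof.
move=> mA Aoo; split; first exact/measurable_indicP.
rewrite (_ : (fun _ => _) = EFin \o (\1_A)).
  apply/integrableP; split; first by apply/measurable_EFinP; exact/measurable_indicP.
  rewrite (eq_integral (fun x => (\1_A x)%:E)) ?integral_indic ?setIT//.
  by move=> x _ /=; rewrite ger0_norm.
by apply/funext => x /=; rewrite indicE; case: (_ \in _); rewrite ?expr1n ?expr0n.
Qed.

(** By translation invariance the squared distance is twice the defect of the inner product of the
    indicator with its translate. That defect tends to 0 by dominated convergence, since for x in an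
    open U the point x + z is eventually in U. The contradiction supplies the sequence required by
    dominated convergence. *)
Lemma translation_cont_open (U : set E) : open U -> (leb U < +oo)%E -> L2_translation_cont (\1_U).
Proof.
move=> oU Uoo; have mU := open_measurable_rV oU; have LU := L2_indic mU Uoo.
split=> // e e0; apply: contrapT => H.
have {}H k : exists z : E, `|z| < k.+1%:R^-1 /\ e < normL2 leb setT (shiftf (\1_U) z \- (\1_U : E -> R)).
  apply: contrapT => K; apply: H; exists k.+1%:R^-1; first by rewrite invr_gt0.
  move=> z zk; rewrite leNgt; apply/negP => ?; apply: K; by exists z.
have [z Hz] := choice H.
have Lz k := L2_shiftf (z k) LU.
have E2 k : normL2 leb setT (shiftf (\1_U) (z k) \- (\1_U : E -> R)) ^+ 2 =
    2 * (dotL2 leb setT (\1_U) (\1_U) - dotL2 leb setT (shiftf (\1_U) (z k)) (\1_U)).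
  rewrite sqr_normL2 dotL2Bl// ?dotL2Br//; try exact: L2B.
  rewrite -(sqr_normL2 _ _ (shiftf _ _)) normL2_shiftf// sqr_normL2 (dotL2C _ _ (\1_U : E -> R) (shiftf _ _)).
  ring.
have cv : dotL2 leb setT (shiftf (\1_U) (z k)) (\1_U) @[k --> \oo] --> dotL2 leb setT (\1_U : E -> R) (\1_U).
  apply: fine_cvg; rewrite dotL2_EFin//.
  have [] := @dominated_convergence _ _ _ leb setT measurableT
    (fun k x => (shiftf (\1_U) (z k) x * \1_U x)%:E) (fun x => (\1_U x * \1_U x)%:E) (fun x => (\1_U x)%:E).
  - move=> k; apply/measurable_EFinP; apply: measurable_funM; [exact: (Lz k).1|exact: LU.1].
  - by apply/measurable_EFinP; apply: measurable_funM; exact: LU.1.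
  - apply: aeW => x _; apply: cvg_EFin; first exact: nearW.
    have [Ux|nUx] := pselect (U x); last first.
      rewrite indicE memNset// mulr0; under eq_fun do rewrite mulr0; exact: cvg_cst.
    rewrite indicE mem_set// mulr1.
    have zx : x + z k @[k --> \oo] --> x.
      rewrite -[X in _ --> X]addr0; apply: cvgD; first exact: cvg_cst.
      apply: norm_cvg0; apply: squeeze_cvgr (@cvg_harmonic R); last exact: cvg_cst.
      by near=> k; rewrite normr_ge0 ltW// (Hz k).1.
    have {}zx : \forall k \near \oo, U (x + z k) := zx _ (open_nbhs_nbhs (conj oU Ux)).
    apply: cvg_near_cst; apply: filterS zx => k Uk.
    by rewrite /= /shiftf indicE mem_set// mulr1.
  - have := LU.2; rewrite (_ : (fun _ => _) = (fun x => (\1_U x)%:E))//.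
    by apply/funext => x; rewrite indicE; case: (_ \in _); rewrite ?expr1n ?expr0n.
  - apply: aeW => x k _ /=; rewrite lee_fin /shiftf !indicE.
    by case: (_ \in _); case: (_ \in _); rewrite ?mulr1 ?mulr0 ?normr1 ?normr0.
  - by [].
have cv2 : normL2 leb setT (shiftf (\1_U) (z k) \- (\1_U : E -> R)) ^+ 2 @[k --> \oo] --> (0 : R).
  under eq_fun do rewrite E2.
  rewrite -(mulr0 2) -(subrr (dotL2 leb setT (\1_U : E -> R) (\1_U))).
  by apply: cvgM; [exact: cvg_cst|apply: cvgB => //; exact: cvg_cst].
have e20 : 0 < e ^+ 2 by rewrite exprn_gt0.
move/cvgrPdist_lt : cv2 => /(_ _ e20)[k0 _ /(_ k0)] /=.
rewrite leqnn => /(_ isT); rewrite sub0r normrN ger0_norm ?sqr_ge0//.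
rewrite ltr_pXn2r ?nnegrE ?normL2_ge0 ?(ltW e0)//.
by rewrite ltNge ltW// (Hz k0).2.
Unshelve. all: by end_near. Qed.

(** Dynkin's lemma on the pi-system of open sets. Intersecting with an open [D0] of finite measure
    keeps complements square integrable: their indicator is [\1_D0] minus one already treated. *)
Lemma translation_cont_indic (D0 A : set E) : open D0 -> (leb D0 < +oo)%E -> measurable A ->
  L2_translation_cont (\1_(A `&` D0)).
Proof.
move=> oD D0oo mA; have mD := open_measurable_rV oD.
pose G : set (set E) := [set A | measurable A /\ L2_translation_cont (\1_(A `&` D0) : E -> R)].
suff : G A by case.
have finI B : measurable B -> (leb (B `&` D0) < +oo)%E.
  move=> mB; apply: le_lt_trans D0oo; apply: le_measure; rewrite ?inE; [exact: measurableI|exact: mD|exact: subIsetr].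
have gen : (@measurable _ E) = <<s @open E >>.
  apply/seteqP; split; last first.
    apply: smallest_sub; first exact: sigma_algebra_measurable.
    by move=> B; exact: open_measurable_rV.
  apply: smallest_sub; first exact: smallest_sigma_algebra.
  rewrite -bigcup_seq/=; apply: bigcup_sub => i _ _ [B mB <-]; rewrite setTI.
  have mc : measurable_fun [set: g_sigma_algebraType (@open E)] (fun x : g_sigma_algebraType (@open E) => (x : E) ord0 i).
    apply: (measurability _ (RGenOpens.measurableE R)) => _ [_ [a [b ->] <-]].
    rewrite setTI; apply: sub_sigma_algebra.
    have /continuousP : continuous (fun x : E => x ord0 i) by exact: coord_continuous.
    by apply; exact: interval_open.
  by have := mc measurableT B mB; rewrite setTI.
have := mA; rewrite gen; apply: (@dynkin_induction _ _ (@open E)) => //.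
- by move=> B C; exact: openI.
- by split=> //; rewrite setTI; exact: translation_cont_open.
- by move=> B oB; split; [exact: open_measurable_rV|apply: translation_cont_open; [exact: openI|apply: finI; exact: open_measurable_rV]].
- move=> B mB [_ HB]; split; first exact: measurableC.
  rewrite (_ : \1_(~` B `&` D0) = \1_D0 \- \1_(B `&` D0)).
    by apply: translation_contB => //; exact: translation_cont_open.
  apply/funext => x /=; rewrite !indicE !in_setI in_setC.
  by case: (x \in B); case: (x \in D0); rewrite /= ?subrr ?subr0.
- move=> F mF tF HF; have mUF : measurable (\bigcup_k F k) by exact: bigcup_measurable.
  split=> //.
  have LUF : L2 leb setT (\1_((\bigcup_k F k) `&` D0)) by apply: L2_indic; [exact: measurableI|exact: finI].
  have TF k : L2_translation_cont (\1_(F k `&` D0)) by case: (HF k).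
  pose s m : E -> R := fun x => \sum_(k < m) \1_(F k `&` D0) x.
  have Ts m : L2_translation_cont (s m).
    elim: m => [|m IH].
      rewrite (_ : s 0%N = (fun x => 0 * \1_(F 0%N `&` D0) x)); first exact: translation_contZ.
      by apply/funext => x; rewrite /s big_ord0 mul0r.
    rewrite (_ : s m.+1 = s m \+ \1_(F m `&` D0)); first exact: translation_contD.
    by apply/funext => x; rewrite /s big_ord_recr.
  have sE m x : s m x = \1_((\bigcup_(k < m) F k) `&` D0) x.
    rewrite /s; elim: m => [|m IH]; first by rewrite big_ord0 bigcup_mkord big_ord0 set0I indic0.
    rewrite big_ord_recr/= IH !bigcup_mkord big_ord_recr/= setIUl !indicE in_setU.
    case: (boolP (x \in F m `&` D0)) => [|_]; last by rewrite orbF addr0.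
    rewrite inE => -[Fm Dx]; rewrite memNset ?add0r ?orbT// => -[].
    rewrite -bigcup_mkord => -[k /= km Fk _].
    by have E : k = m := tF k m I I (ex_intro _ x (conj Fk Fm)); rewrite E ltnn in km.
  apply: translation_cont_lim => // e e0.
  have : normL2 leb setT (\1_((\bigcup_k F k) `&` D0) \- s m) @[m --> \oo] --> (0 : R).
    apply: (cvg_normL2_dominated _ (v := \1_((\bigcup_k F k) `&` D0))) => //.
    - by move=> m; case: (Ts m).
    - move=> m x _; rewrite sE; rewrite !indicE !in_setI.
      case: (boolP (x \in \bigcup_(k < m) F k)) => [|_] /=; last by rewrite subr0 ger0_norm.
      rewrite inE => -[k /= _ Fk]; rewrite [x \in \bigcup_k F k]mem_set; last by exists k.
      by rewrite subrr normr0.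
    - move=> x _; have [[k _ Fk]|nF] := pselect ((\bigcup_k F k) x).
        apply: cvg_near_cst; exists k.+1 => // m /= km; rewrite sE !indicE !in_setI.
        by congr ((_ && _)%:R); rewrite !mem_set//; exists k.
      rewrite indicE in_setI memNset//=; under eq_fun do rewrite sE.
      apply: cvg_near_cst; apply: nearW => m; rewrite indicE in_setI memNset// => -[k _ Fk]; by apply: nF; exists k.
  move/cvgrPdist_le => /(_ _ e0)[m _ /(_ m (leqnn m))] H.
  exists (s m) => //; apply: le_trans H; rewrite sub0r normrN; exact: ler_norm.
Qed.

Import HBSimple HBNNSimple.

(** Positive and negative parts are approximated from below by simple functions. The level sets of
    their nonzero values lie in [D0], which reduces everything to indicators. *)
Lemma translation_cont_L2 (D0 : set E) w : open D0 -> (leb D0 < +oo)%E -> L2 leb setT w ->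
  (forall x, ~ D0 x -> w x = 0) -> L2_translation_cont w.
Proof.
move=> oD D0oo; have mD := open_measurable_rV oD.
wlog w0 : w / forall x, 0 <= w x.
  move=> H Lw wD.
  have Lp : L2 leb setT (fun x => Num.max (w x) 0).
    have := Lw.2; split; first exact: (measurable_maxr Lw.1).
    apply: le_integrable H0 => //.
      by apply/measurable_EFinP; apply: measurable_funX; exact: (measurable_maxr Lw.1).
    move=> x _; rewrite /= lee_fin !normrX lerXn2r ?nnegrE//.
    by rewrite /Num.max; case: ifPn => //; rewrite normr0.
  have Ln : L2 leb setT (fun x => Num.max (- w x) 0).
    have := Lw.2; split; first exact: (measurable_maxr (measurable_funN Lw.1)).
    apply: le_integrable H0 => //.
      by apply/measurable_EFinP; apply: measurable_funX; exact: (measurable_maxr (measurable_funN Lw.1)).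
    move=> x _; rewrite /= lee_fin !normrX lerXn2r ?nnegrE//.
    by rewrite /Num.max; case: ifPn => //; rewrite ?normr0 ?normrN.
  rewrite (_ : w = (fun x => Num.max (w x) 0) \- (fun x => Num.max (- w x) 0)).
    apply: translation_contB; apply: H => //.
    - by move=> x; rewrite le_max lexx orbT.
    - by move=> x /wD ->; rewrite maxxx.
    - by move=> x; rewrite le_max lexx orbT.
    - by move=> x /wD ->; rewrite oppr0 maxxx.
  apply/funext => x /=; rewrite /Num.max oppr_lt0.
  by case: (ltgtP (w x) 0) => [?|?|->]; rewrite ?subr0 ?sub0r ?opprK ?oppr0.
move=> Lw wD.
have mEw : measurable_fun setT (EFin \o w) by apply/measurable_EFinP; exact: Lw.1.
pose h_ k := nnsfun_approx measurableT mEw k.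
have hw k x : 0 <= h_ k x <= w x.
  rewrite fun_ge0/= -lee_fin /h_ nnsfun_approxE; apply: le_approx => //.
  by move=> y _; rewrite /= lee_fin.
have ch x : h_ k x @[k --> \oo] --> w x.
  have := @cvg_nnsfun_approx _ _ _ setT measurableT (EFin \o w) mEw (fun y _ => _ : (0 <= (EFin \o w) y)%E) x I.
  by move=> /(_ ltac:(by move=> y /=; rewrite lee_fin)) /fine_cvgP[_].
have Lh k : L2 leb setT (h_ k).
  split; first exact: measurable_funP.
  apply: le_integrable Lw.2 => //; first by apply/measurable_EFinP; apply: measurable_funX; exact: measurable_funP.
  move=> x _ /=; have /andP[h0 hwx] := hw k x.
  by rewrite lee_fin !normrX lerXn2r ?nnegrE// !ger0_norm.
have Th k : L2_translation_cont (h_ k).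
  pose s : seq R := finmap.enum_fset (fset_set (h_ k @` setT)).
  rewrite (_ : (h_ k : E -> R) = (fun x => \sum_(i < size s)
      (s`_i * \1_(h_ k @^-1` [set s`_i] `&` D0) x))); last first.
    apply/funext => x; rewrite fimfunEord; apply: eq_bigr => i _.
    set r := _`_i; have [->|r0] := eqVneq r 0; first by rewrite !mul0r.
    congr (_ * _); rewrite !indicE in_setI; congr ((_ : bool)%:R).
    apply/idP/andP => [/set_mem /= hr|[]//]; split; first exact/mem_set.
    apply/mem_set; apply: contrapT => /wD wx0; have := hw k x.
    by rewrite wx0 hr -eq_le eq_sym (negbTE r0).
  apply: translation_cont_sum => i; apply: translation_contZ; apply: translation_cont_indic => //.
apply: translation_cont_lim => // e e0.
have : normL2 leb setT (w \- h_ m) @[m --> \oo] --> (0 : R).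
  apply: (cvg_normL2_dominated _ (v := w)) => //.
  move=> m x _; have /andP[h0 hwx] := hw m x.
  by rewrite ger0_norm ?subr_ge0// lerBlDr lerDl.
move/cvgrPdist_le => /(_ _ e0)[m _ /(_ m (leqnn m))] H.
exists (h_ m) => //; apply: le_trans H; rewrite sub0r normrN; exact: ler_norm.
Qed.

End shift_L2.

(** * Mollification *)

Section bounded_support.
Context {R : realType} {n : nat}.
Local Notation E := 'rV[R]_n.
Local Notation leb := (lebesgue_rV n).
Implicit Types f rho : E -> R.

Definition bsupp f := exists r, forall x, r < `|x| -> f x = 0.

Lemma closed_ball_rV_closed (r : R) : closed [set x : E | `|x| <= r].
Proof.
apply: (closed_comp (f := fun x : E => `|x|) (D := [set x | x <= r])).
  by move=> x _; exact: norm_continuous.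
exact: closed_le.
Qed.

Lemma closed_ball_rV_compact (r : R) : compact [set x : E | `|x| <= r].
Proof.
apply: bounded_closed_compact; last exact: closed_ball_rV_closed.
exists r; split; first exact: num_real.
by move=> y ry x /= /le_trans; apply; exact: ltW.
Qed.

Lemma compact_bounded_fun (K : set E) f : compact K -> {in K, continuous f} ->
  exists2 M : R, 0 <= M & forall x, K x -> `|f x| <= M.
Proof.
move=> cK cf.
have : compact (f @` K).
  by apply: continuous_compact => //; apply/continuous_in_subspaceT.
move=> /compact_bounded[M [_ HM]]; exists (`|M| + 1) => [|x Kx]; first by rewrite addr_ge0.
by apply: (HM (`|M| + 1)) => /=; [rewrite (le_lt_trans (ler_norm M))// ltrDl|exists x].
Qed.

Lemma bsupp_bounded f : continuous f -> bsupp f -> exists2 M : R, 0 <= M & forall x, `|f x| <= M.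
Proof.
move=> cf [r Hr]; have [M M0 HM] := compact_bounded_fun (@closed_ball_rV_compact r) (fun x _ => cf x).
exists M => // x; have [xr|rx] := leP `|x| r; first exact: HM.
by rewrite Hr// normr0.
Qed.

Lemma open_pderiv0 (U : set E) f i : open U -> (forall x, U x -> f x = 0) ->
  forall x, U x -> pderiv f i x = 0.
Proof.
move=> oU f0 x Ux; rewrite /pderiv (@near_eq_derive _ _ _ f (cst 0)) ?derive_cst//.
have := open_nbhs_nbhs (conj oU Ux); apply: filterS => y /f0 ->//.
Qed.

Lemma bsupp_pderiv f i : bsupp f -> bsupp (pderiv f i).
Proof.
move=> [r Hr]; exists r => x rx.
apply: (@open_pderiv0 [set x | r < `|x|]) => //.
rewrite (_ : mkset _ = (fun x : E => `|x|) @^-1` [set t | r < t])//.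
by apply: open_comp; [move=> y _; exact: norm_continuous|exact: open_gt].
Qed.

Lemma continuous_bsupp_L2 f : continuous f -> bsupp f -> L2 leb setT f.
Proof.
move=> cf bf; have [M M0 HM] := bsupp_bounded cf bf; have [r Hr] := bf.
pose D := [set x : E | `|x| <= r].
have mD : measurable D by apply: closed_measurable_rV; exact: closed_ball_rV_closed.
have Doo : (leb D < +oo)%E.
  apply: bounded_lebesgue_fin => //; exists r; split; first exact: num_real.
  by move=> y ry x /= /le_trans; apply; exact: ltW.
have LD : L2 leb D f.
  by apply: (L2_bounded mD Doo (M := M)) => //; exact: continuous_measurable_rV.
split; first exact: continuous_measurable_rV.
apply/integrableP; split.
  by apply/measurable_EFinP; apply: measurable_funX; exact: continuous_measurable_rV.
have /integrableP[_] := LD.2; rewrite [X in (X < _)%E](integral_mkcond D).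
congr (_ < _)%E; apply: eq_integral => x _; rewrite patchE; case: ifPn => // /negP xD.
rewrite Hr ?expr0n ?abse0// ltNge; apply/negP => h; apply: xD; exact/mem_set.
Qed.

Lemma continuous_bsupp_integrable f : continuous f -> bsupp f -> leb.-integrable setT (EFin \o f).
Proof.
move=> cf bf; have [r Hr] := bf; have Lf := continuous_bsupp_L2 cf bf.
pose D := [set x : E | `|x| <= r].
have mD : measurable D by apply: closed_measurable_rV; exact: closed_ball_rV_closed.
have Doo : (leb D < +oo)%E.
  apply: bounded_lebesgue_fin => //; exists r; split; first exact: num_real.
  by move=> y ry x /= /le_trans; apply; exact: ltW.
have := L2_mul_integrable measurableT Lf (L2_indic mD Doo).
rewrite (_ : (fun _ => _) = EFin \o f)//; apply/funext => x /=; congr EFin; rewrite indicE.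
case: (boolP (x \in D)) => [|/negP xD]; rewrite ?mulr1// mulr0 Hr// ltNge.
apply/negP => h; apply: xD; exact/mem_set.
Qed.

End bounded_support.

Section convolution.
Context {R : realType} {n : nat}.
Local Notation E := 'rV[R]_n.
Local Notation leb := (lebesgue_rV n).
Implicit Types (w rho : E -> R).

(** A correlation rather than a convolution: a kernel concentrated near [a] averages w near x + a,
    so a kernel placed off the origin samples inside the domain. *)
Definition mollify (D : set E) w rho (x : E) : R := dotL2 leb D w (fun y : E => rho (y - x)).

Lemma bsupp_shift rho x : bsupp rho -> bsupp (fun y : E => rho (y - x)).
Proof.
move=> [r Hr]; exists (r + `|x|) => y; rewrite -ltrBrDr => h; apply: Hr.
by apply: (lt_le_trans h); apply: lerB_dist.
Qed.

Lemma continuous_shift_rV rho (x : E) : continuous rho -> continuous (fun y : E => rho (y - x)).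
Proof.
move=> cr; have H : continuous ((fun z : E => z - x) : E -> E).
  by move=> z; apply: (@cvgB R E E (nbhs z) _ id (cst x)); [exact: cvg_id|exact: cvg_cst].
by move=> y; apply: (@continuous_comp _ _ _ (fun z : E => z - x) rho); [exact: H|exact: cr].
Qed.

Lemma smooth_shift rho x : smooth rho -> smooth (fun y : E => rho (y - x)).
Proof.
move=> sr; apply: (@smooth_coind _ _ [set f | exists2 g, smooth g & f = (fun y => g (y - x))]); last by exists rho.
move=> _ [g sg ->]; have H y : differentiable (fun z => g (z - x)) y /\ forall k, pderiv (fun z => g (z - x)) k y = pderiv g k (y - x).
  apply: differentiable_of_expansion => e e0.
  have [d d0 Hd] := differentiable_expansion (smooth_differentiable (y - x) sg) e0.
  by exists d => // h /Hd; rewrite (addrAC y).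
split=> [y|i]; first by have [] := H y.
exists (pderiv g i); first exact: smooth_pderiv.
by apply/funext => y; have [_ ->] := H y.
Qed.

Variable D : set E.
Hypotheses (mD : measurable D) (Doo : (leb D < +oo)%E).

Let LD (f : E -> R) : continuous f -> bsupp f -> L2 leb D f.
Proof.
move=> cf bf; have [Lm Li] := continuous_bsupp_L2 cf bf.
by split; [exact: measurable_funTS|exact: integrableS Li].
Qed.

(** Differentiation under the integral: the Taylor remainder of the kernel is uniform in y, and
    Cauchy-Schwarz on a set of finite measure makes the error quadratic in h. *)
Lemma conv_smooth w rho : L2 leb D w -> smooth rho -> bsupp rho ->
  smooth (mollify D w rho) /\ forall i, pderiv (mollify D w rho) i = (fun x => - mollify D w (pderiv rho i) x).
Proof.
move=> Lw sr br.
have H rho' : smooth rho' -> bsupp rho' -> forall x, differentiable (mollify D w rho') x /\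
    forall k, pderiv (mollify D w rho') k x = - mollify D w (pderiv rho' k) x.
  clear rho sr br; move=> sr br x.
  have [C C0 HC] : exists2 C : R, 0 <= C & forall i j x, `|pderiv (pderiv rho' i) j x| <= C.
    have HM (ij : 'I_n * 'I_n) : exists M : R, 0 <= M /\ forall x, `|pderiv (pderiv rho' ij.1) ij.2 x| <= M.
      case: ij => i j; have [M M0 HM] := bsupp_bounded (smooth_continuous (smooth_pderiv j (smooth_pderiv i sr))) (bsupp_pderiv j (bsupp_pderiv i br)).
      by exists M.
    have [M HM'] := choice HM.
    exists (\sum_i \sum_j M (i, j)).
      by apply: sumr_ge0 => i _; apply: sumr_ge0 => j _; have [] := HM' (i, j).
    move=> i j y; have [_ /(_ y)/le_trans] := HM' (i, j); apply.
    rewrite (bigD1 i)//= (bigD1 j)//= -addrA lerDl addr_ge0// sumr_ge0// => k _; first by have [] := HM' (i, k).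
    by apply: sumr_ge0 => l _; have [] := HM' (k, l).
  pose W := normL2 leb D w * normL2 leb D (cst 1).
  have L1 : L2 leb D (cst 1) by apply: (L2_bounded mD Doo (M := 1)) => // y _; rewrite normr1.
  have W0 : 0 <= W by rewrite mulr_ge0 ?normL2_ge0.
  pose C' := n%:R ^+ 2 * C * W + 1.
  have C'0 : 0 < C' by apply: ltr_wpDl => //; apply: mulr_ge0 => //; apply: mulr_ge0 => //; exact: sqr_ge0.
  apply: differentiable_of_expansion => e e0.
  exists (e / C'); first by rewrite divr_gt0.
  move=> h hd.
  have K0 : 0 <= n%:R ^+ 2 * C * `|h| ^+ 2 by apply: mulr_ge0; [apply: mulr_ge0 => //; exact: sqr_ge0|exact: sqr_ge0].
  have Lr (g : E -> R) z : smooth g -> bsupp g -> L2 leb D (fun y => g (y - z)).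
    by move=> sg bg; apply: LD; [apply: continuous_shift_rV; exact: smooth_continuous|exact: bsupp_shift].
  pose err (y : E) := rho' (y - (x + h)) - rho' (y - x) + \sum_k h ord0 k * pderiv rho' k (y - x).
  have LS : L2 leb D (fun y => \sum_k h ord0 k * pderiv rho' k (y - x)).
    by apply: L2_sum => // k _; apply: L2Z => //; apply: Lr; [exact: smooth_pderiv|exact: bsupp_pderiv].
  have Lerr : L2 leb D err by apply: L2D => //; apply: L2B => //; exact: Lr.
  have -> : mollify D w rho' (x + h) - mollify D w rho' x - \sum_k h ord0 k * - mollify D w (pderiv rho' k) x = dotL2 leb D w err.
    rewrite dotL2Dr// ?dotL2Br//; try exact: Lr; last by apply: L2B => //; exact: Lr.
    congr (_ + _); rewrite dotL2_sumr//; last first.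
      by move=> k _; apply: L2Z => //; apply: Lr; [exact: smooth_pderiv|exact: bsupp_pderiv].
    rewrite -sumrN; apply: eq_bigr => k _; rewrite dotL2Zr ?mulrN ?opprK//.
    by apply: Lr; [exact: smooth_pderiv|exact: bsupp_pderiv].
  apply: le_trans (cauchy_schwarzL2 mD Lw Lerr) _.
  have nerr : normL2 leb D err <= n%:R ^+ 2 * C * `|h| ^+ 2 * normL2 leb D (cst 1).
    have := normL2Z mD (n%:R ^+ 2 * C * `|h| ^+ 2) L1.
    rewrite ger0_norm//.
    move=> <-; apply: normL2_mono => //; first exact: L2Z.
    move=> y _ /=; rewrite mulr1 [leRHS]ger0_norm//.
    have := smooth_taylor sr C0 HC (y - x) (- h); rewrite normrN.
    rewrite /err opprD addrA; congr (_ <= _); congr `|_|; congr (_ + _).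
    by rewrite -sumrN; apply: eq_bigr => k _; rewrite mxE mulNr opprK.
  apply: le_trans (ler_wpM2l (normL2_ge0 _ _ _) nerr) _.
  rewrite (_ : normL2 leb D w * _ = n%:R ^+ 2 * C * W * `|h| * `|h|); last first.
    by rewrite /W; move: (normL2 _ _ _) (normL2 _ _ _) (n%:R ^+ 2) `|h| => a b c t; ring.
  rewrite ler_wpM2r// (@le_trans _ _ (C' * `|h|))//; first by rewrite ler_wpM2r// lerDl.
  by rewrite mulrC -ler_pdivlMr// ltW.
split; last by move=> i; apply/funext => x; have [_] := H _ sr br x.
(* Each derivative flips the sign, so the stable class consists of scalar multiples of
   mollifications. *)
apply: (@smooth_coind _ _ [set f | exists c rho', [/\ smooth rho', bsupp rho' & f = (fun x => c * mollify D w rho' x)]]); last first.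
  by exists 1, rho; split => //; apply/funext => x; rewrite mul1r.
move=> _ [c [rho' [sr' br' ->]]]; split=> [x|i].
  by apply: differentiableM; [exact: differentiable_cst|have [] := H _ sr' br' x].
exists (- c), (pderiv rho' i); split; [exact: smooth_pderiv|exact: bsupp_pderiv|].
apply/funext => x; have [dx px] := H _ sr' br' x.
rewrite (_ : (fun _ => _) = cst c \* mollify D w rho')//.
by rewrite pderivM// ?pderiv_cst ?px /= ?mulr0 ?addr0 ?mulrN ?mulNr//; exact: differentiable_cst.
Qed.

End convolution.

Section kernels.
Context {R : realType} {n : nat}.
Local Notation E := 'rV[R]_n.
Local Notation leb := (lebesgue_rV n).
Implicit Types (w rho : E -> R).

Definition kernel_at (a : E) (r : R) rho :=
  [/\ smooth rho, (forall z, 0 <= rho z), (forall z, rho z != 0 -> `|z - a| < r)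
   & (\int[leb]_z (rho z)%:E = 1)%E].

Lemma kernel_bsupp a r rho : kernel_at a r rho -> bsupp rho.
Proof.
move=> [_ _ H _]; exists (r + `|a|) => x hx; apply/eqP; apply: contraTT hx => /H xa.
by rewrite -leNgt -lerBlDr (le_trans (lerB_dist _ _))// ltW.
Qed.

Lemma kernel_exists a r : 0 < r -> exists rho, kernel_at a r rho.
Proof.
move=> r0; have cb := smooth_continuous (box_bump_smooth a r).
have bb : bsupp (box_bump a r).
  exists (r + `|a|) => x hx; apply/eqP; rewrite eq_le box_bump_ge0 andbT leNgt box_bump_gt0// -leNgt.
  by apply: (le_trans _ (lerB_dist _ _)); rewrite lerBrDr ltW.
have ib := continuous_bsupp_integrable cb bb.
have ib' : (\int[leb]_z (box_bump a r z)%:E = (\int[leb]_z (box_bump a r z))%:E)%E.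
  by rewrite /Rintegral fineK//; exact: integrable_fin_num ib.
set c := (\int[leb]_z (box_bump a r z))%R in ib'.
have c0 : 0 <= c by apply: Rintegral_ge0 => x _; exact: box_bump_ge0.
(* A zero integral would make the bump vanish almost everywhere on a ball of positive measure, where
   it is positive. *)
have {}c0 : 0 < c.
  rewrite lt_neqAle c0 andbT eq_sym; apply/eqP => c00.
  have : (\int[leb]_z `|(box_bump a r z)%:E| = 0)%E.
    by rewrite (eq_integral (fun z => (box_bump a r z)%:E)) ?ib' ?c00// => z _; rewrite gee0_abs// lee_fin box_bump_ge0.
  have mb : measurable_fun setT (fun z => (box_bump a r z)%:E).
    by apply/measurable_EFinP; exact: continuous_measurable_rV.
  move/(ae_eq_integral_abs leb measurableT mb) => [N [mN N0 sub]].
  have : (leb (ball a r) <= leb N)%E.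
    apply: le_measure; rewrite ?inE//; first by apply: open_measurable_rV; exact: ball_open.
    move=> z az; apply: sub => /= /(_ I) /= -[bz].
    by have := box_bump_gt0 a z r0; rewrite bz ltxx -normrN opprB; move: az; rewrite -ball_normE/= => ->.
  rewrite N0 ball_rect// lebesgue_rV_rect; last by move=> i; apply: open_measurable; exact: ball_open.
  rewrite (eq_bigr (fun=> (r *+ 2)%:E)) => [|i _]; last by rewrite lebesgue_measure_ball// ltW.
  by rewrite prodEFin lee_fin leNgt prodr_gt0// => i _; rewrite mulrn_wgt0.
exists (fun z => c^-1 * box_bump a r z); split.
- by apply: smoothZ; exact: box_bump_smooth.
- by move=> z; rewrite mulr_ge0 ?box_bump_ge0// invr_ge0 ltW.
- by move=> z; rewrite mulf_eq0 negb_or => /andP[_ bz]; rewrite -box_bump_gt0// lt_neqAle eq_sym bz box_bump_ge0.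
- under eq_integral do rewrite EFinM.
  by rewrite integralZl// ib' -EFinM mulVf// gt_eqF.
Qed.

Lemma conv_restrict (D : set E) w rho x : mollify D w rho x = mollify setT (w \_ D) rho x.
Proof.
rewrite /mollify /dotL2 Rintegral_mkcond; apply: eq_Rintegral => y _; rewrite !patchE.
by case: ifPn => //; rewrite mul0r.
Qed.

Lemma L2_restrict (D : set E) w : measurable D -> L2 leb D w -> L2 leb setT (w \_ D).
Proof.
move=> mD [mw iw]; split; first by apply/(measurable_restrictT _ mD).
have := (integrable_mkcond (fun x => (w x ^+ 2)%:E) mD).1 iw.
apply: eq_integrable => // x _; rewrite !patchE; case: ifPn => //; by rewrite expr0n.
Qed.

(** Variance argument: if b is the mean of v for the probability density rho, then the integral of
    (v - c)^2 rho exceeds (b - c)^2 by the integral of (v - b)^2 rho. *)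
Lemma conv_jensen w a r rho x : L2 leb setT w -> kernel_at a r rho ->
  (((mollify setT w rho x - w x) ^+ 2)%:E <= \int[leb]_z ((w (x + z)%R - w x) ^+ 2 * rho z)%:E)%E.
Proof.
move=> Lw kr; have [sr r0 rs ir] := kr; have br := kernel_bsupp kr.
have cr := smooth_continuous sr.
have Lr := continuous_bsupp_L2 cr br; have irho := continuous_bsupp_integrable cr br.
pose v z := w (x + z).
have Lv : L2 leb setT v.
  by rewrite (_ : v = shiftf w x); [exact: L2_shiftf|apply/funext => z; rewrite /v /shiftf addrC].
have vr : mollify setT w rho x = dotL2 leb setT v rho.
  have Ls : L2 leb setT (fun y : E => rho (y - x)).
    by apply: continuous_bsupp_L2; [exact: continuous_shift_rV|exact: bsupp_shift].
  rewrite /mollify.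
  (* Polarization reduces translation invariance of the inner product to that of the norm, which
     involves nonnegative integrands only. *)
  have sq u1 u2 (L1 : L2 leb setT u1) (L2' : L2 leb setT u2) :
      dotL2 leb setT u1 u2 = (normL2 leb setT (u1 \+ u2) ^+ 2 - normL2 leb setT u1 ^+ 2 - normL2 leb setT u2 ^+ 2) / 2.
    rewrite !sqr_normL2 dotL2Dl// ?dotL2Dr//; try exact: L2D.
    by rewrite (dotL2C _ _ u2 u1); field.
  rewrite !sq//.
  have -> : v = shiftf w x by apply/funext => z; rewrite /v /shiftf addrC.
  have Er : rho = shiftf (fun y : E => rho (y - x)) x by apply/funext => z; rewrite /shiftf addrK.
  have -> : shiftf w x \+ rho = shiftf (w \+ (fun y : E => rho (y - x))) x by rewrite {1}Er.
  have E3 : normL2 leb setT rho = normL2 leb setT (fun y : E => rho (y - x)).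
    by rewrite [in LHS]Er normL2_shiftf.
  by rewrite normL2_shiftf ?normL2_shiftf// ?E3//; exact: L2D.
have [M M0 HM] := bsupp_bounded cr br.
have ivr : leb.-integrable setT (fun z => (v z * rho z)%:E) by exact: L2_mul_integrable.
have ivvr : leb.-integrable setT (fun z => (v z ^+ 2 * rho z)%:E).
  have := L2_mul_integrable measurableT Lv (L2_bdd_mul measurableT (continuous_measurable_rV measurableT cr) (fun z _ => HM z) Lv).
  by apply: eq_integrable => // z _; congr EFin; ring.
set c := w x; set b := dotL2 leb setT v rho in vr.
have rho1 : \int[leb]_z (rho z) = 1 by rewrite /Rintegral ir.
pose A := \int[leb]_z (v z ^+ 2 * rho z).
have I1 t : leb.-integrable setT (EFin \o (fun z => (v z - t) ^+ 2 * rho z)).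
  have i3 := integrableZl measurableT (t ^+ 2) irho.
  have i2 := integrableZl measurableT (- 2 * t) ivr.
  have := integrableD measurableT (integrableD measurableT ivvr i2) i3.
  by apply: eq_integrable => // z _ /=; rewrite -!EFinM -!EFinD; congr EFin; ring.
have H t : \int[leb]_z ((v z - t) ^+ 2 * rho z) = A - 2 * t * b + t ^+ 2.
  rewrite (@eq_Rintegral _ _ _ _ _ (fun z => v z ^+ 2 * rho z + (- 2 * t) * (v z * rho z) + t ^+ 2 * rho z)).
    rewrite RintegralD//; last first.
    - by have := integrableZl measurableT (t ^+ 2) irho; apply: eq_integrable.
    - have := integrableD measurableT ivvr (integrableZl measurableT (- 2 * t) ivr).
      by apply: eq_integrable.
    rewrite RintegralD//; last first.
      by have := integrableZl measurableT (- 2 * t) ivr; apply: eq_integrable.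
    rewrite RintegralZl// RintegralZl// rho1 mulr1 -/A -/(dotL2 leb setT v rho) -/b; ring.
  by move=> z _; ring.
rewrite vr (_ : (\int[leb]_z _)%E = (\int[leb]_z ((v z - c) ^+ 2 * rho z))%:E); last first.
  by rewrite /Rintegral fineK//; exact: integrable_fin_num (I1 c).
rewrite lee_fin H.
have : 0 <= \int[leb]_z ((v z - b) ^+ 2 * rho z).
  by apply: Rintegral_ge0 => z _; rewrite mulr_ge0 ?sqr_ge0.
rewrite H; have aux (a1 b1 c1 : R) : 0 <= a1 - 2 * b1 * b1 + b1 ^+ 2 -> (b1 - c1) ^+ 2 <= a1 - 2 * c1 * b1 + c1 ^+ 2 by nra.
exact: aux.
Qed.

(** Jensen's inequality and Tonelli: it suffices to bound the translation differences for z in the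
    support of the kernel. An arbitrary D allows the estimate on one patch of the domain as well as
    on the whole space. *)
Lemma normL2_conv_le (D : set E) w a r rho (c : R) : measurable D -> 0 <= c ->
  L2 leb setT w -> kernel_at a r rho ->
  (forall z, rho z != 0 -> (\int[leb]_(x in D) ((w (x + z)%R - w x) ^+ 2)%:E <= (c ^+ 2)%:E)%E) ->
  L2 leb D (mollify setT w rho \- w) -> normL2 leb D (mollify setT w rho \- w) <= c.
Proof.
move=> mD c0 Lw kr H Lc; have [sr r0 rs ir] := kr.
rewrite -ler_sqr ?nnegrE ?normL2_ge0// sqr_normL2 -lee_fin dotL2_EFin//.
pose f (p : E * E) : \bar R := ((w (p.1 + p.2) - w p.1) ^+ 2 * rho p.2 * \1_D p.1)%:E.
have mf : measurable_fun setT f.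
  apply/measurable_EFinP; apply: measurable_funM; last first.
    by apply: measurableT_comp; [exact/measurable_indicP|exact: measurable_fst].
  apply: measurable_funM; last first.
    by apply: measurableT_comp; [exact: continuous_measurable_rV (smooth_continuous sr)|exact: measurable_snd].
  apply: measurable_funX; apply: measurable_funB.
    apply: measurableT_comp; first exact: Lw.1.
    apply: measurable_fun_rV => i; under eq_fun do rewrite mxE.
    by apply: measurable_funD; apply: measurableT_comp (measurable_coord i) _; [exact: measurable_fst|exact: measurable_snd].
  by apply: measurableT_comp; [exact: Lw.1|exact: measurable_fst].
have f0 p : (0 <= f p)%E by rewrite /f lee_fin mulr_ge0// mulr_ge0// sqr_ge0.
apply: (@le_trans _ _ (\int[leb]_x \int[leb]_z f (x, z))%E).
  rewrite integral_mkcond; apply: ge0_le_integral => //.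
  - by move=> x _; rewrite patchE; case: ifPn => // _; rewrite lee_fin -expr2 sqr_ge0.
  - apply/(measurable_restrictT _ mD); apply/measurable_EFinP; apply: measurable_funM; exact: Lc.1.
  - exact: measurable_fun_fubini_tonelli_F.
  move=> x _; rewrite patchE; case: ifPn => xD; last exact: integral_ge0.
  rewrite -expr2; apply: le_trans (conv_jensen x Lw kr) _.
  by under [leRHS]eq_integral do rewrite /f /= indicE xD mulr1.
rewrite (@fubini_tonelli _ _ _ _ _ leb leb f)//.
apply: (@le_trans _ _ (\int[leb]_z ((c ^+ 2)%:E * (rho z)%:E))%E); last first.
  rewrite ge0_integralZl//= ?ir ?mule1// ?lee_fin ?sqr_ge0//.
    by apply/measurable_EFinP; exact: continuous_measurable_rV (smooth_continuous sr).
  by move=> z _; rewrite lee_fin.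
apply: ge0_le_integral => //.
- by move=> z _; exact: integral_ge0.
- exact: measurable_fun_fubini_tonelli_G.
- by apply/measurable_funeM/measurable_EFinP; exact: continuous_measurable_rV (smooth_continuous sr).
move=> z _; have [rz|rz] := eqVneq (rho z) 0.
  rewrite rz mule0 (eq_integral (cst 0%E)) ?integral0// => x _.
  by rewrite /f /= rz mulr0 mul0r.
rewrite (eq_integral (fun x => (rho z)%:E * (((fun x => ((w (x + z)%R - w x) ^+ 2)%:E) \_ D) x))%E); last first.
  move=> x _; rewrite /f /= patchE indicE; case: ifPn => _; rewrite ?mulr1 ?mulr0 ?mule0//.
  by rewrite -EFinM mulrC.
rewrite ge0_integralZl//=.
- by rewrite -integral_mkcond muleC lee_wpmul2r ?lee_fin ?H.
- apply/(measurable_restrictT _ mD); apply/measurable_EFinP; apply: measurable_funX.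
  apply: measurable_funTS; apply: measurable_funB; last exact: Lw.1.
  exact: (measurable_shiftf z Lw.1).
- by move=> x _; rewrite patchE; case: ifPn => // _; rewrite lee_fin sqr_ge0.
- by rewrite lee_fin.
Qed.

Lemma conv_L2_approx w e : L2_translation_cont w -> 0 < e ->
  exists2 d : R, 0 < d & forall a r rho, `|a| + r < d -> kernel_at a r rho ->
    (L2 leb setT (mollify setT w rho)) -> normL2 leb setT (mollify setT w rho \- w) <= e.
Proof.
move=> [Lw cw] e0; have [d d0 Hd] := cw _ e0; exists d => // a r rho ard kr Lc.
apply: (normL2_conv_le measurableT (ltW e0) Lw kr) => //; last exact: L2B.
move=> z rz; have [_ _ rs _] := kr.
have zd : `|z| < d.
  apply: lt_trans ard; rewrite -(subrK a z) (le_lt_trans (ler_normD _ _))// addrC ltrD2l; exact: rs.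
have Ls := L2_shiftf z Lw.
have := Hd z zd; rewrite -ler_sqr ?nnegrE ?normL2_ge0 ?(ltW e0)// sqr_normL2 -lee_fin dotL2_EFin//; exact: L2B.
Qed.

End kernels.

(** * Partitions of unity *)

Lemma pderiv_sum {R : realType} n m (F : 'I_m -> 'rV[R]_n -> R) i x :
  (forall j, differentiable (F j) x) ->
  pderiv (fun y => \sum_j F j y) i x = \sum_j pderiv (F j) i x.
Proof.
move=> dF; suff [] : differentiable (fun y => \sum_j F j y) x /\
  pderiv (fun y => \sum_j F j y) i x = \sum_j pderiv (F j) i x by [].
elim: (index_enum _) => [|j l [dl pl]].
  rewrite (_ : (fun y => _) = cst 0); last by apply/funext => y; rewrite big_nil.
  by rewrite pderiv_cst big_nil; split => //; exact: differentiable_cst.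
rewrite (_ : (fun y => _) = F j \+ (fun y => \sum_(j <- l) F j y)); last first.
  by apply/funext => y; rewrite big_cons.
by split; [exact: differentiableD|rewrite pderivD// pl big_cons].
Qed.

Section partition_of_unity.
Context {R : realType} {n : nat}.
Local Notation E := 'rV[R]_n.
Implicit Types (K : set E) (P : E -> R -> Prop).

(** The predicate [P] records what is known on each ball, such as a cone or a chart, so that these
    data survive the passage to a finite subcover. *)
Lemma compact_ball_cover K P : compact K -> (forall x, K x -> exists2 r : R, 0 < r & P x r) ->
  exists N (a : 'I_N -> E) (r : 'I_N -> R),
    (forall j, [/\ K (a j), 0 < r j & P (a j) (r j)]) /\
    forall x, K x -> exists j, `|x - a j| < r j.
Proof.
move=> cK HP; have [rad Hrad] : exists rad : E -> R, forall x, K x -> 0 < rad x /\ P x (rad x).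
  suff /choice[rad Hrad] : forall x, exists r : R, K x -> 0 < r /\ P x r by exists rad.
  by move=> x; have [/HP[r r0 Pr]|nK] := pselect (K x); [exists r|exists 0].
move: cK; rewrite compact_cover => /(_ _ K (fun x => ball x (rad x)))[].
- by move=> x /Hrad[r0 _]; exact: ball_open.
- by move=> x Kx; exists x => //; apply: ballxx; have [] := Hrad x Kx.
move=> D' D'K cov; pose s := finmap.enum_fset D'.
exists (size s), (fun j => nth 0 s j), (fun j => rad (nth 0 s j)); split=> [j|x /cov[a /= aD xa]].
  have Kj : K (nth 0 s j) by apply/set_mem; apply: D'K; exact: mem_nth.
  by have [] := Hrad _ Kj.
have ai : (index a s < size s)%N by rewrite index_mem.
by exists (Ordinal ai) => /=; rewrite nth_index// distrC; move: xa; rewrite -ball_normE.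
Qed.

(** The sum is 1 on an open neighbourhood of K, not just on K, so that the derivatives of the sum
    vanish on K. *)
Record pou K P N (a : 'I_N -> E) (r : 'I_N -> R) (zeta : 'I_N -> E -> R) : Prop := Pou {
  pou_loc : forall j, [/\ K (a j), 0 < r j & P (a j) (r j)];
  pou_smooth : forall j, smooth (zeta j);
  pou_ge0 : forall j x, 0 <= zeta j x;
  pou_supp : forall j x, zeta j x != 0 -> `|x - a j| < r j;
  pou_sum : exists2 U, open U /\ K `<=` U & forall x, U x -> \sum_j zeta j x = 1 }.

Lemma pou_exists K P : compact K -> (forall x, K x -> exists2 r : R, 0 < r & P x r) ->
  exists N (a : 'I_N -> E) r zeta, pou K P a r zeta.
Proof.
move=> cK HP; have [N [a [r [Har cov]]]] := compact_ball_cover cK HP.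
pose B j := box_bump (a j) (r j); pose theta x := \sum_j B j x.
have sth : smooth theta by apply: smooth_sum => j _; exact: box_bump_smooth.
have th0 x : 0 <= theta x by apply: sumr_ge0 => j _; exact: box_bump_ge0.
have thK x : K x -> 0 < theta x.
  move=> /cov[j xj]; rewrite /theta (bigD1 j)//= ltr_pwDl//; last by apply: sumr_ge0 => k _; exact: box_bump_ge0.
  by rewrite box_bump_gt0//; have [] := Har j.
have [c c0 Hc] : exists2 c : R, 0 < c & forall x, K x -> c < theta x.
  have cinv : {in K, continuous (fun x => (theta x)^-1)}.
    move=> x /set_mem/thK tx; apply: (@continuousV R E theta); last exact: smooth_continuous.
    by rewrite gt_eqF.
  have [M M0 HM] := compact_bounded_fun cK cinv.
  have M1 : 0 < M + 1 by rewrite ltr_wpDl.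
  exists (M + 1)^-1 => [|x Kx]; first by rewrite invr_gt0.
  have := HM x Kx; rewrite ger0_norm ?invr_ge0// => h.
  by rewrite -[ltRHS]invrK ltf_pV2 ?posrE ?invr_gt0 ?thK// (le_lt_trans h)// ltrDl.
(* This denominator is smooth and positive everywhere and equals theta wherever theta >= c, so
   dividing by it is harmless off K and normalizes near K. *)
pose den x := theta x + flat 1 (c - theta x).
have den0 x : 0 < den x.
  have [h|h] := ltP (theta x) c; first by rewrite /den ltr_wpDl// flat1_gt0 subr_gt0.
  by rewrite /den ltr_pwDl ?flat1_ge0// (lt_le_trans c0).
have sden : smooth den.
  apply: (smoothD sth); apply: (@smooth_comp _ _ (flat 1) (fun x => c - theta x)); first exact: smooth1_flat.
  by apply: (@smoothB _ _ (cst c) theta) => //; exact: smooth_cst.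
exists N, a, r, (fun j x => B j x * (den x)^-1); split => //.
- move=> j; apply: (@smoothM _ _ (B j) (fun x => (den x)^-1)); first exact: box_bump_smooth.
  by apply: smooth_inv => // x; rewrite gt_eqF.
- by move=> j x; rewrite divr_ge0 ?box_bump_ge0// ltW.
- move=> j x; rewrite mulf_eq0 negb_or => /andP[Bx _].
  by rewrite -box_bump_gt0; [rewrite lt_neqAle eq_sym Bx box_bump_ge0|have [] := Har j].
exists [set x | c < theta x].
  split; last exact: Hc.
  rewrite (_ : mkset _ = theta @^-1` [set t | c < t])//.
  by apply: open_comp; [move=> x _; exact: smooth_continuous|exact: open_gt].
move=> x /= ctx; rewrite -mulr_suml -/(theta x).
have -> : den x = theta x.
  rewrite /den; suff -> : flat 1 (c - theta x) = 0 by rewrite addr0.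
  by apply/eqP; rewrite eq_le flat1_ge0 andbT leNgt flat1_gt0 subr_gt0 -leNgt ltW.
by rewrite divff// gt_eqF// (lt_trans c0).
Qed.

Section pou_facts.
Context K P N (a : 'I_N -> E) (r : 'I_N -> R) (zeta : 'I_N -> E -> R).
Hypothesis H : pou K P a r zeta.

Lemma pou_bsupp j : bsupp (zeta j).
Proof.
exists (r j + `|a j|) => x hx; apply/eqP; apply: contraTT hx => /(pou_supp H) xa.
by rewrite -leNgt -lerBlDr (le_trans (lerB_dist _ _))// ltW.
Qed.

Lemma pou_pderiv_sum i x : K x -> \sum_j pderiv (zeta j) i x = 0.
Proof.
move=> Kx; have [U [oU KU] HU] := pou_sum H.
have := pderiv_sum i (fun j => smooth_differentiable x (pou_smooth H j)) => <-.
transitivity (pderiv (cst 1 : E -> R) i x); last by rewrite pderiv_cst.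
apply: near_eq_derive; have := open_nbhs_nbhs (conj oU (KU _ Kx)).
by apply: filterS => y /HU.
Qed.

Lemma pou_decomp psi x : K x -> psi x = \sum_j zeta j x * psi x.
Proof. by move=> Kx; have [U [_ /(_ _ Kx) Ux] /(_ _ Ux) HU] := pou_sum H; rewrite -mulr_suml HU mul1r. Qed.

Lemma pou_pderiv0 j i x : pderiv (zeta j) i x != 0 -> `|x - a j| <= r j.
Proof.
apply: contraNT; rewrite -ltNge => rx; apply/eqP.
apply: (@open_pderiv0 _ _ [set y : E | r j < `|y - a j|]) => //.
- rewrite (_ : mkset _ = (fun y : E => `|y - a j|) @^-1` [set t | r j < t])//.
  have cn := @continuous_shift_rV R n (fun z : E => `|z|) (a j) (@norm_continuous _ _).
  by apply: open_comp; [move=> y _; exact: cn|exact: open_gt].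
- by move=> y ry; apply/eqP; apply: contraTT ry => /(pou_supp H); rewrite /= -leNgt => /ltW.
Qed.

End pou_facts.

Lemma cutoff_exists K : compact K ->
  exists chi : E -> R, [/\ smooth chi, bsupp chi & forall x, K x -> chi x = 1].
Proof.
move=> cK; have [N [a [r [z H]]]] := @pou_exists K (fun _ _ => True) cK (fun x _ => ex_intro2 _ _ 1 ltr01 I).
exists (fun x => \sum_j z j x); split.
- by apply: smooth_sum => j _; exact: pou_smooth H j.
- have /choice[M HM] := fun j => pou_bsupp H j.
  exists (\sum_j `|M j|) => x hx; rewrite big1// => j _; apply: HM; apply: le_lt_trans hx.
  by rewrite (le_trans (ler_norm _))// (bigD1 j)//= lerDl sumr_ge0.
- by move=> x Kx; have [U [_ /(_ _ Kx) Ux] /(_ _ Ux)] := pou_sum H.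
Qed.

End partition_of_unity.

(** * Integration along coordinate lines *)

Section ftc_line.
Context {R : realType}.
Implicit Types (F f : R -> R).
Local Notation leb1 := (@lebesgue_measure R).

Lemma integral_is_derive F f (a b : R) : a < b ->
  (forall t, is_derive t (1 : R) F (f t)) -> continuous (f : R -> R) ->
  (\int[leb1]_(t in `[a, b]) (f t)%:E = (F b - F a)%:E)%E.
Proof.
move=> ab dF cf; have cF : continuous F.
  by move=> t; apply/differentiable_continuous/derivable1_diffP; have [] := dF t.
rewrite (@continuous_FTC2 _ f F a b ab) ?EFinB//.
- exact: continuous_subspaceT.
- split.
  + by move=> x _; have [] := dF x.
  + exact: cvg_at_right_filter (cF a).
  + exact: cvg_at_left_filter (cF b).
- by move=> x _; rewrite derive1E; have [_ ->] := dF x.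
Qed.

Lemma is_derive_far F f M : (forall t, is_derive t (1 : R) F (f t)) ->
  (forall t, M < `|t| -> F t = 0) -> forall t, M < `|t| -> f t = 0.
Proof.
move=> dF F0 t Mt; have [_ <-] := dF t.
rewrite -[RHS](derive_cst (V := R^o) (W := R^o) (0 : R^o) t 1).
apply: near_eq_derive; near=> s; apply: F0.
near: s; apply: (@cvgr_gt _ _ (nbhs t) _ (fun s => `|s|) `|t|) => //.
exact: norm_continuous.
Unshelve. all: by end_near. Qed.

Lemma integral_is_derive_line F f M : (forall t, is_derive t (1 : R) F (f t)) ->
  continuous (f : R -> R) -> (forall t, M < `|t| -> F t = 0) ->
  (\int[leb1]_t (f t)%:E = 0)%E.
Proof.
move=> dF cf F0; have f0 := is_derive_far dF F0.
pose m := `|M| + 1; have Mm : M < m by rewrite (le_lt_trans (ler_norm M))// ltrDl.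
have m0 : 0 < m by rewrite ltr_wpDl.
have := @integral_is_derive F f (- m) m _ dF cf.
rewrite !F0 ?normrN ?(gtr0_norm m0)// subrr => H.
rewrite -[RHS]/(0%:E) -H; last by rewrite gtrN.
rewrite [RHS]integral_mkcond; apply: eq_integral => t _; rewrite patchE; case: ifPn => // /negP tm.
congr EFin; apply: f0; apply: (lt_le_trans Mm); rewrite leNgt; apply/negP => h; apply: tm.
by rewrite inE /= in_itv/= -ler_norml ltW.
Qed.

Lemma integral_is_derive_halfline (b : bool) F f M :
  (forall t, is_derive t (1 : R) F (f t)) ->
  continuous (f : R -> R) -> (forall t, M < `|t| -> F t = 0) ->
  (\int[leb1]_(t in [set t : R | (0 < (-1) ^+ b * t)%R]) (f t)%:E = (- (-1) ^+ b * F 0)%:E)%E.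
Proof.
move=> dF cf F0; have f0 := is_derive_far dF F0.
pose m := `|M| + 1; have Mm : M < m by rewrite (le_lt_trans (ler_norm M))// ltrDl.
have m0 : 0 < m by rewrite ltr_wpDl.
have mf D : measurable_fun D (EFin \o f).
  by apply: measurable_funTS; apply/measurable_EFinP; exact: continuous_measurable_fun.
case: b => /=.
- have := @integral_is_derive F f (- m) 0 _ dF cf.
  rewrite oppr_lt0 (F0 (- m)) ?normrN ?(gtr0_norm m0)// subr0 opprK expr1 mul1r => <- //.
  rewrite -integral_itv_bndo_bndc//.
  rewrite integral_mkcond [RHS]integral_mkcond; apply: eq_integral => t _; rewrite !patchE.
  have [tm|tm] := ltP t (- m); last first.
    rewrite (_ : (t \in _) = (t \in `[(- m), 0[%classic))//.
    by apply/idP/idP; rewrite !inE /= in_itv/= tm/= mulN1r oppr_gt0.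
  rewrite f0; first by case: ifP => _; case: ifP.
  by rewrite ltr0_norm ?(lt_trans tm) ?oppr_lt0// ltrNr (lt_trans tm)// ltrN2.
- have := @integral_is_derive F f 0 m m0 dF cf.
  rewrite (F0 m) ?(gtr0_norm m0)// sub0r expr0 mulN1r => <- //.
  rewrite -integral_itv_obnd_cbnd//.
  rewrite integral_mkcond [RHS]integral_mkcond; apply: eq_integral => t _; rewrite !patchE.
  have [tm|tm] := ltP m t; last first.
    rewrite (_ : (t \in _) = (t \in `]0, m]%classic))//.
    by apply/idP/idP; rewrite !inE /= in_itv/= tm/= mul1r ?andbT.
  rewrite f0; first by case: ifP => _; case: ifP.
  by rewrite gtr0_norm ?(lt_trans m0)// (lt_trans Mm).
Qed.

End ftc_line.

Section integration_by_parts.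
Context {R : realType} {n : nat}.
Local Notation E := 'rV[R]_n.+1.
Local Notation leb := (lebesgue_rV n.+1).
Implicit Types (psi : E -> R).

Lemma insert_coord_line (i : 'I_n.+1) (t : R) (y : 'rV[R]_n) :
  insert_coord i t y = insert_coord i 0 y + t *: delta_mx ord0 i.
Proof.
apply/rowP => j; rewrite !mxE eqxx /=; case: (unliftP i j) => [k ->|->] /=.
  by rewrite eq_sym (negPf (neq_lift _ _)) mulr0 addr0.
by rewrite eqxx mulr1 add0r.
Qed.

Lemma is_derive_insert psi (i : 'I_n.+1) y (t : R) : differentiable psi (insert_coord i t y) ->
  is_derive t (1 : R) (fun s => psi (insert_coord i s y)) (pderiv psi i (insert_coord i t y)).
Proof.
rewrite insert_coord_line => /is_derive_line.
under eq_fun do rewrite -insert_coord_line.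
rewrite (bigD1 i)//= mxE !eqxx mul1r big1 ?addr0 // => k /negPf ki.
by rewrite mxE ki andbF mul0r.
Qed.

Lemma continuous_insert i (y : 'rV[R]_n) : continuous (fun t : R => insert_coord i t y).
Proof.
rewrite (_ : (fun _ => _) = fun t : R => insert_coord i 0 y + t *: delta_mx ord0 i); last first.
  by apply/funext => t; rewrite insert_coord_line.
move=> t; apply: cvgD; first exact: cvg_cst.
by apply: cvgZr_tmp; exact: cvg_id.
Qed.

Lemma insert_coord_norm i (t : R) (y : 'rV[R]_n) : `|t| <= `|insert_coord i t y|.
Proof. by have := coord_le_norm (insert_coord i t y) i; rewrite mxE unlift_none. Qed.

Lemma integral_pderiv0 psi i : (forall x, differentiable psi x) -> continuous (pderiv psi i) ->
  bsupp psi -> \int[leb]_x (pderiv psi i x) = 0.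
Proof.
move=> dpsi cpsi [M bpsi].
have ipsi := continuous_bsupp_integrable cpsi (bsupp_pderiv i (ex_intro _ M bpsi)).
rewrite /Rintegral (integral_rV_insert i ipsi)/= integral0_eq// => y _.
apply: (@integral_is_derive_line _ (fun s => psi (insert_coord i s y)) _ M).
- by move=> t; apply: is_derive_insert.
- by move=> t; apply: continuous_comp; [exact: continuous_insert|exact: cpsi].
- by move=> t Mt; apply: bpsi; apply: (lt_le_trans Mt); exact: insert_coord_norm.
Qed.

End integration_by_parts.

(** * Weak derivatives *)

Lemma pderiv_shift {R : realType} n (rho : 'rV[R]_n -> R) (x : 'rV[R]_n) i : smooth rho ->
  pderiv (fun y : 'rV[R]_n => rho (y - x)) i = (fun y : 'rV[R]_n => pderiv rho i (y - x)).
Proof.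
move=> sr; apply/funext => y; have dr := smooth_differentiable (y - x) sr.
suff [_ ->//] : differentiable (fun z : 'rV[R]_n => rho (z - x)) y /\
  forall k, pderiv (fun z : 'rV[R]_n => rho (z - x)) k y = pderiv rho k (y - x).
apply: differentiable_of_expansion => e e0.
have [d d0 Hd] := differentiable_expansion dr e0.
by exists d => // h /Hd; rewrite (addrAC y).
Qed.

Section weak_derivatives.
Context {R : realType} {n : nat}.
Local Notation E := 'rV[R]_n.+1.
Local Notation leb := (lebesgue_rV n.+1).
Variable Om : set E.
Hypotheses (oO : open Om) (bO : bounded_set Om).
Local Notation dot := (dotL2 leb Om).
Local Notation nrm := (normL2 leb Om).
Local Notation L2O := (L2 leb Om).
Local Notation wd i u v := (is_wderiv Om [:: i] u v).
Implicit Types (u v w phi psi rho f : E -> R).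

Lemma measurable_open : measurable Om. Proof. exact: open_measurable_rV. Qed.
Local Notation mO := measurable_open.

Lemma open_lebesgue_fin : (leb Om < +oo)%E.
Proof. exact: bounded_lebesgue_fin mO bO. Qed.
Local Notation Ofin := open_lebesgue_fin.

Lemma bounded_norm_le : exists2 M : R, 0 < M & forall x, closure Om x -> `|x| <= M.
Proof.
have [M [_ HM]] := bO; exists (`|M| + 1) => [|x]; first by rewrite ltr_wpDl.
have sub : Om `<=` [set x : E | `|x| <= `|M| + 1].
  by move=> y Oy; apply: HM => //; rewrite (le_lt_trans (ler_norm M))// ltrDl.
have cl := @closed_ball_rV_closed R n.+1 (`|M| + 1).
by move=> /(closure_subset sub); rewrite -(closure_id _).1.
Qed.

Lemma closure_compact : compact (closure Om).
Proof.
have [M M0 HM] := bounded_norm_le.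
apply: bounded_closed_compact; last exact: closed_closure.
exists M; split; first exact: num_real.
by move=> y My x /HM /le_trans; apply; exact: ltW.
Qed.

Lemma continuous_bounded_on f : continuous f -> exists2 M : R, 0 <= M & forall x, Om x -> `|f x| <= M.
Proof.
move=> cf; have [M M0 HM] := compact_bounded_fun closure_compact (fun x _ => cf x).
by exists M => // x /subset_closure; exact: HM.
Qed.

Lemma continuous_L2 f : continuous f -> L2O f.
Proof.
move=> cf; have [M M0 HM] := continuous_bounded_on cf.
by apply: (L2_bounded mO Ofin _ HM); exact: continuous_measurable_rV mO cf.
Qed.

Lemma smooth_L2 f : smooth f -> L2O f.
Proof. by move=> /smooth_continuous; exact: continuous_L2. Qed.

Lemma L2_contM f u : continuous f -> L2O u -> L2O (fun x => f x * u x).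
Proof.
move=> cf Lu; have [M M0 HM] := continuous_bounded_on cf.
by apply: (L2_bdd_mul mO _ HM) => //; exact: continuous_measurable_rV mO cf.
Qed.

Lemma normL2_contM f : continuous f ->
  exists2 M : R, 0 <= M & forall u, L2O u -> nrm (fun x => f x * u x) <= M * nrm u.
Proof.
move=> cf; have [M M0 HM] := continuous_bounded_on cf; exists M => // u Lu.
by apply: (normL2_bdd_mul mO M0 _ HM) => //; exact: continuous_measurable_rV mO cf.
Qed.

Lemma test_fun_bsupp phi : test_fun Om phi -> bsupp phi.
Proof.
move=> [_ [K [cK _ K0]]]; have /compact_bounded[M [_ HM]] := cK.
exists (`|M| + 1) => x Mx; apply: K0 => Kx; move: Mx; apply/negP; rewrite -leNgt.
by apply: HM => //; rewrite (le_lt_trans (ler_norm M))// ltrDl.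
Qed.

Lemma test_fun_out phi x : test_fun Om phi -> ~ Om x -> phi x = 0.
Proof. by move=> [_ [K [_ KO K0]]] nx; apply: K0 => /KO. Qed.

Lemma test_fun_pderiv phi i : test_fun Om phi -> test_fun Om (pderiv phi i).
Proof.
move=> [sp [K [cK KO K0]]]; split; first exact: smooth_pderiv.
exists K; split => // x nK; apply: (@open_pderiv0 _ _ (~` K)) => //.
by apply: closed_openC; apply: compact_closed => //; exact: norm_hausdorff.
Qed.

Lemma test_fun_L2 phi : test_fun Om phi -> L2O phi.
Proof. by move=> [sp _]; exact: smooth_L2. Qed.

Lemma Rintegral_supp psi : (forall x, ~ Om x -> psi x = 0) ->
  \int[leb]_(x in Om) psi x = \int[leb]_x psi x.
Proof.
move=> h; rewrite Rintegral_mkcond; apply: eq_Rintegral => x _; rewrite patchE.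
by case: ifPn => // /negP xO; rewrite h// => Ox; apply: xO; exact/mem_set.
Qed.

Lemma wd1P i u v : wd i u v <->
  L2O v /\ forall phi, test_fun Om phi -> dot u (pderiv phi i) = - dot v phi.
Proof. by rewrite /is_wderiv /= expr1; split=> -[Lv H]; split => // phi /H ->; rewrite mulN1r. Qed.

(** C^1 is the regularity of g o Phi with Phi smooth and g merely C^2, the case that the weak chain
    rule requires. *)
Lemma wd_C1 f i : (forall x, differentiable f x) -> continuous (pderiv f i) -> wd i f (pderiv f i).
Proof.
move=> df cf; apply/wd1P; split=> [|phi tphi]; first exact: continuous_L2.
have [sphi _] := tphi; have cfu : continuous f by move=> x; exact: differentiable_continuous.
have dphi x := smooth_differentiable x sphi.
have E1 x : pderiv (f \* phi) i x = f x * pderiv phi i x + pderiv f i x * phi x.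
  by rewrite pderivM// (mulrC (phi x)).
have c1 : continuous (pderiv (f \* phi) i).
  rewrite (_ : pderiv _ _ = (f \* pderiv phi i) \+ (pderiv f i \* phi)); last by apply/funext => x; rewrite E1.
  have c3 := smooth_continuous (smooth_pderiv i sphi); have c4 := smooth_continuous sphi.
  by move=> x; apply: (@continuousD R R E); apply: (@continuousM R E); [exact: cfu|exact: c3|exact: cf|exact: c4].
have b1 : bsupp (f \* phi) by have [r Hr] := test_fun_bsupp tphi; exists r => x /Hr /= ->; rewrite mulr0.
have := integral_pderiv0 (fun x => differentiableM (df x) (dphi x)) c1 b1.
rewrite -Rintegral_supp; last first.
  by move=> x nx; rewrite E1 (test_fun_out tphi nx) (test_fun_out (test_fun_pderiv i tphi) nx) !mulr0 addr0.
rewrite (@eq_Rintegral _ _ _ _ _ (fun x => f x * pderiv phi i x + pderiv f i x * phi x)); last by move=> x _; rewrite E1.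
rewrite RintegralD//; first by move=> /eqP; rewrite addr_eq0 => /eqP.
- exact: mO.
- by apply: (L2_mul_integrable mO); [exact: continuous_L2|apply: test_fun_L2; exact: test_fun_pderiv].
- by apply: (L2_mul_integrable mO); [exact: continuous_L2|exact: test_fun_L2].
Qed.

Lemma wd_smooth f i : smooth f -> wd i f (pderiv f i).
Proof.
move=> sf; apply: wd_C1 => [x|]; first exact: smooth_differentiable.
by apply: smooth_continuous; exact: smooth_pderiv.
Qed.

Lemma wdB i u v u' v' : L2O u -> L2O u' -> wd i u v -> wd i u' v' -> wd i (u \- u') (v \- v').
Proof.
move=> Lu Lu' /wd1P[Lv H] /wd1P[Lv' H']; apply/wd1P; split=> [|phi tp]; first by apply: (L2B mO).
have Lp := test_fun_L2 tp; have Lp' := test_fun_L2 (test_fun_pderiv i tp).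
by rewrite !(dotL2Bl mO)// H// H'// opprD.
Qed.

Lemma wd_lim i (u_ v_ : nat -> E -> R) u v : (forall k, L2O (u_ k)) -> L2O u -> L2O v ->
  (forall k, wd i (u_ k) (v_ k)) ->
  nrm (u \- u_ k) @[k --> \oo] --> 0 -> nrm (v \- v_ k) @[k --> \oo] --> 0 -> wd i u v.
Proof.
move=> Lu_ Lu Lv H cu cv; apply/wd1P; split=> // phi tp.
have Lp := test_fun_L2 tp; have Lp' := test_fun_L2 (test_fun_pderiv i tp).
have c0 w : L2O w -> nrm (w \- w) @[k --> \oo] --> 0.
  move=> Lw; rewrite (_ : nrm _ = 0); first exact: cvg_cst.
  by rewrite -[RHS](normL2_0 leb mO); apply: eq_normL2 => x _; rewrite /= subrr.
have Lv_ k : L2O (v_ k) by have [] := H k.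
have c1 := cvg_dotL2 mO Lu_ Lu (fun=> Lp') Lp' cu (c0 _ Lp').
have c2 := cvg_dotL2 mO Lv_ Lv (fun=> Lp) Lp cv (c0 _ Lp).
apply: (cvg_unique _ c1) => //; rewrite (_ : (fun k => _) = (fun k => - dot (v_ k) phi)); first exact: cvgN.
by apply/funext => k; have /wd1P[_ ->] := H k.
Qed.

(** The derivative moves from the kernel to u only at points x where the translated kernel is a test
    function in the domain; the cone condition will provide such kernels up to the boundary. *)
Lemma wd_mollify i u v rho (x : E) : L2O u -> wd i u v -> smooth rho -> bsupp rho ->
  test_fun Om (fun y : E => rho (y - x)) ->
  pderiv (mollify Om u rho) i x = mollify Om v rho x.
Proof.
move=> Lu /wd1P[Lv H] sr br tr; have [_ ->] := conv_smooth mO Ofin Lu sr br.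
have := H _ tr; rewrite (pderiv_shift x i sr) /mollify => ->.
exact: opprK.
Qed.

End weak_derivatives.

Section finite_bounds.
Context {R : realType} {I : finType}.

Lemma finite_pos_lb (d : I -> R) : (forall i, 0 < d i) -> exists2 d0 : R, 0 < d0 & forall i, d0 <= d i.
Proof.
move=> d0; have s0 : 0 < \sum_i (d i)^-1 + 1 by rewrite ltr_wpDl// sumr_ge0// => i _; rewrite invr_ge0 ltW.
exists (\sum_i (d i)^-1 + 1)^-1 => [|i]; first by rewrite invr_gt0.
rewrite -[leRHS]invrK lef_pV2 ?posrE ?invr_gt0// (bigD1 i)//= -addrA lerDl addr_ge0// sumr_ge0// => j _.
by rewrite invr_ge0 ltW.
Qed.

Lemma le_sum_norm (M : I -> R) i : M i <= \sum_i `|M i|.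
Proof. by rewrite (le_trans (ler_norm _))// (bigD1 i)//= lerDl sumr_ge0. Qed.

End finite_bounds.

Lemma le0_eps {R : realType} (a C : R) : 0 <= C -> (forall e : R, 0 < e -> a <= C * e) -> a <= 0.
Proof.
move=> C0 H; rewrite leNgt; apply/negP => a0; have C1 : 0 < C + 1 by rewrite ltr_wpDl.
apply/negP: (H (a / (C + 1)) (divr_gt0 a0 C1)); rewrite -ltNge mulrCA gtr_pMr// ltr_pdivrMr// mul1r.
by rewrite ltrDl.
Qed.

Lemma closed_ballc_compact {R : realType} n (c : 'rV[R]_n) (r : R) : compact [set y : 'rV[R]_n | `|y - c| <= r].
Proof.
apply: bounded_closed_compact.
  exists (r + `|c|); split; first exact: num_real.
  move=> M rM y /= yr; rewrite -(subrK c y) (le_trans (ler_normD _ _))// (le_trans _ (ltW rM))//.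
  by rewrite lerD2r.
have cn := @continuous_shift_rV R n (fun z : 'rV[R]_n => `|z|) c (@norm_continuous _ _).
rewrite (_ : mkset _ = (fun y : 'rV[R]_n => `|y - c|) @^-1` [set t | t <= r])//.
by apply: closed_comp; [move=> y _; exact: cn|exact: closed_le].
Qed.

(** * Approximation up to the boundary under a cone condition *)

Section cone_condition.
Context {R : realType} {n : nat}.
Local Notation E := 'rV[R]_n.+1.
Local Notation leb := (lebesgue_rV n.+1).
Implicit Types (Om : set E) (u v w phi psi rho f : E -> R) (a x z : E) (r d k t e C M : R).

(* Holds at all scales t <= t0, hence controls the segments from x to x + z. *)
Definition cone Om a r := exists (e : E) (k t0 : R), [/\ `|e| <= 1, 0 < k <= 1, 0 < t0 &
  forall x, Om x -> `|x - a| < r -> forall t z, 0 < t <= t0 -> `|z - t *: e| <= k * t -> Om (x + z)].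

(** The first clause serves weak derivatives, the second the estimate of u (x + z) - u x along the
    segment; [|a'| + r' < d] makes every admissible z shorter than d. *)
Definition good_kernel Om a r d rho := exists a' r', [/\ kernel_at a' r' rho, `|a'| + r' < d &
  forall x, Om x -> `|x - a| < r -> test_fun Om (fun y : E => rho (y - x)) /\
    forall z, rho z != 0 -> forall t, 0 <= t <= 1 -> Om (x + t *: z)].

Lemma good_kernel_exists Om a r d : cone Om a r -> 0 < d -> exists rho, good_kernel Om a r d rho.
Proof.
move=> [e [k [t0 [e1 /andP[k0 k1] t00 H]]]] d0.
(* The kernel is centred at t e with radius k t, so its support lies within 2 t < 3 t <= d of the
   origin. *)
pose t := Num.min t0 (d / 3).
have tpos : 0 < t by rewrite lt_min t00 divr_gt0.
have tt0 : t <= t0 by rewrite ge_min lexx.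
have td : t * 3 <= d by rewrite -ler_pdivlMr// ge_min lexx orbT.
have [rho krho] := kernel_exists (t *: e) (mulr_gt0 k0 tpos); have [sr r0 rs ir] := krho.
exists rho, (t *: e), (k * t); split => //.
  rewrite normrZ gtr0_norm//.
  have : t * `|e| <= t by rewrite ler_piMr// ltW.
  have : k * t <= t by rewrite ler_piMl// ltW.
  move: (t * `|e|) (k * t) => p q; lra.
move=> x Ox xa; split=> [|z rz s /andP[s0 s1]].
  split; first exact: smooth_shift.
  exists [set y : E | `|y - (x + t *: e)| <= k * t]; split; first exact: closed_ballc_compact.
    move=> y /= yx; rewrite -(subrK x y) addrC; apply: (H x Ox xa t) => //; first by rewrite tpos.
    by rewrite -addrA -opprD.
  move=> y /= yx; apply/eqP; apply: contra_notT yx => /rs.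
  by rewrite -addrA -opprD => /ltW.
have [->|s0'] := eqVneq s 0; first by rewrite scale0r addr0.
have sp : 0 < s by rewrite lt_neqAle eq_sym s0' s0.
apply: (H x Ox xa (s * t)).
  by rewrite mulr_gt0//= (le_trans _ tt0)// ler_piMl// ltW.
rewrite -scalerA -scalerBr normrZ gtr0_norm// mulrCA ler_pM2l//; exact/ltW/rs.
Qed.

Lemma good_kernel_smooth Om a r d rho : good_kernel Om a r d rho -> smooth rho.
Proof. by move=> [? [? [[]]]]. Qed.

Lemma good_kernel_bsupp Om a r d rho : good_kernel Om a r d rho -> bsupp rho.
Proof. by move=> [? [? [/kernel_bsupp]]]. Qed.

Lemma normL2_sub (D D' : set E) w : measurable D -> measurable D' -> D `<=` D' -> L2 leb D' w ->
  L2 leb D w /\ normL2 leb D w <= normL2 leb D' w.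
Proof.
move=> mD mD' DD' [mw iw]; have L : L2 leb D w.
  by split; [apply: measurable_funS mw|apply: integrableS iw].
split=> //; rewrite -ler_sqr ?nnegrE ?normL2_ge0// !sqr_normL2 -lee_fin !dotL2_EFin//.
apply: ge0_subset_integral => //; first by apply/measurable_EFinP; exact: measurable_funM.
by move=> x _; rewrite lee_fin -expr2 sqr_ge0.
Qed.

Lemma normL2_patch (D : set E) w : normL2 leb D w = normL2 leb setT (w \_ D).
Proof.
rewrite /normL2 /dotL2 Rintegral_mkcond; congr Num.sqrt; apply: eq_Rintegral => x _; rewrite !patchE.
by case: ifPn => //; rewrite mul0r.
Qed.

Lemma normL2_sum_le (D : set E) (I : finType) (F : I -> E -> R) c : measurable D ->
  (forall i, L2 leb D (F i)) -> \sum_i normL2 leb D (F i) <= c ->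
  normL2 leb D (fun x => \sum_i F i x) <= c.
Proof. by move=> mD LF; apply: le_trans; apply: normL2_sum. Qed.

Section mollification.
Variables (Om : set E).
Hypotheses (oO : open Om) (bO : bounded_set Om).
Local Notation dot := (dotL2 leb Om).
Local Notation nrm := (normL2 leb Om).
Local Notation L2O := (L2 leb Om).
Local Notation wd i u v := (is_wderiv Om [:: i] u v).
Local Notation mO := (measurable_open oO).
Local Notation Ofin := (open_lebesgue_fin oO bO).

Lemma mollify_bsupp w rho : bsupp rho -> bsupp (mollify Om w rho).
Proof.
move=> [r Hr]; have [M M0 HM] := bounded_norm_le bO; exists (M + r) => x Mx.
rewrite /mollify -(dotL2_0l leb mO w) dotL2C; apply: eq_dotL2 => // y Oy; apply: Hr.
rewrite distrC; apply: lt_le_trans (lerB_dist _ _).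
by rewrite ltrBrDr (le_lt_trans _ Mx)// addrC lerD2r HM//; exact: subset_closure.
Qed.

Lemma mollify_smooth w rho : L2O w -> smooth rho -> bsupp rho -> smooth (mollify Om w rho).
Proof. by move=> Lw sr br; have [] := conv_smooth mO Ofin Lw sr br. Qed.

Lemma mollify_L2T w rho : L2O w -> smooth rho -> bsupp rho -> L2 leb setT (mollify Om w rho).
Proof.
move=> Lw sr br; apply: continuous_bsupp_L2; last exact: mollify_bsupp.
by apply: smooth_continuous; exact: mollify_smooth.
Qed.

Lemma mollify_approx w e : L2O w -> 0 < e ->
  exists2 d : R, 0 < d & forall a' r' rho, kernel_at a' r' rho -> `|a'| + r' < d ->
    nrm (mollify Om w rho \- w) <= e.
Proof.
move=> Lw e0; have Lw0 := L2_restrict mO Lw.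
have w0 x : ~ Om x -> (w \_ Om) x = 0 by move=> nx; rewrite patchE memNset.
have T := translation_cont_L2 oO Ofin Lw0 w0.
have [d d0 Hd] := conv_L2_approx T e0; exists d => // a' r' rho kr ard.
have [sr _ _ _] := kr; have br := kernel_bsupp kr; have LT := mollify_L2T Lw sr br.
have E1 : mollify Om w rho = mollify setT (w \_ Om) rho by apply/funext => x; rewrite conv_restrict.
rewrite E1 in LT *; have := Hd a' r' rho ard kr LT; apply: le_trans.
have [_] := normL2_sub mO measurableT (@subsetT _ _) (L2B measurableT LT Lw0).
apply: le_trans; rewrite le_eqVlt; apply/orP; left; apply/eqP; apply: eq_normL2 => x Ox /=.
by rewrite patchT//; exact/mem_set.
Qed.

Lemma mollify_approx_fin (I : finType) (w : I -> E -> R) e : (forall i, L2O (w i)) -> 0 < e ->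
  exists2 d : R, 0 < d & forall a' r' rho, kernel_at a' r' rho -> `|a'| + r' < d ->
    forall i, nrm (mollify Om (w i) rho \- w i) <= e.
Proof.
move=> Lw e0; have /choice[d Hd] : forall i, exists d : R, 0 < d /\ forall a' r' rho, kernel_at a' r' rho -> `|a'| + r' < d ->
    nrm (mollify Om (w i) rho \- w i) <= e.
  by move=> i; have [d d0 Hd] := mollify_approx (Lw i) e0; exists d.
have [d0 d00 Hd0] := finite_pos_lb (fun i => (Hd i).1).
exists d0 => // a' r' rho kr h i; apply: (Hd i).2 kr _; exact: (lt_le_trans h (Hd0 i)).
Qed.

Variables (N : nat) (a : 'I_N -> E) (r : 'I_N -> R) (zeta : 'I_N -> E -> R).
Hypothesis Hpou : pou (closure Om) (cone Om) a r zeta.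

Let czeta j := smooth_continuous (pou_smooth Hpou j).
Let cdzeta j i := smooth_continuous (smooth_pderiv i (pou_smooth Hpou j)).

Lemma pou_kernels d : 0 < d -> exists rho : 'I_N -> E -> R, forall j, good_kernel Om (a j) (r j) d (rho j).
Proof.
move=> d0; suff /choice[rho] : forall j, exists rho, good_kernel Om (a j) (r j) d rho by exists rho.
by move=> j; apply: good_kernel_exists => //; have [] := pou_loc Hpou j.
Qed.

Lemma pou_decompO u x : Om x -> u x = \sum_j zeta j x * u x.
Proof. by move=> Ox; apply: (pou_decomp Hpou); exact: subset_closure. Qed.

Lemma contM_bound_fin (I : finType) (f : I -> E -> R) : (forall i, continuous (f i)) ->
  exists2 C : R, 0 <= C & forall i u, L2O u -> nrm (fun x => f i x * u x) <= C * nrm u.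
Proof.
move=> cf; have /choice[M HM] : forall i, exists M : R, 0 <= M /\ forall u, L2O u -> nrm (fun x => f i x * u x) <= M * nrm u.
  by move=> i; have [M M0 H] := normL2_contM oO bO (cf i); exists M.
exists (\sum_i `|M i|) => [|i u Lu]; first exact: sumr_ge0.
by apply: (le_trans ((HM i).2 u Lu)); rewrite ler_wpM2r ?normL2_ge0// le_sum_norm.
Qed.

Lemma zeta_supp j x : zeta j x != 0 -> `|x - a j| < r j. Proof. exact: (pou_supp Hpou). Qed.

(** Where zeta_j is nonzero the mollification of u pairs it with a test function and is therefore 0.
    Hence zeta_j u equals zeta_j times the approximation error, which is as small as desired. *)
Lemma wd_unique0 u : L2O u -> (forall phi, test_fun Om phi -> dot u phi = 0) -> nrm u = 0.
Proof.
move=> Lu H; have [C C0 HC] := contM_bound_fin czeta.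
apply/eqP; rewrite eq_le normL2_ge0 andbT; apply: (@le0_eps _ _ (C *+ N)); first exact: mulrn_wge0.
move=> e e0; have [d d0 Hd] := mollify_approx Lu e0; have [rho Hrho] := pou_kernels d0.
have Lj j : L2O (u \- mollify Om u (rho j)).
  apply: (L2B mO Lu); apply: (smooth_L2 oO bO); apply: mollify_smooth => //.
    exact: (good_kernel_smooth (Hrho j)).
  exact: (good_kernel_bsupp (Hrho j)).
have -> : nrm u = nrm (fun x => \sum_j zeta j x * (u \- mollify Om u (rho j)) x).
  apply: eq_normL2 => x Ox; rewrite [LHS](pou_decompO u Ox); apply: eq_bigr => j _ /=.
  have [->|zj] := eqVneq (zeta j x) 0; first by rewrite !mul0r.
  have [a' [r' [_ _ /(_ x Ox (zeta_supp zj))[tr _]]]] := Hrho j.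
  by rewrite /mollify H// subr0.
apply: (normL2_sum_le mO).
  by move=> j; exact: (L2_contM oO bO (@czeta j) (Lj j)).
rewrite [leRHS](_ : _ = \sum_(j < N) C * e); last by rewrite sumr_const card_ord mulrnAl.
apply: ler_sum => j _.
apply: (le_trans (HC j _ (Lj j))); rewrite ler_wpM2l// normL2_distC.
by have [a' [r' [kr h _]]] := Hrho j; exact: (Hd _ _ _ kr h).
Qed.

(** Each patch is mollified with its own inward kernel and the results are glued by zeta. The
    commutator terms (d_i zeta_j) u add up to zero because the zeta_j sum to 1 near the closure,
    leaving only mollification errors. *)
Lemma smooth_approx u (p : 'I_n.+1 -> E -> R) e : L2O u -> (forall i, wd i u (p i)) -> 0 < e ->
  exists Phi, [/\ smooth Phi, bsupp Phi, nrm (u \- Phi) <= e & forall i, nrm (p i \- pderiv Phi i) <= e].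
Proof.
move=> Lu Hp e0; have Lp i : L2O (p i) by have [] := Hp i.
have [C C0 HC] := contM_bound_fin czeta.
have [C' C'0 HC'] := contM_bound_fin (f := fun ji : 'I_N * 'I_n.+1 => pderiv (zeta ji.1) ji.2) (fun ji => @cdzeta ji.1 ji.2).
(* Each of the N patches contributes at most (C + C') e / c, so the total stays below e; the added 1
   keeps c positive. *)
pose c := (C + C') *+ N + 1; have c0 : 0 < c by rewrite ltr_wpDl// mulrn_wge0// addr_ge0.
have ec : 0 < e / c by rewrite divr_gt0.
pose w (o : option 'I_n.+1) := if o is Some i then p i else u.
have Lw o : L2O (w o) by case: o.
have [d d0 Hd] := mollify_approx_fin Lw ec; have [rho Hrho] := pou_kernels d0.
have sr j := good_kernel_smooth (Hrho j); have br j := good_kernel_bsupp (Hrho j).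
have sA j v : L2O v -> smooth (mollify Om v (rho j)) by move=> Lv; exact: mollify_smooth.
have LA j o : L2O (mollify Om (w o) (rho j) \- w o).
  by apply: (L2B mO _ (Lw o)); apply: (smooth_L2 oO bO); exact: sA.
have HA j o : nrm (mollify Om (w o) (rho j) \- w o) <= e / c.
  by have [a' [r' [kr h _]]] := Hrho j; exact: (Hd _ _ _ kr h o).
pose T j x := zeta j x * mollify Om u (rho j) x.
have sT j : smooth (T j) by apply: smoothM; [exact: (pou_smooth Hpou j)|exact: sA].
have eN (g h : 'I_N -> R) : (forall j, g j <= C * (e / c)) -> (forall j, h j <= C' * (e / c)) ->
    \sum_j (g j + h j) <= e.
  move=> Hg Hh; apply: (@le_trans _ _ (\sum_(j < N) (C + C') * (e / c))).
    by apply: ler_sum => j _; rewrite mulrDl lerD.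
  rewrite sumr_const card_ord -mulrnAl mulrCA ger_pMr// ler_pdivrMr// mul1r.
  by rewrite lerDl.
exists (fun x => \sum_j T j x); split.
- by apply: smooth_sum => j _; exact: sT.
- have /choice[M HM] := fun j => pou_bsupp Hpou j.
  exists (\sum_j `|M j|) => x hx; rewrite big1// => j _; rewrite /T HM ?mul0r//.
  by apply: le_lt_trans hx; exact: le_sum_norm.
- rewrite normL2_distC (_ : nrm _ = nrm (fun x => \sum_j zeta j x * (mollify Om u (rho j) \- u) x)); last first.
    apply: eq_normL2 => x Ox /=; rewrite [X in _ - X](pou_decompO u Ox) -sumrB.
    by apply: eq_bigr => j _; rewrite mulrBr.
  apply: (normL2_sum_le mO).
    by move=> j; exact: (L2_contM oO bO (@czeta j) (LA j None)).
  rewrite (eq_bigr (fun j => nrm (fun x => zeta j x * (mollify Om u (rho j) \- u) x) + 0)) => [|j _]; last by rewrite addr0.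
  apply: eN => j; last by rewrite mulr_ge0// ltW.
  by apply: (le_trans (HC j _ (LA j None))); rewrite ler_wpM2l//; exact: (HA j None).
move=> i; rewrite normL2_distC (_ : nrm _ = nrm (fun x => \sum_j
   (zeta j x * (mollify Om (p i) (rho j) \- p i) x + pderiv (zeta j) i x * (mollify Om u (rho j) \- u) x))); last first.
  apply: eq_normL2 => x Ox /=.
  rewrite (@pderiv_sum _ _ _ T) => [|j]; last exact: smooth_differentiable.
  have S0 : \sum_j pderiv (zeta j) i x * u x = 0.
    by rewrite -mulr_suml (pou_pderiv_sum Hpou) ?mul0r//; exact: subset_closure.
  transitivity (\sum_j (pderiv (T j) i x - zeta j x * p i x - pderiv (zeta j) i x * u x)).
    by rewrite sumrB S0 subr0 sumrB -(pou_decompO (p i) Ox).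
  apply: eq_bigr => j _.
  rewrite /T pderivM; [|exact: (smooth_differentiable x (pou_smooth Hpou j))|exact: (smooth_differentiable x (sA j u Lu))].
  have [->|zj] := eqVneq (zeta j x) 0; first by ring.
  have [a' [r' [_ _ /(_ x Ox (zeta_supp zj))[tr _]]]] := Hrho j.
  rewrite (wd_mollify oO bO Lu (Hp i) (sr j) (br j) tr); ring.
have L1 j := L2_contM oO bO (@czeta j) (LA j (Some i)).
have L2' j := L2_contM oO bO (@cdzeta j i) (LA j None).
apply: (normL2_sum_le mO); first by move=> j; exact: (L2D mO (L1 j) (L2' j)).
apply: (@le_trans _ _ (\sum_j (nrm (fun x => zeta j x * (mollify Om (p i) (rho j) \- p i) x) +
    nrm (fun x => pderiv (zeta j) i x * (mollify Om u (rho j) \- u) x)))).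
  by apply: ler_sum => j _; exact: (normL2D mO (L1 j) (L2' j)).
apply: eN => j.
  by apply: (le_trans (HC j _ (LA j (Some i)))); rewrite ler_wpM2l//; exact: (HA j (Some i)).
by apply: (le_trans (HC' (j, i) _ (LA j None))); rewrite ler_wpM2l//; exact: (HA j None).
Qed.

(** The rule holds for smooth approximations Phi. The error splits into the change of g, the change
    of g' and the change of the gradient, each linear in the distance from u to Phi in H^1. *)
Lemma wd_chain (g : R -> R) (K : R) u (p : 'I_n.+1 -> E -> R) : 0 <= K ->
  (forall s, derivable g s 1) -> (forall s, `|g s| <= K) -> (forall s, `|derive1 g s| <= K) ->
  (forall s t, `|g s - g t| <= K * `|s - t|) ->
  (forall s t, `|derive1 g s - derive1 g t| <= K * `|s - t|) -> continuous (derive1 g) ->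
  L2O u -> (forall i, wd i u (p i)) ->
  L2O (g \o u) /\ forall i, wd i (g \o u) (fun x => derive1 g (u x) * p i x).
Proof.
move=> K0 dg gK g'K gL g'L cg' Lu Hp; have Lp i : L2O (p i) by have [] := Hp i.
have cg : continuous g by move=> s; apply/differentiable_continuous/derivable1_diffP.
have mgo (h : R -> R) v : continuous h -> L2O v -> measurable_fun Om (h \o v).
  by move=> ch Lv; apply: measurableT_comp; [exact: continuous_measurable_fun|exact: Lv.1].
have Lg v : L2O v -> L2O (g \o v) by move=> Lv; exact: (L2_bounded mO Ofin (mgo g v cg Lv) (fun x _ => gK (v x))).
have Lg' v w : L2O v -> L2O w -> L2O (fun x => derive1 g (v x) * w x).
  by move=> Lv Lw; apply: (L2_bdd_mul mO (M := K)) => //; exact: mgo.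
split; first exact: Lg.
move=> i; apply/wd1P; split; first exact: Lg'.
move=> phi tphi; have Lphi := test_fun_L2 oO bO tphi; have Ldphi := test_fun_L2 oO bO (test_fun_pderiv i tphi).
have [M M0 HM] := continuous_bounded_on bO (smooth_continuous tphi.1).
apply/eqP; rewrite -subr_eq0 opprK -normr_le0.
pose X := K * nrm (pderiv phi i) + (K * M * nrm (p i) + K * nrm phi).
apply: (@le0_eps _ _ X).
  by rewrite /X !addr_ge0// ?mulr_ge0// normL2_ge0.
move=> e e0; have [Phi [sPhi bPhi He Hde]] := smooth_approx Lu Hp e0.
have LPhi := smooth_L2 oO bO sPhi; have LdPhi := smooth_L2 oO bO (smooth_pderiv i sPhi).
have dP x : differentiable (g \o Phi) x /\ pderiv (g \o Phi) i x = derive1 g (Phi x) * pderiv Phi i x.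
  by apply: pderiv_comp => //; exact: smooth_differentiable.
have pE : pderiv (g \o Phi) i = fun x => derive1 g (Phi x) * pderiv Phi i x by apply/funext => x; have [] := dP x.
have cP : continuous (pderiv (g \o Phi) i).
  rewrite pE => x; apply: (@continuousM R E (derive1 g \o Phi) (pderiv Phi i)).
    by apply: continuous_comp; [exact: smooth_continuous|exact: cg'].
  by apply: smooth_continuous; exact: smooth_pderiv.
have /wd1P[_ /(_ _ tphi) HPhi] := wd_C1 oO bO (fun x => (dP x).1) cP.
have L1 := L2B mO (Lg _ Lu) (Lg _ LPhi).
have L2' := L2B mO (Lg' _ _ Lu (Lp i)) (Lg' _ _ LPhi (Lp i)).
have L3 := Lg' _ _ LPhi (L2B mO (Lp i) LdPhi).
have -> : dot (g \o u) (pderiv phi i) + dot (fun x => derive1 g (u x) * p i x) phi =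
   dot ((g \o u) \- (g \o Phi)) (pderiv phi i) +
   (dot ((fun x => derive1 g (u x) * p i x) \- (fun x => derive1 g (Phi x) * p i x)) phi +
   dot (fun x => derive1 g (Phi x) * (p i \- pderiv Phi i) x) phi).
  rewrite -(dotL2Dl mO L2' L3 Lphi) (dotL2Bl mO (Lg _ Lu) (Lg _ LPhi) Ldphi) HPhi opprK pE -addrA.
  congr (_ + _); rewrite -(dotL2Dl mO (Lg' _ _ LPhi LdPhi) (L2D mO L2' L3) Lphi).
  by apply: eq_dotL2 => // x _ /=; ring.
apply: (le_trans (ler_normD _ _)); rewrite /X mulrDl lerD//.
  apply: (le_trans (cauchy_schwarzL2 mO L1 Ldphi)); rewrite mulrAC ler_wpM2r ?normL2_ge0//.
  apply: le_trans (ler_wpM2l K0 He); rewrite -(ger0_norm K0) -(normL2Z mO K (L2B mO Lu LPhi)).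
  apply: (normL2_mono mO L1 (L2Z mO K (L2B mO Lu LPhi))) => x _ /=.
  by rewrite normrM (ger0_norm K0) gL.
apply: (le_trans (ler_normD _ _)); rewrite mulrDl lerD//.
  rewrite (_ : dot _ phi = dot (fun x => phi x * (derive1 g (u x) - derive1 g (Phi x))) (p i)); last first.
    (* The bounded test function is grouped with the difference of g', since g' u - g' Phi is small
       in L^2 only and has to be paired with p in L^2. *)
    by apply: eq_Rintegral => x _ /=; ring.
  have Lgg : L2O (fun x => derive1 g (u x) - derive1 g (Phi x)).
    apply: (L2_bounded mO Ofin (M := K + K)); first by apply: measurable_funB; exact: mgo.
    by move=> x _; rewrite (le_trans (ler_normB _ _))// lerD.
  have cphi := smooth_continuous tphi.1.
  have L4 := L2_contM oO bO cphi Lgg.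
  apply: (le_trans (cauchy_schwarzL2 mO L4 (Lp i))); rewrite mulrAC ler_wpM2r ?normL2_ge0//.
  have KM0 : 0 <= K * M by rewrite mulr_ge0.
  apply: le_trans (ler_wpM2l KM0 He); rewrite -(ger0_norm KM0) -(normL2Z mO _ (L2B mO Lu LPhi)).
  apply: (normL2_mono mO L4 (L2Z mO _ (L2B mO Lu LPhi))) => x Ox /=.
  by rewrite !normrM mulrC (ger0_norm K0) (ger0_norm M0) mulrAC ler_pM// HM.
apply: (le_trans (cauchy_schwarzL2 mO L3 Lphi)); rewrite mulrAC ler_wpM2r ?normL2_ge0//.
apply: le_trans (ler_wpM2l K0 (Hde i)).
exact: (normL2_bdd_mul mO K0 (mgo _ _ cg' LPhi) (fun x _ => g'K (Phi x)) (L2B mO (Lp i) LdPhi)).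
Qed.

End mollification.

End cone_condition.

(** * Rellich compactness *)

Lemma smooth_lipschitz {R : realType} n (f : 'rV[R]_n -> R) : smooth f -> bsupp f ->
  exists2 L : R, 0 <= L & forall x y : 'rV[R]_n, `|f x - f y| <= L * `|x - y|.
Proof.
move=> sf bf; have /choice[M HM] : forall k, exists M : R, 0 <= M /\ forall x, `|pderiv f k x| <= M.
  move=> k; have [M M0 HM] := bsupp_bounded (smooth_continuous (smooth_pderiv k sf)) (bsupp_pderiv k bf).
  by exists M.
exists (\sum_k M k) => [|x y]; first by apply: sumr_ge0 => k _; have [] := HM k.
pose v := x - y; pose h (t : R) := f (y + t *: v).
have dh t : is_derive t (1 : R) h (\sum_k v ord0 k * pderiv f k (y + t *: v)).
  by apply: is_derive_line; exact: smooth_differentiable.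
have ch : continuous h by move=> t; apply/differentiable_continuous/derivable1_diffP; have [] := dh t.
have [c _] := @MVT R h _ 0 1 ltr01 (fun t _ => dh t) (continuous_subspaceT ch).
rewrite subr0 mulr1 /h scale1r scale0r addr0 (_ : y + v = x) => [->|]; last by rewrite /v addrC subrK.
rewrite mulr_suml (le_trans (ler_norm_sum _ _ _))//; apply: ler_sum => k _.
by rewrite normrM mulrC ler_pM// ?coord_le_norm//; have [] := HM k.
Qed.

Section rellich.
Context {R : realType} {n : nat}.
Local Notation E := 'rV[R]_n.+1.
Local Notation leb := (lebesgue_rV n.+1).
Implicit Types (u v w phi psi rho f : E -> R) (x z : E) (r d t e C M : R).
Variables (Om : set E).
Hypotheses (oO : open Om) (bO : bounded_set Om).
Local Notation dot := (dotL2 leb Om).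
Local Notation nrm := (normL2 leb Om).
Local Notation L2O := (L2 leb Om).
Local Notation wd i u v := (is_wderiv Om [:: i] u v).
Local Notation mO := (measurable_open oO).
Local Notation Ofin := (open_lebesgue_fin oO bO).

Lemma normL2_shift_sub (D : set E) w z : measurable D -> (forall x, D x -> Om (x + z)) -> L2O w ->
  L2 leb D (fun x => w (x + z)) /\ normL2 leb D (fun x => w (x + z)) <= nrm w.
Proof.
move=> mD DO Lw; have Lw0 := L2_restrict mO Lw.
have [L1 L2'] := normL2_sub mD measurableT (@subsetT _ _) (L2_shiftf z Lw0).
have eqD x : D x -> shiftf (w \_ Om) z x = w (x + z) by move=> Dx; rewrite /shiftf patchE mem_set//; exact: DO.
split; first exact: (eq_L2 mD eqD L1).
by rewrite -(eq_normL2 leb eqD) (normL2_patch Om) -(normL2_shiftf z Lw0).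
Qed.

(** The segment is cut into m + 1 equal pieces. The increments telescope, and each is estimated by
    the first order expansion with error of order m^-2, translated within Om. The accumulated error
    is of order 1/m and disappears as m grows. *)
Lemma shift_smooth_le Phi (D : set E) z : smooth Phi -> bsupp Phi -> measurable D ->
  (forall x, D x -> forall t, 0 <= t <= 1 -> Om (x + t *: z)) ->
  normL2 leb D (fun x => Phi (x + z) - Phi x) <= \sum_i `|z ord0 i| * nrm (pderiv Phi i).
Proof.
move=> sP bP mD Dz.
have [C C0 HC] : exists2 C : R, 0 <= C & forall i j x, `|pderiv (pderiv Phi i) j x| <= C.
  have /choice[M HM] : forall ij : 'I_n.+1 * 'I_n.+1, exists M : R, forall x, `|pderiv (pderiv Phi ij.1) ij.2 x| <= M.
    move=> [i j]; have [M M0 HM] := bsupp_bounded (smooth_continuous (smooth_pderiv j (smooth_pderiv i sP))) (bsupp_pderiv j (bsupp_pderiv i bP)).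
    by exists M.
  exists (\sum_ij `|M ij|) => [|i j x]; first exact: sumr_ge0.
  exact: (le_trans (HM (i, j) x) (le_sum_norm M (i, j))).
have L1 : L2O (cst 1) by apply: (continuous_L2 oO bO); exact: cst_continuous.
have LdP i : L2O (pderiv Phi i) by apply: (smooth_L2 oO bO); exact: smooth_pderiv.
pose B : R := \sum_i `|z ord0 i| * nrm (pderiv Phi i).
pose W := n.+1%:R ^+ 2 * C * `|z| ^+ 2 * nrm (cst 1).
have W0 : 0 <= W by rewrite /W !mulr_ge0 ?normL2_ge0 ?sqr_ge0.
have H (m : nat) : normL2 leb D (fun x => Phi (x + z) - Phi x) - B <= W * m.+1%:R^-1.
  pose h := m.+1%:R^-1 *: z; pose G x := Phi (x + h) - Phi x.
  have LG : L2O G.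
    apply: (L2B mO); last exact: (smooth_L2 oO bO).
    apply: (smooth_L2 oO bO); have := smooth_shift (- h) sP.
    by under eq_fun do rewrite opprK.
  have LS : L2O (fun x => \sum_i h ord0 i * pderiv Phi i x) by apply: (L2_sum mO) => i _; exact: (L2Z mO).
  have nG : nrm G <= m.+1%:R^-1 * B + W * m.+1%:R^-1 ^+ 2.
    pose err x := G x - \sum_i h ord0 i * pderiv Phi i x.
    have Lerr : L2O err by exact: (L2B mO LG LS).
    rewrite (_ : nrm G = nrm ((fun x => \sum_i h ord0 i * pderiv Phi i x) \+ err)); last first.
      by apply: eq_normL2 => x _; rewrite /err /= addrC subrK.
    apply: (le_trans (normL2D mO LS Lerr)); apply: lerD.
      apply: (normL2_sum_le mO) => [i|]; first exact: (L2Z mO).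
      rewrite mulr_sumr ler_sum// => i _; rewrite (normL2Z mO)// mxE normrM mulrA.
      by rewrite (@ger0_norm _ m.+1%:R^-1) ?invr_ge0.
    have -> : W * m.+1%:R^-1 ^+ 2 = nrm (fun=> n.+1%:R ^+ 2 * C * `|h| ^+ 2 * 1).
      rewrite (normL2Z mO)// ger0_norm ?mulr_ge0 ?sqr_ge0// /W /h normrZ ger0_norm ?invr_ge0// exprMn.
      by move: (nrm _) (m.+1%:R^-1 ^+ 2) (`|z| ^+ 2) (n.+1%:R ^+ 2) => p q s t; ring.
    apply: (normL2_mono mO Lerr); first exact: (L2Z mO).
    by move=> x _; rewrite mulr1 [leRHS]ger0_norm ?mulr_ge0 ?sqr_ge0//; exact: smooth_taylor sP C0 HC x h.
  pose T (k : 'I_m.+1) x := G (x + (k%:R * m.+1%:R^-1) *: z).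
  have HT k : L2 leb D (T k) /\ normL2 leb D (T k) <= nrm G.
    apply: normL2_shift_sub => // x Dx; apply: Dz => //.
    by rewrite mulr_ge0 ?invr_ge0//= ler_pdivrMr// mul1r ler_nat ltnW.
  rewrite lerBlDr (@eq_normL2 _ _ _ _ _ _ (fun x => \sum_k T k x)); last first.
    move=> x Dx; rewrite /T /G.
    rewrite (eq_bigr (fun k : 'I_m.+1 => Phi (x + (k.+1%:R * m.+1%:R^-1) *: z) - Phi (x + (k%:R * m.+1%:R^-1) *: z))); last first.
      by move=> k _; rewrite /h -addrA -scalerDl -(natr1 k) mulrDl mul1r.
    rewrite -(big_mkord xpredT (fun k => Phi (x + (k.+1%:R * m.+1%:R^-1) *: z) - Phi (x + (k%:R * m.+1%:R^-1) *: z))).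
    rewrite (telescope_sumr (fun k => Phi (x + (k%:R * m.+1%:R^-1) *: z)))//.
    by rewrite divff ?pnatr_eq0// mul0r scale1r scale0r addr0.
  apply: (normL2_sum_le mD) => [k|]; first by have [] := HT k.
  apply: (@le_trans _ _ (\sum_(k < m.+1) nrm G)); first by apply: ler_sum => k _; have [] := HT k.
  rewrite sumr_const card_ord -[nrm G *+ _]mulr_natl.
  apply: (@le_trans _ _ (m.+1%:R * (m.+1%:R^-1 * B + W * m.+1%:R^-1 ^+ 2))); first by rewrite ler_wpM2l.
  have m0 : m.+1%:R != 0 :> R by rewrite pnatr_eq0.
  rewrite le_eqVlt; apply/orP; left; apply/eqP; move: (m.+1%:R) m0 => q q0; by field.
rewrite -subr_le0; apply: (le0_eps W0) => e e0.
apply: (le_trans (H (Num.truncn e^-1))); rewrite ler_wpM2l//.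
by rewrite -[leRHS]invrK lef_pV2 ?posrE ?invr_gt0// ltW// truncnS_gt.
Qed.

Variables (N : nat) (a : 'I_N -> E) (r : 'I_N -> R) (zeta : 'I_N -> E -> R).
Hypothesis Hpou : pou (closure Om) (cone Om) a r zeta.

Lemma shift_H1_le u (p : 'I_n.+1 -> E -> R) (D : set E) z : L2O u -> (forall i, wd i u (p i)) ->
  measurable D -> (forall x, D x -> forall t, 0 <= t <= 1 -> Om (x + t *: z)) ->
  L2 leb D (fun x => u (x + z) - u x) /\
  normL2 leb D (fun x => u (x + z) - u x) <= `|z| * \sum_i nrm (p i).
Proof.
move=> Lu Hp mD Dz; have Lp i : L2O (p i) by have [] := Hp i.
have D1 x : D x -> Om (x + z) by move=> Dx; rewrite -(scale1r z); apply: Dz; rewrite ?ler01 ?lexx.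
have D0 x : D x -> Om (x + 0) by move=> Dx; rewrite -(scale0r z); apply: Dz; rewrite ?ler01 ?lexx.
have L0 w : L2O w -> L2 leb D w /\ normL2 leb D w <= nrm w.
  by move=> Lw; have := normL2_shift_sub mD D0 Lw; under eq_fun do rewrite addr0.
have Ld w : L2O w -> L2 leb D (fun x => w (x + z) - w x).
  by move=> Lw; apply: (L2B mD); [have [] := normL2_shift_sub mD D1 Lw|have [] := L0 w Lw].
split; first exact: Ld.
rewrite -subr_le0; apply: (@le0_eps _ _ (2 + `|z| * n.+1%:R)); first by rewrite addr_ge0// mulr_ge0.
move=> e e0; have [Phi [sP bP He Hde]] := smooth_approx oO bO Hpou Lu Hp e0.
have LP := smooth_L2 oO bO sP; have Lw := L2B mO Lu LP.
rewrite lerBlDr (@eq_normL2 _ _ _ _ _ _ ((fun x => (u \- Phi) (x + z) - (u \- Phi) x) \+ (fun x => Phi (x + z) - Phi x))); last first.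
  by move=> x _ /=; ring.
apply: (le_trans (normL2D mD (Ld _ Lw) (Ld _ LP))).
apply: (@le_trans _ _ (e + e + `|z| * \sum_i (nrm (p i) + e))); last first.
  have -> : \sum_i (nrm (p i) + e) = \sum_i nrm (p i) + n.+1%:R * e.
    by rewrite big_split sumr_const card_ord mulr_natl.
  by move: (\sum_i nrm (p i)) `|z| (n.+1%:R) => s t q; rewrite le_eqVlt; apply/orP; left; apply/eqP; ring.
apply: lerD.
  have [La Ha] := normL2_shift_sub mD D1 Lw; have [Lb Hb] := L0 _ Lw.
  by apply: (le_trans (normL2B mD La Lb)); apply: lerD; [exact: (le_trans Ha)|exact: (le_trans Hb)].
apply: (le_trans (shift_smooth_le sP bP mD Dz)); rewrite mulr_sumr; apply: ler_sum => i _.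
apply: ler_pM => //; [exact: normL2_ge0|exact: coord_le_norm|].
have LdP := smooth_L2 oO bO (smooth_pderiv i sP).
rewrite (@eq_normL2 _ _ _ _ _ _ (p i \- (p i \- pderiv Phi i))); last by move=> x _ /=; ring.
by apply: (le_trans (normL2B mO (Lp i) (L2B mO (Lp i) LdP))); rewrite lerD2l.
Qed.

Let D j := Om `&` [set x : E | `|x - a j| < r j].

Lemma measurable_patch_dom j : measurable (D j).
Proof.
apply: measurableI; first exact: mO.
rewrite (_ : [set x : E | _] = ball (a j) (r j)); first by apply: open_measurable_rV; apply: ball_open; have [] := pou_loc Hpou j.
by rewrite -ball_normE; apply/seteqP; split=> x /=; rewrite distrC.
Qed.
Let mD := measurable_patch_dom.

(** Translation differences of an H^1 function are linear in |z|. Unlike a density argument, this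
    yields a rate of approximation that is uniform on bounded sets of H^1, which compactness
    requires. *)
Lemma mollify_rate u (p : 'I_n.+1 -> E -> R) j d rho : L2O u -> (forall i, wd i u (p i)) ->
  0 < d -> good_kernel Om (a j) (r j) d rho ->
  normL2 leb (D j) (mollify Om u rho \- u) <= d * \sum_i nrm (p i).
Proof.
move=> Lu Hp d0 Hrho; have [a' [r' [kr ard Hx]]] := Hrho; have [_ _ rs _] := kr.
have sr := good_kernel_smooth Hrho; have br := good_kernel_bsupp Hrho.
have Lw0 := L2_restrict mO Lu; have LT := mollify_L2T oO bO Lu sr br.
have E1 : mollify Om u rho = mollify setT (u \_ Om) rho by apply/funext => x; rewrite conv_restrict.
have patchD x : D j x -> (u \_ Om) x = u x by move=> [Ox _]; rewrite patchE mem_set.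
have eqD w : normL2 leb (D j) (w \- u) = normL2 leb (D j) (w \- (u \_ Om)).
  by apply: eq_normL2 => x Dx /=; rewrite patchD.
have c0 : 0 <= d * \sum_i nrm (p i) by rewrite mulr_ge0 ?(ltW d0)// sumr_ge0// => i _; exact: normL2_ge0.
rewrite eqD E1 in LT *; apply: (normL2_conv_le (mD j) c0 Lw0 kr); last first.
  by apply: (L2B (mD j)); [have [] := normL2_sub (mD j) measurableT (@subsetT _ _) LT|
     have [] := normL2_sub (mD j) measurableT (@subsetT _ _) Lw0].
move=> z rz; have Dz x : D j x -> forall t, 0 <= t <= 1 -> Om (x + t *: z).
  by move=> [Ox xa]; have [_ H] := Hx x Ox xa; exact: (H z rz).
have [LD Hle] := shift_H1_le Lu Hp (mD j) Dz.
have zd : `|z| <= d.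
  apply: ltW; apply: lt_trans ard; rewrite -{1}(subrK a' z) (le_lt_trans (ler_normD _ _))// addrC ltrD2l; exact: rs.
rewrite (@eq_integral _ _ _ _ _ (fun x => ((u (x + z) - u x) * (u (x + z) - u x))%:E)); last first.
  move=> x /set_mem Dx; rewrite (patchD x Dx) patchE mem_set ?expr2//.
  by rewrite -(scale1r z); apply: (Dz x Dx); rewrite ler01 lexx.
rewrite -dotL2_EFin// -sqr_normL2 lee_fin ler_sqr ?nnegrE ?normL2_ge0//.
apply: (le_trans Hle); rewrite ler_wpM2r// sumr_ge0// => i _; exact: normL2_ge0.
Qed.

Lemma zeta_normL2_le : exists2 C : R, 0 <= C &
  forall j w, L2O w -> nrm (fun x => zeta j x * w x) <= C * normL2 leb (D j) w.
Proof.
have cz j := smooth_continuous (pou_smooth Hpou j).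
have /choice[M HM] : forall j, exists M : R, 0 <= M /\ forall x, Om x -> `|zeta j x| <= M.
  by move=> j; have [M M0 HM] := continuous_bounded_on bO (cz j); exists M.
exists (\sum_j `|M j|) => [|j w Lw]; first exact: sumr_ge0.
have DO : D j `<=` Om by move=> x [].
have [Lw' _] := normL2_sub (mD j) mO DO Lw.
rewrite normL2_patch (_ : _ \_ Om = (fun x => zeta j x * w x) \_ (D j)); last first.
  apply/funext => x; rewrite !patchE; have [xD|xD] := pselect (D j x).
    by rewrite !mem_set//; exact: DO.
  rewrite [in RHS]memNset//; case: ifPn => // /set_mem Ox.
  have [->|/(pou_supp Hpou) xa] := eqVneq (zeta j x) 0; first by rewrite mul0r.
  by exfalso; apply: xD.
rewrite -normL2_patch; apply: le_trans (_ : M j * normL2 leb (D j) w <= _).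
  apply: (normL2_bdd_mul (mD j) (HM j).1) => //; last by move=> x [Ox _]; exact: (HM j).2.
  exact: continuous_measurable_rV.
by rewrite ler_wpM2r ?normL2_ge0//; exact: le_sum_norm.
Qed.

(** An ultrafilter gives all bounded sequences a limit simultaneously, in place of repeated
    extraction of subsequences. *)
Lemma ultra_bounded (G : set_system nat) {UG : UltraFilter G} (c : nat -> R) B e :
  (forall k, `|c k| <= B) -> 0 < e -> exists l : R, G [set k | `|c k - l| < e].
Proof.
move=> cB e0; have := @segment_compact R (- B) B; rewrite compact_ultra => /(_ (c @ G) _).
have UcG : UltraFilter (c @ G).
  split; first exact: fmap_proper_filter.
  move=> H pH sub; rewrite predeqE => A; split=> [HA|]; last exact: sub.
  rewrite /fmap /=; have [//|GnA] := in_ultra_setVsetC (c @^-1` A) UG.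
  have HnA : H (~` A) by apply: sub.
  have := filterI HA HnA; rewrite setICr => H0; exfalso; have := @filter_not_empty _ H pH; apply; exact: H0.
have GB : (c @ G) `[- B, B]%classic.
  have FG : Filter G := @filter_filter _ _ (@ultra_proper _ _ UG).
  apply: (@filterS _ G FG setT) => [k _ /=|]; last exact: (@filterT _ G FG).
  by rewrite in_itv/= -ler_norml.
move=> /(_ UcG GB)[l [_ /= Gl]]; exists l.
have FG : Filter G := @filter_filter _ _ (@ultra_proper _ _ UG).
have : G (c @^-1` ball l e) by exact: (Gl _ (nbhsx_ballx l e e0)).
by apply: (@filterS _ G FG) => k /=; rewrite -ball_normE /= distrC.
Qed.

(** Mollifications of a bounded set are equi-Lipschitz, so finitely many of their values at the
    points of a net control them uniformly; [mollify_rate] transfers the smallness back to the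
    functions. *)
Lemma rellich_ultra (G : set_system nat) {UG : UltraFilter G}
  (u_ : nat -> E -> R) (p_ : nat -> 'I_n.+1 -> E -> R) M e :
  (forall k, L2O (u_ k)) -> (forall k i, wd i (u_ k) (p_ k i)) ->
  (forall k, nrm (u_ k) <= M) -> (forall k i, nrm (p_ k i) <= M) -> 0 < e ->
  exists2 A, G A & forall k l, A k -> A l -> nrm (u_ k \- u_ l) <= e.
Proof.
move=> Lu Hp uM pM e0; have M0 : 0 <= M by exact: le_trans (normL2_ge0 _ _ _) (uM 0%N).
have [C C0 HC] := zeta_normL2_le.
have L1 : L2O (cst 1) by apply: (continuous_L2 oO bO); exact: cst_continuous.
pose V := nrm (cst 1); have V0 : 0 <= V by exact: normL2_ge0.
pose B := M *+ n.+1; have B0 : 0 <= B by exact: mulrn_wge0.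
(* On each of the N patches the error is C (t B + t V + t B): two mollification errors and one
   uniform error t over a set of norm V. Dividing e by Q makes the total at most e. *)
pose Q := (C * (2 * B + V)) *+ N + 1.
have CQ : 0 <= C * (2 * B + V) by rewrite mulr_ge0// addr_ge0// mulr_ge0.
have Q0 : 0 < Q by rewrite ltr_wpDl// mulrn_wge0.
pose t := e / Q; have t0 : 0 < t by rewrite divr_gt0.
have [rho Hrho] := pou_kernels Hpou t0.
have sr j := good_kernel_smooth (Hrho j); have br j := good_kernel_bsupp (Hrho j).
have Lr j x : L2O (fun y : E => rho j (y - x)) by apply: (smooth_L2 oO bO); exact: smooth_shift.
have /choice[L HL] : forall j, exists L : R, 0 <= L /\ forall x y, `|rho j x - rho j y| <= L * `|x - y|.
  by move=> j; have [L L0 HL] := smooth_lipschitz (sr j) (br j); exists L.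
pose Lm := \sum_j `|L j|; have Lm0 : 0 <= Lm by exact: sumr_ge0.
have lipA j w x y : L2O w -> nrm w <= M -> `|mollify Om w (rho j) x - mollify Om w (rho j) y| <= M * Lm * V * `|x - y|.
  move=> Lw wM; rewrite /mollify -(dotL2Br mO (Lr j x) (Lr j y) Lw).
  apply: (le_trans (cauchy_schwarzL2 mO Lw (L2B mO (Lr j x) (Lr j y)))).
  rewrite -!mulrA; apply: ler_pM => //; try exact: normL2_ge0.
  apply: (@le_trans _ _ (nrm (fun=> (Lm * `|x - y|) * 1))).
    apply: (normL2_mono mO (L2B mO (Lr j x) (Lr j y)) (L2Z mO _ L1)) => z _ /=.
    rewrite mulr1 [leRHS]ger0_norm ?mulr_ge0//; apply: le_trans ((HL j).2 _ _) _.
    rewrite (_ : z - x - (z - y) = y - x); last by rewrite opprB addrC addrA subrK.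
    by rewrite distrC ler_wpM2r//; exact: le_sum_norm.
  by rewrite (normL2Z mO _ L1) ger0_norm ?mulr_ge0// -/V mulrAC mulrA.
pose del := t / 3 / (M * Lm * V + 1).
have MLV : 0 <= M * Lm * V by rewrite !mulr_ge0.
have del0 : 0 < del by rewrite /del !divr_gt0// ltr_wpDl.
have [N' [q [rq [Hq cov]]]] := @compact_ball_cover R n.+1 (closure Om) (fun _ s => s = del)
  (closure_compact bO) (fun x _ => ex_intro2 _ _ del del0 erefl).
have bd j x k : `|mollify Om (u_ k) (rho j) x| <= M * nrm (fun y : E => rho j (y - x)).
  by apply: (le_trans (cauchy_schwarzL2 mO (Lu k) (Lr j x))); rewrite ler_wpM2r ?normL2_ge0.
(* Two values within t/6 of the same limit differ by at most t/3; moving from x to a net point costs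
   t/3 for each function, which gives t altogether. *)
have /choice[l Hl] : forall ji : 'I_N * 'I_N', exists l : R,
    G [set k | `|mollify Om (u_ k) (rho ji.1) (q ji.2) - l| < t / 6].
  by move=> [j i]; apply: ultra_bounded (bd j (q i)) _; rewrite divr_gt0.
have FG : Filter G := @filter_filter _ _ (@ultra_proper _ _ UG).
have GA : G [set k | forall ji : 'I_N * 'I_N', `|mollify Om (u_ k) (rho ji.1) (q ji.2) - l ji| < t / 6].
  exact: (@filter_forall _ _ (fun ji => [set k | `|mollify Om (u_ k) (rho ji.1) (q ji.2) - l ji| < t / 6]) G FG Hl).
exists [set k | forall ji : 'I_N * 'I_N', `|mollify Om (u_ k) (rho ji.1) (q ji.2) - l ji| < t / 6]; first exact: GA.
move=> k m Ak Am.
have sup j x : Om x -> `|mollify Om (u_ k) (rho j) x - mollify Om (u_ m) (rho j) x| <= t.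
  move=> /subset_closure/cov[i]; have [_ _ ->] := Hq i => xq.
  have near w : L2O w -> nrm w <= M -> `|mollify Om w (rho j) x - mollify Om w (rho j) (q i)| <= t / 3.
    move=> Lw wM; apply: (le_trans (lipA j w x (q i) Lw wM)).
    apply: (@le_trans _ _ (M * Lm * V * del)); first by rewrite ler_wpM2l// ltW.
    rewrite /del mulrCA ger_pMr ?divr_gt0// ler_pdivrMr ?ltr_wpDl// mul1r lerDl//.
  have := near _ (Lu k) (uM k); have := near _ (Lu m) (uM m).
  have := Ak (j, i); have := Am (j, i) => /=.
  move: (mollify Om (u_ k) (rho j) x) (mollify Om (u_ m) (rho j) x) => a1 a2.
  move: (mollify Om (u_ k) (rho j) (q i)) (mollify Om (u_ m) (rho j) (q i)) (l (j, i)) => b1 b2 b.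
  rewrite !ltr_norml !ler_norml => /andP[h1 h2] /andP[h3 h4] /andP[h5 h6] /andP[h7 h8].
  by apply/andP; split; lra.
have Lw := L2B mO (Lu k) (Lu m).
have cz j := smooth_continuous (pou_smooth Hpou j).
rewrite (@eq_normL2 _ _ _ _ _ _ (fun x => \sum_j zeta j x * (u_ k \- u_ m) x)); last first.
  by move=> x Ox; exact: (pou_decompO Hpou (u_ k \- u_ m) Ox).
apply: (normL2_sum_le mO) => [j|]; first exact: (L2_contM oO bO (cz j) Lw).
apply: (@le_trans _ _ (\sum_(j < N) C * (t * (2 * B + V)))); last first.
  rewrite sumr_const card_ord mulrCA -mulrnAr /t mulrAC -mulrA ger_pMr// ler_pdivrMr// mul1r.
  by rewrite /Q lerDl.
apply: ler_sum => j _; apply: (le_trans (HC j _ Lw)); rewrite ler_wpM2l//.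
have DO : D j `<=` Om by move=> x [].
have LD w : L2O w -> L2 leb (D j) w by move=> Lw'; have [] := normL2_sub (mD j) mO DO Lw'.
have LA i : L2 leb (D j) (mollify Om (u_ i) (rho j)).
  by apply: LD; apply: (smooth_L2 oO bO); exact: mollify_smooth.
have HB i : normL2 leb (D j) (mollify Om (u_ i) (rho j) \- u_ i) <= t * B.
  apply: (le_trans (mollify_rate (Lu i) (Hp i) t0 (Hrho j))); rewrite ler_wpM2l ?(ltW t0)//.
  apply: (@le_trans _ _ (\sum_(i0 < n.+1) M)); first by apply: ler_sum => i0 _; exact: pM.
  by rewrite sumr_const card_ord.
have HA : normL2 leb (D j) (mollify Om (u_ k) (rho j) \- mollify Om (u_ m) (rho j)) <= t * V.
  have := normL2_sub (mD j) mO DO L1; move=> [L1D HV].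
  apply: (@le_trans _ _ (normL2 leb (D j) (fun=> t * 1))).
    apply: (normL2_mono (mD j) (L2B (mD j) (LA k) (LA m)) (L2Z (mD j) t L1D)) => x [Ox _].
    by rewrite mulr1 (ger0_norm (ltW t0)); exact: sup.
  by rewrite (normL2Z (mD j) _ L1D) (ger0_norm (ltW t0)) ler_wpM2l ?(ltW t0).
have T1 := normL2_triangle (mD j) (LD _ (Lu k)) (LA k) (LD _ (Lu m)).
have T2 := normL2_triangle (mD j) (LA k) (LA m) (LD _ (Lu m)).
apply: (le_trans T1); rewrite normL2_distC.
apply: (@le_trans _ _ (t * B + (t * V + t * B))); last by rewrite le_eqVlt; apply/orP; left; apply/eqP; ring.
by apply: lerD => //; apply: (le_trans T2); apply: lerD.
Qed.

(** The ultrafilter refines the tails, so [sg m] can be taken beyond m and in the first m + 1 sets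
    of [rellich_ultra], for tolerances 1, 1/2, and so on. [sg] need not be increasing: [k <= sg k]
    is enough to pass to limits. *)
Lemma rellich (u_ : nat -> E -> R) (p_ : nat -> 'I_n.+1 -> E -> R) M :
  (forall k, L2O (u_ k)) -> (forall k i, wd i (u_ k) (p_ k i)) ->
  (forall k, nrm (u_ k) <= M) -> (forall k i, nrm (p_ k i) <= M) ->
  exists sg : nat -> nat, (forall k, (k <= sg k)%N) /\ forall e, 0 < e ->
    exists N0, forall k l, (N0 <= k)%N -> (N0 <= l)%N -> nrm (u_ (sg k) \- u_ (sg l)) <= e.
Proof.
move=> Lu Hp uM pM; have [G [UG sub]] := ultraFilterLemma eventually_filter.
have e_gt0 (m : nat) : 0 < m.+1%:R^-1 :> R by rewrite invr_gt0.
have /choice[A HA] : forall m : nat, exists A, G A /\ forall k l, A k -> A l -> nrm (u_ k \- u_ l) <= m.+1%:R^-1.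
  by move=> m; have [A GA HA] := rellich_ultra Lu Hp uM pM (e_gt0 m); exists A.
have /choice[sg Hsg] : forall m : nat, exists k, (m <= k)%N /\ forall i : 'I_m.+1, A i k.
  move=> m; have G1 : G [set k | forall i : 'I_m.+1, A i k] by apply: filter_forall => i; have [] := HA i.
  have G2 : G [set k | (m <= k)%N] by apply: sub; exists m.
  by have [k [k1 k2]] := filter_ex (filterI G1 G2); exists k.
exists sg; split=> [k|e e0]; first by have [] := Hsg k.
exists (Num.truncn e^-1) => k l hk hl.
have [_ Hk] := Hsg k; have [_ Hl] := Hsg l.
have := Hk (inord (Num.truncn e^-1)); have := Hl (inord (Num.truncn e^-1)).
rewrite !inordK ?ltnS// => Al Ak; apply: le_trans ((HA _).2 _ _ Ak Al) _.
by rewrite -[leRHS]invrK lef_pV2 ?posrE ?invr_gt0// ltW// truncnS_gt.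
Qed.

End rellich.

(** * Charts, normals and surface integrals *)

Section chart_geometry.
Context {R : realType} {n : nat}.
Local Notation E := 'rV[R]_n.+1.
Implicit Types (f : E -> R) (v w x z : E) (i : 'I_n.+1) (h : 'rV[R]_n -> R) (y : 'rV[R]_n) (t e d : R).

(** The norm of row vectors is the maximum norm, so Euclidean lengths, needed for unit normals and
    for the collar, are expressed with [dotv]. *)
Definition dotv v w : R := \sum_j v ord0 j * w ord0 j.
Definition grad f x : E := \row_j pderiv f j x.

Lemma dotvC v w : dotv v w = dotv w v.
Proof. by apply: eq_bigr => j _; rewrite mulrC. Qed.

Lemma dotvDl u v w : dotv (u + v) w = dotv u w + dotv v w.
Proof. by rewrite -big_split; apply: eq_bigr => j _; rewrite mxE mulrDl. Qed.

Lemma dotvZl t v w : dotv (t *: v) w = t * dotv v w.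
Proof. by rewrite mulr_sumr; apply: eq_bigr => j _; rewrite mxE mulrA. Qed.

Lemma dotvDr u v w : dotv w (u + v) = dotv w u + dotv w v.
Proof. by rewrite !(dotvC w) dotvDl. Qed.

Lemma dotvZr t v w : dotv v (t *: w) = t * dotv v w.
Proof. by rewrite !(dotvC v) dotvZl. Qed.

Lemma dotv_ge0 v : 0 <= dotv v v.
Proof. by apply: sumr_ge0 => j _; rewrite -expr2 sqr_ge0. Qed.

Lemma dotv_eq0 v : dotv v v = 0 -> v = 0.
Proof.
move=> /eqP; rewrite psumr_eq0 => [/allP H|j _]; last by rewrite -expr2 sqr_ge0.
by apply/rowP => j; have := H j (mem_index_enum j); rewrite mulf_eq0 orbb mxE => /eqP.
Qed.

Lemma dotv_norm_le v : `|v| ^+ 2 <= dotv v v.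
Proof.
have [s0 sE] : 0 <= Num.sqrt (dotv v v) /\ Num.sqrt (dotv v v) ^+ 2 = dotv v v by rewrite sqrtr_ge0 sqr_sqrtr ?dotv_ge0.
rewrite -sE ler_sqr ?nnegrE//; apply/(rV_norm_le v s0) => k.
rewrite -ler_sqr ?nnegrE// sE real_normK ?num_real// /dotv (bigD1 k)//= expr2 lerDl.
by apply: sumr_ge0 => j _; rewrite -expr2 sqr_ge0.
Qed.

(* Test with v = a / A - c / C. *)
Lemma half_space_dir (a c : E) (A C : R) : 0 < A -> 0 < C -> dotv a a = A ^+ 2 -> dotv c c = C ^+ 2 ->
  (forall v, 0 < dotv a v -> 0 <= dotv c v) -> A^-1 *: a = C^-1 *: c.
Proof.
move=> A0 C0 aA cC H; apply/eqP; rewrite -subr_eq0; apply/eqP; apply: dotv_eq0.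
set v := A^-1 *: a - C^-1 *: c; apply/eqP; rewrite eq_le dotv_ge0 andbT leNgt; apply/negP => v0.
pose k := dotv a c / (A * C).
have Av0 : A != 0 by rewrite gt_eqF.
have Cv0 : C != 0 by rewrite gt_eqF.
have acE : dotv a c = k * A * C by rewrite /k; field; rewrite ?Av0 ?Cv0.
have avE : dotv a v = A * (1 - k).
  rewrite /v dotvDr -scaleNr !dotvZr aA acE; field; by rewrite ?Av0 ?Cv0.
have cvE : dotv c v = C * (k - 1).
  rewrite /v dotvDr -scaleNr !dotvZr cC (dotvC c) acE; field; by rewrite ?Av0 ?Cv0.
have vE : dotv v v = 2 * (1 - k).
  rewrite {1}/v dotvDl -scaleNr !dotvZl avE cvE; field; by rewrite ?Av0 ?Cv0.
have k1 : 0 < 1 - k by move: v0; rewrite vE pmulr_rgt0.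
have := H v; rewrite avE mulr_gt0// cvE => /(_ isT); rewrite pmulr_rge0// => ?.
by move: k1; rewrite ltNge => /negP; apply; lra.
Qed.

Lemma dotv_grad f x v : dotv (grad f x) v = \sum_j v ord0 j * pderiv f j x.
Proof. by apply: eq_bigr => j _; rewrite mxE mulrC. Qed.

Lemma grad_dir_gt0 f x v : differentiable f x -> f x = 0 -> 0 < dotv (grad f x) v ->
  exists2 d : R, 0 < d & forall t, 0 < t < d -> 0 < f (x + t *: v).
Proof.
rewrite dotv_grad => df f0 D0; set D := \sum_j _ in D0.
have nv : 0 < 2 * (`|v| + 1) by rewrite mulr_gt0// ltr_wpDl.
have [d d0 Hd] := differentiable_expansion df (divr_gt0 D0 nv).
exists (d / (`|v| + 1)); first by rewrite divr_gt0// ltr_wpDl.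
move=> t /andP[t0]; rewrite ltr_pdivlMr ?ltr_wpDl// => td.
have tv : `|t *: v| = t * `|v| by rewrite normrZ gtr0_norm.
have h : `|t *: v| < d by rewrite tv (le_lt_trans _ td)// ler_pM2l// lerDl.
have := Hd _ h; rewrite f0 subr0 tv (_ : \sum_k _ = t * D); last first.
  by rewrite mulr_sumr; apply: eq_bigr => j _; rewrite mxE mulrA.
have : D / (2 * (`|v| + 1)) * (t * `|v|) <= t * D / 2.
  have q0 := normr_ge0 v; move: (`|v|) q0 => q q0; have q1 : 0 < q + 1 by rewrite ltr_wpDl.
  rewrite -subr_ge0 (_ : _ - _ = t * D / (2 * (q + 1))); last by field; rewrite gt_eqF.
  by rewrite divr_ge0// ?mulr_ge0// ltW.
have : 0 < t * D by rewrite mulr_gt0.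
move: (D / _ * _) (f _) (t * D) => p q s s0 ps; rewrite ler_norml => /andP[h1 _]; lra.
Qed.

Lemma grad_dir_ge0 f x v d : differentiable f x -> f x = 0 -> 0 < d ->
  (forall t, 0 < t < d -> 0 <= f (x + t *: v)) -> 0 <= dotv (grad f x) v.
Proof.
move=> df f0 d0 H; rewrite leNgt; apply/negP => D0.
have dN : differentiable (\- f) x by exact: differentiableN.
have gN : dotv (grad (\- f) x) v = - dotv (grad f x) v.
  rewrite -mulN1r -dotvZl; congr dotv; apply/rowP => j.
  by rewrite !mxE mulN1r /pderiv deriveN//; exact: diff_derivable.
have [||d' d'0 Hd'] := @grad_dir_gt0 (\- f) x v dN; first by rewrite /= f0 oppr0.
  by rewrite gN oppr_gt0.
have m0 : 0 < Num.min d d' / 2 by rewrite divr_gt0// lt_min d0.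
have mm : Num.min d d' / 2 < Num.min d d' by rewrite ltr_pdivrMr// ltr_pMr ?lt_min ?d0// ltr1n.
have := H (Num.min d d' / 2); have := Hd' (Num.min d d' / 2).
rewrite m0 /= (lt_le_trans mm) ?ge_min ?lexx ?orbT// => /(_ isT).
rewrite (lt_le_trans mm) ?ge_min ?lexx// oppr_gt0 => h1 /(_ isT); by rewrite leNgt h1.
Qed.

Lemma col'_insert i t y : col' i (insert_coord i t y) = y.
Proof. by apply/rowP => k; rewrite !mxE liftK. Qed.

Lemma insert_col' i x : insert_coord i (x ord0 i) (col' i x) = x.
Proof. by apply/rowP => j; rewrite mxE; case: (unliftP i j) => [k ->|->] //=; rewrite mxE. Qed.

Lemma insert_coordE i t y : insert_coord i t y ord0 i = t.
Proof. by rewrite mxE unlift_none. Qed.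

Lemma insert_coord_lift i t y k : insert_coord i t y ord0 (lift i k) = y ord0 k.
Proof. by rewrite mxE liftK. Qed.

Lemma col'D i x z : col' i (x + z) = col' i x + col' i z.
Proof. by apply/rowP => k; rewrite !mxE. Qed.

Lemma col'_norm_le i z : `|col' i z| <= `|z|.
Proof. by apply/(rV_norm_le _ (normr_ge0 z)) => k; rewrite mxE coord_le_norm. Qed.

Lemma norm_insert_coord i t y c : 0 <= c -> (`|insert_coord i t y| <= c) <-> `|t| <= c /\ `|y| <= c.
Proof.
move=> c0; split=> [H|[Ht Hy]].
  split; first by rewrite -(insert_coordE i t y); exact: le_trans (coord_le_norm _ _) H.
  by apply/(rV_norm_le _ c0) => k; rewrite -(insert_coord_lift i t); exact: le_trans (coord_le_norm _ _) H.
apply/(rV_norm_le _ c0) => j; rewrite mxE; case: (unliftP i j) => [k _|_] //=.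
exact: le_trans (coord_le_norm _ _) Hy.
Qed.

Lemma diff_comp_col' i h x : differentiable h (col' i x) ->
  differentiable (fun z : E => h (col' i z)) x /\
  forall j, pderiv (fun z : E => h (col' i z)) j x = oapp (fun k => pderiv h k (col' i x)) 0 (unlift i j).
Proof.
move=> dh; apply: differentiable_of_expansion => e e0.
have [d d0 Hd] := differentiable_expansion dh e0.
exists d => // v vd; rewrite col'D (bigD1_ord i)//= unlift_none mulr0 add0r.
under eq_bigr do rewrite liftK /=.
have := Hd (col' i v) (le_lt_trans (col'_norm_le i v) vd).
rewrite (eq_bigr (fun k => v ord0 (lift i k) * pderiv h k (col' i x))) => [|k _]; last by rewrite mxE.
by move=> /le_trans; apply; rewrite ler_wpM2l ?(ltW e0)// col'_norm_le.
Qed.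

Lemma smooth_comp_col' i h : smooth h -> smooth (fun z : E => h (col' i z)).
Proof.
move=> sh; apply: (@smooth_coind _ _ [set f | exists2 g, smooth g & f = (fun z => g (col' i z))]); last by exists h.
move=> _ [g sg ->]; have H x := diff_comp_col' (smooth_differentiable (col' i x) sg).
split=> [x|j]; first by have [] := H x.
case: (unliftP i j) => [k jk|ji].
  exists (pderiv g k); first exact: smooth_pderiv.
  by apply/funext => x; have [_ ->] := H x; rewrite jk liftK.
exists (cst 0); first exact: smooth_cst.
by apply/funext => x; have [_ ->] := H x; rewrite ji unlift_none.
Qed.

(** Local defining function: in a chart it is positive inside the domain and zero on the boundary,
    and its gradient has Euclidean length [area_density]. *)
Definition level i (b : bool) h (x : E) : R := (-1) ^+ b * (x ord0 i - h (col' i x)).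

Lemma level_smooth i b h : smooth h -> smooth (level i b h).
Proof.
move=> sh; apply: (@smoothZ _ _ _ (fun x : E => x ord0 i - h (col' i x))).
by apply: (@smoothB _ _ (fun x : E => x ord0 i)); [exact: smooth_coord|exact: smooth_comp_col'].
Qed.

Lemma level_insert i b h t y : level i b h (insert_coord i t y) = (-1) ^+ b * (t - h y).
Proof. by rewrite /level insert_coordE col'_insert. Qed.

Lemma sgn_sqr (b : bool) : (-1) ^+ b * (-1) ^+ b = 1 :> R.
Proof. by rewrite -expr2 sqrr_sign. Qed.

Lemma grad_level i b h x : smooth h ->
  grad (level i b h) x = (-1) ^+ b *: insert_coord i 1 (\row_k - pderiv h k (col' i x)).
Proof.
move=> sh; apply/rowP => j; rewrite mxE.
have [dc pc] := diff_comp_col' (smooth_differentiable (col' i x) sh).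
have dx : differentiable (fun z : E => z ord0 i) x by exact: smooth_differentiable (smooth_coord i).
have -> : pderiv (level i b h) j x = (-1) ^+ b * (pderiv (fun z : E => z ord0 i) j x - pderiv (fun z : E => h (col' i z)) j x).
  rewrite /level (_ : (fun z : E => _) = cst ((-1) ^+ b) \* ((fun z : E => z ord0 i) \+ (cst (-1) \* (fun z : E => h (col' i z))))); last first.
    by apply/funext => z /=; rewrite mulN1r.
  have dcN : differentiable (cst (-1) \* (fun z : E => h (col' i z))) x.
    by apply: differentiableM => //; exact: differentiable_cst.
  rewrite pderivM ?pderivD ?pderivM ?pderiv_cst//=; try exact: differentiable_cst; last exact: differentiableD.
  by rewrite !mulr0 !addr0 mulN1r.
rewrite pderiv_coord pc !mxE; congr (_ * _); case: (unliftP i j) => [k ->|->] /=.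
  by rewrite !mxE eq_sym (negPf (neq_lift _ _)) sub0r.
by rewrite eqxx subr0.
Qed.

Lemma dotv_insert i t t' y y' : dotv (insert_coord i t y) (insert_coord i t' y') = t * t' + \sum_k y ord0 k * y' ord0 k.
Proof.
rewrite /dotv (bigD1_ord i)//= !insert_coordE; congr (_ + _).
by apply: eq_bigr => k _; rewrite !insert_coord_lift.
Qed.

Lemma grad_level_norm i b h x : smooth h ->
  dotv (grad (level i b h) x) (grad (level i b h) x) = area_density h (col' i x) ^+ 2.
Proof.
move=> sh; rewrite grad_level// dotvZl dotvZr mulrA sgn_sqr mul1r dotv_insert mulr1.
rewrite /area_density sqr_sqrtr; last by rewrite addr_ge0// sumr_ge0// => k _; exact: sqr_ge0.
by congr (_ + _); apply: eq_bigr => k _; rewrite !mxE mulrNN expr2.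
Qed.

End chart_geometry.

Section area_density.
Context {R : realType} {n : nat} (h : 'rV[R]_n -> R).

Lemma area_density_smooth : smooth h -> smooth (area_density h).
Proof.
move=> sh; apply: (@smooth_sqrt _ _ (fun y => 1 + \sum_k pderiv h k y ^+ 2)) => [|y]; last first.
  by rewrite ltr_wpDr// sumr_ge0// => k _; exact: sqr_ge0.
apply: (@smoothD _ _ (cst 1)); first exact: smooth_cst.
by apply: smooth_sum => k _; apply: smoothM; exact: smooth_pderiv.
Qed.

Lemma area_density_ge1 y : 1 <= area_density h y.
Proof.
rewrite -[leLHS]sqrtr1 ler_sqrt ?lerDl; first by apply: sumr_ge0 => k _; exact: sqr_ge0.
by rewrite addr_ge0// sumr_ge0// => k _; exact: sqr_ge0.
Qed.

Lemma area_density_gt0 y : 0 < area_density h y.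
Proof. exact: lt_le_trans (area_density_ge1 y). Qed.

End area_density.

Section chart_boundary.
Context {R : realType} {n : nat} (Om : set 'rV[R]_n.+1).
Local Notation E := 'rV[R]_n.+1.
Hypothesis oO : open Om.

Lemma bdry_notin (x : E) : bdry Om x -> ~ Om x.
Proof. by move=> [_ H] Ox; apply: H; rewrite (interior_id _).1. Qed.

Lemma bdry_closure (x : E) : bdry Om x -> closure Om x. Proof. by case. Qed.

Lemma closure_bdry (x : E) : closure Om x -> ~ Om x -> bdry Om x.
Proof. by move=> cx nx; split => // /interior_subset. Qed.

Definition chart_normal (i : 'I_n.+1) (b : bool) h (x : E) : E :=
  (- (-1) ^+ b / area_density h (col' i x)) *: insert_coord i 1 (\row_k - pderiv h k (col' i x)).

Lemma chart_normal_grad i b h x : smooth h ->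
  chart_normal i b h x = - ((area_density h (col' i x))^-1 *: grad (level i b h) x).
Proof. by move=> sh; rewrite grad_level// /chart_normal scalerA -scaleNr mulNr mulrC. Qed.

Lemma chart_normal_norm i b h x : smooth h -> dotv (chart_normal i b h x) (chart_normal i b h x) = 1.
Proof.
move=> sh; rewrite chart_normal_grad// -scaleNr dotvZl dotvZr grad_level_norm//.
by have := area_density_gt0 h (col' i x); move: (area_density _ _) => q q0; field; rewrite gt_eqF.
Qed.

Variables (i : 'I_n.+1) (b : bool) (U : set E) (h : 'rV[R]_n -> R).
Hypothesis ch : bdry_chart Om i b U h.

Lemma chart_levelP x : U x -> (Om x <-> 0 < level i b h x).
Proof. by move=> Ux; have [_ _ /(_ _ Ux)] := ch. Qed.

Lemma bdry_level x : U x -> bdry Om x <-> level i b h x = 0.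
Proof.
move=> Ux; have [oU sh _] := ch; have cl := smooth_continuous (level_smooth i b sh).
split=> [bx|l0].
  apply/eqP; rewrite eq_le; apply/andP; split.
    by rewrite leNgt; apply/negP => /(chart_levelP Ux); exact: bdry_notin.
  rewrite leNgt; apply/negP => l0.
  have : nbhs x (U `&` [set z | level i b h z < 0]).
    apply: filterI; first exact: open_nbhs_nbhs.
    by apply: (@cvgr_lt _ _ (nbhs x) _ (level i b h) (level i b h x)) => //; exact: cl.
  move=> /(bdry_closure bx)[z [Oz [Uz lz]]].
  by have /(chart_levelP Uz)/(lt_trans lz) := Oz; rewrite ltxx.
apply: closure_bdry; last by move=> /(chart_levelP Ux); rewrite l0 ltxx.
move=> B Bx; have : nbhs x (B `&` U) by apply: filterI => //; exact: open_nbhs_nbhs.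
move=> /nbhs_ballP[e /= e0 He].
pose z := insert_coord i (x ord0 i + (-1) ^+ b * (e / 2)) (col' i x).
have e2 : 0 < e / 2 by rewrite divr_gt0.
have [Bz Uz] : (B `&` U) z.
  apply: He; rewrite -ball_normE /=; apply: le_lt_trans (_ : e / 2 < e).
    rewrite -{1}(insert_col' i x); apply/(rV_norm_le _ (ltW e2)) => j; rewrite !mxE.
    case: (unliftP i j) => [k _|_] /=; first by rewrite mxE subrr normr0 ltW.
    by rewrite opprD addNKr normrN normrMsign gtr0_norm.
  by rewrite ltr_pdivrMr// ltr_pMr// ltr1n.
exists z; split => //; apply/(chart_levelP Uz).
rewrite level_insert addrAC mulrDr mulrA sgn_sqr mul1r.
by move: l0; rewrite /level => ->; rewrite add0r.
Qed.

(** [outward_normal] picks the formula of some chart. The level functions of two charts are positive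
    on the same side near x, so their gradients define the same half space, and after normalization
    they coincide. *)
Lemma outward_normal_chart x : U x -> bdry Om x -> outward_normal Om x = chart_normal i b h x.
Proof.
move=> Ux bx; have [oU sh HU] := ch; rewrite /outward_normal.
have ex : [set nu | exists i b U h, [/\ bdry_chart Om i b U h, U x &
    nu = chart_normal i b h x]] (chart_normal i b h x) by exists i, b, U, h.
have [i' [b' [U' [h' [ch' Ux' ->]]]]] := xgetPex 0 (ex_intro _ _ ex).
have [oU' sh' HU'] := ch'; rewrite !chart_normal_grad//; congr (- _).
have l0 := (bdry_level Ux).1 bx.
have l0' : level i' b' h' x = 0.
  have cl := smooth_continuous (level_smooth i' b' sh').
  apply/eqP; rewrite eq_le; apply/andP; split.
    by rewrite leNgt; apply/negP => /(HU' _ Ux'); exact: bdry_notin.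
  rewrite leNgt; apply/negP => l1.
  have : nbhs x (U' `&` [set z | level i' b' h' z < 0]).
    apply: filterI; first exact: open_nbhs_nbhs.
    by apply: (@cvgr_lt _ _ (nbhs x) _ (level i' b' h') (level i' b' h' x)) => //; exact: cl.
  move=> /(bdry_closure bx)[z [Oz [Uz lz]]].
  by have /(HU' _ Uz)/(lt_trans lz) := Oz; rewrite ltxx.
apply: half_space_dir; rewrite ?area_density_gt0 ?grad_level_norm//.
move=> v; have sl := level_smooth i b sh; have sl' := level_smooth i' b' sh'.
move=> /(grad_dir_gt0 (smooth_differentiable x sl') l0')[d d0 Hd].
have : nbhs x (U `&` U') by apply: filterI; exact: open_nbhs_nbhs.
move=> /nbhs_ballP[e /= e0 He].
have v1 : 0 < `|v| + 1 by rewrite ltr_wpDl.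
apply: (@grad_dir_ge0 _ _ _ _ _ (Num.min d (e / (`|v| + 1))) (smooth_differentiable x sl) l0).
  by rewrite lt_min d0 divr_gt0.
move=> t /andP[t0]; rewrite lt_min => /andP[td]; rewrite ltr_pdivlMr// => te.
have [Uz Uz'] : (U `&` U') (x + t *: v).
  apply: He; rewrite -ball_normE /= opprD addNKr normrN normrZ gtr0_norm// (le_lt_trans _ te)//.
  by rewrite ler_pM2l// lerDl.
by apply: ltW; apply/(chart_levelP Uz)/(HU' _ Uz'); apply: Hd; rewrite t0.
Qed.

End chart_boundary.

(** * Surface integrals over graphs *)

Section surface_integral.
Context {R : realType}.

Lemma ge0_integral_mrestr d (T : measurableType d) (mu : {measure set T -> \bar R}) (G D : set T)
  (mG : measurable G) (f : T -> \bar R) : measurable D -> measurable_fun D f ->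
  (forall x, D x -> 0 <= f x)%E ->
  (\int[mrestr mu mG]_(x in D) f x = \int[mu]_(x in D `&` G) f x)%E.
Proof.
move=> mD mf f0; rewrite (@ge0_negligible_integral _ _ _ (mrestr mu mG) D (~` G))//; last 2 first.
- exact: measurableC.
- by rewrite /= /mrestr setIC setICr measure0.
rewrite setDE setCK; apply: eq_measure_integral => A mA AD /=.
by rewrite /mrestr; congr (mu _); apply/setIidPl => x /AD[].
Qed.

Variables (n : nat) (i : 'I_n.+1) (h : 'rV[R]_n -> R).
Local Notation E := 'rV[R]_n.+1.
Hypothesis sh : smooth h.

Definition graph_pt (y : 'rV[R]_n) : E := insert_coord i (h y) y.

Lemma measurable_graph_pt : measurable_fun setT graph_pt.
Proof.
apply: (measurableT_comp (measurable_insert i) (g := fun y => (h y, y))).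
apply: measurable_fun_pair; last exact: measurable_id.
exact: continuous_measurable_rV (smooth_continuous sh).
Qed.

(** The region under the area density. Restricting the product measure to it and pushing forward
    along the graph realizes the measure with this density, so Tonelli computes its integrals. *)
Let G : set (measurableTypeR R * 'rV[R]_n) := [set p | 0 < p.1 < area_density h p.2].

Let mG : measurable G.
Proof.
have m1 : measurable_fun [set: measurableTypeR R * 'rV[R]_n] (fun p => area_density h p.2 - p.1).
  apply: measurable_funB; last exact: measurable_fst.
  apply: measurableT_comp (@measurable_snd _ _ _ _) => //.
  exact: continuous_measurable_rV (smooth_continuous (area_density_smooth sh)).
rewrite (_ : G = (fst @^-1` `]0, +oo[%classic) `&` ((fun p => area_density h p.2 - p.1) @^-1` `]0, +oo[%classic)).
  by apply: measurableI; rewrite -[X in measurable X]setTI; [apply: measurable_fst|apply: m1].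
by apply/seteqP; split => p /=; rewrite !in_itv/= !andbT subr_gt0 => /andP.
Qed.

Let P := (@lebesgue_measure R \x lebesgue_rV n)%E.

Let integral_subgraph (F : 'rV[R]_n -> \bar R) : measurable_fun setT F -> (forall y, 0 <= F y)%E ->
  (\int[P]_(p in G) F p.2 = \int[lebesgue_rV n]_y (F y * (area_density h y)%:E))%E.
Proof.
move=> mF F0; rewrite integral_mkcond fubini_tonelli2//=; last 2 first.
- by apply/(measurable_restrictT _ mG); apply: measurable_funTS; apply: measurableT_comp => //; exact: measurable_snd.
- by move=> p; rewrite patchE; case: ifPn.
apply: eq_integral => y _; rewrite /fubini_G.
transitivity (\int[@lebesgue_measure R]_t ((fun=> F y) \_ `]0%R, area_density h y[%classic) t)%E.
  apply: eq_integral => t _; rewrite !patchE.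
  have -> : ((t, y) \in G) = (t \in `]0%R, area_density h y[%classic) by apply/idP/idP; rewrite !inE /= ?in_itv/=.
  by [].
rewrite -integral_mkcond integral_cst//= lebesgue_measure_itv/= lte_fin area_density_gt0.
by rewrite oppr0 adde0.
Qed.

Variables (Om U : set E) (b : bool) (S : {measure set E -> \bar R}).
Hypotheses (oO : open Om) (sS : surface_measure Om S) (ch : bdry_chart Om i b U h).

Lemma measurable_bdry : measurable (bdry Om).
Proof.
apply: measurableD; first by apply: closed_measurable_rV; exact: closed_closure.
by apply: open_measurable_rV; exact: open_interior.
Qed.

Lemma ge0_surface_integral (F : E -> \bar R) : measurable_fun setT F -> (forall x, 0 <= F x)%E ->
  (\int[S]_(x in U `&` bdry Om) F x =
   \int[lebesgue_rV n]_(y in [set y | U (graph_pt y)]) (F (graph_pt y) * (area_density h y)%:E))%E.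
Proof.
move=> mF F0; have [oU _ _] := ch; have mU := open_measurable_rV oU.
have mUB : measurable (U `&` bdry Om) by apply: measurableI => //; exact: measurable_bdry.
have mg := measurable_graph_pt.
have mgs : measurable_fun setT (graph_pt \o snd : measurableTypeR R * 'rV[R]_n -> E).
  by apply: measurableT_comp => //; exact: measurable_snd.
pose m2 : {measure set E -> \bar R} :=
  @measure_function_pushforward__canonical__measure_function_Measure _ _ _ _ _ (mrestr P mG) _ mgs.
have mgA A : measurable A -> measurable (graph_pt @^-1` A) by move=> mA; rewrite -[X in measurable X]setTI; exact: mg.
have m2E (A : set E) : measurable A -> m2 A = (\int[lebesgue_rV n]_(y in graph_pt @^-1` A) (area_density h y)%:E)%E.
  move=> mA; rewrite /m2 /= /pushforward /mrestr -integral_indic ?setTI//=; last first.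
    by have := mgs measurableT A mA; rewrite setTI.
  rewrite [RHS]integral_mkcond.
  transitivity (\int[P]_(p in G) (\1_A (graph_pt p.2))%:E)%E.
    apply: eq_integral => p _; rewrite !indicE.
    by rewrite (_ : (p \in _ @^-1` A) = (graph_pt p.2 \in A)); last by apply/idP/idP; rewrite !inE.
  rewrite (@integral_subgraph (fun y => (\1_A (graph_pt y))%:E)); last 2 first.
  - by apply/measurable_EFinP; apply: measurableT_comp => //; exact/measurable_indicP.
  - by move=> y; rewrite lee_fin indicE.
  apply: eq_integral => y _; rewrite patchE indicE.
  rewrite (_ : (y \in _ @^-1` A) = (graph_pt y \in A)); last by apply/idP/idP; rewrite !inE.
  by case: ifPn; rewrite ?mul1e ?mul0e.
transitivity (\int[m2]_(x in U `&` bdry Om) F x)%E.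
  apply: eq_measure_integral => A mA AU; rewrite m2E//.
  have AU' : A `<=` U by move=> x /AU[].
  by have := sS ch mA AU'; rewrite (_ : A `&` bdry Om = A)//; apply/setIidPl => x /AU[].
pose D := U `&` bdry Om.
have mF' : measurable_fun D F by exact: measurable_funTS.
rewrite /m2 ge0_integral_pushforward//.
have mD' : measurable ((graph_pt \o snd : measurableTypeR R * 'rV[R]_n -> E) @^-1` D).
  by have := mgs measurableT D mUB; rewrite setTI.
rewrite ge0_integral_mrestr//; last 2 first.
- by apply: measurable_funTS; exact: measurableT_comp.
- by move=> x _; exact: F0.
transitivity (\int[P]_(p in G) ((F \_ D) (graph_pt p.2)))%E.
  rewrite setIC integral_mkcondr; apply: eq_integral => p _; rewrite !patchE /=.
  by rewrite (_ : (p \in _ @^-1` D) = (graph_pt p.2 \in D)); last by apply/idP/idP; rewrite !inE.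
rewrite (@integral_subgraph (fun y => (F \_ D) (graph_pt y))); last 2 first.
- by apply: measurableT_comp => //; apply/(measurable_restrictT _ mUB).
- by move=> y; rewrite patchE; case: ifPn.
rewrite [RHS]integral_mkcond; apply: eq_integral => y _; rewrite !patchE.
rewrite (_ : (y \in [set _ | _]) = (graph_pt y \in D)); first by case: ifPn; rewrite ?mul0e.
apply/idP/idP; rewrite !inE; last by case.
move=> Uy; split => //.
by apply/(bdry_level oO ch Uy); rewrite level_insert subrr mulr0.
Qed.

End surface_integral.

(** * The divergence theorem *)

Lemma nonexpansive_continuous {R : realType} m n (f : 'rV[R]_m -> 'rV[R]_n) :
  (forall x y, `|f x - f y| <= `|x - y|) -> continuous f.
Proof.
move=> Hf x A /nbhs_ballP[e /= e0 He]; apply/nbhs_ballP; exists e => //= z.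
rewrite -ball_normE /= => xz; apply: He; rewrite -ball_normE /=; exact: le_lt_trans (Hf _ _) xz.
Qed.

Section localization.
Context {R : realType} {n : nat} (Om : set 'rV[R]_n.+1).
Local Notation E := 'rV[R]_n.+1.
Implicit Types (a x z : E) (r : R).

(** The chart is valid on the ball of twice the radius, which leaves room for the boundary points
    near a patch of radius r. Bounded support of h makes the associated shear a global map that
    preserves bounded supports. *)
Definition loc a r := (forall x, `|x - a| < 2 * r -> Om x) \/
  exists i b h, bsupp h /\ bdry_chart Om i b [set x : E | `|x - a| < 2 * r] h.

Lemma open_ballc a r : open [set x : E | `|x - a| < r].
Proof.
have cn := @continuous_shift_rV R n.+1 (fun z : E => `|z|) a (@norm_continuous _ _).
rewrite (_ : mkset _ = (fun y : E => `|y - a|) @^-1` [set t | t < r])//.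
by apply: open_comp; [move=> y _; exact: cn|exact: open_lt].
Qed.

Lemma nbhs_ballc a (U : set E) : nbhs a U -> exists2 r : R, 0 < r & forall x, `|x - a| < 2 * r -> U x.
Proof.
move=> /nbhs_ballP[e /= e0 He]; exists (e / 2); first by rewrite divr_gt0.
by move=> x; rewrite mulrC divfK// => xa; apply: He; rewrite -ball_normE /= distrC.
Qed.

Hypothesis oO : open Om.

Lemma loc_exists x : smooth_bdry Om -> closure Om x -> exists2 r : R, 0 < r & loc x r.
Proof.
move=> sO cx; have [Ox|nOx] := pselect (Om x).
  have [r r0 Hr] := nbhs_ballc (open_nbhs_nbhs (conj oO Ox)).
  by exists r => //; left.
have [i [b [U [h [[oU sh HU] Ux]]]]] := sO x (closure_bdry cx nOx).
have [r r0 Hr] := nbhs_ballc (open_nbhs_nbhs (conj oU Ux)).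
(* The graph function is changed only outside the projection of the chart ball, where the chart
   condition does not see it. *)
have [chi [schi bchi chi1]] := cutoff_exists (@closed_ballc_compact R n (col' i x) (2 * r)).
exists r => //; right; exists i, b, (chi \* h); split.
  by have [M HM] := bchi; exists M => y /HM /= ->; rewrite mul0r.
split; [exact: open_ballc|exact: smoothM|].
move=> z zx; rewrite (HU z (Hr z zx)) /= chi1 ?mul1r//=.
rewrite (_ : col' i z - col' i x = col' i (z - x)); last by apply/rowP => k; rewrite !mxE.
exact: le_trans (col'_norm_le _ _) (ltW zx).
Qed.

Lemma loc_cone a r : 0 < r -> loc a r -> cone Om a r.
Proof.
move=> r0 [H|[i [b [h [bh [oU sh HU]]]]]].
  exists 0, 1, r; split => //; first by rewrite normr0.
    by rewrite ltr01 lexx.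
  move=> x Ox xa t z /andP[t0 tr]; rewrite scaler0 subr0 mul1r => zt; apply: H.
  rewrite addrAC (le_lt_trans (ler_normD _ _))// mulr_natl mulr2n ltr_leD// (le_trans zt)//.
have [L L0 HL] := smooth_lipschitz sh bh.
pose s : R := (-1) ^+ b; have L2 : 0 < 2 + L by rewrite ltr_pwDl.
(* With k (2 + L) = 1 the level function gains at least t - k t - L k t = k t > 0. The bound t <= r
   / 2 gives |z| <= 2 t <= r, so x + z stays in the chart ball. *)
exists (s *: delta_mx ord0 i), (2 + L)^-1, (r / 2); split.
- apply/(rV_norm_le _ ler01) => j; rewrite !mxE eqxx /= normrMsign.
  by case: eqP => _; rewrite ?normr1 ?normr0.
- by rewrite invr_gt0 L2/= invf_le1// (le_trans (_ : 1 <= 2))// ?ler1n// lerDl.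
- by rewrite divr_gt0.
move=> x Ox xa t z /andP[t0 tr] zt; set k := (2 + L)^-1 in zt.
have k0 : 0 < k by rewrite invr_gt0.
have kL : k * (2 + L) = 1 by rewrite mulVf// gt_eqF.
have kt : k * t <= t by rewrite ler_piMl ?(ltW t0)// invf_le1// (le_trans (_ : 1 <= 2))// ?ler1n// lerDl.
have zE j : z ord0 j = (z - t *: (s *: delta_mx ord0 i)) ord0 j + t * (s * (j == i)%:R).
  by rewrite !mxE eqxx /= subrK.
have sn : `|s| = 1 by rewrite normr_sign.
have xz : `|x + z - a| < 2 * r.
  rewrite addrAC (le_lt_trans (ler_normD _ _))// mulr_natl mulr2n ltr_leD//.
  apply/(rV_norm_le _ (ltW r0)) => j; rewrite zE (le_trans (ler_normD _ _))//.
  apply: (@le_trans _ _ (t + t)); last by move: tr; rewrite ler_pdivlMr// mulr_natr mulr2n.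
  apply: lerD; first by apply: le_trans kt; exact: le_trans (coord_le_norm _ _) zt.
  rewrite normrM gtr0_norm// normrM sn mul1r ler_piMr ?(ltW t0)//.
  by case: eqP => _; rewrite ?normr1 ?normr0.
apply/(HU (x + z) xz); have x2 : `|x - a| < 2 * r by rewrite (lt_trans xa)// mulr_natl mulr2n ltrDl.
have /(HU x x2) := Ox; rewrite -/s col'D => lx.
have cz : `|col' i z| <= k * t.
  apply/(rV_norm_le _ (mulr_ge0 (ltW k0) (ltW t0))) => j; rewrite mxE zE.
  rewrite eq_sym (negPf (neq_lift _ _)) !mulr0 addr0; exact: le_trans (coord_le_norm _ _) zt.
have hz : `|h (col' i x + col' i z) - h (col' i x)| <= L * (k * t).
  by apply: (le_trans (HL _ _)); rewrite addrC addKr ler_wpM2l.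
have zi : `|s * z ord0 i - t| <= k * t.
  rewrite -[leLHS]mul1r -sn -normrM mulrBr mulrA /s sgn_sqr mul1r -/s.
  apply: le_trans zt; apply: le_trans (coord_le_norm _ i); by rewrite !mxE !eqxx mulr1 mulrC.
have -> : s * ((x + z) ord0 i - h (col' i x + col' i z)) =
   s * (x ord0 i - h (col' i x)) + (s * z ord0 i - t) + t - s * (h (col' i x + col' i z) - h (col' i x)).
  by rewrite mxE; ring.
have h2 : `|s * (h (col' i x + col' i z) - h (col' i x))| <= L * (k * t) by rewrite normrM sn mul1r.
move: zi h2 lx; rewrite !ler_norml.
move: (s * (h _ - _)) (s * z ord0 i - t) (s * (x ord0 i - _)) => p q u /andP[q1 _] /andP[_ p1] u0.
have : 0 < k * t by rewrite mulr_gt0.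
have : k * t * 2 + L * (k * t) = t by rewrite -[RHS]mul1r -[X in _ = X * _]kL; ring.
move: q1 p1; move: (L * (k * t)) (k * t) => y2 y1; lra.
Qed.

End localization.

Lemma pou_imp {R : realType} n (K : set 'rV[R]_n) P Q N a r zeta :
  (forall x s, 0 < s -> P x s -> Q x s) -> @pou R n K P N a r zeta -> pou K Q a r zeta.
Proof.
move=> PQ [H1 H2 H3 H4 H5]; split => // j; have [Kj rj Pj] := H1 j.
by split => //; exact: PQ.
Qed.

(** * Flattening a boundary graph by a shear *)

Section shear.
Context {R : realType} {n : nat} (i : 'I_n.+1) (h : 'rV[R]_n -> R).
Local Notation E := 'rV[R]_n.+1.
Local Notation leb := (lebesgue_rV n.+1).
Hypotheses (sh : smooth h) (bh : bsupp h).
Implicit Types (eta F : E -> R) (b : bool).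

(** A translation on every line in direction i: it preserves Lebesgue measure by translation
    invariance in one variable, and it carries the half space to the region on one side of the
    graph. *)
Definition shear (x : E) : E := insert_coord i (x ord0 i + h (col' i x)) (col' i x).

Lemma shear_insert t y : shear (insert_coord i t y) = insert_coord i (t + h y) y.
Proof. by rewrite /shear insert_coordE col'_insert. Qed.

Lemma level_shear b x : level i b h (shear x) = (-1) ^+ b * x ord0 i.
Proof. by rewrite level_insert addrK. Qed.

Lemma measurable_shear : measurable_fun setT shear.
Proof.
have mc : measurable_fun [set: E] (col' i : E -> 'rV[R]_n).
  by apply: measurable_fun_rV => k; under eq_fun do rewrite mxE; exact: measurable_coord.
apply: (measurableT_comp (measurable_insert i) (g := fun x : E => (x ord0 i + h (col' i x), col' i x))).
apply: measurable_fun_pair => //; apply: measurable_funD; first exact: measurable_coord.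
apply: (measurableT_comp _ mc); exact: continuous_measurable_rV (smooth_continuous sh).
Qed.

Lemma ge0_integral_shift1 (c : R) (F : measurableTypeR R -> \bar R) :
  measurable_fun setT F -> (forall t, 0 <= F t)%E ->
  (\int[@lebesgue_measure R]_t F (t + c)%R = \int[@lebesgue_measure R]_t F t)%E.
Proof.
move=> mF F0.
have ms : measurable_fun [set: measurableTypeR R] (fun t : measurableTypeR R => (t + c)%R : measurableTypeR R).
  by apply: measurable_funD => //; exact: measurable_id.
pose m2 : {measure set (measurableTypeR R) -> \bar R} :=
  @measure_function_pushforward__canonical__measure_function_Measure
    _ _ _ (measurableTypeR R) _ (@lebesgue_measure R) _ ms.
transitivity (\int[m2]_x F x)%E.
  by rewrite /m2 ge0_integral_pushforward.
by apply: eq_measure_integral => B mB _; exact: lebesgue_measure_shift.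
Qed.

Lemma ge0_integral_shear (F : E -> \bar R) : measurable_fun setT F -> (forall x, 0 <= F x)%E ->
  (\int[leb]_x F (shear x) = \int[leb]_x F x)%E.
Proof.
move=> mF F0; rewrite (ge0_integral_rV_insert i)//; last exact: (measurableT_comp mF measurable_shear).
rewrite [RHS](ge0_integral_rV_insert i)//; apply: eq_integral => y _.
under eq_integral do rewrite shear_insert.
rewrite (@ge0_integral_shift1 (h y) (fun t => F (insert_coord i t y)))//.
apply: (measurableT_comp mF); apply: (measurableT_comp (measurable_insert i) (g := fun t => (t, y))).
by apply: measurable_fun_pair.
Qed.

Lemma integral_shear (F : E -> \bar R) : measurable_fun setT F ->
  (\int[leb]_x F (shear x) = \int[leb]_x F x)%E.
Proof.
move=> mF; rewrite integralE [RHS]integralE; congr (_ - _)%E.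
- transitivity (\int[leb]_x (F^\+ (shear x)))%E; first by apply: eq_integral => x _; rewrite unlock.
  by apply: ge0_integral_shear; [apply/measurable_funepos|].
- transitivity (\int[leb]_x (F^\- (shear x)))%E; first by apply: eq_integral => x _; rewrite unlock.
  by apply: ge0_integral_shear; [apply/measurable_funeneg|].
Qed.

Let f (z : E) := h (col' i z).

Lemma diff_shear eta x : smooth eta -> differentiable (fun z : E => eta (shear z)) x /\
  forall j, pderiv (fun z : E => eta (shear z)) j x =
    pderiv eta j (shear x) + pderiv f j x * pderiv eta i (shear x).
Proof.
move=> se; apply: differentiable_of_expansion => e e0.
have [L L0 HL] := smooth_lipschitz sh bh.
pose A := `|pderiv eta i (shear x)| + 1; have A0 : 0 < A by rewrite ltr_wpDl.
have L1 : 0 < 1 + L by rewrite ltr_pwDl.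
have [d1 d10 H1] := differentiable_expansion (smooth_differentiable (shear x) se) (divr_gt0 (divr_gt0 e0 (ltr0Sn R 1)) L1).
have df := smooth_differentiable x (smooth_comp_col' i sh).
have [d2 d20 H2] := differentiable_expansion df (divr_gt0 (divr_gt0 e0 (ltr0Sn R 1)) A0).
exists (Num.min (d1 / (1 + L)) d2); first by rewrite lt_min d20 divr_gt0.
move=> v; rewrite lt_min ltr_pdivlMr// => /andP[v1 v2].
pose w := shear (x + v) - shear x; pose del := f (x + v) - f x.
have wE j : w ord0 j = v ord0 j + (j == i)%:R * del.
  rewrite /w /shear !mxE; case: (unliftP i j) => [k ->|->] /=.
    by rewrite !mxE eq_sym (negPf (neq_lift _ _)) mul0r addr0 addrC addKr.
  by rewrite eqxx mul1r /del /f; ring.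
have delL : `|del| <= L * `|v|.
  by apply: (le_trans (HL _ _)); rewrite col'D addrC addKr ler_wpM2l// col'_norm_le.
have wv : `|w| <= `|v| * (1 + L).
  have q0 : 0 <= `|v| * (1 + L) by rewrite mulr_ge0// ltW.
  apply/(rV_norm_le _ q0) => j; rewrite wE (_ : `|v| * (1 + L) = `|v| + L * `|v|); last by ring.
  rewrite (le_trans (ler_normD _ _))// lerD ?coord_le_norm//.
  rewrite normrM mulrC (le_trans _ delL)// ler_piMr//.
  by case: eqP => _; rewrite ?normr1 ?normr0.
have {}H1 := H1 w (le_lt_trans wv v1); have {}H2 := H2 v v2.
have -> : shear (x + v) = shear x + w by rewrite /w [shear x + _]addrC subrK.
have E1 : \sum_k w ord0 k * pderiv eta k (shear x) = \sum_k v ord0 k * pderiv eta k (shear x) + del * pderiv eta i (shear x).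
  under eq_bigr do rewrite wE mulrDl.
  rewrite big_split/=; congr (_ + _); rewrite (bigD1 i)//= eqxx mul1r big1 ?addr0// => j /negPf ->.
  by rewrite !mul0r.
rewrite (_ : _ - _ - _ = (eta (shear x + w) - eta (shear x) - \sum_k w ord0 k * pderiv eta k (shear x)) +
   (f (x + v) - f x - \sum_k v ord0 k * pderiv f k x) * pderiv eta i (shear x)); last first.
  have -> : \sum_k v ord0 k * (pderiv eta k (shear x) + pderiv f k x * pderiv eta i (shear x)) =
     \sum_k v ord0 k * pderiv eta k (shear x) + (\sum_k v ord0 k * pderiv f k x) * pderiv eta i (shear x).
    by rewrite mulr_suml -big_split; apply: eq_bigr => k _; rewrite mulrDr mulrA.
  by rewrite E1 /del; ring.
apply: (le_trans (ler_normD _ _)).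
have -> : e * `|v| = e / 2 * `|v| + e / 2 * `|v| by field.
apply: lerD.
  apply: (le_trans H1); rewrite mulrAC ler_pdivrMr// -[leRHS]mulrA ler_wpM2l//.
  by rewrite divr_ge0// ltW.
rewrite normrM; apply: (@le_trans _ _ (e / 2 / A * `|v| * A)).
  by apply: ler_pM => //; rewrite /A lerDl.
by rewrite mulrAC divfK// gt_eqF.
Qed.

Lemma shear_bsupp eta : bsupp eta -> bsupp (fun z => eta (shear z)).
Proof.
move=> [r Hr]; have [M M0 HM] := bsupp_bounded (smooth_continuous sh) bh.
exists (`|r| + M) => x xr; apply: Hr; rewrite ltNge; apply/negP => le_r; move: xr; apply/negP; rewrite -leNgt.
have r0 : 0 <= r by exact: le_trans le_r.
have [xi xc] := (norm_insert_coord i _ _ r0).1 le_r.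
have rM : r <= `|r| + M by rewrite (le_trans (ler_norm r))// lerDl.
rewrite -(insert_col' i x); apply/norm_insert_coord; first by rewrite addr_ge0.
split; last exact: le_trans xc rM.
rewrite -[X in `|X|](addrK (h (col' i x))) (le_trans (ler_normB _ _))// lerD//.
exact: le_trans xi (ler_norm _).
Qed.

Lemma continuous_shear : continuous shear.
Proof.
have cc : continuous f by exact: smooth_continuous (smooth_comp_col' i sh).
rewrite (_ : shear = fun x : E => x + f x *: delta_mx ord0 i); last first.
  apply/funext => x; apply/rowP => j; rewrite !mxE eqxx /=; case: (unliftP i j) => [k ->|->] /=.
    by rewrite mxE eq_sym (negPf (neq_lift _ _)) mulr0 addr0.
  by rewrite eqxx mulr1.
move=> x; apply: (@cvgD R E E (nbhs x) _ id (fun x => f x *: delta_mx ord0 i)); first exact: cvg_id.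
by apply: cvgZr_tmp; exact: cc.
Qed.

Lemma shear_graph y : shear (insert_coord i 0 y) = graph_pt i h y.
Proof. by rewrite shear_insert add0r. Qed.

End shear.

Section half_space.
Context {R : realType} {n : nat} (i : 'I_n.+1).
Local Notation E := 'rV[R]_n.+1.
Local Notation leb := (lebesgue_rV n.+1).
Implicit Types (H : E -> R) (b : bool).

Definition half_space b : set E := [set x | 0 < (-1) ^+ b * x ord0 i].

Lemma open_half_space b : open (half_space b).
Proof.
rewrite (_ : half_space b = (fun x : E => (-1) ^+ b * x ord0 i) @^-1` [set t | 0 < t])//.
apply: open_comp; last exact: open_gt.
move=> x _; apply: smooth_continuous; apply: (@smoothZ _ _ _ (fun x : E => x ord0 i)); exact: smooth_coord.
Qed.

Lemma half_space_pderiv_tangent b H j : i != j -> (forall x, differentiable H x) ->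
  continuous (pderiv H j) -> bsupp H -> \int[leb]_(x in half_space b) (pderiv H j x) = 0.
Proof.
move=> ij dH cH [M bH]; have mS := open_measurable_rV (@open_half_space b).
have iH := continuous_bsupp_integrable cH (bsupp_pderiv j (ex_intro _ M bH)).
have iH' := integrable_mkcond (EFin \o pderiv H j) mS.
rewrite /Rintegral integral_mkcond (@integral_rV_insert _ _ j); last first.
  by apply/iH'; apply: integrableS iH.
rewrite integral0_eq// => y _.
pose c := 0 < (-1) ^+ b * (insert_coord j 0 y) ord0 i.
have inS t : (insert_coord j t y \in half_space b) = c.
  have -> : c = (0 < (-1) ^+ b * (insert_coord j t y) ord0 i).
    by rewrite /c !mxE; case: (unliftP j i) => [k _|e] //=; rewrite e eqxx in ij.
  by apply/idP/idP; rewrite inE.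
under eq_integral do rewrite patchE inS.
case: c {inS}; last by rewrite integral0_eq.
apply: (@integral_is_derive_line _ (fun s => H (insert_coord j s y)) _ M).
- by move=> t; exact: is_derive_insert.
- by move=> t; apply: continuous_comp; [exact: continuous_insert|exact: cH].
- by move=> t Mt; apply: bH; apply: (lt_le_trans Mt); exact: insert_coord_norm.
Qed.

Lemma continuous_col' : continuous (fun x : E => col' i x : 'rV[R]_n).
Proof.
apply: nonexpansive_continuous => x z.
rewrite (_ : col' i x - col' i z = col' i (x - z)); last by apply/rowP => k; rewrite !mxE.
exact: col'_norm_le.
Qed.

Lemma continuous_insert_slice (t : R) : continuous (fun y => insert_coord i t y : E).
Proof.
apply: nonexpansive_continuous => y z.
rewrite (_ : insert_coord i t y - insert_coord i t z = insert_coord i 0 (y - z)).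
  by apply/norm_insert_coord => //; rewrite normr0.
by apply/rowP => j; rewrite !mxE; case: (unlift i j) => [k|] /=; rewrite ?mxE ?subrr.
Qed.

Lemma slice_bsupp H (t : R) : bsupp H -> bsupp (fun y => H (insert_coord i t y)).
Proof.
move=> [M bH]; exists M => y My; rewrite bH//; apply: (lt_le_trans My).
by apply/(rV_norm_le _ (normr_ge0 _)) => k; rewrite -(insert_coord_lift i t); exact: coord_le_norm.
Qed.

Lemma slice_integrable H (c : 'rV[R]_n -> R) : continuous H -> bsupp H -> continuous c ->
  (lebesgue_rV n).-integrable setT (EFin \o (fun y => c y * H (insert_coord i 0 y))).
Proof.
move=> cH /(slice_bsupp 0)[M bH] cc; apply: continuous_bsupp_integrable.
  move=> y; apply: (@continuousM R 'rV[R]_n c (fun y => H (insert_coord i 0 y))); first exact: cc.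
  by apply: continuous_comp; [exact: continuous_insert_slice|exact: cH].
by exists M => y My; rewrite bH ?mulr0.
Qed.

Lemma col'_mul_integrable H (c : 'rV[R]_n -> R) : continuous H -> bsupp H -> continuous c ->
  leb.-integrable setT (EFin \o (fun x => c (col' i x) * H x)).
Proof.
move=> cH [M bH] cc; apply: continuous_bsupp_integrable.
  move=> x; apply: (@continuousM R E (fun x => c (col' i x))); last exact: cH.
  by apply: continuous_comp; [exact: continuous_col'|exact: cc].
by exists M => x Mx; rewrite bH ?mulr0.
Qed.

(** The weight depends on the tangential variables only, so it is constant along the lines of
    integration. In the divergence theorem it is 1 or a derivative of h. *)
Lemma half_space_pderiv_normal b H (c : 'rV[R]_n -> R) : (forall x, differentiable H x) ->
  continuous (pderiv H i) -> bsupp H -> continuous c ->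
  \int[leb]_(x in half_space b) (c (col' i x) * pderiv H i x) =
  - (-1) ^+ b * \int[lebesgue_rV n]_y (c y * H (insert_coord i 0 y)).
Proof.
move=> dH cH [M bH] cc; have mS := open_measurable_rV (@open_half_space b).
have iF := col'_mul_integrable cH (bsupp_pderiv i (ex_intro _ M bH)) cc.
have iF' := integrable_mkcond (EFin \o (fun x => c (col' i x) * pderiv H i x)) mS.
have cH0 : continuous H by move=> x; exact: differentiable_continuous.
rewrite -RintegralZl//; last exact: (slice_integrable cH0 (ex_intro _ M bH) cc).
rewrite /Rintegral integral_mkcond (@integral_rV_insert _ _ i); last by apply/iF'; apply: integrableS iF.
congr fine; apply: eq_integral => y _.
transitivity (\int[@lebesgue_measure R]_(t in [set t : R | (0 < (-1) ^+ b * t)%R]) ((c y * pderiv H i (insert_coord i t y))%:E))%E.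
  rewrite [RHS]integral_mkcond; apply: eq_integral => t _; rewrite !patchE /= col'_insert.
  have -> : (insert_coord i t y \in half_space b) = (t \in [set t : R | (0 < (-1) ^+ b * t)%R]) by apply/idP/idP; rewrite !inE /half_space /= insert_coordE.
  by [].
have dF t : is_derive t (1 : R) (fun t => c y * H (insert_coord i t y)) (c y * pderiv H i (insert_coord i t y)).
  have dI := @is_derive_insert _ _ H i y t (dH (insert_coord i t y)).
  exact: (@is_deriveZ _ _ _ (fun s : R => H (insert_coord i s y)) (c y) t 1 _ dI).
have cG : continuous (fun t : R => c y * pderiv H i (insert_coord i t y)).
  move=> t; apply: (@continuousM R R (cst (c y)) (fun t => pderiv H i (insert_coord i t y))); first exact: cst_continuous.
  by apply: continuous_comp; [exact: continuous_insert|exact: cH].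
rewrite (@integral_is_derive_halfline _ b _ _ M dF cG); first by congr EFin; rewrite mulrCA.
by move=> t Mt; rewrite bH ?mulr0//; apply: (lt_le_trans Mt); exact: insert_coord_norm.
Qed.

End half_space.

Section chart_integrals.
Context {R : realType} {n : nat}.
Local Notation E := 'rV[R]_n.+1.
Local Notation leb := (lebesgue_rV n.+1).
Variables (Om U : set E) (S : {measure set E -> \bar R}) (i : 'I_n.+1) (b : bool) (h : 'rV[R]_n -> R).
Hypotheses (oO : open Om) (ch : bdry_chart Om i b U h) (bh : bsupp h).
Implicit Types (F eta : E -> R).

Let sh : smooth h. Proof. by have [] := ch. Qed.

Lemma integral_chart F : measurable_fun setT F -> (forall x, ~ U x -> F x = 0) ->
  \int[leb]_(x in Om) F x = \int[leb]_(x in half_space i b) F (shear i h x).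
Proof.
move=> mF F0; rewrite /Rintegral; congr fine; rewrite integral_mkcond [RHS]integral_mkcond.
rewrite -(@integral_shear _ _ i h sh ((EFin \o F) \_ Om)); last first.
  by apply/(measurable_restrictT _ (open_measurable_rV oO)); apply: measurable_funTS; exact/measurable_EFinP.
apply: eq_integral => x _; rewrite !patchE /=.
have [Ux|nUx] := pselect (U (shear i h x)); last by rewrite F0//; case: ifP; case: ifP.
rewrite (_ : (shear i h x \in Om) = (x \in half_space i b))//.
have := chart_levelP ch Ux; rewrite level_shear => -[H1 H2].
by apply/idP/idP; rewrite !inE; [exact: H1|exact: H2].
Qed.

Hypothesis sS : surface_measure Om S.

Lemma ge0_surface_integral_supp (F : E -> \bar R) : measurable_fun setT F -> (forall x, 0 <= F x)%E ->
  (forall x, ~ U x -> F x = 0%E) ->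
  (\int[S]_(x in bdry Om) F x = \int[lebesgue_rV n]_y (F (graph_pt i h y) * (area_density h y)%:E))%E.
Proof.
move=> mF F0 FU; transitivity (\int[S]_(x in U `&` bdry Om) F x)%E.
  rewrite integral_mkcond [RHS]integral_mkcond; apply: eq_integral => x _; rewrite !patchE.
  have [Ux|nUx] := pselect (U x); last by rewrite FU//; case: ifP; case: ifP.
  rewrite (_ : (x \in U `&` bdry Om) = (x \in bdry Om))//.
  by apply/idP/idP => /set_mem H; apply/mem_set; [case: H|split].
rewrite (ge0_surface_integral sh oO sS ch)// [LHS]integral_mkcond; apply: eq_integral => y _; rewrite patchE.
by case: ifPn => // /negP nU; rewrite FU ?mul0e// => Uy; apply: nU; exact/mem_set.
Qed.

Lemma surface_integral F : measurable_fun setT F -> (forall x, ~ U x -> F x = 0) ->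
  \int[S]_(x in bdry Om) F x = \int[lebesgue_rV n]_y (F (graph_pt i h y) * area_density h y).
Proof.
move=> mF FU; rewrite /Rintegral; congr fine; rewrite integralE [RHS]integralE.
have mF' : measurable_fun setT (EFin \o F) by exact/measurable_EFinP.
have aF (f g : R) : 0 <= g -> (maxe (f * g)%:E 0 = maxe f%:E 0 * g%:E)%E.
  by move=> g0; rewrite -[0%E]/(0%:E) -!EFin_max -EFinM maxr_pMl// mul0r.
have aF' (f g : R) : 0 <= g -> (maxe (- (f * g)%:E) 0 = maxe (- f%:E) 0 * g%:E)%E.
  by move=> g0; rewrite -!EFinN -mulNr aF.
congr (_ - _)%E.
- rewrite ge0_surface_integral_supp; [|exact/measurable_funepos|exact: funepos_ge0|].
    by apply: eq_integral => y _; rewrite !funeposE /= aF// ltW// area_density_gt0.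
  by move=> x nU; rewrite funeposE /= FU// maxxx.
- rewrite ge0_surface_integral_supp; [|exact/measurable_funeneg|exact: funeneg_ge0|].
    by apply: eq_integral => y _; rewrite !funenegE; symmetry; apply: aF'; exact: (ltW (area_density_gt0 h y)).
  by move=> x nU; rewrite funenegE /= FU// oppr0 maxxx.
Qed.

Lemma chart_normal_smooth k : smooth (fun x => chart_normal i b h x ord0 k).
Proof.
pose c (x : E) := (area_density h (col' i x))^-1.
have sc : smooth c.
  apply: (@smooth_comp_col' _ _ i (fun y => (area_density h y)^-1)).
  by apply: smooth_inv; [exact: area_density_smooth|move=> y; rewrite gt_eqF// area_density_gt0].
rewrite (_ : (fun x => _) = fun x => - (-1) ^+ b * (c x * insert_coord i 1 (\row_k - pderiv h k (col' i x)) ord0 k)); last first.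
  by apply/funext => x; rewrite !mxE mulrA.
apply: smoothZ; apply: (smoothM sc); case: (unliftP i k) => [l ->|->].
  rewrite (_ : (fun x => _) = (fun x : E => - pderiv h l (col' i x))).
    by apply: smoothN; apply: smooth_comp_col'; exact: smooth_pderiv.
  by apply/funext => x; rewrite insert_coord_lift mxE.
rewrite (_ : (fun x => _) = cst 1); first exact: smooth_cst.
by apply/funext => x; rewrite insert_coordE.
Qed.

(* For a direction e_k tangent to the shear, d_k eta = d_k (eta o shear) -
   (d_k h) d_i eta in the sheared coordinates, where the boundary is flat. *)
Lemma gauss_chart eta k : smooth eta -> bsupp eta -> (forall x, ~ U x -> eta x = 0) ->
  (forall x, ~ U x -> pderiv eta k x = 0) ->
  \int[leb]_(x in Om) pderiv eta k x = \int[S]_(x in bdry Om) (eta x * chart_normal i b h x ord0 k).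
Proof.
move=> se be eU deU; have sde j := smooth_pderiv j se.
pose H (x : E) := eta (shear i h x).
have dH x : differentiable H x by have [] := diff_shear i sh bh x se.
have pH j : pderiv H j = fun x => pderiv eta j (shear i h x) +
    pderiv (fun z => h (col' i z)) j x * pderiv eta i (shear i h x).
  by apply/funext => x; have [_] := diff_shear i sh bh x se.
have pf j x : pderiv (fun z : E => h (col' i z)) j x = oapp (fun k => pderiv h k (col' i x)) 0 (unlift i j).
  by have [_] := diff_comp_col' (smooth_differentiable (col' i x) sh).
have cS : continuous (shear i h) by exact: continuous_shear.
have ceta j : continuous (fun x => pderiv eta j (shear i h x)).
  by move=> x; apply: continuous_comp; [exact: cS|exact: smooth_continuous].
have cf j : continuous (pderiv (fun z : E => h (col' i z)) j).
  by apply: smooth_continuous; apply: smooth_pderiv; exact: smooth_comp_col'.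
have cH j : continuous (pderiv H j).
  rewrite pH => x; apply: (@continuousD R R E (fun x => pderiv eta j (shear i h x))); first exact: ceta.
  by apply: (@continuousM R E (pderiv (fun z : E => h (col' i z)) j)); [exact: cf|exact: ceta].
have cH0 : continuous H by move=> x; exact: differentiable_continuous.
have bH : bsupp H by exact: shear_bsupp.
have c1 : continuous (cst 1 : 'rV[R]_n -> R) by exact: cst_continuous.
have mS := open_measurable_rV (@open_half_space R n i b).
rewrite (integral_chart _ deU); last by apply: continuous_measurable_rV => //; exact: smooth_continuous.
rewrite (@surface_integral (fun x => eta x * chart_normal i b h x ord0 k)); last 2 first.
- by apply: continuous_measurable_rV => //; apply: smooth_continuous; apply: smoothM => //; exact: chart_normal_smooth.
- by move=> x nU; rewrite eU// mul0r.
have cnE y : chart_normal i b h (graph_pt i h y) ord0 k * area_density h y =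
    - (-1) ^+ b * insert_coord i 1 (\row_k - pderiv h k y) ord0 k.
  by rewrite mxE col'_insert mulrAC divfK// gt_eqF// area_density_gt0.
under [RHS]eq_Rintegral do rewrite -mulrA cnE.
case: (unliftP i k) cnE => [l kl|->] _; last first.
  rewrite (@eq_Rintegral _ _ _ _ _ (fun x => 1 * pderiv H i x)); last first.
    by move=> x _; rewrite pH pf unlift_none /= mul0r addr0 mul1r.
  rewrite (@half_space_pderiv_normal _ _ i b H (cst 1) dH (cH i) bH c1).
  rewrite -RintegralZl//; last exact: (slice_integrable i cH0 bH c1).
  by apply: eq_Rintegral => y _; rewrite insert_coordE /H shear_graph /= mul1r mulr1 mulrC.
have ik : i != k by rewrite kl neq_lift.
pose c := pderiv h l; have cc : continuous c by apply: smooth_continuous; exact: smooth_pderiv.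
have i1 : leb.-integrable (half_space i b) (EFin \o pderiv H k).
  by apply: (integrableS measurableT mS (@subsetT _ _)); exact: (continuous_bsupp_integrable (cH k) (bsupp_pderiv k bH)).
have i2 : leb.-integrable (half_space i b) (EFin \o (fun x => c (col' i x) * pderiv H i x)).
  apply: (integrableS measurableT mS (@subsetT _ _)).
  exact: (col'_mul_integrable i (cH i) (bsupp_pderiv i bH) cc).
rewrite (@eq_Rintegral _ _ _ _ _ (fun x => pderiv H k x - c (col' i x) * pderiv H i x)); last first.
  by move=> x _; rewrite !pH !pf kl liftK unlift_none /=; rewrite /c; ring.
rewrite RintegralB// (half_space_pderiv_tangent b ik dH (cH k) bH) sub0r.
rewrite (@half_space_pderiv_normal _ _ i b H c dH (cH i) bH cc).
rewrite mulNr opprK -RintegralZl//; last exact: (slice_integrable i cH0 bH cc).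
by apply: eq_Rintegral => y _; rewrite kl insert_coord_lift mxE mulrNN /H shear_graph mulrA mulrC.
Qed.

End chart_integrals.

(** * The divergence theorem on the whole domain *)

Section gauss.
Context {R : realType} {n : nat}.
Local Notation E := 'rV[R]_n.+1.
Local Notation leb := (lebesgue_rV n.+1).
Variables (Om : set E) (S : {measure set E -> \bar R}).
Hypotheses (oO : open Om) (bO : bounded_set Om) (sS : surface_measure Om S).
Local Notation bd := (bdry Om).
Local Notation dot := (dotL2 leb Om).
Local Notation dotS := (dotL2 S bd).
Local Notation mO := (measurable_open oO).
Local Notation mbd := (@measurable_bdry R n Om).
Implicit Types (f psi : E -> R).

Variables (N : nat) (a : 'I_N -> E) (r : 'I_N -> R) (zeta : 'I_N -> E -> R).
Hypothesis Hpou : pou (closure Om) (loc Om) a r zeta.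

Let r2 j : r j < 2 * r j.
Proof. by have [_ rj _] := pou_loc Hpou j; rewrite mulr_natl mulr2n ltrDl. Qed.

Let zeta_out j x : ~ `|x - a j| < 2 * r j -> zeta j x = 0.
Proof.
move=> H; apply/eqP; apply: contra_notT H => /(pou_supp Hpou) xa.
exact: lt_trans xa (r2 j).
Qed.

Let dzeta_out j k x : ~ `|x - a j| < 2 * r j -> pderiv (zeta j) k x = 0.
Proof.
move=> H; apply/eqP; apply: contra_notT H => /(pou_pderiv0 Hpou) xa.
exact: le_lt_trans xa (r2 j).
Qed.

(** The zeta_j sum to 1 on the boundary, and in its chart each one is a continuous function of
    bounded support integrated against the area density. *)
Lemma surface_fin : (S bd < +oo)%E.
Proof.
have mz j : measurable_fun setT (zeta j).
  by apply: continuous_measurable_rV => //; exact: smooth_continuous (pou_smooth Hpou j).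
have -> : S bd = (\sum_j \int[S]_(x in bd) (zeta j x)%:E)%E.
  rewrite -ge0_integral_sum//; last 3 first.
  - exact: mbd.
  - by move=> j; apply: measurable_funTS; apply/measurable_EFinP; exact: mz.
  - by move=> j x _; rewrite lee_fin (pou_ge0 Hpou).
  rewrite (eq_integral (cst 1%E)) ?integral_cst ?mul1e//; first exact: mbd.
  move=> x /set_mem bx; rewrite sumEFin; congr EFin; have [U [_ KU] ->//] := pou_sum Hpou.
  by apply: KU; exact: bdry_closure.
apply: lte_sum_pinfty => j _; have [_ rj [Hj|[i [b [h [bh ch]]]]]] := pou_loc Hpou j.
  rewrite integral0_eq// => x bx; congr EFin; apply: zeta_out => /Hj.
  exact: bdry_notin oO _ bx.
rewrite (ge0_surface_integral_supp oO ch sS).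
- have sh : smooth h by have [] := ch.
  have zs := smooth_continuous (pou_smooth Hpou j).
  have cH : continuous (fun x => zeta j (shear i h x)).
    by move=> x; apply: continuous_comp; [exact: continuous_shear|exact: zs].
  have ca : continuous (area_density h) by apply: smooth_continuous; exact: area_density_smooth.
  have := slice_integrable i cH (shear_bsupp i sh bh (pou_bsupp Hpou j)) ca.
  move=> /(integrable_fin_num measurableT); rewrite (eq_integral (fun y => ((zeta j (graph_pt i h y))%:E * (area_density h y)%:E)%E)).
    by rewrite ltey_eq => ->.
  by move=> y _; rewrite /= shear_graph -EFinM mulrC.
- by apply/measurable_EFinP; exact: mz.
- by move=> x; rewrite lee_fin (pou_ge0 Hpou).
- by move=> x nx; rewrite zeta_out.
Qed.

Lemma continuous_L2S f : continuous f -> L2 S bd f.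
Proof.
move=> cf; have [M M0 HM] := compact_bounded_fun (closure_compact bO) (fun x _ => cf x).
apply: (L2_bounded mbd surface_fin (M := M)); first exact: continuous_measurable_rV mbd cf.
by move=> x /bdry_closure; exact: HM.
Qed.

Lemma smooth_L2S f : smooth f -> L2 S bd f.
Proof. by move=> /smooth_continuous; exact: continuous_L2S. Qed.

(** Chart normals glued by the partition of unity. The result is smooth on the whole space and has
    unit length on the boundary only, where all chart formulas agree. *)
Lemma normal_extension : exists nu : 'I_n.+1 -> E -> R, (forall k, smooth (nu k)) /\
  forall x, bd x -> forall k, nu k x = outward_normal Om x ord0 k.
Proof.
have /choice[nu Hnu] : forall j, exists nu : 'I_n.+1 -> E -> R, (forall k, smooth (nu k)) /\
    forall x, bd x -> `|x - a j| < r j -> forall k, nu k x = outward_normal Om x ord0 k.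
  move=> j; have [_ rj [Hj|[i [b [h [bh ch]]]]]] := pou_loc Hpou j.
    exists (fun _ => cst 0); split=> [k|x bx xa]; first exact: smooth_cst.
    by exfalso; apply: (bdry_notin oO bx); apply: Hj; exact: lt_trans xa (r2 j).
  exists (fun k x => chart_normal i b h x ord0 k); split=> [k|x bx xa k].
    by apply: (chart_normal_smooth ch).
  by rewrite (outward_normal_chart oO ch)//; exact: lt_trans xa (r2 j).
exists (fun k x => \sum_j zeta j x * nu j k x); split=> [k|x bx k].
  by apply: smooth_sum => j _; apply: smoothM; [exact: pou_smooth Hpou j|have [] := Hnu j].
rewrite [RHS](pou_decomp Hpou (fun x => outward_normal Om x ord0 k) (bdry_closure bx)).
apply: eq_bigr => j _; have [->|/(pou_supp Hpou) xa] := eqVneq (zeta j x) 0; first by rewrite !mul0r.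
by have [_ ->] := Hnu j.
Qed.

Lemma outward_normal_norm x : bd x -> dotv (outward_normal Om x) (outward_normal Om x) = 1.
Proof.
move=> bx; have [U [_ KU] Hsum] := pou_sum Hpou.
have [j zj] : exists j, zeta j x != 0.
  apply: contrapT => H; have := Hsum x (KU x (bdry_closure bx)); rewrite big1 => [/eqP|j _].
    by rewrite eq_sym oner_eq0.
  by apply/eqP; apply: contra_notT H => zj; exists j.
have xa := lt_trans (pou_supp Hpou zj) (r2 j).
have [_ rj [Hj|[i [b [h [bh ch]]]]]] := pou_loc Hpou j; first by exfalso; apply: (bdry_notin oO bx); exact: Hj.
by rewrite (outward_normal_chart oO ch)// chart_normal_norm//; have [] := ch.
Qed.

Variable nu : 'I_n.+1 -> E -> R.
Hypotheses (snu : forall k, smooth (nu k)) (nuE : forall x, bd x -> forall k, nu k x = outward_normal Om x ord0 k).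

(** Patches inside the domain contribute zero to both sides; boundary patches are [gauss_chart] with
    the double ball as chart domain. *)
Lemma gauss psi k : smooth psi ->
  \int[leb]_(x in Om) pderiv psi k x = dotS psi (nu k).
Proof.
move=> sp; have sz j : smooth (zeta j \* psi) by apply: smoothM => //; exact: pou_smooth Hpou j.
have bz j : bsupp (zeta j \* psi).
  by have [M HM] := pou_bsupp Hpou j; exists M => x /HM /= ->; rewrite mul0r.
have L1 : L2 leb Om (cst 1) by apply: (continuous_L2 oO bO); exact: cst_continuous.
have Ld j : L2 leb Om (pderiv (zeta j \* psi) k) by apply: (smooth_L2 oO bO); exact: smooth_pderiv.
transitivity (dot (fun x => \sum_j pderiv (zeta j \* psi) k x) (cst 1)).
  apply: eq_Rintegral => x /set_mem Ox; rewrite mulr1 -pderiv_sum; last first.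
    by move=> j; exact: smooth_differentiable.
  have [U [oU KU] Hsum] := pou_sum Hpou; apply: near_eq_derive.
  have := open_nbhs_nbhs (conj oU (KU x (subset_closure Ox))).
  by apply: filterS => y Uy /=; rewrite -mulr_suml Hsum// mul1r.
rewrite (dotL2_suml mO) => [|j _|]; [|exact: Ld|exact: L1].
have LS j : L2 S bd (zeta j \* psi) by apply: smooth_L2S; exact: sz.
transitivity (dotS (fun x => \sum_j (zeta j \* psi) x) (nu k)); last first.
  by apply: eq_dotL2 => // x bx; rewrite [RHS](pou_decomp Hpou psi (bdry_closure bx)).
rewrite (dotL2_suml mbd) => [|j _|]; [|exact: LS|exact: smooth_L2S].
apply: eq_bigr => j _; rewrite /dotL2; under eq_Rintegral do rewrite mulr1.
have out x : ~ `|x - a j| < 2 * r j -> (zeta j \* psi) x = 0 by move=> nx /=; rewrite zeta_out// mul0r.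
have dout x : ~ `|x - a j| < 2 * r j -> pderiv (zeta j \* psi) k x = 0.
  move=> nx; rewrite pderivM; [|exact: smooth_differentiable (pou_smooth Hpou j)|exact: smooth_differentiable].
  by rewrite zeta_out// dzeta_out// mul0r mulr0 addr0.
have [_ rj [Hj|[i [b [h [bh ch]]]]]] := pou_loc Hpou j.
  rewrite Rintegral_supp => [|x nx]; last by apply: dout => /Hj.
  rewrite integral_pderiv0//; [|by move=> x; exact: smooth_differentiable|by apply: smooth_continuous; exact: smooth_pderiv].
  rewrite (@eq_Rintegral _ _ _ _ _ (cst 0)) ?Rintegral_cst ?mul0r//; first exact: mbd.
  by move=> x /set_mem bx; rewrite out ?mul0r// => /Hj; exact: bdry_notin oO _ bx.
rewrite (gauss_chart oO ch bh sS (sz j) (bz j) out dout).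
apply: eq_Rintegral => x /set_mem bx; have [xa|nxa] := pselect (`|x - a j| < 2 * r j); last by rewrite out// !mul0r.
by rewrite nuE// (outward_normal_chart oO ch).
Qed.

End gauss.

(** * Traces *)

Lemma young2 {R : realType} (e C G : R) : 0 < e -> 2 * (C * G) <= e * G ^+ 2 + C ^+ 2 / e.
Proof.
move=> e0; rewrite -subr_ge0 (_ : _ - _ = (e * G - C) ^+ 2 / e); first by rewrite divr_ge0 ?sqr_ge0// ltW.
by field; rewrite gt_eqF.
Qed.

Lemma cvg_sum_seq {R : realType} (I : Type) (s : seq I) (f_ : I -> nat -> R) (l : I -> R) :
  (forall i, f_ i k @[k --> \oo] --> l i) ->
  (\sum_(i <- s) f_ i k) @[k --> \oo] --> \sum_(i <- s) l i.
Proof.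
move=> H; elim: s => [|i s IH].
  by rewrite big_nil; under eq_fun do rewrite big_nil; exact: cvg_cst.
rewrite big_cons; under eq_fun do rewrite big_cons.
exact: cvgD.
Qed.

Section traces.
Context {R : realType} {n : nat}.
Local Notation E := 'rV[R]_n.+1.
Local Notation leb := (lebesgue_rV n.+1).
Variables (Om : set E) (S : {measure set E -> \bar R}).
Hypotheses (oO : open Om) (bO : bounded_set Om) (sS : surface_measure Om S).
Local Notation bd := (bdry Om).
Local Notation dot := (dotL2 leb Om).
Local Notation nrm := (normL2 leb Om).
Local Notation L2O := (L2 leb Om).
Local Notation dotS := (dotL2 S bd).
Local Notation nrmS := (normL2 S bd).
Local Notation L2S := (L2 S bd).
Local Notation wd i u v := (is_wderiv Om [:: i] u v).
Local Notation mO := (measurable_open oO).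
Local Notation mbd := (@measurable_bdry R n Om).
Implicit Types (f psi u v t : E -> R) (p q : 'I_n.+1 -> E -> R) (e C M : R).

Variables (N : nat) (a : 'I_N -> E) (r : 'I_N -> R) (zeta : 'I_N -> E -> R).
Hypothesis Hpou : pou (closure Om) (loc Om) a r zeta.
Let Hcone : pou (closure Om) (cone Om) a r zeta := pou_imp (@loc_cone R n Om) Hpou.
Variable nu : 'I_n.+1 -> E -> R.
Hypotheses (snu : forall k, smooth (nu k)) (nuE : forall x, bd x -> forall k, nu k x = outward_normal Om x ord0 k).

Local Notation smooth_L2O := (smooth_L2 oO bO).
Local Notation smooth_L2bd := (smooth_L2S oO bO sS Hpou).
Let cnu k := smooth_continuous (snu k).

Lemma nu_sqr_sum x : bd x -> \sum_k nu k x * nu k x = 1.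
Proof.
by move=> bx; rewrite -(outward_normal_norm oO Hpou bx); apply: eq_bigr => k _; rewrite nuE.
Qed.

(* Apply the divergence theorem to psi^2 nu. *)
Lemma trace_ineq e : 0 < e -> exists2 C : R, 0 <= C & forall psi, smooth psi ->
  nrmS psi ^+ 2 <= e * \sum_k nrm (pderiv psi k) ^+ 2 + C * nrm psi ^+ 2.
Proof.
move=> e0; have [M1 M10 HM1] := contM_bound_fin oO bO cnu.
have cdnu k : continuous (pderiv (nu k) k) by apply: smooth_continuous; exact: smooth_pderiv.
have [M2 M20 HM2] := contM_bound_fin oO bO cdnu.
exists ((M1 ^+ 2 / e + M2) *+ n.+1).
  by apply: mulrn_wge0; rewrite addr_ge0// divr_ge0 ?sqr_ge0// ltW.
move=> psi sp; have Lp := smooth_L2O sp.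
have Ldp k : L2O (pderiv psi k) by apply: smooth_L2O; exact: smooth_pderiv.
pose w k x := nu k x * (psi x * psi x).
have sw k : smooth (w k) by apply: (smoothM (snu k)); exact: smoothM.
have Lw k := L2_contM oO bO (@cnu k) Lp.
have Ldw k := L2_contM oO bO (@cdnu k) Lp.
have -> : nrmS psi ^+ 2 = \sum_k dotS (w k) (nu k).
  transitivity (dotS (fun x => \sum_k w k x * nu k x) (cst 1)).
    rewrite sqr_normL2; apply: eq_Rintegral => x /set_mem bx.
    rewrite mulr1 (eq_bigr (fun k => psi x * psi x * (nu k x * nu k x))); last by move=> k _; rewrite /w; ring.
    by rewrite -mulr_sumr nu_sqr_sum ?mulr1.
  rewrite (dotL2_suml mbd) => [|k _|]; last 2 first.
  - by apply: smooth_L2bd; apply: (smoothM (sw k)).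
  - by apply: smooth_L2bd; exact: smooth_cst.
  by apply: eq_bigr => k _; apply: eq_Rintegral => x _; rewrite mulr1.
rewrite mulr_sumr mulrnAl -[X in _ *+ X](card_ord n.+1) -sumr_const -big_split.
apply: ler_sum => k _ /=; rewrite -(gauss oO bO sS Hpou snu nuE k (sw k)).
have -> : \int[leb]_(x in Om) pderiv (w k) k x =
    2 * dot (fun x => nu k x * psi x) (pderiv psi k) + dot (fun x => pderiv (nu k) k x * psi x) psi.
  rewrite -(dotL2Zl mO 2 (Lw k) (Ldp k)) /dotL2 -RintegralD//; [|exact: mO|exact: (L2_mul_integrable mO (L2Z mO 2 (Lw k)) (Ldp k))|exact: (L2_mul_integrable mO (Ldw k) Lp)].
  apply: eq_Rintegral => x _; have dpsi := smooth_differentiable x sp.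
  rewrite (_ : w k = nu k \* (psi \* psi))// pderivM ?pderivM//=; [ring|exact: smooth_differentiable|].
  exact: differentiableM.
have := dotL2_le mO (Lw k) (Ldp k); have := dotL2_le mO (Ldw k) Lp.
have := HM1 k psi Lp; have := HM2 k psi Lp.
have := normL2_ge0 leb Om psi; have := normL2_ge0 leb Om (pderiv psi k).
have := normL2_ge0 leb Om (fun x => nu k x * psi x).
move: (dot _ _) (dot _ _) (nrm _) (nrm _) (nrm (pderiv psi k)) (nrm psi).
move=> A B D C G P C0 G0 P0 D1 C1 B1 A1.
have CM : C ^+ 2 <= M1 ^+ 2 * P ^+ 2 by rewrite -exprMn ler_sqr ?nnegrE ?mulr_ge0.
have BM : B <= M2 * P ^+ 2 by apply: (le_trans B1); rewrite expr2 mulrA ler_wpM2r.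
have Y := young2 C G e0.
have CE : C ^+ 2 / e <= M1 ^+ 2 / e * P ^+ 2 by rewrite [leRHS]mulrAC ler_wpM2r// invr_ge0 ltW.
rewrite [(_ + M2) * _]mulrDl; move: (C * G) (e * G ^+ 2) (C ^+ 2 / e) (M1 ^+ 2 / e * _) (M2 * P ^+ 2) A1 BM Y CE => *; lra.
Qed.

(** The gradient is an explicit family, since the representative selected by [wderiv] need not
    respect differences or limits. *)
Definition H1 u p := L2O u /\ forall i, wd i u (p i).

Lemma H1_L2 u p : H1 u p -> L2O u. Proof. by case. Qed.

Lemma H1_gradL2 u p i : H1 u p -> L2O (p i).
Proof. by move=> [_ H]; have [] := H i. Qed.

Lemma H1_smooth psi : smooth psi -> H1 psi (pderiv psi).
Proof. by move=> sp; split=> [|i]; [exact: smooth_L2O|exact: (wd_smooth oO bO)]. Qed.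

Lemma H1B u p v q : H1 u p -> H1 v q -> H1 (u \- v) (fun i => p i \- q i).
Proof.
move=> [Lu Hu] [Lv Hv]; split=> [|i]; first exact: (L2B mO).
exact: (wdB oO bO).
Qed.

Lemma wd_unique i u v v' : wd i u v -> wd i u v' -> nrm (v \- v') = 0.
Proof.
move=> /wd1P[Lv Hv] /wd1P[Lv' Hv']; apply: (wd_unique0 oO bO Hcone (L2B mO Lv Lv')) => phi tphi.
have Lphi := test_fun_L2 oO bO tphi.
rewrite (dotL2Bl mO Lv Lv' Lphi); apply/eqP; rewrite subr_eq0 -eqr_opp; apply/eqP.
by rewrite -Hv// -Hv'.
Qed.

Lemma wderivP i u v : wd i u v -> wd i u (wderiv Om [:: i] u) /\ nrm (wderiv Om [:: i] u \- v) = 0.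
Proof.
move=> H; have Hw : wd i u (wderiv Om [:: i] u) by apply: (xgetPex (cst 0)); exists v.
by split => //; exact: wd_unique Hw H.
Qed.

Lemma normH1E u p : H1 u p -> normH1 Om u = nrm u + \sum_i nrm (p i).
Proof.
move=> [Lu Hp]; congr (_ + _); apply: eq_bigr => i _; have [Hw Hn] := wderivP (Hp i).
by apply: (normL2_dist0 mO _ _ Hn); [have [] := Hw|have [] := Hp i].
Qed.

Lemma Hk1P u : Hk Om 1 u <-> exists p, H1 u p.
Proof.
split=> [[Lu H]|[p [Lu Hp]]].
  by have /choice[p Hp] := fun i => H [:: i] isT; exists p; split.
split=> // -[_|i [|//] _]; first by exists u; split=> // phi _; rewrite /= expr0 mul1r.
by exists (p i); exact: Hp.
Qed.

Definition H1_cvg (u_ : nat -> E -> R) (p_ : nat -> 'I_n.+1 -> E -> R) u p :=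
  (nrm (u \- u_ k) @[k --> \oo] --> 0) /\ forall i, nrm (p i \- p_ k i) @[k --> \oo] --> 0.

Lemma is_trace_H1 u t : is_trace Om S u t -> forall p, H1 u p ->
  L2S t /\ exists phi_ : nat -> E -> R, [/\ forall k, smooth (phi_ k),
    H1_cvg phi_ (fun k => pderiv (phi_ k)) u p & nrmS (t \- phi_ k) @[k --> \oo] --> 0].
Proof.
move=> [_ Lt [phi_ [sphi cH cS]]] p Hp; split => //; exists phi_; split => //.
have E1 k : normH1 Om (u \- phi_ k) = nrm (u \- phi_ k) + \sum_i nrm (p i \- pderiv (phi_ k) i).
  by rewrite (normH1E (H1B Hp (H1_smooth (sphi k)))).
have bound (x_ : nat -> R) : (forall k, 0 <= x_ k <= normH1 Om (u \- phi_ k)) -> x_ k @[k --> \oo] --> 0.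
  move=> Hx; apply: (@squeeze_cvgr _ _ _ _ (cst 0) (fun k => normH1 Om (u \- phi_ k))) => //; last exact: cvg_cst.
  by apply: nearW => k; exact: Hx.
split=> [|i]; apply: bound => k; rewrite normL2_ge0 E1 /=.
  by rewrite lerDl sumr_ge0// => i _; exact: normL2_ge0.
rewrite (bigD1 i)//= addrCA lerDl addr_ge0 ?normL2_ge0// sumr_ge0// => j _; exact: normL2_ge0.
Qed.

Lemma is_trace_of_cvg u p t (phi_ : nat -> E -> R) : H1 u p -> L2S t ->
  (forall k, smooth (phi_ k)) -> H1_cvg phi_ (fun k => pderiv (phi_ k)) u p ->
  nrmS (t \- phi_ k) @[k --> \oo] --> 0 -> is_trace Om S u t.
Proof.
move=> Hp Lt sphi [c1 c2] cS; split => //; first by apply/Hk1P; exists p.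
exists phi_; split => //.
have E1 k : normH1 Om (u \- phi_ k) = nrm (u \- phi_ k) + \sum_i nrm (p i \- pderiv (phi_ k) i).
  by rewrite (normH1E (H1B Hp (H1_smooth (sphi k)))).
rewrite (_ : (fun k => _) = fun k => nrm (u \- phi_ k) + \sum_i nrm (p i \- pderiv (phi_ k) i)); last by apply/funext.
have c2' := @cvg_sum_seq R _ (index_enum 'I_n.+1) (fun i k => nrm (p i \- pderiv (phi_ k) i)) (fun=> 0) c2.
have E0 : 0 + \sum_(i < n.+1) (fun=> 0 : R) i = 0 by rewrite big1 ?addr0.
by rewrite -[X in _ --> X]E0; exact: (cvgD c1 c2').
Qed.

Lemma cvg_nrmB (u_ v_ : nat -> E -> R) u v : (forall k, L2O (u_ k)) -> L2O u ->
  (forall k, L2O (v_ k)) -> L2O v ->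
  nrm (u \- u_ k) @[k --> \oo] --> 0 -> nrm (v \- v_ k) @[k --> \oo] --> 0 ->
  nrm ((u \- v) \- (u_ k \- v_ k)) @[k --> \oo] --> 0.
Proof.
move=> Lu_ Lu Lv_ Lv cu cv.
apply: (@squeeze_cvgr _ _ _ _ (cst 0) (fun k => nrm (u \- u_ k) + nrm (v \- v_ k))); last first.
- by rewrite -[0]addr0; exact: cvgD.
- exact: cvg_cst.
apply: nearW => k; rewrite normL2_ge0 /=.
apply: le_trans (normL2B mO (L2B mO Lu (Lu_ k)) (L2B mO Lv (Lv_ k))).
rewrite le_eqVlt; apply/orP; left; apply/eqP; apply: eq_normL2 => x _ /=; ring.
Qed.

(** The inequality for smooth functions passes to the limit along approximating sequences. Stated
    for a pair, it contains both continuity of traces in H^1 and their uniqueness up to null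
    sets. *)
Lemma is_trace_ineq e : 0 < e -> exists2 C : R, 0 <= C & forall u p v q t s,
  H1 u p -> H1 v q -> is_trace Om S u t -> is_trace Om S v s ->
  nrmS (t \- s) ^+ 2 <= e * \sum_k nrm (p k \- q k) ^+ 2 + C * nrm (u \- v) ^+ 2.
Proof.
move=> e0; have [C C0 HC] := trace_ineq e0; exists C => // u p v q t s Hu Hv tu sv.
have [Lt [f_ [sf [cf cdf] cft]]] := is_trace_H1 tu Hu.
have [Ls [g_ [sg [cg cdg] cgs]]] := is_trace_H1 sv Hv.
have Lf k := smooth_L2O (sf k); have Lg k := smooth_L2O (sg k).
have LSf k := smooth_L2bd (sf k); have LSg k := smooth_L2bd (sg k).
have Ldf k i := smooth_L2O (smooth_pderiv i (sf k)).
have Ldg k i := smooth_L2O (smooth_pderiv i (sg k)).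
have Lp i := H1_gradL2 i Hu; have Lq i := H1_gradL2 i Hv.
have c1 := cvg_normL2 mO (fun k => L2B mO (Lf k) (Lg k)) (L2B mO (H1_L2 Hu) (H1_L2 Hv))
  (cvg_nrmB Lf (H1_L2 Hu) Lg (H1_L2 Hv) cf cg).
have c2 i := cvg_normL2 mO (fun k => L2B mO (Ldf k i) (Ldg k i)) (L2B mO (Lp i) (Lq i))
  (cvg_nrmB (fun k => Ldf k i) (Lp i) (fun k => Ldg k i) (Lq i) (cdf i) (cdg i)).
have c3 : nrmS (f_ k \- g_ k) @[k --> \oo] --> nrmS (t \- s).
  apply: (cvg_normL2 mbd (fun k => L2B mbd (LSf k) (LSg k)) (L2B mbd Lt Ls)).
  apply: (@squeeze_cvgr _ _ _ _ (cst 0) (fun k => nrmS (t \- f_ k) + nrmS (s \- g_ k))); last first.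
  - by rewrite -[0]addr0; exact: cvgD.
  - exact: cvg_cst.
  apply: nearW => k; rewrite normL2_ge0 /=.
  apply: le_trans (normL2B mbd (L2B mbd Lt (LSf k)) (L2B mbd Ls (LSg k))).
  rewrite le_eqVlt; apply/orP; left; apply/eqP; apply: eq_normL2 => x _ /=; ring.
have sqr (x_ : nat -> R) (l : R) : x_ k @[k --> \oo] --> l -> (fun k => x_ k ^+ 2) @ \oo --> l ^+ 2.
  by move=> cx; rewrite expr2; under eq_fun do rewrite expr2; exact: cvgM.
have cL := sqr _ _ c3.
have cR : (fun k => e * (\sum_i nrm (pderiv (f_ k) i \- pderiv (g_ k) i) ^+ 2) + C * nrm (f_ k \- g_ k) ^+ 2) @ \oo -->
    e * \sum_k nrm (p k \- q k) ^+ 2 + C * nrm (u \- v) ^+ 2.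
  apply: cvgD; apply: cvgM; [exact: cvg_cst| |exact: cvg_cst|exact: sqr].
  by apply: (@cvg_sum_seq R _ _ (fun i k => nrm (pderiv (f_ k) i \- pderiv (g_ k) i) ^+ 2) (fun i => nrm (p i \- q i) ^+ 2)) => i; exact: sqr.
apply: (ler_cvg_to cL cR); apply: nearW => k.
have := HC (f_ k \- g_ k) (smoothB (sf k) (sg k)).
rewrite (eq_bigr (fun i => nrm (pderiv (f_ k) i \- pderiv (g_ k) i) ^+ 2))// => i _.
congr (_ ^+ 2); apply: eq_normL2 => x _.
by rewrite /pderiv deriveB//; apply: diff_derivable; exact: smooth_differentiable.
Qed.

(** Smooth approximations at rate 1/(k + 1) have boundary values that are Cauchy by [trace_ineq],
    and L^2 of the boundary is complete. *)
Lemma trace_exists u p : H1 u p -> exists t, is_trace Om S u t.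
Proof.
move=> Hu; have Lp i := H1_gradL2 i Hu.
have /choice[f_ Hf] : forall k : nat, exists Phi, [/\ smooth Phi, nrm (u \- Phi) <= k.+1%:R^-1 &
    forall i, nrm (p i \- pderiv Phi i) <= k.+1%:R^-1].
  move=> k; have k0 : 0 < k.+1%:R^-1 :> R by rewrite invr_gt0.
  by have [Phi [sP _ P1 P2]] := smooth_approx oO bO Hcone (H1_L2 Hu) Hu.2 k0; exists Phi.
have sf k : smooth (f_ k) by have [] := Hf k.
have Lf k := smooth_L2O (sf k); have Ldf k i := smooth_L2O (smooth_pderiv i (sf k)).
have LSf k := smooth_L2bd (sf k).
have inv0 (x_ : nat -> R) : (forall k, 0 <= x_ k <= k.+1%:R^-1) -> x_ k @[k --> \oo] --> 0.
  move=> Hx; apply: (@squeeze_cvgr _ _ _ _ (cst 0) (fun k => k.+1%:R^-1)).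
  - by apply: nearW => k; exact: Hx.
  - exact: cvg_cst.
  - exact: cvg_harmonic.
have cf : H1_cvg f_ (fun k => pderiv (f_ k)) u p.
  by split=> [|i]; apply: inv0 => k; rewrite normL2_ge0 /=; have [_ h1 h2] := Hf k.
have [C C0 HC] := trace_ineq ltr01.
pose B := n.+1%:R + C; have B0 : 0 < B by rewrite ltr_pwDl.
have Hd k l : nrmS (f_ k \- f_ l) ^+ 2 <= B * (k.+1%:R^-1 + l.+1%:R^-1) ^+ 2.
  have tri w w' w'' : L2O w -> L2O w' -> L2O w'' -> nrm (w \- w') <= k.+1%:R^-1 -> nrm (w \- w'') <= l.+1%:R^-1 ->
      nrm (w' \- w'') ^+ 2 <= (k.+1%:R^-1 + l.+1%:R^-1) ^+ 2.
    move=> Lw Lw' Lw'' h1 h2; rewrite ler_sqr ?nnegrE ?normL2_ge0 ?addr_ge0 ?invr_ge0//.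
    by apply: (le_trans (normL2_triangle mO Lw' Lw Lw'')); rewrite normL2_distC lerD.
  have [_ k1 k2] := Hf k; have [_ l1 l2] := Hf l.
  apply: (le_trans (HC _ (smoothB (sf k) (sf l)))); rewrite mul1r /B mulrDl; apply: lerD.
    rewrite mulr_natl -[X in _ *+ X](card_ord n.+1) -sumr_const; apply: ler_sum => i _.
    rewrite (@eq_normL2 _ _ _ _ _ _ (pderiv (f_ k) i \- pderiv (f_ l) i)); first exact: tri (Lp i) _ _ (k2 i) (l2 i).
    by move=> x _; rewrite /pderiv deriveB//; apply: diff_derivable; exact: smooth_differentiable.
  by rewrite ler_wpM2l//; exact: tri (H1_L2 Hu) _ _ k1 l1.
have [t Lt ct] : exists2 t, L2S t & nrmS (t \- f_ k) @[k --> \oo] --> 0.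
  apply: (L2_complete mbd LSf) => e e0.
  pose d := e / (2 * (B + 1)); have d0 : 0 < d by rewrite divr_gt0// mulr_gt0// ltr_wpDl// ltW.
  exists (Num.truncn d^-1) => // M /= HM k l Mk Ml.
  have small j : (M <= j)%N -> j.+1%:R^-1 <= d.
    move=> Mj; rewrite -[leRHS]invrK lef_pV2 ?posrE ?invr_gt0//.
    by rewrite (le_trans (ltW (truncnS_gt _)))// ler_nat ltnS (leq_trans HM).
  rewrite -ler_sqr ?nnegrE ?normL2_ge0 ?(ltW e0)//; apply: (le_trans (Hd k l)).
  apply: (@le_trans _ _ ((B + 1) ^+ 2 * (d + d) ^+ 2)).
    apply: ler_pM; rewrite ?sqr_ge0 ?(ltW B0)//.
      by have := ltW B0; nra.
    by rewrite ler_sqr ?nnegrE ?addr_ge0 ?invr_ge0 ?(ltW d0)// lerD ?small.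
  by rewrite -exprMn le_eqVlt; apply/orP; left; apply/eqP; congr (_ ^+ 2); rewrite /d; field; rewrite gt_eqF// ltr_wpDl// ltW.
by exists t; exact: is_trace_of_cvg Hu Lt sf cf ct.
Qed.

Lemma traceP u p : H1 u p -> is_trace Om S u (trace Om S u).
Proof. by move=> /trace_exists[t tu]; apply: (xgetPex (cst 0)); exists t. Qed.

End traces.

(** * The boundary collar *)

Section collar_distance.
Context {R : realType} {n : nat} (Om : set 'rV[R]_n.+1).
Local Notation E := 'rV[R]_n.+1.
Hypotheses (oO : open Om) (bO : bounded_set Om) (sO : smooth_bdry Om).
Implicit Types (v w x z : E) (e t : R).

Lemma sqr_dist_continuous z : continuous (fun x : E => dotv (z - x) (z - x)).
Proof.
rewrite (_ : (fun x => _) = fun x : E => \sum_j (z ord0 j - x ord0 j) * (z ord0 j - x ord0 j)).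
  apply: smooth_continuous; apply: smooth_sum => j _.
  have s : smooth (fun x : E => z ord0 j - x ord0 j) := smoothB (smooth_cst _) (smooth_coord j).
  exact: (smoothM s s).
by apply/funext => x; rewrite /dotv; apply: eq_bigr => j _; rewrite !mxE.
Qed.

Lemma bdry_compact : compact (bdry Om).
Proof.
apply: (subclosed_compact _ (closure_compact bO)); last by move=> x [].
rewrite /bdry setDE; apply: closedI; first exact: closed_closure.
by apply: open_closedC; exact: open_interior.
Qed.

(** A segment that avoids the boundary meets Om and its closure in the same set of parameters, which
    is then open and closed in a connected interval. *)
Lemma segment_in z w : Om z -> (forall t, 0 <= t <= 1 -> ~ bdry Om (z + t *: (w - z))) -> Om w.
Proof.
move=> Oz H; pose c t := z + t *: (w - z).
have cc : continuous c.
  by move=> t; apply: cvgD; [exact: cvg_cst|apply: cvgZr_tmp; exact: cvg_id].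
have /(_ (`[0, 1] `&` c @^-1` Om)) := @segment_connected R 0 1.
have e : `[0, 1] `&` c @^-1` Om = `[0, 1] `&` c @^-1` (closure Om) :> set R.
  apply/seteqP; split=> t [t01 Ot]; split=> //; first exact: subset_closure.
  apply: contrapT => nO; apply: (H t); first by move: t01; rewrite /= in_itv.
  exact: closure_bdry.
have h0 : (`[0, 1] `&` c @^-1` Om) !=set0.
  by exists 0; split; rewrite /= ?in_itv /= ?lexx ?ler01// /c scale0r addr0.
move=> /(_ h0) E01'; have E01 : `[0, 1] `&` c @^-1` Om = `[0, 1]%classic :> set R.
  apply: E01'.
    by exists (c @^-1` Om) => //; apply: open_comp => // t _; exact: cc.
  by exists (c @^-1` (closure Om)) => //; apply: closed_comp => [t _|]; [exact: cc|exact: closed_closure]. have : (`[0, 1]%classic : set R) 1 by rewrite /= in_itv /= ler01 lexx.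
by rewrite -E01 => -[_]; rewrite /c /= scale1r subrKC.
Qed.

Lemma dotvBl u v w : dotv (u - v) w = dotv u w - dotv v w.
Proof. by rewrite dotvDl -scaleN1r dotvZl mulN1r. Qed.

Lemma dotvBr u v w : dotv w (u - v) = dotv w u - dotv w v.
Proof. by rewrite dotvC dotvBl !(dotvC w). Qed.

Lemma sqr_dotv_le v w : dotv v w ^+ 2 <= dotv v v * dotv w w.
Proof.
have := dotv_ge0 (dotv v v *: w - dotv v w *: v).
rewrite dotvBl !dotvBr !dotvZl !dotvZr (dotvC w v).
have [v0 _|v0 H] := eqVneq (dotv v v) 0.
  by rewrite v0 mul0r (_ : dotv v w = 0) ?expr0n// (dotv_eq0 v0) /dotv big1// => j _; rewrite mxE mul0r.
have {}v0 : 0 < dotv v v by rewrite lt_neqAle eq_sym v0 dotv_ge0.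
rewrite -(ler_pM2l v0) -subr_ge0; apply: le_trans H _; rewrite le_eqVlt; apply/orP; left; apply/eqP; ring.
Qed.

(** Let x be a boundary point nearest to z. The open ball around z of radius |z - x| lies in Om, and
    touching the boundary at x it forces z - x to be a negative multiple of the outward normal. The
    collar is thus a Euclidean distance neighbourhood for every e, and in particular open. *)
Lemma collarP e : 0 < e -> Om `&` collar Om e =
  Om `&` [set z | exists2 x, bdry Om x & dotv (z - x) (z - x) < e ^+ 2].
Proof.
move=> e0; apply/seteqP; split=> z [Oz Hz]; split => //.
  have [x [s [bx /andP[s0 se] zE]]] := Hz; exists x => //.
  have [i [b [U [h [ch Ux]]]]] := sO bx; have [_ sh _] := ch.
  rewrite zE addrAC subrr add0r -scaleNr dotvZl dotvZr (outward_normal_chart oO ch Ux bx) chart_normal_norm//.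
  by rewrite mulr1 mulrNN -expr2 ltr_sqr ?nnegrE// ltW.
have [x1 bx1 x1e] := Hz.
have [x bx Hmin] : exists2 x, bdry Om x & forall y, bdry Om y -> dotv (z - x) (z - x) <= dotv (z - y) (z - y).
  have [|c] := @EVT_min_rV _ _ (fun x : E => dotv (z - x) (z - x)) _ (ex_intro _ x1 bx1) bdry_compact.
    by apply: continuous_subspaceT; exact: sqr_dist_continuous.
  by move=> /set_mem bc Hc; exists c => // y by_; apply: Hc; exact/mem_set.
pose d := Num.sqrt (dotv (z - x) (z - x)).
have d2 : dotv (z - x) (z - x) = d ^+ 2 by rewrite sqr_sqrtr// dotv_ge0.
have d0 : 0 < d.
  rewrite lt_neqAle sqrtr_ge0 andbT eq_sym; apply/eqP => d0; apply: (bdry_notin oO bx).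
  by move: d2; rewrite d0 expr0n /= => /dotv_eq0 /eqP; rewrite subr_eq0 => /eqP <-.
have de : d < e by rewrite -ltr_sqr ?nnegrE ?(ltW d0) ?(ltW e0)// -d2 (le_lt_trans (Hmin _ bx1)).
(* A boundary point on the segment from z to w would be nearer to z than x. *)
have ballO w : dotv (z - w) (z - w) < d ^+ 2 -> Om w.
  move=> wd; apply: (segment_in Oz) => t /andP[t0 t1] /Hmin; rewrite d2 leNgt => /negP; apply.
  rewrite opprD addNKr -scalerN opprB dotvZl dotvZr mulrA -expr2; apply: le_lt_trans wd.
  by rewrite ler_piMl ?dotv_ge0// exprn_ile1.
have [i [b [U [h [ch Ux]]]]] := sO bx; have [oU sh _] := ch.
pose g := level i b h; have sg : smooth g by exact: level_smooth.
have gx : g x = 0 by exact/(bdry_level oO ch Ux).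
(* From x, a direction v with (z - x).v > 0 enters the touching ball, hence Om, so the level
   function has a nonnegative derivative along v; [half_space_dir] concludes. *)
have dir : d^-1 *: (z - x) = (area_density h (col' i x))^-1 *: grad g x.
  apply: half_space_dir => //; [exact: area_density_gt0|exact: grad_level_norm|] => v wv.
  have [s s0 sU] : exists2 s : R, 0 < s & forall t, 0 < t < s -> U (x + t *: v).
    have : \forall t \near (0 : R), U (x + t *: v).
      have cl : (fun t : R => x + t *: v) t @[t --> (0 : R)] --> x.
        rewrite -[X in _ --> X]addr0 -(scale0r v); apply: cvgD; first exact: cvg_cst.
        by apply: cvgZr_tmp; exact: cvg_id.
      by apply: cl; exact: open_nbhs_nbhs.
    move=> /nbhs_ballP[s /= s0 Hs]; exists s => // t /andP[t0 ts]; apply: Hs.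
    by rewrite -ball_normE /= sub0r normrN gtr0_norm.
  (* For t < m one has t |v|^2 < (z - x).v, hence |z - x - t v|^2 < |z - x|^2. *)
  pose m := Num.min s (dotv (z - x) v / (dotv v v + 1)).
  have V0 : 0 < dotv v v + 1 by rewrite ltr_wpDl// dotv_ge0.
  have m0 : 0 < m by rewrite lt_min s0 divr_gt0.
  apply: (grad_dir_ge0 (smooth_differentiable x sg) gx m0) => t /andP[t0].
  rewrite lt_min => /andP[ts]; rewrite ltr_pdivlMr// => tv; apply/ltW.
  apply/(chart_levelP ch); first by apply: sU; rewrite t0.
  apply: ballO; rewrite -d2 opprD addrA; move: (z - x) wv tv => p wv tv; rewrite dotvBl !dotvBr !dotvZl !dotvZr (dotvC v).
  have := dotv_ge0 v; move: (dotv v v) (dotv p v) (dotv p p) V0 wv tv => V W Z *; nra.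
exists x, d; rewrite (ltW d0); split => //.
rewrite (outward_normal_chart oO ch Ux bx) chart_normal_grad// -/g -dir scalerN opprK scalerA divff ?gt_eqF// scale1r.
by rewrite subrKC.
Qed.

Lemma open_collar e : 0 < e -> open (Om `&` collar Om e).
Proof.
move=> e0; rewrite collarP//; apply: openI => //.
rewrite (_ : [set z | _] = \bigcup_(x in bdry Om) [set z : E | dotv (x - z) (x - z) < e ^+ 2]).
  apply: bigcup_open => x _.
  by apply: (open_comp (f := fun z : E => dotv (x - z) (x - z)) (D := [set t | t < e ^+ 2])) => //; move=> z _; exact: sqr_dist_continuous.
have sw (x z : E) : dotv (z - x) (z - x) = dotv (x - z) (x - z).
  by rewrite -opprB -scaleN1r dotvZl dotvZr !mulN1r opprK.
by apply/seteqP; split=> z [x bx H]; exists x => //=; move: H; rewrite sw.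
Qed.

End collar_distance.

(** * The collar in one chart *)

Section chart_collar.
Context {R : realType} {n : nat} (Om : set 'rV[R]_n.+1).
Local Notation E := 'rV[R]_n.+1.
Hypotheses (oO : open Om) (bO : bounded_set Om) (sO : smooth_bdry Om).
Implicit Types (v w x z : E) (e t : R) (eta : E -> R) (y : 'rV[R]_n).
Variables (i : 'I_n.+1) (b : bool) (h : 'rV[R]_n -> R) (a : E) (r : R).
Hypotheses (bh : bsupp h) (ch : bdry_chart Om i b [set x : E | `|x - a| < 2 * r] h).
Let sh : smooth h. Proof. by have [] := ch. Qed.
Let g := level i b h.
Let A := area_density h.

Lemma level_taylor : exists2 C : R, 0 <= C &
  forall z v, `|g (z + v) - g z - dotv (grad g z) v| <= C * dotv v v.
Proof.
have /choice[M HM] : forall jk : 'I_n * 'I_n, exists M : R, 0 <= M /\ forall y, `|pderiv (pderiv h jk.1) jk.2 y| <= M.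
  move=> [j k] /=; have sd := smooth_pderiv k (smooth_pderiv j sh).
  by have [M M0 HM] := bsupp_bounded (smooth_continuous sd) (bsupp_pderiv k (bsupp_pderiv j bh)); exists M.
have M0 : 0 <= \sum_jk M jk by apply: sumr_ge0 => jk _; have [] := HM jk.
exists (n%:R ^+ 2 * \sum_jk M jk) => [|z v]; first by rewrite mulr_ge0 ?sqr_ge0.
have H y (w : 'rV[R]_n) : `|h (y + w) - h y - \sum_k w ord0 k * pderiv h k y| <= n%:R ^+ 2 * (\sum_jk M jk) * `|w| ^+ 2.
  apply: (smooth_taylor sh M0) => j k u.
  by apply: le_trans (proj2 (HM (j, k)) u) _; rewrite (bigD1 (j, k))//= lerDl sumr_ge0// => jk _; have [] := HM jk.
have -> : g (z + v) - g z - dotv (grad g z) v =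
    - (-1) ^+ b * (h (col' i z + col' i v) - h (col' i z) - \sum_k (col' i v) ord0 k * pderiv h k (col' i z)).
  have vE : v = insert_coord i (v ord0 i) (col' i v) by rewrite insert_col'.
  rewrite /g grad_level// dotvZl [X in dotv _ X]vE dotv_insert /level col'D mxE mul1r.
  rewrite [in X in _ * (_ + X)](eq_bigr (fun k => - ((col' i v) ord0 k * pderiv h k (col' i z)))); last first.
    by move=> k _; rewrite mxE mulrC mulrN.
  by rewrite sumrN; move: ((-1) ^+ b) => s; ring.
rewrite mulNr normrN normrM normrX normrN1 expr1n mul1r; apply: le_trans (H _ _) _.
apply: ler_wpM2l; first by rewrite mulr_ge0 ?sqr_ge0.
apply: le_trans _ (dotv_norm_le v); rewrite ler_sqr ?nnegrE//; exact: col'_norm_le.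
Qed.

Variable C : R.
Hypotheses (C0 : 0 <= C) (HC : forall z v, `|g (z + v) - g z - dotv (grad g z) v| <= C * dotv v v).
Variable e : R.
Hypotheses (e0 : 0 < e) (er : e <= r).

(** Taylor at z with gradient of length A: a zero of the level function at distance less than e
    bounds its value at z, up to the quadratic remainder. *)
Lemma level_near z x : g x = 0 -> dotv (z - x) (z - x) < e ^+ 2 -> g z < A (col' i z) * e + C * e ^+ 2.
Proof.
move=> gx; rewrite -opprB -scaleN1r dotvZl dotvZr !mulN1r opprK => xz.
have := HC z (x - z); rewrite subrKC gx sub0r ler_norml => /andP[H _].
have : dotv (grad g z) (x - z) ^+ 2 < (A (col' i z) * e) ^+ 2.
  apply: le_lt_trans (sqr_dotv_le _ _) _.
  by rewrite /g grad_level_norm// exprMn ltr_pM2l// exprn_gt0// area_density_gt0.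
have A0 : 0 < A (col' i z) * e by rewrite mulr_gt0// area_density_gt0.
move: A0 xz H; move: (dotv (grad g z) _) (dotv _ _) (A _ * e) (g z) => p q T s A0 qe H pT.
have : - T < p by apply: contraTT pT; rewrite -!leNgt => h1; nra.
have : C * q <= C * e ^+ 2 by rewrite ler_wpM2l// ltW.
lra.
Qed.

(** Descend from z along the unit gradient. At distance e the level is at most g z - A e + C e^2 <
    0, so it vanishes at an intermediate point. *)
Lemma near_level z : 0 < g z -> g z < A (col' i z) * e - C * e ^+ 2 ->
  exists2 x, g x = 0 & dotv (z - x) (z - x) < e ^+ 2.
Proof.
move=> gz0 gz; pose w := (A (col' i z))^-1 *: grad g z.
have A0 := area_density_gt0 h (col' i z).
have ww : dotv w w = 1.
  rewrite /w dotvZl dotvZr /g grad_level_norm// /A; move: (area_density _ _) A0 => t t0; field; rewrite gt_eqF//.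
have gw : dotv (grad g z) w = A (col' i z).
  by rewrite /w dotvZr /g grad_level_norm// expr2 mulKf ?gt_eqF.
pose p t := g (z + (- t) *: w).
have cp : {within `[0, e], continuous p}.
  apply: continuous_subspaceT => t; apply: (@continuous_comp _ _ _ (fun t => z + (- t) *: w) g).
    by apply: cvgD; [exact: cvg_cst|apply: cvgZr_tmp; apply: cvgN; exact: cvg_id].
  by apply: smooth_continuous; exact: level_smooth.
have p0 : p 0 = g z by rewrite /p oppr0 scale0r addr0.
have pe : p e < 0.
  have := HC z ((- e) *: w); rewrite dotvZr gw dotvZl dotvZr ww mulr1 mulNr mulrNN ler_norml => /andP[_].
  rewrite -/(p e) -expr2; move: gz; rewrite (mulrC _ e); move: (e * _) (C * _) (g z) (p e) => *; lra.
have [|t] := @IVT R p 0 e 0 (ltW e0) cp.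
  by rewrite p0 ge_min le_max (ltW pe) (ltW gz0) orbT.
rewrite in_itv /= => /andP[t0 te] pt.
exists (z + (- t) *: w) => //; rewrite opprD addNKr -scaleNr opprK dotvZl dotvZr ww mulr1 -expr2.
rewrite ltr_sqr ?nnegrE ?(ltW e0)// lt_neqAle te andbT.
by apply: contraTneq pe => te'; rewrite -te' pt ltxx.
Qed.

(** The condition [e <= r] keeps the nearby boundary point inside the double ball, where the chart
    identifies the boundary with the zero set. *)
Lemma collar_level z : `|z - a| < r -> (Om `&` collar Om e) z -> 0 < g z < A (col' i z) * e + C * e ^+ 2.
Proof.
rewrite collarP// => za [Oz [x bx xz]]; have r0 : 0 < r by exact: lt_le_trans e0 er.
have Uz : `|z - a| < 2 * r by apply: (lt_trans za); rewrite ltr_pMl// ltr1n.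
have xa : `|x - a| < 2 * r.
  rewrite -(subrK z x) -addrA (le_lt_trans (ler_normD _ _))// mulr2n mulrDl mul1r ltrD// distrC.
  apply: lt_le_trans er; rewrite -ltr_sqr ?nnegrE ?(ltW e0)//.
  exact: le_lt_trans (dotv_norm_le _) xz.
rewrite (level_near _ xz) ?andbT; first exact/(chart_levelP ch).
exact/(bdry_level oO ch).
Qed.

Lemma level_collar z : `|z - a| < r -> 0 < g z < A (col' i z) * e - C * e ^+ 2 -> (Om `&` collar Om e) z.
Proof.
move=> za /andP[gz0 /(near_level gz0)[x gx xz]]; have r0 : 0 < r by exact: lt_le_trans e0 er.
have Uz : `|z - a| < 2 * r by apply: (lt_trans za); rewrite ltr_pMl// ltr1n.
have xa : `|x - a| < 2 * r.
  rewrite -(subrK z x) -addrA (le_lt_trans (ler_normD _ _))// mulr2n mulrDl mul1r ltrD// distrC.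
  apply: lt_le_trans er; rewrite -ltr_sqr ?nnegrE ?(ltW e0)//.
  exact: le_lt_trans (dotv_norm_le _) xz.
rewrite collarP//; split; first exact/(chart_levelP ch).
by exists x => //; exact/(bdry_level oO ch).
Qed.

Local Notation leb := (lebesgue_rV n.+1).
Let Z eta : E -> R := fun x => \1_(Om `&` collar Om e) x * eta x.

Let mcol : measurable (Om `&` collar Om e).
Proof. by apply: open_measurable_rV; exact: open_collar. Qed.

Let mZ eta : continuous eta -> measurable_fun setT (Z eta).
Proof.
by move=> ceta; apply: measurable_funM; [exact: measurable_indic|exact: continuous_measurable_rV].
Qed.

Lemma integral_collar_chart eta : continuous eta -> (forall x, 0 <= eta x) ->
  (\int[leb]_(x in Om `&` collar Om e) (eta x)%:E =
   \int[lebesgue_rV n]_y \int[@lebesgue_measure R]_t (Z eta (insert_coord i (t + h y) y))%:E)%E.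
Proof.
move=> ceta eta0; transitivity (\int[leb]_x (Z eta x)%:E)%E.
  rewrite integral_mkcond; apply: eq_integral => x _; rewrite patchE /Z indicE.
  by case: (_ \in _); rewrite ?mul1r ?mul0r.
have Z0 x : (0 <= (Z eta x)%:E)%E by rewrite lee_fin mulr_ge0.
have mZ' : measurable_fun setT (EFin \o Z eta) by apply/measurable_EFinP; exact: mZ.
rewrite -(ge0_integral_shear i sh mZ' Z0) (@ge0_integral_rV_insert _ _ i).
- by apply: eq_integral => y _; apply: eq_integral => t _; rewrite shear_insert.
- by apply: (measurableT_comp mZ'); exact: measurable_shear.
- by move=> x; exact: Z0.
Qed.

Lemma measurable_signed_itv (c : R) : measurable [set t : R | (0 < (-1) ^+ b * t < c)%R].
Proof.
have cs : continuous (fun t : R => (-1) ^+ b * t) by move=> t; apply: cvgM; [exact: cvg_cst|exact: cvg_id].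
apply: open_measurable; rewrite (_ : [set t | _] = (fun t : R => (-1) ^+ b * t) @^-1` `]0, c[%classic).
  by apply: open_comp => // t _; exact: cs.
by apply/seteqP; split=> t; rewrite /= in_itv.
Qed.

Lemma lebesgue_signed_itv (c : R) : 0 <= c ->
  (@lebesgue_measure R [set t : R | (0 < (-1) ^+ b * t < c)%R] = c%:E)%E.
Proof.
move=> c0; case: b; rewrite ?expr1 ?expr0.
  rewrite (_ : [set t | _] = `]- c, 0[%classic); last first.
    by apply/seteqP; split=> t; rewrite /= in_itv /= mulN1r oppr_gt0 ltrNl andbC.
  rewrite lebesgue_measure_itv /= lte_fin oppr_lt0; case: ltP => c0'; first by rewrite -EFinB sub0r opprK.
  by congr EFin; apply/eqP; rewrite eq_le c0.
rewrite (_ : [set t | _] = `]0, c[%classic); last first.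
  by apply/seteqP; split=> t; rewrite /= in_itv /= mul1r.
rewrite lebesgue_measure_itv /= lte_fin; case: ltP => c0'; first by rewrite -EFinB subr0.
by congr EFin; apply/eqP; rewrite eq_le c0.
Qed.

Lemma integral_signed_itv (c K : R) : 0 <= c ->
  (\int[@lebesgue_measure R]_t (K * \1_[set t : R | (0 < (-1) ^+ b * t < c)%R] t)%:E = (K * c)%:E)%E.
Proof.
move=> c0; pose D := [set t : R | (0 < (-1) ^+ b * t < c)%R].
have mD : measurable D by exact: measurable_signed_itv.
rewrite EFinM -(lebesgue_signed_itv c0).
transitivity (\int[@lebesgue_measure R]_(t in D) (cst K%:E t))%E; last by rewrite integral_cst.
rewrite [RHS]integral_mkcond.
by apply: eq_integral => t _; rewrite patchE indicE -/D; case: (_ \in D); rewrite ?mulr1 ?mulr0.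
Qed.

Let mline y eta : continuous eta ->
  measurable_fun setT (fun t : measurableTypeR R => (Z eta (insert_coord i (t + h y) y))%:E).
Proof.
move=> ceta; apply/measurable_EFinP; apply: (measurableT_comp (mZ ceta)).
apply: (measurableT_comp (f := fun p : measurableTypeR R * 'rV[R]_n => insert_coord i p.1 p.2)
  (g := fun t : measurableTypeR R => (t + h y, y))); first exact: measurable_insert.
apply/measurable_fun_pairP; split; last exact: measurable_cst.
exact: (@measurable_funD _ (measurableTypeR R) R setT id (cst (h y))).
Qed.

Let mitv (c K : R) : measurable_fun setT
  (fun t : measurableTypeR R => (K * \1_[set t : R | (0 < (-1) ^+ b * t < c)%R] t)%:E).
Proof.
by apply/measurable_EFinP; apply: measurable_funM => //; apply: measurable_indic; exact: measurable_signed_itv.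
Qed.

Let level_line t y : g (insert_coord i (t + h y) y) = (-1) ^+ b * t.
Proof. by rewrite /g level_insert addrK. Qed.

Variables (eta : E -> R).
Hypotheses (seta : smooth eta) (eta_r : forall x, eta x != 0 -> `|x - a| < r) (eta0 : forall x, 0 <= eta x).

(** By [collar_level] the slice of the collar over y, within the support of eta, lies in an interval
    of length A e + C e^2; the companion bound from below uses the inner interval of length A e - C
    e^2. *)
Lemma slice_collar_le y (K : R) : (forall t, 0 < (-1) ^+ b * t < A y * e + C * e ^+ 2 ->
    eta (insert_coord i (t + h y) y) <= K) -> 0 <= K ->
  (\int[@lebesgue_measure R]_t (Z eta (insert_coord i (t + h y) y))%:E <= (K * (A y * e + C * e ^+ 2))%:E)%E.
Proof.
move=> HK K0; rewrite -integral_signed_itv; last first.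
  by rewrite addr_ge0 ?mulr_ge0 ?sqr_ge0 ?(ltW e0)// ltW// area_density_gt0.
apply: ge0_le_integral => //.
- by move=> t _; rewrite lee_fin mulr_ge0.
- by apply: mline; exact: smooth_continuous.
move=> t _; rewrite lee_fin /Z !indicE; set z := insert_coord _ _ _.
have [->|ez] := eqVneq (eta z) 0; first by rewrite mulr0 mulr_ge0.
case: (boolP (z \in _)) => [/set_mem zC|_]; last by rewrite mul0r mulr_ge0.
have := collar_level (eta_r ez) zC; rewrite level_line col'_insert => tT.
by rewrite mem_set// mul1r mulr1 HK.
Qed.

Lemma slice_collar_ge y (K : R) : (forall t, 0 < (-1) ^+ b * t < A y * e - C * e ^+ 2 ->
    K <= eta (insert_coord i (t + h y) y)) -> 0 < K -> 0 <= A y * e - C * e ^+ 2 ->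
  ((K * (A y * e - C * e ^+ 2))%:E <= \int[@lebesgue_measure R]_t (Z eta (insert_coord i (t + h y) y))%:E)%E.
Proof.
move=> HK K0 T0; rewrite -integral_signed_itv//.
apply: ge0_le_integral => //.
- by move=> t _; rewrite lee_fin mulr_ge0// ltW.
- by apply: mline; exact: smooth_continuous.
move=> t _; rewrite lee_fin /Z !indicE; set z := insert_coord _ _ _.
case: (boolP (t \in _)) => [/set_mem /= tT|_]; last by rewrite mulr0 mulr_ge0.
have Kz := HK _ tT; rewrite mem_set ?mul1r ?mulr1//.
apply: level_collar; first by apply: eta_r; rewrite gt_eqF// (lt_le_trans K0 Kz).
by rewrite level_line col'_insert.
Qed.

Lemma measurable_slice_collar : measurable_fun setT
  (fun y => \int[@lebesgue_measure R]_t (Z eta (insert_coord i (t + h y) y))%:E)%E.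
Proof.
pose F (p : measurableTypeR R * 'rV[R]_n) := (Z eta (shear i h (insert_coord i p.1 p.2)))%:E.
have mF : measurable_fun setT F.
  apply/measurable_EFinP; apply: measurableT_comp; first exact: (mZ (smooth_continuous seta)).
  by apply: measurableT_comp; [exact: measurable_shear|exact: measurable_insert].
rewrite (_ : (fun y => _) = fubini_G (@lebesgue_measure R) F).
  by apply: measurable_fun_fubini_tonelli_G => // p; rewrite lee_fin mulr_ge0.
by apply/funext => y; apply: eq_integral => t _; rewrite /F shear_insert.
Qed.

Let J y := (\int[@lebesgue_measure R]_t (Z eta (insert_coord i (t + h y) y))%:E)%E.
Let J0 y : (0 <= J y)%E.
Proof. by apply: integral_ge0 => t _; rewrite lee_fin mulr_ge0. Qed.

Let collarE : (\int[leb]_(x in Om `&` collar Om e) (eta x)%:E = \int[lebesgue_rV n]_y J y)%E.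
Proof. by rewrite integral_collar_chart//; exact: smooth_continuous. Qed.

Lemma integral_collar_le (G : 'rV[R]_n -> \bar R) : measurable_fun setT G ->
  (forall y, (J y <= G y)%E) ->
  (\int[leb]_(x in Om `&` collar Om e) (eta x)%:E <= \int[lebesgue_rV n]_y G y)%E.
Proof.
move=> mG JG; rewrite collarE; apply: ge0_le_integral => //.
exact: measurable_slice_collar.
Qed.

Lemma integral_collar_ge (G H : 'rV[R]_n -> \bar R) : measurable_fun setT G -> measurable_fun setT H ->
  (forall y, 0 <= G y)%E -> (forall y, 0 <= H y)%E -> (forall y, (G y <= J y + H y)%E) ->
  (\int[lebesgue_rV n]_y G y <= \int[leb]_(x in Om `&` collar Om e) (eta x)%:E + \int[lebesgue_rV n]_y H y)%E.
Proof.
move=> mG mH G0 H0 GJ; have mJ := measurable_slice_collar; rewrite collarE -ge0_integralD//.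
  by apply: ge0_le_integral => //; apply: emeasurable_funD.
Qed.

End chart_collar.

Section chart_collar_estimates.
Context {R : realType} {n : nat} (Om : set 'rV[R]_n.+1).
Local Notation E := 'rV[R]_n.+1.
Local Notation leb := (lebesgue_rV n.+1).
Hypotheses (oO : open Om) (bO : bounded_set Om) (sO : smooth_bdry Om).
Implicit Types (v w x z : E) (e t : R) (eta : E -> R) (y : 'rV[R]_n).
Variables (i : 'I_n.+1) (b : bool) (h : 'rV[R]_n -> R) (a : E) (r : R).
Hypotheses (bh : bsupp h) (ch : bdry_chart Om i b [set x : E | `|x - a| < 2 * r] h) (r0 : 0 < r).
Let sh : smooth h. Proof. by have [] := ch. Qed.
Let A := area_density h.

Let supp_bsupp eta : (forall x, eta x != 0 -> `|x - a| < r) -> forall x, `|a| + r <= `|x| -> eta x = 0.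
Proof.
move=> H x; apply: contraTeq => /H xa; rewrite -ltNge -(subrK a x) addrC.
by apply: (le_lt_trans (ler_normD _ _)); rewrite ltrD2l.
Qed.

Let area_bound : exists2 K : R, 1 <= K & forall y, `|y| <= `|a| + r -> A y <= K.
Proof.
have cA := smooth_continuous (area_density_smooth sh).
have [K K0 HK] := compact_bounded_fun (@closed_ball_rV_compact R n (`|a| + r)) (fun y _ => cA y).
by exists (1 + K) => [|y ya]; [rewrite lerDl|apply: le_trans (ler_norm _) (le_trans (HK y ya) _); rewrite lerDr].
Qed.

Let norm_slice t y : `|y| <= `|insert_coord i t y|.
Proof. by rewrite -[X in `|X| <= _](col'_insert i t y); exact: col'_norm_le. Qed.

(** Over each y the slice integral is e A times the boundary value of eta, up to order e^2: the
    length of the slice is known to that order, and eta varies by order e along it. Integrating in y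
    over a bounded set keeps the order. *)
Lemma collar_chart_cvg (S : {measure set E -> \bar R}) eta : surface_measure Om S -> smooth eta ->
  (forall x, eta x != 0 -> `|x - a| < r) -> (forall x, 0 <= eta x) ->
  exists2 C : R, 0 <= C & forall e, 0 < e -> e <= r -> e <= 1 ->
  `|\int[leb]_(x in Om `&` collar Om e) eta x - e * \int[S]_(x in bdry Om) eta x| <= C * e ^+ 2.
Proof.
move=> sS seta eta_r eta0.
have eta_out := supp_bsupp eta_r.
have beta : bsupp eta by exists (`|a| + r) => x /ltW; exact: eta_out.
have ceta := smooth_continuous seta.
have [L L0 HL] := smooth_lipschitz seta beta.
have [M M0 HM] := bsupp_bounded ceta beta.
have [C C0 HC] := level_taylor bh ch.
have [K K1 HK] := area_bound.
pose B := [set y : 'rV[R]_n | `|y| <= `|a| + r].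
have mB : measurable B by apply: closed_measurable_rV; exact: closed_ball_rV_closed.
have Boo : (lebesgue_rV n B < +oo)%E.
  by apply: bounded_lebesgue_fin => //; exists (`|a| + r); split; [exact: num_real|move=> x xr y yB; apply: le_trans yB (ltW xr)].
pose lB := fine (lebesgue_rV n B).
have lBE : lebesgue_rV n B = lB%:E by rewrite fineK// ge0_fin_numE.
(* C M accounts for the uncertain length C e^2 of the slice; L (K + C)^2 for the Lipschitz variation
   over a slice of length at most (K + C) e, where e <= 1 is used. *)
pose C1 := C * M + L * (K + C) ^+ 2.
have C10 : 0 <= C1 by rewrite addr_ge0// mulr_ge0// sqr_ge0.
exists (C1 * lB) => [|e e0 er e1]; first by rewrite mulr_ge0// fine_ge0.
pose H0 y := eta (graph_pt i h y).
have H0E y : H0 y = eta (insert_coord i (0 + h y) y) by rewrite add0r.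
pose G y := e * (A y * H0 y).
have A0 y : 0 < A y := area_density_gt0 h y.
have G0 y : 0 <= G y := mulr_ge0 (ltW e0) (mulr_ge0 (ltW (A0 y)) (eta0 _)).
pose Q y := (C1 * e ^+ 2) * \1_B y.
have Q0 y : 0 <= Q y by rewrite mulr_ge0// mulr_ge0// sqr_ge0.
have mH0 : measurable_fun setT H0.
  by apply: (measurableT_comp (continuous_measurable_rV measurableT ceta)); exact: measurable_graph_pt.
have mA : measurable_fun setT A.
  by apply: continuous_measurable_rV => //; apply: smooth_continuous; exact: area_density_smooth.
have mG : measurable_fun setT (fun y => (G y)%:E).
  by apply/measurable_EFinP; apply: measurable_funM => //; apply: measurable_funM.
have mQ : measurable_fun setT (fun y => (Q y)%:E).
  by apply/measurable_EFinP; apply: measurable_funM => //; exact: measurable_indic.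
have lip t y : `|eta (insert_coord i (t + h y) y) - H0 y| <= L * `|t|.
  rewrite H0E; apply: le_trans (HL _ _) _; rewrite ler_wpM2l//.
  rewrite (insert_coord_line i (t + h y)) (insert_coord_line i (0 + h y)) opprD addrACA subrr !add0r -scalerBl addrK normrZ ler_piMr//.
  by apply/(rV_norm_le _ ler01) => k; rewrite mxE; case: (_ && _); rewrite ?normr1 ?normr0.
have out y t : ~ B y -> eta (insert_coord i t y) = 0.
  by move=> /negP; rewrite -ltNge => /ltW yB; apply: eta_out; apply: le_trans yB _.
have absE t : 0 < (-1) ^+ b * t -> `|t| = (-1) ^+ b * t.
  by move=> t0; rewrite -(gtr0_norm t0) normrM normrX normrN1 expr1n mul1r.
have upper y : (\int[@lebesgue_measure R]_t (\1_(Om `&` collar Om e) (insert_coord i (t + h y) y) *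
    eta (insert_coord i (t + h y) y))%:E <= (G y + Q y)%:E)%E.
  have [By|nBy] := pselect (B y); last first.
    rewrite integral0_eq ?lee_fin ?addr_ge0// => t _; by rewrite out// mulr0.
  pose T := A y * e + C * e ^+ 2.
  have T0 : 0 <= T by rewrite addr_ge0 ?mulr_ge0 ?sqr_ge0 ?(ltW e0) ?(ltW (A0 y)).
  apply: le_trans (@slice_collar_le _ _ _ oO bO sO _ _ _ _ _ ch _ C0 HC _ e0 er _ seta eta_r eta0 y (H0 y + L * T) _ _) _.
  - move=> t /andP[t0 tT]; have := lip t y; rewrite ler_norml => /andP[_]; rewrite lerBlDl => /le_trans; apply.
    by rewrite lerD2l ler_wpM2l// absE// ltW.
  - by rewrite addr_ge0 ?mulr_ge0 ?eta0.
  rewrite lee_fin -/T /G /Q indicE mem_set//= mulr1.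
  have := HK _ By; have := A0 y; have := eta0 (graph_pt i h y); have := HM (graph_pt i h y).
  rewrite -/(H0 y) /T /C1; move: (H0 y) (A y) => u v uM u0 v0 vK.
  have {}uM : u <= M := le_trans (ler_norm _) uM.
  have h1 : C * e ^+ 2 * u <= C * M * e ^+ 2 by rewrite mulrAC ler_wpM2r ?sqr_ge0// ler_wpM2l.
  have h2 : v * e + C * e ^+ 2 <= (K + C) * e.
    by rewrite mulrDl expr2 mulrA lerD ?ler_wpM2r ?(ltW e0)// ler_piMr// mulr_ge0 ?(ltW e0).
  have h3 : L * (v * e + C * e ^+ 2) ^+ 2 <= L * (K + C) ^+ 2 * e ^+ 2.
    have v1 : 0 <= v * e + C * e ^+ 2 by rewrite addr_ge0 ?mulr_ge0 ?sqr_ge0 ?(ltW e0) ?(ltW v0).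
    by rewrite -[leRHS]mulrA -exprMn ler_wpM2l// ler_sqr ?nnegrE// (le_trans v1 h2).
  rewrite -subr_ge0; apply: le_trans (_ : 0 <= (C * M * e ^+ 2 - C * e ^+ 2 * u) + (L * (K + C) ^+ 2 * e ^+ 2 - L * (v * e + C * e ^+ 2) ^+ 2)) _; first by rewrite addr_ge0 ?subr_ge0.
  by rewrite le_eqVlt; apply/orP; left; apply/eqP; ring.
have lower y : ((G y)%:E <= \int[@lebesgue_measure R]_t (\1_(Om `&` collar Om e) (insert_coord i (t + h y) y) *
    eta (insert_coord i (t + h y) y))%:E + (Q y)%:E)%E.
  have J0 : (0 <= \int[@lebesgue_measure R]_t (\1_(Om `&` collar Om e) (insert_coord i (t + h y) y) *
    eta (insert_coord i (t + h y) y))%:E)%E by apply: integral_ge0 => t _; rewrite lee_fin mulr_ge0.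
  have [By|nBy] := pselect (B y); last first.
    have -> : G y = 0 by rewrite /G H0E out// !mulr0.
    by apply: adde_ge0 => //; rewrite lee_fin.
  pose T := A y * e - C * e ^+ 2; pose k := H0 y - L * (A y * e).
  have QE : Q y = C * M * e ^+ 2 + L * (K + C) ^+ 2 * e ^+ 2 by rewrite /Q indicE mem_set// mulr1 /C1; ring.
  have u0 : 0 <= H0 y := eta0 _; have uM : H0 y <= M := le_trans (ler_norm _) (HM _).
  have v0 := A0 y; have vK := HK _ By.
  have h2 : L * (A y * e) ^+ 2 <= L * (K + C) ^+ 2 * e ^+ 2.
    rewrite -[leRHS]mulrA -exprMn ler_wpM2l// ler_sqr ?nnegrE ?mulr_ge0 ?(ltW e0) ?(ltW v0) ?addr_ge0//.
    - by rewrite ler_wpM2r ?(ltW e0)// (le_trans vK)// lerDl.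
    - by rewrite (le_trans ler01).
  have h1 : H0 y * (C * e ^+ 2) <= C * M * e ^+ 2 by rewrite mulrCA mulrA ler_wpM2r ?sqr_ge0// ler_wpM2l.
  have q0 : 0 <= C * M * e ^+ 2 by rewrite mulr_ge0 ?sqr_ge0// mulr_ge0.
  have Ae0 : 0 < A y * e by rewrite mulr_gt0.
  (* If T < 0, there is no inner interval, A e < C e^2 and [G y] is itself within the error. *)
  have [T0|T0] := leP 0 T; last first.
    rewrite -[leLHS]add0e; apply: leeD => //; rewrite lee_fin QE /G.
    have : H0 y * (A y * e) <= H0 y * (C * e ^+ 2) by rewrite ler_wpM2l// -subr_le0 ltW.
    move: h1 h2 (sqr_ge0 (A y * e)); move: (H0 y * (C * e ^+ 2)) (C * M * e ^+ 2) (L * (K + C) ^+ 2 * e ^+ 2) => p q s h1 h2 h3 h4.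
    have -> : e * (A y * H0 y) = H0 y * (A y * e) by ring.
    have : 0 <= L * (A y * e) ^+ 2 by rewrite mulr_ge0.
    move: (L * _) (H0 y * _) h1 h2 h4 => *; lra.
  (* If the lower bound k for eta is not positive, then H0 <= L A e and again [G y] is within the
     error. *)
  have [k0|k0] := ltP 0 k; last first.
    rewrite -[leLHS]add0e; apply: leeD => //; rewrite lee_fin QE /G.
    have : H0 y * (A y * e) <= L * (A y * e) ^+ 2.
      by rewrite expr2 [leRHS]mulrA ler_wpM2r ?(ltW Ae0)// -subr_le0.
    have -> : e * (A y * H0 y) = H0 y * (A y * e) by ring.
    move: h2 q0; move: (H0 y * _) (C * M * e ^+ 2) (L * (K + C) ^+ 2 * e ^+ 2) (L * _) => *; lra.
  apply: le_trans (leeD2r _ (@slice_collar_ge _ _ _ oO bO sO _ _ _ _ _ ch _ HC _ e0 er _ seta eta_r eta0 y k _ k0 T0)).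
    rewrite -EFinD lee_fin QE /G /k -/T.
    have : (H0 y - L * (A y * e)) * T = H0 y * (A y * e) - H0 y * (C * e ^+ 2) - L * (A y * e) ^+ 2 + L * (A y * e) * (C * e ^+ 2).
      by rewrite /T; ring.
    have -> : e * (A y * H0 y) = H0 y * (A y * e) by ring.
    move=> ->; have : 0 <= L * (A y * e) * (C * e ^+ 2) by rewrite mulr_ge0 ?(mulr_ge0 C0) ?sqr_ge0// mulr_ge0// ltW.
    move: h1 h2; move: (H0 y * (C * e ^+ 2)) (H0 y * (A y * e)) (C * M * e ^+ 2) (L * (K + C) ^+ 2 * e ^+ 2) (L * (A y * e) ^+ 2) (L * (A y * e) * (C * e ^+ 2)) => *; lra.
  move=> t /andP[t0 tT]; have := lip t y; rewrite ler_norml => /andP[h3 _].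
  have h4 : L * `|t| <= L * (A y * e).
    rewrite ler_wpM2l// absE//; apply: (le_trans (ltW tT)).
    by rewrite gerBl mulr_ge0 ?sqr_ge0.
  move: h3 h4; rewrite /k; move: (L * `|t|) (L * (A y * e)) (eta _) (H0 y) => *; lra.
have IQ : (\int[lebesgue_rV n]_y (Q y)%:E = (C1 * lB * e ^+ 2)%:E)%E.
  rewrite (_ : C1 * lB * e ^+ 2 = C1 * e ^+ 2 * lB); last by ring.
  rewrite EFinM -lBE; transitivity (\int[lebesgue_rV n]_(y in B) (cst (C1 * e ^+ 2)%:E y))%E; last by rewrite integral_cst.
  rewrite [RHS]integral_mkcond; apply: eq_integral => y _; rewrite patchE /Q indicE.
  by case: (_ \in B); rewrite ?mulr1 ?mulr0.
have mcol := open_measurable_rV (open_collar oO bO sO e0).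
have Lcol : L2 leb (Om `&` collar Om e) (cst 1).
  apply: (L2_bounded mcol (M := 1)) => //; last by move=> x _; rewrite normr1.
  by apply: le_lt_trans (open_lebesgue_fin oO bO); apply: le_measure; rewrite ?inE//; exact: open_measurable_rV.
have Lcole : L2 leb (Om `&` collar Om e) eta.
  apply: (L2_bounded mcol (M := M)) => //; last by apply: continuous_measurable_rV.
  by apply: le_lt_trans (open_lebesgue_fin oO bO); apply: le_measure; rewrite ?inE//; exact: open_measurable_rV.
have IE : (\int[leb]_(x in Om `&` collar Om e) (eta x)%:E = (\int[leb]_(x in Om `&` collar Om e) eta x)%:E)%E.
  have := dotL2_EFin mcol Lcole Lcol; rewrite /dotL2 (@eq_Rintegral _ _ _ _ _ eta) => [->|x _]; last by rewrite mulr1.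
  by apply: eq_integral => x _; rewrite mulr1.
have SE : (\int[lebesgue_rV n]_y (G y)%:E = (e * \int[S]_(x in bdry Om) eta x)%:E)%E.
  have r2 x : ~ `|x - a| < 2 * r -> eta x = 0.
    by move=> /negP; apply: contraNeq => /eta_r xa; apply: (lt_trans xa); rewrite ltr_pMl// ltr1n.
  rewrite EFinM (surface_integral oO ch sS (continuous_measurable_rV measurableT ceta) r2).
  have iG : (lebesgue_rV n).-integrable setT (fun y => (H0 y * A y)%:E).
    have := @slice_integrable R n i (fun x => eta (shear i h x)) A; rewrite /comp.
    move=> H; apply: eq_integrable (H _ _ _) => //.
    - by move=> y _; rewrite shear_graph mulrC.
    - by move=> x; apply: continuous_comp; [exact: continuous_shear|exact: ceta].
    - exact: shear_bsupp.
    - by apply: smooth_continuous; exact: area_density_smooth.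
  rewrite /Rintegral fineK; last by rewrite (integrable_fin_num _ iG).
  rewrite -ge0_integralZl_EFin ?(ltW e0)//.
  - by apply: eq_integral => y _; rewrite -EFinM /G [A y * _]mulrC.
  - by move=> y _; rewrite lee_fin mulr_ge0// ?eta0// ltW.
  - exact: measurable_int iG.
have up := integral_collar_le oO bO sO ch e0 seta eta0 (emeasurable_funD mG mQ) upper.
have lo := integral_collar_ge oO bO sO ch e0 seta eta0 mG mQ (fun y => G0 y) (fun y => Q0 y) lower.
have GQ : (\int[lebesgue_rV n]_y ((G y)%:E + (Q y)%:E) = (e * \int[S]_(x in bdry Om) eta x)%:E + (C1 * lB * e ^+ 2)%:E)%E.
  by rewrite (@ge0_integralD _ _ _ _ _ _ (fun y => (G y)%:E) (fun y => (Q y)%:E)) ?SE ?IQ// => y _; rewrite lee_fin.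
move: up lo; rewrite GQ IE SE IQ -!EFinD !lee_fin => up lo.
by rewrite ler_distl lerBlDr up lo.
Qed.

Lemma halfline_shift (F : measurableTypeR R -> \bar R) (c : R) : measurable_fun setT F ->
  (forall t, 0 <= F t)%E -> 0 < (-1) ^+ b * c ->
  (\int[@lebesgue_measure R]_(t in [set t : R | (0 < (-1) ^+ b * t)%R]) F (t + c)%R <=
   \int[@lebesgue_measure R]_(t in [set t : R | (0 < (-1) ^+ b * t)%R]) F t)%E.
Proof.
move=> mF F0 c0; pose D := [set t : R | (0 < (-1) ^+ b * t)%R].
have mD : measurable D.
  have cs : continuous (fun t : R => (-1) ^+ b * t) by move=> t; apply: cvgM; [exact: cvg_cst|exact: cvg_id].
  by apply: open_measurable; apply: (open_comp (f := fun t : R => (-1) ^+ b * t) (D := [set u | 0 < u])) => // t _; exact: cs.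
have mFD : measurable_fun setT (F \_ D).
  by apply/(measurable_restrictT _ mD); exact: measurable_funTS.
have FD0 t : (0 <= (F \_ D) t)%E by rewrite patchE; case: ifP.
have msh : measurable_fun setT (fun t : measurableTypeR R => (t + c : measurableTypeR R)).
  exact: (@measurable_funD _ (measurableTypeR R) R setT id (cst c)).
rewrite -/D integral_mkcond [leRHS]integral_mkcond -(ge0_integral_shift1 c mFD FD0).
apply: ge0_le_integral => //.
- by move=> t _; rewrite patchE; case: ifP.
- by apply/(measurable_restrictT _ mD); apply: measurable_funTS; exact: measurableT_comp.
- exact: measurableT_comp.
move=> t _; rewrite !patchE; case: ifP => [tD|_]; last by case: ifP.
by rewrite mem_set//; move: tD; rewrite inE /D /= mulrDr => tD; rewrite addr_gt0.
Qed.

(** Since eta has bounded support, its value is minus the integral of its derivative along the ray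
    pointing into the domain; the ray is part of the half-line that starts at the boundary. *)
Let line_derive_le eta (t : R) y : smooth eta -> bsupp eta -> 0 < (-1) ^+ b * t ->
  ((eta (insert_coord i (t + h y) y))%:E <=
   \int[@lebesgue_measure R]_(t in [set t : R | (0 < (-1) ^+ b * t)%R]) (`|pderiv eta i (insert_coord i (t + h y) y)|)%:E)%E.
Proof.
move=> seta [m Hm] t0; pose D := [set t : R | (0 < (-1) ^+ b * t)%R].
pose c := t + h y; pose F s := eta (insert_coord i (s + c) y); pose f s := pderiv eta i (insert_coord i (s + c) y).
have cins : continuous (fun s : R => insert_coord i (s + c) y).
  by move=> s; apply: (@continuous_comp _ _ _ (fun s : R => s + c) (fun s => insert_coord i s y)); [apply: cvgD; [exact: cvg_id|exact: cvg_cst]|exact: continuous_insert].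
have cf : continuous f.
  by move=> s; apply: continuous_comp; [exact: cins|exact: (smooth_continuous (smooth_pderiv i seta))].
have dF s : is_derive s (1 : R) F (f s).
  have d1 := @is_derive_insert _ _ eta i y (s + c) (smooth_differentiable _ seta).
  have d2 : is_derive s (1 : R) (fun s : R => s + c) 1 by apply: is_derive_eq; rewrite addr0.
  by have := @is_derive1_comp _ (fun s => eta (insert_coord i s y)) (fun s => s + c) s _ _ d1 d2; rewrite mulr1.
have F0 s : `|c| + m < `|s| -> F s = 0.
  move=> cs; apply: Hm; apply: lt_le_trans (insert_coord_norm i (s + c) y).
  by have := ler_normB (s + c) c; rewrite addrK; lra.
have := integral_is_derive_halfline b dF cf F0; rewrite -/D => FE.
have mcf : measurable_fun setT (f : measurableTypeR R -> R) by exact: continuous_measurable_fun.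
have mD : measurable D.
  have cs : continuous (fun t : R => (-1) ^+ b * t) by move=> u; apply: cvgM; [exact: cvg_cst|exact: cvg_id].
  by apply: open_measurable; apply: (open_comp (f := fun t : R => (-1) ^+ b * t) (D := [set u | 0 < u])) => // u _; exact: cs.
have -> : (eta (insert_coord i (t + h y) y))%:E = (F 0)%:E by rewrite /F add0r.
apply: (@le_trans _ _ (\int[@lebesgue_measure R]_(s in D) `|(f s)%:E|)%E).
  have mfD : measurable_fun D (EFin \o f) by apply/measurable_EFinP; exact: measurable_funTS.
  apply: le_trans _ (le_abse_integral (@lebesgue_measure R) mD mfD); rewrite [X in `|X|%E]FE.
  by rewrite abse_EFin lee_fin normrM normrN normrX normrN1 expr1n mul1r ler_norm.
have -> : (\int[@lebesgue_measure R]_(s in D) `|(f s)%:E| =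
    \int[@lebesgue_measure R]_(s in D) (`|pderiv eta i (insert_coord i (s + t + h y) y)|)%:E)%E.
  by apply: eq_integral => s _; rewrite abse_EFin /f /c addrA.
apply: (@halfline_shift (fun s => (`|pderiv eta i (insert_coord i (s + h y) y)|)%:E) t _ _ t0).
  apply/measurable_EFinP; apply: measurableT_comp => //; apply: continuous_measurable_fun.
  move=> s; apply: (@continuous_comp _ _ _ (fun s => insert_coord i (s + h y) y) (pderiv eta i)); last exact: (smooth_continuous (smooth_pderiv i seta)).
  by apply: (@continuous_comp _ _ _ (fun s : R => s + h y) (fun s => insert_coord i s y)); [apply: cvgD; [exact: cvg_id|exact: cvg_cst]|exact: continuous_insert].
by move=> s; rewrite lee_fin.
Qed.

(** On each line eta is at most the integral of |d_i eta| over the part inside the domain, while the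
    slice of the collar has length at most (K + C) e. Integrating in y yields a bound linear in
    e. *)
Lemma collar_chart_le : exists2 C : R, 0 <= C & forall eta e, smooth eta ->
  (forall x, eta x != 0 -> `|x - a| < r) -> (forall x, 0 <= eta x) -> 0 < e -> e <= r -> e <= 1 ->
  (\int[leb]_(x in Om `&` collar Om e) (eta x)%:E <=
   (C * e)%:E * \int[leb]_(x in Om) (`|pderiv eta i x|)%:E)%E.
Proof.
have [C C0 HC] := level_taylor bh ch; have [K K1 HK] := area_bound.
exists (K + C) => [|eta e seta eta_r eta0 e0 er e1]; first by rewrite addr_ge0// (le_trans ler01).
have eta_out := supp_bsupp eta_r.
have beta : bsupp eta by exists (`|a| + r) => x /ltW; exact: eta_out.
have ceta := smooth_continuous seta; have cd := smooth_continuous (smooth_pderiv i seta).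
pose D := [set t : R | (0 < (-1) ^+ b * t)%R].
pose P x := (`|pderiv eta i x| * \1_Om x)%:E.
have mP : measurable_fun setT P.
  apply/measurable_EFinP; apply: measurable_funM; last by apply: measurable_indic; exact: open_measurable_rV.
  by apply: measurableT_comp => //; exact: continuous_measurable_rV.
have P0 x : (0 <= P x)%E by rewrite lee_fin mulr_ge0.
have deta_out x : ~ `|x - a| < 2 * r -> pderiv eta i x = 0.
  move=> /negP; rewrite -leNgt => xr; apply: (@open_pderiv0 _ _ [set x : E | r < `|x - a|]).
  - apply: (open_comp (f := fun x : E => `|x - a|) (D := [set t | r < t])) => //; move=> z _.
    apply: (@continuous_comp _ _ _ (fun z : E => z - a) (fun z => `|z|)); last exact: norm_continuous.
    by apply: (nonexpansive_continuous (f := fun z : E => z - a)) => u v; rewrite opprD addrACA subrr addr0.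
  - by move=> z /= rz; apply/eqP; apply: contraTT rz => /eta_r; rewrite -leNgt => /ltW.
  - by apply: lt_le_trans xr; rewrite ltr_pMl// ltr1n.
pose G y := (\int[@lebesgue_measure R]_t P (insert_coord i (t + h y) y))%E.
have GE y : (\int[@lebesgue_measure R]_(t in D) (`|pderiv eta i (insert_coord i (t + h y) y)|)%:E = G y)%E.
  rewrite integral_mkcond; apply: eq_integral => t _; rewrite patchE /P indicE.
  set z := insert_coord _ _ _.
  have [az|/negP/deta_out ->] := boolP (`|z - a| < 2 * r); last by rewrite normr0 mul0r; case: ifP.
  rewrite (_ : (z \in Om) = (t \in D)); first by case: (t \in D); rewrite ?mulr1 ?mulr0.
  have := chart_levelP ch az; rewrite level_insert addrK => -[H1 H2].
  by apply/idP/idP => /set_mem ?; apply/mem_set; [exact: H1|exact: H2].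
have mG : measurable_fun setT G.
  pose F (p : measurableTypeR R * 'rV[R]_n) := P (shear i h (insert_coord i p.1 p.2)).
  rewrite (_ : G = fubini_G (@lebesgue_measure R) F).
    apply: measurable_fun_fubini_tonelli_G => [|p]; last exact: P0.
    apply: (measurableT_comp mP).
    by apply: measurableT_comp; [exact: measurable_shear|exact: measurable_insert].
  by apply/funext => y; apply: eq_integral => t _; rewrite /F shear_insert.
have IG : (\int[lebesgue_rV n]_y G y = \int[leb]_(x in Om) (`|pderiv eta i x|)%:E)%E.
  rewrite [RHS]integral_mkcond; transitivity (\int[leb]_x P x)%E.
    rewrite -(ge0_integral_shear i sh mP P0) (@ge0_integral_rV_insert _ _ i).
    - by apply: eq_integral => y _; apply: eq_integral => t _; rewrite shear_insert.
    - by apply: (measurableT_comp mP); exact: measurable_shear.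
    - by [].
  by apply: eq_integral => x _; rewrite patchE /P indicE; case: (_ \in Om); rewrite ?mulr1 ?mulr0.
have G0 y : (0 <= G y)%E by apply: integral_ge0.
have c0 : 0 <= (K + C) * e by rewrite mulr_ge0 ?(ltW e0)// addr_ge0// (le_trans ler01).
rewrite -IG -ge0_integralZl_EFin//.
apply: (integral_collar_le oO bO sO ch e0 seta eta0); first exact: measurable_funeM.
move=> y; have [yB|] := leP `|y| (`|a| + r); last first.
  move=> yB; rewrite integral0_eq ?mule_ge0// => t _; rewrite eta_out ?mulr0//.
  by apply: le_trans (ltW yB) _.
(* The slice bound takes a real constant; on a line with infinite integral there is nothing to
   prove. *)
have [Goo|] := eqVneq (G y) +oo%E.
  by rewrite Goo gt0_muley ?leey// lte_fin mulr_gt0// (lt_le_trans ltr01)// (le_trans K1) ?lerDl.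
rewrite -ltey => Goo; have GyE : G y = (fine (G y))%:E by rewrite fineK// ge0_fin_numE.
apply: le_trans (@slice_collar_le _ _ _ oO bO sO _ _ _ _ _ ch _ C0 HC _ e0 er _ seta eta_r eta0 y (fine (G y)) _ _) _.
- move=> t /andP[t0 _]; rewrite -lee_fin -GyE -GE; exact: line_derive_le.
- exact: fine_ge0.
suff le : A y * e + C * e ^+ 2 <= (K + C) * e.
  rewrite [in leRHS]GyE -EFinM lee_fin [leLHS]mulrC; apply: ler_wpM2r => //.
  by apply: fine_ge0; exact: G0.
rewrite [leRHS]mulrDl; apply: lerD.
  by rewrite ler_wpM2r ?(ltW e0)// HK.
by rewrite ler_wpM2l// expr2 ler_piMr// ltW.
Qed.

End chart_collar_estimates.

(** * Uniform collar estimates and the collar limit *)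

Section collar_estimates.
Context {R : realType} {n : nat}.
Local Notation E := 'rV[R]_n.+1.
Local Notation leb := (lebesgue_rV n.+1).
Variables (Om : set E) (S : {measure set E -> \bar R}).
Hypotheses (oO : open Om) (bO : bounded_set Om) (sO : smooth_bdry Om) (sS : surface_measure Om S).
Local Notation bd := (bdry Om).
Local Notation dot := (dotL2 leb Om).
Local Notation nrm := (normL2 leb Om).
Local Notation L2O := (L2 leb Om).
Local Notation dotS := (dotL2 S bd).
Local Notation nrmS := (normL2 S bd).
Local Notation L2S := (L2 S bd).
Local Notation mO := (measurable_open oO).
Local Notation mbd := (@measurable_bdry R n Om).
Local Notation col e := (Om `&` collar Om e).
Local Notation dotC e := (dotL2 leb (col e)).
Local Notation nrmC e := (normL2 leb (col e)).
Local Notation L2C e := (L2 leb (col e)).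
Implicit Types (f psi u v w t : E -> R) (p q : 'I_n.+1 -> E -> R) (e C M : R).

Variables (N : nat) (a : 'I_N -> E) (r : 'I_N -> R) (zeta : 'I_N -> E -> R).
Hypothesis Hpou : pou (closure Om) (loc Om) a r zeta.
Let Hcone : pou (closure Om) (cone Om) a r zeta := pou_imp (@loc_cone R n Om) Hpou.

Local Notation H1 := (H1 Om).

Lemma measurable_collar e : 0 < e -> measurable (col e).
Proof. by move=> e0; apply: open_measurable_rV; exact: open_collar. Qed.
Local Notation mC := measurable_collar.

Lemma L2_collar e w : 0 < e -> L2O w -> L2C e w /\ nrmC e w <= nrm w.
Proof. by move=> e0 Lw; apply: (normL2_sub (mC e0) mO _ Lw) => x []. Qed.

Let zeta_r j x : zeta j x != 0 -> `|x - a j| < r j := @pou_supp _ _ _ _ _ _ _ _ Hpou j x.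
Let sz j := pou_smooth Hpou j.

(** A patch whose double ball lies in Om keeps a distance of at least [r j] from the boundary, so
    thin collars miss it. *)
Let interior_collar j x e : (forall x, `|x - a j| < 2 * r j -> Om x) -> 0 < e -> e <= r j ->
  col e x -> zeta j x = 0.
Proof.
move=> HO e0 er; rewrite collarP// => -[_ [y by_ yx]]; apply/eqP; apply: contraT => /zeta_r xa.
exfalso; apply: (bdry_notin oO by_); apply: HO.
rewrite -(subrK x y) -addrA (le_lt_trans (ler_normD _ _))// mulr2n mulrDl mul1r ltrD// distrC.
apply: lt_le_trans er; rewrite -ltr_sqr ?nnegrE ?(ltW e0)//.
exact: le_lt_trans (dotv_norm_le _) yx.
Qed.

Let interior_bdry j x : (forall x, `|x - a j| < 2 * r j -> Om x) -> bd x -> zeta j x = 0.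
Proof.
move=> HO bx; apply/eqP; apply: contraT => /zeta_r xa; exfalso; apply: (bdry_notin oO bx); apply: HO.
have [_ rj _] := pou_loc Hpou j; apply: (lt_trans xa); rewrite ltr_pMl// ltr1n//.
Qed.

Let collar_cvg_pos psi : smooth psi -> (forall x, 0 <= psi x) ->
  exists2 e1 : R, 0 < e1 & exists2 C : R, 0 <= C & forall e, 0 < e -> e <= e1 ->
  `|\int[leb]_(x in col e) psi x - e * \int[S]_(x in bd) psi x| <= C * e ^+ 2.
Proof.
move=> sp p0; have se j : smooth (zeta j \* psi) := smoothM (sz j) sp.
have /choice[ec Hj] : forall j, exists ec : R * R, [/\ 0 < ec.1, 0 <= ec.2 & forall e, 0 < e -> e <= ec.1 ->
    `|\int[leb]_(x in col e) (zeta j x * psi x) - e * \int[S]_(x in bd) (zeta j x * psi x)| <= ec.2 * e ^+ 2].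
  move=> j; have [_ rj [HO|[i [b [h [bh ch]]]]]] := pou_loc Hpou j.
    exists (r j, 0); split => // e e0 er; rewrite mul0r.
    have z0 : \int[leb]_(x in col e) (zeta j x * psi x) = 0.
      rewrite (@eq_Rintegral _ _ _ _ _ (cst 0)) => [|x /set_mem xC]; last by rewrite (interior_collar HO e0 er xC) mul0r.
      by rewrite /Rintegral /= integral0_eq.
    have z1 : \int[S]_(x in bd) (zeta j x * psi x) = 0.
      rewrite (@eq_Rintegral _ _ _ _ _ (cst 0)) => [|x /set_mem bx]; last by rewrite (interior_bdry HO bx) mul0r.
      by rewrite /Rintegral /= integral0_eq.
    by rewrite z0 z1 mulr0 subrr normr0.
  have eta_r x : (zeta j \* psi) x != 0 -> `|x - a j| < r j by rewrite /= mulf_eq0 negb_or => /andP[/zeta_r].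
  have eta0 x : 0 <= (zeta j \* psi) x by rewrite mulr_ge0 ?(pou_ge0 Hpou).
  have [C C0 HC] := collar_chart_cvg oO bO sO bh ch rj sS (se j) eta_r eta0.
  exists (Num.min (r j) 1, C); split => //= [|e e0]; first by rewrite lt_min rj ltr01.
  by rewrite le_min => /andP[er e1]; exact: HC.
have [e1 e10 He1] := finite_pos_lb (fun j => (fun H => let: And3 h _ _ := H in h) (Hj j)).
exists e1 => //; exists (\sum_j (ec j).2) => [|e e0 ee1]; first by apply: sumr_ge0 => j _; have [] := Hj j.
have L1 : L2C e (cst 1) by apply: (L2_collar e0 (smooth_L2 oO bO (smooth_cst 1))).1.
have -> : \int[leb]_(x in col e) psi x = \sum_j \int[leb]_(x in col e) (zeta j x * psi x).
  transitivity (dotC e (fun x => \sum_j zeta j x * psi x) (cst 1)).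
    by apply: eq_Rintegral => x /set_mem[Ox _]; rewrite mulr1; exact: (pou_decomp Hpou psi (subset_closure Ox)).
  rewrite (dotL2_suml (mC e0)) => [|j _|//]; last by apply: (L2_collar e0 (smooth_L2 oO bO (se j))).1.
  by apply: eq_bigr => j _; apply: eq_Rintegral => x _; rewrite mulr1.
have -> : \int[S]_(x in bd) psi x = \sum_j \int[S]_(x in bd) (zeta j x * psi x).
  transitivity (dotS (fun x => \sum_j zeta j x * psi x) (cst 1)).
    by apply: eq_Rintegral => x /set_mem bx; rewrite mulr1; exact: (pou_decomp Hpou psi (bdry_closure bx)).
  rewrite (dotL2_suml mbd) => [|j _|]; last 2 first.
  - exact: (smooth_L2S oO bO sS Hpou (se j)).
  - exact: (smooth_L2S oO bO sS Hpou (smooth_cst 1)).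
  by apply: eq_bigr => j _; apply: eq_Rintegral => x _; rewrite mulr1.
rewrite mulr_sumr -sumrB mulr_suml; apply: le_trans (ler_norm_sum _ _ _) _.
by apply: ler_sum => j _; have [_ _ H] := Hj j; apply: H => //; exact: le_trans ee1 (He1 j).
Qed.

Lemma collar_cvg_smooth psi : smooth psi ->
  exists2 e1 : R, 0 < e1 & exists2 C : R, 0 <= C & forall e, 0 < e -> e <= e1 ->
  `|\int[leb]_(x in col e) psi x - e * \int[S]_(x in bd) psi x| <= C * e ^+ 2.
Proof.
(* The positive part of psi is not smooth; psi is instead the difference of the nonnegative smooth
   functions psi^2 + 1 + psi and psi^2 + 1. *)
move=> sp; pose f2 x := psi x * psi x + 1; pose f1 x := f2 x + psi x.
have s2 : smooth f2 by apply: smoothD; [exact: smoothM|exact: smooth_cst].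
have s1 : smooth f1 by exact: smoothD.
have [|e1 e10 [C1 C10 H1]] := collar_cvg_pos s1; first by move=> x; rewrite /f1 /f2; have := sqr_ge0 (psi x + 2^-1); nra.
have [|e2 e20 [C2 C20 H2]] := collar_cvg_pos s2; first by move=> x; rewrite addr_ge0// -expr2 sqr_ge0.
exists (Num.min e1 e2); first by rewrite lt_min e10.
exists (C1 + C2) => [|e e0]; first exact: addr_ge0.
rewrite le_min => /andP[ee1 ee2].
have L1 : L2C e (cst 1) by apply: (L2_collar e0 (smooth_L2 oO bO (smooth_cst 1))).1.
have Lc f : smooth f -> L2C e f by move=> sf; apply: (L2_collar e0 (smooth_L2 oO bO sf)).1.
have -> : \int[leb]_(x in col e) psi x = \int[leb]_(x in col e) f1 x - \int[leb]_(x in col e) f2 x.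
  have := dotL2Bl (mC e0) (Lc _ s1) (Lc _ s2) L1; rewrite /dotL2.
  under eq_Rintegral do rewrite mulr1 /= /f1 addrAC subrr add0r.
  by move=> ->; congr (_ - _); apply: eq_Rintegral => x _; rewrite mulr1.
have -> : \int[S]_(x in bd) psi x = \int[S]_(x in bd) f1 x - \int[S]_(x in bd) f2 x.
  have Ls f (sf : smooth f) := smooth_L2S oO bO sS Hpou sf.
  have := dotL2Bl mbd (Ls _ s1) (Ls _ s2) (Ls _ (smooth_cst 1)); rewrite /dotL2.
  under eq_Rintegral do rewrite mulr1 /= /f1 addrAC subrr add0r.
  by move=> ->; congr (_ - _); apply: eq_Rintegral => x _; rewrite mulr1.
have := H1 _ e0 ee1; have := H2 _ e0 ee2; rewrite mulrDl mulrBr.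
move: (\int[leb]_(x in _) f1 x) (\int[leb]_(x in _) f2 x) (e * _) (e * _) => A B D F h2 h1.
rewrite (_ : A - B - (D - F) = (A - D) - (B - F)); last by ring.
by apply: (le_trans (ler_normB _ _)); exact: lerD.
Qed.

Definition H1sq u p : R := nrm u ^+ 2 + \sum_k nrm (p k) ^+ 2.

Lemma H1sqE u p : H1sq u p = nrm u ^+ 2 + \sum_k nrm (p k) ^+ 2.
Proof. by []. Qed.

(** [collar_chart_le] applied to zeta_j psi^2. Its derivative is psi times a combination of psi and
    d_i psi, so Cauchy-Schwarz bounds the integral by the H^1 norm. *)
Lemma collar_ineq_smooth : exists2 e1 : R, 0 < e1 & exists2 C : R, 0 <= C & forall psi e, smooth psi ->
  0 < e -> e <= e1 -> nrmC e psi ^+ 2 <= C * e * H1sq psi (pderiv psi).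
Proof.
have [M0 M00 HM0] := contM_bound_fin oO bO (fun j => smooth_continuous (sz j)).
have [M1 M10 HM1] := contM_bound_fin oO bO (f := fun ji : 'I_N * 'I_n.+1 => pderiv (zeta ji.1) ji.2)
  (fun ji => smooth_continuous (smooth_pderiv ji.2 (sz ji.1))).
have /choice[ec Hj] : forall j, exists ec : R * R, [/\ 0 < ec.1, 0 <= ec.2 & forall psi e, smooth psi ->
    0 < e -> e <= ec.1 -> \int[leb]_(x in col e) (zeta j x * (psi x * psi x)) <= ec.2 * e * H1sq psi (pderiv psi)].
  move=> j; have [_ rj [HO|[i [b [h [bh ch]]]]]] := pou_loc Hpou j.
    exists (r j, 0); split => // psi e sp e0 er; rewrite !mul0r (@eq_Rintegral _ _ _ _ _ (cst 0)) => [|x /set_mem xC]; last by rewrite (interior_collar HO e0 er xC) mul0r.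
    by rewrite /Rintegral /= integral0_eq.
  have [C C0 HC] := collar_chart_le oO bO sO bh ch rj.
  exists (Num.min (r j) 1, C * (M1 + M0)); split => /= [||psi e sp e0]; [by rewrite lt_min rj ltr01|by rewrite mulr_ge0// addr_ge0|].
  rewrite le_min => /andP[er e1]; pose eta := zeta j \* (psi \* psi).
  have seta : smooth eta by apply: smoothM => //; exact: smoothM.
  have Lp := smooth_L2 oO bO sp; have Ldp k := smooth_L2 oO bO (smooth_pderiv k sp).
  have eta_r x : eta x != 0 -> `|x - a j| < r j by rewrite /eta /= mulf_eq0 negb_or => /andP[/zeta_r].
  have eta0 x : 0 <= eta x by rewrite mulr_ge0 ?(pou_ge0 Hpou)// [X in _ <= X](_ : _ = psi x ^+ 2) ?sqr_ge0.
  have := HC eta e seta eta_r eta0 e0 er e1.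
  pose w x := pderiv (zeta j) i x * psi x + 2 * (zeta j x * pderiv psi i x).
  have L1 := L2_contM oO bO (smooth_continuous (smooth_pderiv i (sz j))) Lp.
  have L2' := L2_contM oO bO (smooth_continuous (sz j)) (Ldp i).
  have Lw : L2O w := L2D mO L1 (L2Z mO 2 L2').
  have dE x : `|pderiv eta i x| = `|psi x| * `|w x|.
    have d1 := smooth_differentiable x sp; have d2 := smooth_differentiable x (sz j).
    rewrite /eta pderivM ?pderivM//; last exact: differentiableM.
    by rewrite -normrM; congr `|_|; rewrite /w /=; ring.
  have Labs f : L2O f -> L2O (fun x => `|f x|).
    move=> [mf if2]; split; first exact: measurableT_comp.
    by apply: eq_integrable if2 => [|x _]; [exact: mO|rewrite real_normK// num_real].
  have nabs f : L2O f -> nrm (fun x => `|f x|) = nrm f.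
    by move=> Lf; rewrite /normL2; congr Num.sqrt; apply: eq_Rintegral => x _; rewrite -normrM ger0_norm// -expr2 sqr_ge0.
  have -> : (\int[leb]_(x in Om) (`|pderiv eta i x|)%:E = (dot (fun x => `|psi x|) (fun x => `|w x|))%:E)%E.
    by rewrite (dotL2_EFin mO (Labs _ Lp) (Labs _ Lw)); apply: eq_integral => x _; rewrite dE.
  have Lc : L2C e eta by apply: (L2_collar e0 (smooth_L2 oO bO seta)).1.
  have Lc1 : L2C e (cst 1) by apply: (L2_collar e0 (smooth_L2 oO bO (smooth_cst 1))).1.
  have -> : (\int[leb]_(x in col e) (eta x)%:E = (\int[leb]_(x in col e) eta x)%:E)%E.
    have := dotL2_EFin (mC e0) Lc Lc1; rewrite /dotL2 (@eq_Rintegral _ _ _ _ _ eta) => [->|x _]; last by rewrite mulr1.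
    by apply: eq_integral => x _; rewrite mulr1.
  rewrite -EFinM lee_fin => H; apply: (le_trans H).
  rewrite (_ : C * (M1 + M0) * e * _ = C * e * ((M1 + M0) * H1sq psi (pderiv psi))); last by ring.
  rewrite ler_wpM2l ?mulr_ge0 ?(ltW e0)//.
  apply: le_trans (dotL2_le mO (Labs _ Lp) (Labs _ Lw)) _; rewrite !nabs//.
  have nw : nrm w <= M1 * nrm psi + 2 * (M0 * nrm (pderiv psi i)).
    apply: le_trans (normL2D mO L1 (L2Z mO 2 L2')) _; apply: lerD; first exact: (HM1 (j, i)).
    by rewrite (normL2Z mO 2 L2') ger0_norm// ler_wpM2l//; exact: HM0.
  apply: le_trans (ler_wpM2l (normL2_ge0 _ _ _) nw) _.
  rewrite /H1sq; have : nrm (pderiv psi i) ^+ 2 <= \sum_k nrm (pderiv psi k) ^+ 2.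
    by rewrite (bigD1 i)//= lerDl; apply: sumr_ge0 => k _; exact: sqr_ge0.
  move: (\sum_k _) (nrm psi) (nrm (pderiv psi i)) => s x y ys.
  have q1 : 0 <= M1 * s by rewrite mulr_ge0// (le_trans _ ys) ?sqr_ge0.
  have q2 : M0 * (2 * (x * y)) <= M0 * (x ^+ 2 + s).
    rewrite ler_wpM2l//; have := sqr_ge0 (x - y); nra.
  rewrite -subr_ge0; apply: le_trans (_ : 0 <= M1 * s + (M0 * (x ^+ 2 + s) - M0 * (2 * (x * y)))) _; first by rewrite addr_ge0 ?subr_ge0.
  by rewrite le_eqVlt; apply/orP; left; apply/eqP; ring.
have [e1 e10 He1] := finite_pos_lb (fun j => (fun H => let: And3 h _ _ := H in h) (Hj j)).
exists e1 => //; exists (\sum_j (ec j).2) => [|psi e sp e0 ee1]; first by apply: sumr_ge0 => j _; have [] := Hj j.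
have sp2 : smooth (psi \* psi) := smoothM sp sp.
have L1 : L2C e (cst 1) by apply: (L2_collar e0 (smooth_L2 oO bO (smooth_cst 1))).1.
have -> : nrmC e psi ^+ 2 = \sum_j \int[leb]_(x in col e) (zeta j x * (psi x * psi x)).
  rewrite sqr_normL2; transitivity (dotC e (fun x => \sum_j zeta j x * (psi x * psi x)) (cst 1)).
    by apply: eq_Rintegral => x /set_mem[Ox _]; rewrite mulr1; exact: (pou_decomp Hpou (psi \* psi) (subset_closure Ox)).
  rewrite (dotL2_suml (mC e0)) => [|j _|//]; last by apply: (L2_collar e0 (smooth_L2 oO bO (smoothM (sz j) sp2))).1.
  by apply: eq_bigr => j _; apply: eq_Rintegral => x _; rewrite mulr1.
rewrite !mulr_suml; apply: ler_sum => j _; have [_ _ H] := Hj j; apply: H => //; exact: le_trans ee1 (He1 j).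
Qed.

Variable nu : 'I_n.+1 -> E -> R.
Hypotheses (snu : forall k, smooth (nu k)) (nuE : forall x, bd x -> forall k, nu k x = outward_normal Om x ord0 k).

Lemma cvg_sqr (x_ : nat -> R) (l : R) : x_ k @[k --> \oo] --> l -> (fun k => x_ k ^+ 2) @ \oo --> l ^+ 2.
Proof. by move=> cx; rewrite expr2; under eq_fun do rewrite expr2; exact: cvgM. Qed.

Lemma trace_seq u p : H1 u p -> L2S (trace Om S u) /\ exists phi_ : nat -> E -> R,
  [/\ forall k, smooth (phi_ k), H1_cvg Om phi_ (fun k => pderiv (phi_ k)) u p &
      nrmS (trace Om S u \- phi_ k) @[k --> \oo] --> 0].
Proof.
move=> Hu; have tu := traceP oO bO sS Hpou snu nuE Hu.
by have := is_trace_H1 oO bO Hpou tu Hu.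
Qed.

Lemma H1sq_cvg0 u p (phi_ : nat -> E -> R) : H1_cvg Om phi_ (fun k => pderiv (phi_ k)) u p ->
  H1sq (u \- phi_ k) (fun i => p i \- pderiv (phi_ k) i) @[k --> \oo] --> 0.
Proof.
move=> [c1 c2]; have E0 : 0 = (0 : R) ^+ 2 + \sum_(i < n.+1) (0 : R) ^+ 2.
  by rewrite expr0n /= big1 ?addr0.
rewrite [X in _ --> X]E0; apply: cvgD; first exact: (cvg_sqr c1).
apply: (@cvg_sum_seq R _ _ (fun i k => nrm (p i \- pderiv (phi_ k) i) ^+ 2) (fun i => 0 ^+ 2)) => i.
exact: (cvg_sqr (c2 i)).
Qed.

Lemma H1sq_cvg u p (phi_ : nat -> E -> R) : H1 u p -> (forall k, smooth (phi_ k)) ->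
  H1_cvg Om phi_ (fun k => pderiv (phi_ k)) u p ->
  H1sq (phi_ k) (pderiv (phi_ k)) @[k --> \oo] --> H1sq u p.
Proof.
move=> Hu sf [c1 c2]; have Lf k := smooth_L2 oO bO (sf k).
have Ldf k i := smooth_L2 oO bO (smooth_pderiv i (sf k)).
apply: cvgD; first exact: (cvg_sqr (cvg_normL2 mO Lf (H1_L2 Hu) c1)).
apply: (@cvg_sum_seq R _ _ (fun i k => nrm (pderiv (phi_ k) i) ^+ 2) (fun i => nrm (p i) ^+ 2)) => i.
exact: (cvg_sqr (cvg_normL2 mO (fun k => Ldf k i) (H1_gradL2 i Hu) (c2 i))).
Qed.

Lemma collar_ineq : exists2 e1 : R, 0 < e1 & exists2 C : R, 0 <= C & forall u p e, H1 u p ->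
  0 < e -> e <= e1 -> nrmC e u ^+ 2 <= C * e * H1sq u p.
Proof.
have [e1 e10 [C C0 HC]] := collar_ineq_smooth; exists e1 => //; exists C => // u p e Hu e0 ee1.
have [_ [f_ [sf cf _]]] := trace_seq Hu; have Lf k := smooth_L2 oO bO (sf k).
have c1 : nrmC e (f_ k) @[k --> \oo] --> nrmC e u.
  apply: (cvg_normL2 (mC e0) (fun k => (L2_collar e0 (Lf k)).1) (L2_collar e0 (H1_L2 Hu)).1).
  apply: (@squeeze_cvgr _ _ _ _ (cst 0) (fun k => nrm (u \- f_ k))); [|exact: cvg_cst|exact: cf.1].
  by apply: nearW => k; rewrite normL2_ge0 /=; apply: (L2_collar e0 (L2B mO (H1_L2 Hu) (Lf k))).2.
have c2 : (fun k => C * e * H1sq (f_ k) (pderiv (f_ k))) @ \oo --> C * e * H1sq u p.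
  by apply: cvgM; [exact: cvg_cst|exact: H1sq_cvg].
by apply: (ler_cvg_to (cvg_sqr c1) c2); apply: nearW => k; exact: HC.
Qed.

(** Each collar norm carries a factor sqrt e, and the product of two of them cancels 1/e. The form
    with norms also covers functions known only to be dominated pointwise by u. *)
Lemma collar_norm_le : exists2 e1 : R, 0 < e1 & exists2 C : R, 0 <= C & forall u p v s e, H1 u p -> H1 v s ->
  0 < e -> e <= e1 -> e^-1 * (nrmC e u * nrmC e v) <= C * (Num.sqrt (H1sq u p) * Num.sqrt (H1sq v s)).
Proof.
have [e1 e10 [C C0 HC]] := collar_ineq; exists e1 => //; exists C => // u p v s e Hu Hv e0 ee1.
have bound w p' : H1 w p' -> nrmC e w <= Num.sqrt (C * e) * Num.sqrt (H1sq w p').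
  move=> Hw; rewrite -sqrtrM ?mulr_ge0 ?(ltW e0)// -(@ger0_norm _ (nrmC e w)) ?normL2_ge0// -sqrtr_sqr.
  by rewrite ler_wsqrtr// HC.
rewrite mulrC ler_pdivrMr//.
apply: le_trans (ler_pM (normL2_ge0 _ _ _) (normL2_ge0 _ _ _) (bound _ _ Hu) (bound _ _ Hv)) _.
rewrite mulrACA -expr2 sqr_sqrtr ?mulr_ge0 ?(ltW e0)// le_eqVlt; apply/orP; left; apply/eqP; ring.
Qed.

Lemma collar_dot_le : exists2 e1 : R, 0 < e1 & exists2 C : R, 0 <= C & forall u p v q e, H1 u p -> H1 v q ->
  0 < e -> e <= e1 -> `|e^-1 * dotC e u v| <= C * (Num.sqrt (H1sq u p) * Num.sqrt (H1sq v q)).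
Proof.
have [e1 e10 [C C0 HC]] := collar_norm_le; exists e1 => //; exists C => // u p v q e Hu Hv e0 ee1.
apply: le_trans (HC _ _ _ _ e Hu Hv e0 ee1); rewrite normrM (gtr0_norm (x := e^-1)) ?invr_gt0//.
rewrite ler_wpM2l ?invr_ge0 ?(ltW e0)//.
exact: (cauchy_schwarzL2 (mC e0) (L2_collar e0 (H1_L2 Hu)).1 (L2_collar e0 (H1_L2 Hv)).1).
Qed.

(** The limit is known for smooth functions. The bound [collar_dot_le], uniform in e, allows w and
    phi to be replaced by smooth approximations first and e to tend to 0 afterwards. *)
Lemma collar_cvg w q phi p (eps_ : nat -> R) : H1 w q -> H1 phi p -> (forall k, 0 < eps_ k) ->
  eps_ k @[k --> \oo] --> 0 ->
  (eps_ k)^-1 * dotC (eps_ k) w phi @[k --> \oo] --> dotS (trace Om S w) (trace Om S phi).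
Proof.
move=> Hw Hp ep0 ep; have [e1 e10 [C C0 HC]] := collar_dot_le.
have [Lt [f_ [sf cf cft]]] := trace_seq Hw; have [Ls [g_ [sg cg cgt]]] := trace_seq Hp.
have sqc (x_ : nat -> R) (l : R) : x_ k @[k --> \oo] --> l -> (fun k => Num.sqrt (x_ k)) @ \oo --> Num.sqrt l.
  by move=> cx; apply: (cvg_comp _ _ cx); exact: sqrt_continuous.
pose T := dotS (trace Om S w) (trace Om S phi).
pose B1 m := C * (Num.sqrt (H1sq (w \- f_ m) (fun i => q i \- pderiv (f_ m) i)) * Num.sqrt (H1sq phi p)).
pose B2 m := C * (Num.sqrt (H1sq (f_ m) (pderiv (f_ m))) * Num.sqrt (H1sq (phi \- g_ m) (fun i => p i \- pderiv (g_ m) i))).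
pose B3 m := `|dotS (f_ m) (g_ m) - T|.
have cB : (fun m => B1 m + B2 m + B3 m) @ \oo --> (0 : R).
  have E0 : (0 : R) = C * (Num.sqrt 0 * Num.sqrt (H1sq phi p)) + C * (Num.sqrt (H1sq w q) * Num.sqrt 0) + `|T - T|.
    by rewrite sqrtr0 mul0r !mulr0 subrr normr0 !addr0.
  rewrite [X in _ --> X]E0; apply: cvgD; first apply: cvgD.
  - by apply: cvgM; [exact: cvg_cst|apply: cvgM; [exact: sqc (H1sq_cvg0 cf)|exact: cvg_cst]].
  - by apply: cvgM; [exact: cvg_cst|apply: cvgM; [exact: sqc (H1sq_cvg Hw sf cf)|exact: sqc (H1sq_cvg0 cg)]].
  - apply: cvg_norm; apply: cvgB; last exact: cvg_cst.
    exact: (cvg_dotL2 mbd (fun k => smooth_L2S oO bO sS Hpou (sf k)) Lt (fun k => smooth_L2S oO bO sS Hpou (sg k)) Ls cft cgt).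
apply/cvgrPdist_le => d d0; have d2 : 0 < d / 2 by rewrite divr_gt0.
have [m Hm] : exists m, B1 m + B2 m + B3 m <= d / 2.
  have /cvgrPdist_le/(_ _ d2)[m _ H] := cB; exists m; have := H m (leqnn m).
  by rewrite sub0r normrN => /(le_trans (ler_norm _)).
have [e2 e20 [D D0 HD]] := collar_cvg_smooth (smoothM (sf m) (sg m)).
(* The last term makes the smooth error D e at most d / 2; the replacement errors use the other
   half. *)
pose e3 := Num.min e1 (Num.min e2 (d / (2 * (D + 1)))).
have D1 : 0 < 2 * (D + 1) by rewrite mulr_gt0// ltr_wpDl.
have e30 : 0 < e3 by rewrite !lt_min e10 e20 divr_gt0.
have /cvgrPdist_le/(_ _ e30)[N0 _ HN] := ep; exists N0 => // k /= N0k.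
have e0 := ep0 k; have := HN k N0k; rewrite sub0r normrN (gtr0_norm e0) !le_min => /and3P[ke1 ke2 ke3].
move: (eps_ k) e0 ke1 ke2 ke3 => e e0 ke1 ke2 ke3.
have Hf := H1_smooth oO bO (sf m); have Hg := H1_smooth oO bO (sg m).
have Lc u s (Hu : H1 u s) := (L2_collar e0 (H1_L2 Hu)).1.
have b1 := HC _ _ _ _ e (H1B oO bO Hw Hf) Hp e0 ke1.
have b2 := HC _ _ _ _ e Hf (H1B oO bO Hp Hg) e0 ke1.
have b3 : `|e^-1 * dotC e (f_ m) (g_ m) - dotS (f_ m) (g_ m)| <= d / 2.
  have := HD e e0 ke2; rewrite -/(dotC e (f_ m) (g_ m)) -/(dotS (f_ m) (g_ m)) => h.
  rewrite (_ : _ - _ = e^-1 * (dotC e (f_ m) (g_ m) - e * dotS (f_ m) (g_ m))); last by rewrite mulrBr mulKf ?gt_eqF.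
  rewrite normrM (gtr0_norm (x := e^-1)) ?invr_gt0// mulrC ler_pdivrMr//; apply: (le_trans h).
  rewrite expr2 mulrA ler_wpM2r ?(ltW e0)//; apply: le_trans (ler_wpM2l D0 ke3) _.
  rewrite mulrCA ler_wpM2l ?(ltW d0)// invfM mulrCA ler_piMr ?invr_ge0//.
  by rewrite ler_pdivrMr ?mul1r ?lerDl// ltr_wpDl.
rewrite distrC; have -> : e^-1 * dotC e w phi - T = e^-1 * dotC e (w \- f_ m) phi + e^-1 * dotC e (f_ m) (phi \- g_ m) +
    (e^-1 * dotC e (f_ m) (g_ m) - dotS (f_ m) (g_ m)) + (dotS (f_ m) (g_ m) - T).
  rewrite (dotL2Bl (mC e0) (Lc _ _ Hw) (Lc _ _ Hf) (Lc _ _ Hp)) (dotL2Br (mC e0) (Lc _ _ Hp) (Lc _ _ Hg) (Lc _ _ Hf)).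
  by move: (dotC _ _ _) (dotC _ _ _) (dotC _ _ _) (dotS _ _) (e^-1) => *; ring.
apply: le_trans (ler_normD _ _) _; apply: le_trans (lerD (ler_normD _ _) (lexx _)) _.
apply: le_trans (lerD (lerD (ler_normD _ _) (lexx _)) (lexx _)) _.
apply: le_trans (lerD (lerD (lerD b1 b2) b3) (lexx _)) _.
by rewrite addrAC; apply: le_trans (lerD Hm (lexx (d / 2))) _; rewrite -splitr.
Qed.

End collar_estimates.

(** * The second-order estimate *)

Section vector_fields.
Context {R : realType} {n : nat}.
Local Notation E := 'rV[R]_n.+1.
Local Notation leb := (lebesgue_rV n.+1).
Variables (Om : set E) (S : {measure set E -> \bar R}).
Hypotheses (oO : open Om) (bO : bounded_set Om) (sO : smooth_bdry Om) (sS : surface_measure Om S).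
Local Notation bd := (bdry Om).
Local Notation dot := (dotL2 leb Om).
Local Notation nrm := (normL2 leb Om).
Local Notation L2O := (L2 leb Om).
Local Notation dotS := (dotL2 S bd).
Local Notation nrmS := (normL2 S bd).
Local Notation L2S := (L2 S bd).
Local Notation mO := (measurable_open oO).
Local Notation mbd := (@measurable_bdry R n Om).
Implicit Types (f psi u v w t : E -> R) (p q : 'I_n.+1 -> E -> R) (e C M : R).

Variables (N : nat) (a : 'I_N -> E) (r : 'I_N -> R) (zeta : 'I_N -> E -> R).
Hypothesis Hpou : pou (closure Om) (loc Om) a r zeta.
Variable nu : 'I_n.+1 -> E -> R.
Hypotheses (snu : forall k, smooth (nu k)) (nuE : forall x, bd x -> forall k, nu k x = outward_normal Om x ord0 k).

Local Notation H1 := (H1 Om).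
Local Notation smO := (smooth_L2 oO bO).
Local Notation smS := (smooth_L2S oO bO sS Hpou).
Local Notation gaussO := (gauss oO bO sS Hpou snu nuE).
Let cnu k := smooth_continuous (snu k).

(** In sheared coordinates f vanishes on a hyperplane, so its derivative along the flattened vector
    [w] is zero. Orthogonality to the normal says that v_i is the sum of the v_k d_k h, which turns
    this derivative into the one along v. *)
Lemma tangential_derivative f x (v : E) : smooth f -> (forall y, bd y -> f y = 0) -> bd x ->
  \sum_j v ord0 j * nu j x = 0 -> \sum_j v ord0 j * pderiv f j x = 0.
Proof.
move=> sf f0 bx vN; have [s s0 [HO|[i [b [h [bh ch]]]]]] := loc_exists oO sO (bdry_closure bx).
  by exfalso; apply: (bdry_notin oO bx); apply: HO; rewrite subrr normr0 mulr_gt0.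
have [oU sh _] := ch; have Ux : `|x - x| < 2 * s by rewrite subrr normr0 mulr_gt0.
have gx : level i b h x = 0 by exact/(bdry_level oO ch Ux).
have xi : x ord0 i = h (col' i x).
  apply/eqP; rewrite -subr_eq0; move/eqP: gx; rewrite /level mulf_eq0 => /orP[|//].
  by rewrite signr_eq0.
pose H z := f (shear i h z); pose z0 := insert_coord i 0 (col' i x).
have sz0 : shear i h z0 = x by rewrite shear_graph /graph_pt -xi insert_col'.
have dH z := diff_shear i sh bh z sf.
pose w := insert_coord i 0 (col' i v) : E.
have near0 : exists2 d : R, 0 < d & forall t : R, `|t| < d -> H (z0 + t *: w) = 0.
  have cs := @continuous_shear R n i h sh.
  have cl0 : (fun t : R => z0 + t *: w) t @[t --> (0 : R)] --> z0.
    rewrite -[X in _ --> X]addr0 -(scale0r w); apply: cvgD; first exact: cvg_cst.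
    by apply: cvgZr_tmp; exact: cvg_id.
  have : \forall t \near (0 : R), `|shear i h (z0 + t *: w) - x| < 2 * s.
    have cl : (fun t : R => shear i h (z0 + t *: w)) t @[t --> (0 : R)] --> x.
      by rewrite -[X in _ --> X]sz0; apply: (cvg_comp _ _ cl0); exact: cs.
    apply: (cl [set z : E | `|z - x| < 2 * s]); apply: open_nbhs_nbhs; split => //; exact: open_ballc.
  move=> /nbhs_ballP[d /= d0 Hd]; exists d => // t td; apply: f0.
  have Ut : `|shear i h (z0 + t *: w) - x| < 2 * s by apply: Hd; rewrite -ball_normE /= sub0r normrN.
  apply/(bdry_level oO ch Ut); rewrite level_shear mxE.
  by rewrite /z0 /w insert_coordE mxE insert_coordE mulr0 addr0 mulr0.
have [d d0 Hd] := near0.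
have Hz0 : H z0 = 0 by rewrite /H sz0 f0.
have g0 : dotv (grad H z0) w = 0.
  apply/eqP; rewrite eq_le; apply/andP; split.
    rewrite -oppr_ge0 -mulN1r -dotvZr; apply: (grad_dir_ge0 (dH z0).1 Hz0 d0) => t /andP[t0 td].
    by rewrite scalerA -/(H _) Hd// mulrN1 normrN gtr0_norm.
  by apply: (grad_dir_ge0 (dH z0).1 Hz0 d0) => t /andP[t0 td]; rewrite -/(H _) Hd// gtr0_norm.
have gE k : pderiv H (lift i k) z0 = pderiv f (lift i k) x + pderiv h k (col' i x) * pderiv f i x.
  rewrite (dH z0).2 sz0; congr (_ + _ * _).
  have := (@diff_comp_col' _ _ i h z0 (smooth_differentiable _ sh)).2 (lift i k); rewrite liftK /= => ->.
  by rewrite /z0 col'_insert.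
have ins (F : 'I_n.+1 -> R) (u : E) : \sum_j u ord0 j * F j = u ord0 i * F i + \sum_k u ord0 (lift i k) * F (lift i k).
  transitivity (dotv (insert_coord i (u ord0 i) (col' i u)) (insert_coord i (F i) (\row_k F (lift i k)))).
    apply: eq_bigr => j _; rewrite insert_col'; congr (_ * _).
    by rewrite mxE; case: (unliftP i j) => [k ->|->] /=; rewrite ?mxE.
  by rewrite dotv_insert; congr (_ + _); apply: eq_bigr => k _; rewrite !mxE.
have wk k : w ord0 (lift i k) = v ord0 (lift i k) by rewrite /w insert_coord_lift mxE.
move: g0; rewrite dotv_grad ins {1}/w insert_coordE mul0r add0r.
under eq_bigr do rewrite wk gE mulrDr mulrA.
rewrite big_split /= -mulr_suml => g0.
pose c : R := - (-1) ^+ b / area_density h (col' i x).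
have c0 : c != 0 by rewrite mulf_neq0// ?oppr_eq0 ?signr_eq0// invr_eq0 gt_eqF// area_density_gt0.
have nE j : nu j x = c * insert_coord i 1 (\row_k - pderiv h k (col' i x)) ord0 j.
  by rewrite nuE// (outward_normal_chart oO ch Ux bx) /chart_normal mxE.
have vN' : v ord0 i * c + \sum_k v ord0 (lift i k) * (c * - pderiv h k (col' i x)) = 0.
  rewrite -[RHS]vN ins nE insert_coordE mulr1; congr (_ + _); apply: eq_bigr => k _.
  by rewrite nE insert_coord_lift mxE.
have : c * (v ord0 i - \sum_k v ord0 (lift i k) * pderiv h k (col' i x)) = 0.
  rewrite -[RHS]vN' mulrBr [c * v ord0 i]mulrC mulr_sumr -sumrN; congr (_ + _); apply: eq_bigr => k _; ring.
move=> /eqP; rewrite mulf_eq0 (negbTE c0) /= subr_eq0 => /eqP vi.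
by rewrite ins vi addrC.
Qed.

Lemma cvg_nrm_contM (m : E -> R) (u_ : nat -> E -> R) u : continuous m -> (forall k, L2O (u_ k)) -> L2O u ->
  nrm (u \- u_ k) @[k --> \oo] --> 0 ->
  nrm ((fun x => m x * u x) \- (fun x => m x * u_ k x)) @[k --> \oo] --> 0.
Proof.
move=> cm Lu_ Lu cu; have [M M0 HM] := normL2_contM oO bO cm.
apply: (@squeeze_cvgr _ _ _ _ (cst 0) (fun k => M * nrm (u \- u_ k))); last first.
- by rewrite -[X in _ --> X](mulr0 M); apply: cvgM => //; exact: cvg_cst.
- exact: cvg_cst.
apply: nearW => k; rewrite normL2_ge0 andTb; apply: le_trans (HM _ (L2B mO Lu (Lu_ k))).
by rewrite le_eqVlt; apply/orP; left; apply/eqP; apply: eq_normL2 => x _ /=; ring.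
Qed.

Lemma cvg_nrm_sum (I : finType) (u_ : I -> nat -> E -> R) (u : I -> E -> R) : (forall l k, L2O (u_ l k)) -> (forall l, L2O (u l)) ->
  (forall l, nrm (u l \- u_ l k) @[k --> \oo] --> 0) ->
  nrm ((fun x => \sum_l u l x) \- (fun x => \sum_l u_ l k x)) @[k --> \oo] --> 0.
Proof.
move=> Lu_ Lu cu.
apply: (@squeeze_cvgr _ _ _ _ (cst 0) (fun k => \sum_l nrm (u l \- u_ l k))); last first.
- have E0 : (0 : R) = \sum_(l : I) 0 by rewrite big1.
  rewrite [X in _ --> X]E0.
  exact: (@cvg_sum_seq R _ _ (fun l k => nrm (u l \- u_ l k)) (fun=> 0)).
- exact: cvg_cst.
apply: nearW => k; rewrite normL2_ge0 andTb.
apply: le_trans (@normL2_sum _ _ _ leb Om mO I (index_enum I) xpredT (fun l => u l \- u_ l k) (fun l _ => L2B mO (Lu l) (Lu_ l k))).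
by rewrite le_eqVlt; apply/orP; left; apply/eqP; apply: eq_normL2 => x _ /=; rewrite sumrB.
Qed.

(* For gradients P = Dv and Q = Dw this integrates tr (Dv Dw) - div v div w, which is
   a divergence. *)
Definition divcurl (P Q : 'I_n.+1 -> 'I_n.+1 -> E -> R) : R :=
  \sum_i \sum_j (dot (P j i) (Q i j) - dot (P j j) (Q i i)).

Implicit Types (P Q : 'I_n.+1 -> 'I_n.+1 -> E -> R).

Lemma divcurlC P Q : divcurl P Q = divcurl Q P.
Proof.
rewrite /divcurl exchange_big; apply: eq_bigr => i _; apply: eq_bigr => j _.
by rewrite (dotL2C _ _ (Q j i)) (dotL2C _ _ (Q j j)).
Qed.

Lemma divcurlDl P P' Q : (forall i j, L2O (P i j)) -> (forall i j, L2O (P' i j)) -> (forall i j, L2O (Q i j)) ->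
  divcurl (fun i j => P i j \+ P' i j) Q = divcurl P Q + divcurl P' Q.
Proof.
move=> LP LP' LQ; rewrite /divcurl -big_split; apply: eq_bigr => i _ /=; rewrite -big_split; apply: eq_bigr => j _ /=.
by rewrite !(dotL2Dl mO) //; ring.
Qed.

Lemma eq_divcurl P P' Q Q' : (forall i j x, Om x -> P i j x = P' i j x) -> (forall i j x, Om x -> Q i j x = Q' i j x) ->
  divcurl P Q = divcurl P' Q'.
Proof.
move=> eP eQ; apply: eq_bigr => i _; apply: eq_bigr => j _.
by congr (_ - _); apply: eq_dotL2 => x Ox; auto.
Qed.

Lemma cvg_divcurl (P_ Q_ : nat -> 'I_n.+1 -> 'I_n.+1 -> E -> R) P Q :
  (forall k i j, L2O (P_ k i j)) -> (forall i j, L2O (P i j)) -> (forall k i j, L2O (Q_ k i j)) -> (forall i j, L2O (Q i j)) ->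
  (forall i j, nrm (P i j \- P_ k i j) @[k --> \oo] --> 0) -> (forall i j, nrm (Q i j \- Q_ k i j) @[k --> \oo] --> 0) ->
  divcurl (P_ k) (Q_ k) @[k --> \oo] --> divcurl P Q.
Proof.
move=> LP_ LP LQ_ LQ cP cQ.
apply: (@cvg_sum_seq R _ _ (fun i k => \sum_j (dot (P_ k j i) (Q_ k i j) - dot (P_ k j j) (Q_ k i i)))
  (fun i => \sum_j (dot (P j i) (Q i j) - dot (P j j) (Q i i)))) => i.
apply: (@cvg_sum_seq R _ _ (fun j k => dot (P_ k j i) (Q_ k i j) - dot (P_ k j j) (Q_ k i i))
  (fun j => dot (P j i) (Q i j) - dot (P j j) (Q i i))) => j.
by apply: cvgB; apply: (cvg_dotL2 mO).
Qed.

Lemma dot_pderivM v w i : smooth v -> smooth w ->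
  dot (pderiv v i) w + dot v (pderiv w i) = dotS (v \* w) (nu i).
Proof.
move=> sv sw; rewrite -(gaussO i (smoothM sv sw)) /dotL2 -RintegralD//; last 3 first.
- exact: mO.
- exact: (L2_mul_integrable mO (smO (smooth_pderiv i sv)) (smO sw)).
- exact: (L2_mul_integrable mO (smO sv) (smO (smooth_pderiv i sw))).
apply: eq_Rintegral => x _; rewrite pderivM; [ring|exact: smooth_differentiable|exact: smooth_differentiable].
Qed.

(** Both products are integrated by parts onto v_j; the volume terms contain d_i d_j w_i in either
    order and cancel. *)
Lemma divcurl_smooth (v w : 'I_n.+1 -> E -> R) : (forall i, smooth (v i)) -> (forall i, smooth (w i)) ->
  divcurl (fun j i => pderiv (v j) i) (fun j i => pderiv (w j) i) =
  \sum_i \sum_j (dotS (v j \* pderiv (w i) j) (nu i) - dotS (v j \* pderiv (w i) i) (nu j)).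
Proof.
move=> sv sw; apply: eq_bigr => i _; apply: eq_bigr => j _.
have aux (A B D F s t : R) : A + D = s -> B + F = t -> D = F -> A - B = s - t by move=> <- <- ->; ring.
apply: (aux _ _ _ _ _ _ (dot_pderivM i (sv j) (smooth_pderiv j (sw i))) (dot_pderivM j (sv j) (smooth_pderiv i (sw i)))).
exact: (f_equal (dotL2 leb Om (v j)) (smooth_pderivC i j (sw i))).
Qed.

Lemma normal_component_le : exists2 M : R, 0 <= M & forall t : 'I_n.+1 -> E -> R, (forall i, L2S (t i)) ->
  L2S (fun x => \sum_i nu i x * t i x) /\ nrmS (fun x => \sum_i nu i x * t i x) <= M * \sum_i nrmS (t i).
Proof.
have /choice[m Hm] : forall i, exists m : R, forall x, bd x -> `|nu i x| <= m.
  move=> i; have [m _ Hm] := compact_bounded_fun (closure_compact bO) (fun x _ => @cnu i x).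
  by exists m => x /bdry_closure; exact: Hm.
have M0 : 0 <= \sum_i `|m i| by exact: sumr_ge0.
exists (\sum_i `|m i|) => // t Lt.
have HM i x : bd x -> `|nu i x| <= \sum_i `|m i| by move=> bx; apply: le_trans (Hm i x bx) (le_sum_norm m i).
have mN i : measurable_fun bd (nu i) by apply: continuous_measurable_rV; [exact: mbd|exact: cnu].
have Lm i : L2S (fun x => nu i x * t i x) := L2_bdd_mul mbd (mN i) (HM i) (Lt i).
split; first by apply: (L2_sum mbd) => i _; exact: Lm.
apply: le_trans (@normL2_sum _ _ _ S bd mbd _ (index_enum 'I_n.+1) xpredT (fun i x => nu i x * t i x) (fun i _ => Lm i)) _; rewrite mulr_sumr; apply: ler_sum => i _.
exact: (normL2_bdd_mul mbd M0 (mN i) (HM i) (Lt i)).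
Qed.

(** Formulated with some traces of an arbitrary field, rather than those selected for a weak
    gradient, so that the condition survives differences and limits. *)
Definition normal_trace0 p := exists t : 'I_n.+1 -> E -> R,
  (forall i, is_trace Om S (p i) (t i)) /\ nrmS (fun x => \sum_i nu i x * t i x) = 0.

Lemma normal_trace0_seq p (q : 'I_n.+1 -> 'I_n.+1 -> E -> R) : (forall i, H1 (p i) (q i)) -> normal_trace0 p -> exists V : nat -> 'I_n.+1 -> E -> R,
  [/\ forall k i, smooth (V k i), forall i, H1_cvg Om (V^~ i) (fun k => pderiv (V k i)) (p i) (q i) &
      nrmS (fun x => \sum_i nu i x * V k i x) @[k --> \oo] --> 0].
Proof.
move=> Hp [t [tp t0]].
have /choice[V HV] : forall i, exists V : nat -> E -> R, [/\ forall k, smooth (V k),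
    H1_cvg Om V (fun k => pderiv (V k)) (p i) (q i) & nrmS (t i \- V k) @[k --> \oo] --> 0].
  by move=> i; have [_ H] := is_trace_H1 oO bO Hpou (tp i) (Hp i).
have Lt i : L2S (t i) by have [] := tp i.
have sV k i : smooth (V i k) by have [] := HV i.
exists (fun k i => V i k); split => [//|i|]; first by have [] := HV i.
have LV k i := smS (sV k i).
have [M M0 HM] := normal_component_le; have [LN _] := HM _ Lt.
rewrite -[X in _ --> X]t0; apply: (cvg_normL2 mbd (fun k => (HM _ (LV k)).1) LN).
apply: (@squeeze_cvgr _ _ _ _ (cst 0) (fun k => M * \sum_i nrmS (t i \- V i k))).
- apply: nearW => k; rewrite normL2_ge0 andTb.
  apply: le_trans (HM _ (fun i => L2B mbd (Lt i) (LV k i))).2.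
  rewrite le_eqVlt; apply/orP; left; apply/eqP; apply: eq_normL2 => x _ /=.
  by rewrite -sumrB; apply: eq_bigr => i _; rewrite mulrBr.
- exact: cvg_cst.
have E0 : (0 : R) = M * \sum_(i < n.+1) 0 by rewrite big1 ?mulr0.
rewrite [X in _ --> X]E0; apply: cvgM; first exact: cvg_cst.
by apply: (@cvg_sum_seq R _ _ (fun i k => nrmS (t i \- V i k)) (fun=> 0)) => i; have [] := HV i.
Qed.

(** For smooth approximations the boundary term pairs the normal component of [V k] with [f_ k], and
    this component tends to 0 in L^2 of the boundary. *)
Lemma green p (q : 'I_n.+1 -> 'I_n.+1 -> E -> R) phi s : (forall i, H1 (p i) (q i)) -> normal_trace0 p -> H1 phi s ->
  dot (fun x => \sum_i q i i x) phi = - \sum_i dot (p i) (s i).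
Proof.
move=> Hp p0 Hphi; have [V [sV cV cN]] := normal_trace0_seq Hp p0.
have [Lt [f_ [sf cf cft]]] := trace_seq oO bO sS Hpou snu nuE Hphi.
have Lq i j : L2O (q i j) := H1_gradL2 j (Hp i).
rewrite (dotL2_suml mO) => [|i _|]; [|exact: Lq|exact: H1_L2 Hphi].
apply/eqP; rewrite -subr_eq0 opprK -big_split; apply/eqP.
have c1 : (fun k => \sum_i (dot (pderiv (V k i) i) (f_ k) + dot (V k i) (pderiv (f_ k) i))) @ \oo -->
    \sum_i (dot (q i i) phi + dot (p i) (s i)).
  apply: (@cvg_sum_seq R _ _ (fun i k => dot (pderiv (V k i) i) (f_ k) + dot (V k i) (pderiv (f_ k) i))
    (fun i => dot (q i i) phi + dot (p i) (s i))) => i.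
  apply: cvgD; apply: (cvg_dotL2 mO) => //.
  - by move=> k; apply: smO; exact: smooth_pderiv.
  - by move=> k; exact: smO.
  - exact: H1_L2 Hphi.
  - exact: (cV i).2.
  - exact: cf.1.
  - by move=> k; exact: smO.
  - exact: H1_L2 (Hp i).
  - by move=> k; apply: smO; exact: smooth_pderiv.
  - exact: H1_gradL2 Hphi.
  - exact: (cV i).1.
  - exact: cf.2.
have c2 : (fun k => \sum_i (dot (pderiv (V k i) i) (f_ k) + dot (V k i) (pderiv (f_ k) i))) @ \oo --> dotS (cst 0) (trace Om S phi).
  have sN k : smooth (fun x => \sum_i nu i x * V k i x) by apply: smooth_sum => i _; exact: smoothM.
  rewrite (_ : (fun k => _) = fun k => dotS (fun x => \sum_i nu i x * V k i x) (f_ k)); last first.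
    apply/funext => k; rewrite (dotL2_suml mbd) => [|i _|]; [|by apply: smS; exact: smoothM|exact: smS].
    apply: eq_bigr => i _; rewrite (dot_pderivM i (sV k i) (sf k)).
    by apply: eq_Rintegral => x _ /=; ring.
  have c0 : nrmS (cst 0 \- (fun x => \sum_i nu i x * V k i x)) @[k --> \oo] --> 0.
    rewrite (_ : (fun k => _) = fun k => nrmS (fun x => \sum_i nu i x * V k i x))//.
    apply/funext => k; rewrite -[RHS]normL2N; apply: eq_normL2 => x _ /=; exact: sub0r.
  have H := @cvg_dotL2 _ _ _ S bd mbd (fun k x => \sum_i nu i x * V k i x) f_ (cst 0) (trace Om S phi).
  apply: H => //; [by move=> k; exact: smS|exact: L2_0|by move=> k; exact: smS].
transitivity (dotS (cst 0) (trace Om S phi)); [exact: (cvg_unique _ c1 c2)|exact: (dotL2_0l S mbd (trace Om S phi))].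
Qed.

Lemma cvg_nrmD (u_ v_ : nat -> E -> R) u v : (forall k, L2O (u_ k)) -> L2O u ->
  (forall k, L2O (v_ k)) -> L2O v ->
  nrm (u \- u_ k) @[k --> \oo] --> 0 -> nrm (v \- v_ k) @[k --> \oo] --> 0 ->
  nrm ((u \+ v) \- (u_ k \+ v_ k)) @[k --> \oo] --> 0.
Proof.
move=> Lu_ Lu Lv_ Lv cu cv.
apply: (@squeeze_cvgr _ _ _ _ (cst 0) (fun k => nrm (u \- u_ k) + nrm (v \- v_ k))); last first.
- by rewrite -[X in _ --> X]addr0; exact: cvgD.
- exact: cvg_cst.
apply: nearW => k; rewrite normL2_ge0 andTb.
apply: le_trans (normL2D mO (L2B mO Lu (Lu_ k)) (L2B mO Lv (Lv_ k))).
rewrite le_eqVlt; apply/orP; left; apply/eqP; apply: eq_normL2 => x _ /=; ring.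
Qed.

(* For a tangent field the boundary terms only involve derivatives of the normal. *)
Lemma divcurl_tangent (w : 'I_n.+1 -> E -> R) : (forall i, smooth (w i)) ->
  (forall x, bd x -> \sum_i w i x * nu i x = 0) ->
  divcurl (fun j i => pderiv (w j) i) (fun j i => pderiv (w j) i) =
  \int[S]_(x in bd) (- \sum_i \sum_j w j x * w i x * pderiv (nu i) j x).
Proof.
move=> sw w0; rewrite divcurl_smooth//.
have sdw i j : smooth (pderiv (w i) j) by exact: smooth_pderiv.
have sm1 i j : smooth (fun x => w j x * pderiv (w i) j x * nu i x) := smoothM (smoothM (sw j) (sdw i j)) (snu i).
have sm2 i j : smooth (fun x => w j x * pderiv (w i) i x * nu j x) := smoothM (smoothM (sw j) (sdw i i)) (snu j).
have S1 : L2S (cst 1) by apply: smS; exact: smooth_cst.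
transitivity (dotS (fun x => \sum_i \sum_j (w j x * pderiv (w i) j x * nu i x - w j x * pderiv (w i) i x * nu j x)) (cst 1)).
  rewrite (dotL2_suml mbd) => [|i _|//]; last by apply: smS; apply: smooth_sum => j _; exact: (smoothB (sm1 i j) (sm2 i j)).
  apply: eq_bigr => i _; rewrite (dotL2_suml mbd) => [|j _|//]; last by apply: smS; exact: (smoothB (sm1 i j) (sm2 i j)).
  apply: eq_bigr => j _; rewrite (dotL2Bl mbd (smS (sm1 i j)) (smS (sm2 i j)) S1).
  by congr (_ - _); apply: eq_Rintegral => x _; rewrite mulr1.
apply: eq_Rintegral => x /set_mem bx; rewrite mulr1.
pose f y := \sum_i w i y * nu i y.
have sf : smooth f by apply: smooth_sum => i _; exact: (smoothM (sw i) (snu i)).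
pose v : E := \row_j w j x.
have v0 : \sum_j v ord0 j * nu j x = 0.
  by rewrite -[RHS](w0 x bx); apply: eq_bigr => j _; rewrite mxE.
have := tangential_derivative sf w0 bx v0.
have dfE j : pderiv f j x = \sum_i (w i x * pderiv (nu i) j x + nu i x * pderiv (w i) j x).
  rewrite /f (pderiv_sum (F := fun i y => w i y * nu i y)) => [|i]; last first.
    by apply: smooth_differentiable; exact: (smoothM (sw i) (snu i)).
  by apply: eq_bigr => i _; rewrite -[LHS]/(pderiv (w i \* nu i) j x) pderivM; [|exact: smooth_differentiable|exact: smooth_differentiable].
move=> H.
have H2 : \sum_i \sum_j w j x * pderiv (w i) i x * nu j x = 0.
  apply: big1 => i _; rewrite (eq_bigr (fun j => pderiv (w i) i x * (w j x * nu j x))) => [|j _]; last by ring.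
  by rewrite -mulr_sumr w0// mulr0.
have H1' : \sum_i \sum_j w j x * w i x * pderiv (nu i) j x + \sum_i \sum_j w j x * pderiv (w i) j x * nu i x = 0.
  rewrite -[RHS]H -big_split /=; under eq_bigr do rewrite -big_split /=.
  rewrite exchange_big /=; apply: eq_bigr => j _; rewrite mxE dfE mulr_sumr.
  by apply: eq_bigr => i _; ring.
under eq_bigr do rewrite sumrB.
by rewrite sumrB H2 subr0; apply/eqP; rewrite -addr_eq0 addrC H1'.
Qed.

(** The boundary terms are phi k times derivatives of X on the boundary, which are not controlled
    along the sequence. With X m frozen they are fixed smooth functions and phi k tends to 0 in L^2;
    only afterwards does m grow. *)
Lemma divcurl_normal (phi : nat -> E -> R) (X : nat -> 'I_n.+1 -> E -> R) P Q :
  (forall k, smooth (phi k)) -> nrmS (phi k) @[k --> \oo] --> 0 ->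
  (forall k i, smooth (X k i)) -> (forall i j, L2O (P i j)) -> (forall i j, L2O (Q i j)) ->
  (forall i j, nrm (P i j \- pderiv (nu i \* phi k) j) @[k --> \oo] --> 0) ->
  (forall i j, nrm (Q i j \- pderiv (X k i) j) @[k --> \oo] --> 0) ->
  divcurl P Q = 0.
Proof.
move=> sphi cphi sX LP LQ cP cQ.
have sF k i : smooth (nu i \* phi k) by exact: smoothM.
have LF k i j : L2O (pderiv (nu i \* phi k) j) by apply: smO; exact: smooth_pderiv.
have LX k i j : L2O (pderiv (X k i) j) by apply: smO; exact: smooth_pderiv.
have z m : divcurl P (fun i j => pderiv (X m i) j) = 0.
  have c1 := @cvg_divcurl (fun k i j => pderiv (nu i \* phi k) j) (fun k i j => pderiv (X m i) j) _ _ LF LP (fun _ => LX m) (LX m) cP.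
  have {}c1 := c1 (fun i j => _).
  have cc i j : nrm (pderiv (X m i) j \- pderiv (X m i) j) @[k --> \oo] --> (0 : R).
    rewrite (_ : (fun k : nat => _) = cst 0); first exact: cvg_cst.
    by apply/funext => k; rewrite -[RHS](normL2_0 leb mO); apply: eq_normL2 => x _ /=; rewrite subrr.
  have {c1}c1 := c1 cc.
  suff c0 : (fun k => divcurl (fun i j => pderiv (nu i \* phi k) j) (fun i j => pderiv (X m i) j)) @ \oo --> (0 : R).
    exact: (cvg_unique _ c1 c0).
  have sY i j l : smooth (fun x => nu l x * pderiv (X m i) j x) := smoothM (snu l) (smooth_pderiv j (sX m i)).
  have term f : smooth f -> dotS (phi k) f @[k --> \oo] --> (0 : R).
    move=> sf; have Lf := smS sf; apply: (@squeeze_cvgr _ _ _ _ (fun k => - (nrmS (phi k) * nrmS f)) (fun k => nrmS (phi k) * nrmS f)).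
    - by apply: nearW => k; rewrite -ler_norml; exact: (cauchy_schwarzL2 mbd (smS (sphi k)) Lf).
    - by rewrite -[X in _ --> X]oppr0 -[X in - X](mul0r (nrmS f)); apply: cvgN; apply: cvgM => //; exact: cvg_cst.
    - by rewrite -[X in _ --> X](mul0r (nrmS f)); apply: cvgM => //; exact: cvg_cst.
  rewrite (_ : (fun k => _) = fun k => \sum_i \sum_j (dotS (phi k) (fun x => nu j x * pderiv (X m i) j x * nu i x) -
      dotS (phi k) (fun x => nu j x * pderiv (X m i) i x * nu j x))); last first.
    apply/funext => k; rewrite (divcurl_smooth (sF k) (sX m)); apply: eq_bigr => i _; apply: eq_bigr => j _.
    by congr (_ - _); apply: eq_Rintegral => x _ /=; ring.
  have E0 : (0 : R) = \sum_(i < n.+1) \sum_(j < n.+1) (0 - 0) by rewrite big1// => i _; rewrite big1// => j _; rewrite subrr.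
  rewrite [X in _ --> X]E0.
  apply: (@cvg_sum_seq R _ _ (fun i k => \sum_j (dotS (phi k) (fun x => nu j x * pderiv (X m i) j x * nu i x) -
      dotS (phi k) (fun x => nu j x * pderiv (X m i) i x * nu j x))) (fun=> \sum_j (0 - 0))) => i.
  apply: (@cvg_sum_seq R _ _ (fun j k => dotS (phi k) (fun x => nu j x * pderiv (X m i) j x * nu i x) -
      dotS (phi k) (fun x => nu j x * pderiv (X m i) i x * nu j x)) (fun=> 0 - 0)) => j.
  by apply: cvgB; apply: term; apply: (smoothM (sY _ _ _) (snu _)).
have cPP i j : nrm (P i j \- P i j) @[k --> \oo] --> (0 : R).
  rewrite (_ : (fun k : nat => _) = cst 0); first exact: cvg_cst.
  by apply/funext => k; rewrite -[RHS](normL2_0 leb mO); apply: eq_normL2 => x _ /=; rewrite subrr.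
have c2 := @cvg_divcurl (fun k => P) (fun k i j => pderiv (X k i) j) _ _ (fun _ => LP) LP LX LQ cPP cQ.
suff c0 : (fun k => divcurl P (fun i j => pderiv (X k i) j)) @ \oo --> (0 : R) by exact: (cvg_unique _ c2 c0).
by rewrite (_ : (fun k => _) = cst 0); [exact: cvg_cst|apply/funext => k; exact: z].
Qed.

(** For symmetric q, [divcurl q q] is the squared norm of q minus that of its trace, so an upper
    bound for it is what is needed. Only the tangent part of the approximating fields contributes in
    the limit; its boundary term is quadratic in the field, and the trace inequality absorbs it. *)
Lemma h2_estimate : exists2 C : R, 0 <= C & forall p (q : 'I_n.+1 -> 'I_n.+1 -> E -> R),
  (forall i, H1 (p i) (q i)) -> normal_trace0 p -> (forall i j, nrm (q i j \- q j i) = 0) ->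
  \sum_i \sum_j nrm (q i j) ^+ 2 <= C * (nrm (fun x => \sum_i q i i x) ^+ 2 + \sum_i nrm (p i) ^+ 2).
Proof.
have [M M0 HM] : exists2 M : R, 0 <= M & forall i j x, bd x -> `|pderiv (nu i) j x| <= M.
  have /choice[m Hm] : forall ij : 'I_n.+1 * 'I_n.+1, exists m : R, forall x, bd x -> `|pderiv (nu ij.1) ij.2 x| <= m.
    move=> [i j]; have cd := smooth_continuous (smooth_pderiv j (snu i)).
    have [m _ Hm] := compact_bounded_fun (closure_compact bO) (fun x _ => cd x).
    by exists m => x /bdry_closure; exact: Hm.
  exists (\sum_ij `|m ij|) => [|i j x bx]; first exact: sumr_ge0.
  by apply: le_trans (Hm (i, j) x bx) (le_sum_norm m (i, j)).
(* The form with coefficients d_j nu_i is bounded by A times the squared length of the field. The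
   choice of e gives A e <= 1/2, so the trace inequality returns at most half of the norm of q. *)
pose A := M * n.+1%:R; have A0 : 0 <= A by rewrite mulr_ge0.
pose e := (2 * (A + 1))^-1; have A1 : 0 < 2 * (A + 1) by rewrite mulr_gt0// ltr_wpDl.
have e0 : 0 < e by rewrite invr_gt0.
have Ae : A * e <= 2^-1.
  rewrite /e invfM mulrCA ler_piMr ?invr_ge0// ler_pdivrMr ?mul1r ?lerDl// ltr_wpDl//.
have [Ce Ce0 HCe] := trace_ineq oO bO sS Hpou snu nuE e0.
exists (2 * (1 + A * Ce)) => [|p q Hp p0 qsym]; first by rewrite mulr_ge0// addr_ge0// mulr_ge0.
have Lq i j : L2O (q i j) := H1_gradL2 j (Hp i); have Lp i : L2O (p i) := H1_L2 (Hp i).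
have [V [sV cV cN]] := normal_trace0_seq Hp p0.
have LV k i : L2O (V k i) := smO (sV k i).
have LdV k i j : L2O (pderiv (V k i) j) := smO (smooth_pderiv j (sV k i)).
(* Split V k into its normal part F k and a field W k that is tangent on the boundary. *)
pose phi k x := \sum_l nu l x * V k l x.
have sphi k : smooth (phi k) by apply: smooth_sum => l _; exact: (smoothM (snu l) (sV k l)).
pose F k i := nu i \* phi k; have sF k i : smooth (F k i) := smoothM (snu i) (sphi k).
have LdF k i j : L2O (pderiv (F k i) j) := smO (smooth_pderiv j (sF k i)).
pose W k i := V k i \- F k i; have sW k i : smooth (W k i) := smoothB (sV k i) (sF k i).
have LdW k i j : L2O (pderiv (W k i) j) := smO (smooth_pderiv j (sW k i)).
have snn i l : smooth (nu i \* nu l) := smoothM (snu i) (snu l).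
pose FI i j : E -> R := (fun x => \sum_l pderiv (nu i \* nu l) j x * p l x) \+ (fun x => \sum_l (nu i \* nu l) x * q l j x).
have cdnn i l j := smooth_continuous (smooth_pderiv j (snn i l)); have cnn i l := smooth_continuous (snn i l).
have La1 i j l := L2_contM oO bO (cdnn i l j) (Lp l).
have La2 i j l := L2_contM oO bO (cnn i l) (Lq l j).
have LFI i j : L2O (FI i j).
  by apply: (L2D mO); apply: (L2_sum mO) => l _.
have dFE k i j x : pderiv (F k i) j x = \sum_l pderiv (nu i \* nu l) j x * V k l x + \sum_l (nu i \* nu l) x * pderiv (V k l) j x.
  have -> : F k i = fun x => \sum_l (nu i \* nu l) x * V k l x.
    by apply/funext => y; rewrite /F /phi /= mulr_sumr; apply: eq_bigr => l _; rewrite mulrA.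
  rewrite (pderiv_sum (F := fun l y => (nu i \* nu l) y * V k l y)) => [|l]; last first.
    by apply: smooth_differentiable; exact: (smoothM (snn i l) (sV k l)).
  rewrite -big_split; apply: eq_bigr => l _.
  rewrite -[LHS]/(pderiv ((nu i \* nu l) \* V k l) j x) pderivM; [|exact: smooth_differentiable|exact: smooth_differentiable].
  by rewrite addrC mulrC.
have cF i j : nrm (FI i j \- pderiv (F k i) j) @[k --> \oo] --> 0.
  rewrite (_ : (fun k => _) = fun k => nrm (FI i j \- ((fun x => \sum_l pderiv (nu i \* nu l) j x * V k l x) \+ (fun x => \sum_l (nu i \* nu l) x * pderiv (V k l) j x)))); last first.
    by apply/funext => k; apply: eq_normL2 => x _ /=; rewrite dFE.
  have Lb1 k l := L2_contM oO bO (cdnn i l j) (LV k l).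
  have Lb2 k l := L2_contM oO bO (cnn i l) (LdV k l j).
  apply: cvg_nrmD.
  - by move=> k; apply: (L2_sum mO) => l _.
  - by apply: (L2_sum mO) => l _.
  - by move=> k; apply: (L2_sum mO) => l _.
  - by apply: (L2_sum mO) => l _.
  - apply: (@cvg_nrm_sum _ (fun l k x => pderiv (nu i \* nu l) j x * V k l x) (fun l x => pderiv (nu i \* nu l) j x * p l x)) => //.
    by move=> l; exact: (cvg_nrm_contM (cdnn i l j) (fun k => LV k l) (Lp l) (cV l).1).
  - apply: (@cvg_nrm_sum _ (fun l k x => (nu i \* nu l) x * pderiv (V k l) j x) (fun l x => (nu i \* nu l) x * q l j x)) => //.
    by move=> l; exact: (cvg_nrm_contM (cnn i l) (fun k => LdV k l j) (Lq l j) ((cV l).2 j)).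
have dWE k i j x : pderiv (W k i) j x = pderiv (V k i) j x - pderiv (F k i) j x.
  by rewrite /pderiv /W deriveB//; apply: diff_derivable; exact: smooth_differentiable.
have cW i j : nrm ((q i j \- FI i j) \- pderiv (W k i) j) @[k --> \oo] --> 0.
  rewrite (_ : (fun k => _) = fun k => nrm ((q i j \- FI i j) \- (pderiv (V k i) j \- pderiv (F k i) j))); last first.
    by apply/funext => k; apply: eq_normL2 => x _ /=; rewrite dWE.
  exact: (cvg_nrmB oO (fun k => LdV k i j) (Lq i j) (fun k => LdF k i j) (LFI i j) ((cV i).2 j) (cF i j)).
pose dV k := fun i j => pderiv (V k i) j; pose dF k := fun i j => pderiv (F k i) j; pose dW k := fun i j => pderiv (W k i) j.
have z1 : divcurl FI q = 0 by apply: (divcurl_normal sphi cN sV LFI Lq cF) => i j; exact: (cV i).2.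
have z2 : divcurl FI (fun i j => q i j \- FI i j) = 0.
  by apply: (divcurl_normal sphi cN sW LFI _ cF cW) => i j; exact: (L2B mO).
have c1 : divcurl (dF k) (dV k) @[k --> \oo] --> (0 : R).
  by rewrite -[X in _ --> X]z1; exact: (@cvg_divcurl dF dV FI q LdF LFI LdV Lq cF (fun i j => (cV i).2 j)).
have c2 : divcurl (dF k) (dW k) @[k --> \oo] --> (0 : R).
  by rewrite -[X in _ --> X]z2; exact: (@cvg_divcurl dF dW FI (fun i j => q i j \- FI i j) LdF LFI LdW (fun i j => L2B mO (Lq i j) (LFI i j)) cF cW).
have c3 : divcurl (dV k) (dV k) @[k --> \oo] --> divcurl q q.
  exact: (@cvg_divcurl dV dV q q LdV Lq LdV Lq (fun i j => (cV i).2 j) (fun i j => (cV i).2 j)).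
have dec k : divcurl (dV k) (dV k) = divcurl (dW k) (dW k) + (divcurl (dF k) (dV k) + divcurl (dF k) (dW k)).
  have dVE i j x : Om x -> dV k i j x = (dF k i j \+ dW k i j) x by move=> _; rewrite /dV /dF /dW /= dWE addrC subrK.
  have s1 Q : (forall i j, L2O (Q i j)) -> divcurl (dV k) Q = divcurl (dF k) Q + divcurl (dW k) Q.
    move=> LQ; rewrite -(divcurlDl (LdF k) (LdW k) LQ); exact: (eq_divcurl dVE (fun _ _ _ _ => erefl)).
  rewrite (s1 _ (LdV k)) (divcurlC (dW k)) (s1 _ (LdW k)).
  by move: (divcurl _ _) (divcurl _ _) (divcurl _ _) => *; ring.
have bW k : divcurl (dW k) (dW k) <= A * \sum_i nrmS (V k i) ^+ 2.
  have sWW : smooth (fun x => - \sum_i \sum_j W k j x * W k i x * pderiv (nu i) j x).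
    apply: smoothN; apply: smooth_sum => i _; apply: smooth_sum => j _.
    exact: (smoothM (smoothM (sW k j) (sW k i)) (smooth_pderiv j (snu i))).
  have sVV : smooth (fun x => \sum_i V k i x * V k i x) by apply: smooth_sum => i _; exact: (smoothM (sV k i) (sV k i)).
  have S1 : L2S (cst 1) by apply: smS; exact: smooth_cst.
  have nn x : bd x -> \sum_i nu i x * nu i x = 1 by exact: (nu_sqr_sum oO Hpou nuE).
  rewrite divcurl_tangent//; last first.
    move=> x bx; rewrite (eq_bigr (fun i => nu i x * V k i x - phi k x * (nu i x * nu i x))) => [|i _].
      by rewrite sumrB -mulr_sumr nn// mulr1 subrr.
    by rewrite /W /F /=; ring.
  have -> : A * \sum_i nrmS (V k i) ^+ 2 = \int[S]_(x in bd) (A * \sum_i V k i x * V k i x).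
    transitivity (A * dotS (fun x => \sum_i V k i x * V k i x) (cst 1)).
      congr (_ * _); rewrite (dotL2_suml mbd) => [|i _|//]; last by apply: smS; exact: (smoothM (sV k i) (sV k i)).
      by apply: eq_bigr => i _; rewrite sqr_normL2; apply: eq_Rintegral => x _; rewrite mulr1.
    rewrite -(dotL2Zl mbd A (smS sVV) S1); apply: eq_Rintegral => x _; by rewrite mulr1.
  have int1 f : smooth f -> S.-integrable bd (EFin \o f).
    move=> sf; have := L2_mul_integrable mbd (smS sf) S1; apply: eq_integrable => [|x _ /=]; [exact: mbd|by rewrite mulr1].
  apply: le_Rintegral => //; [exact: mbd|exact: int1|by apply: int1; apply: (smoothM (smooth_cst A) sVV)|].
  move=> x bx.
  (* On the boundary W is the orthogonal projection of V onto the tangent space, because nu has unit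
     length there. *)
  have w2 : \sum_i W k i x ^+ 2 <= \sum_i V k i x * V k i x.
    have -> : \sum_i W k i x ^+ 2 = \sum_i V k i x * V k i x - 2 * phi k x * (\sum_i nu i x * V k i x) + phi k x * phi k x * \sum_i nu i x * nu i x.
      rewrite (eq_bigr (fun i => (V k i x - nu i x * phi k x) ^+ 2))//; move: (phi k x) => c.
      by rewrite !mulr_sumr -sumrB -big_split /=; apply: eq_bigr => i _; ring.
    rewrite -/(phi k x).
    by rewrite nn// mulr1; have := sqr_ge0 (phi k x); move: (phi k x) (\sum_i _) => a0 b0; nra.
  apply: le_trans (_ : A * \sum_i W k i x ^+ 2 <= _); last by rewrite ler_wpM2l.
  rewrite -sumrN; apply: (@le_trans _ _ (\sum_i \sum_j M * ((W k i x ^+ 2 + W k j x ^+ 2) / 2))).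
    apply: ler_sum => i _; rewrite -sumrN; apply: ler_sum => j _.
    apply: le_trans (ler_norm _) _; rewrite normrN normrM mulrC; apply: ler_pM => //; first exact: HM.
    rewrite ler_norml; apply/andP; split.
      by have := sqr_ge0 (W k j x + W k i x); move: (W k j x) (W k i x) => *; nra.
    by have := sqr_ge0 (W k j x - W k i x); move: (W k j x) (W k i x) => *; nra.
  rewrite le_eqVlt; apply/orP; left; apply/eqP.
  under eq_bigr do rewrite -mulr_sumr -mulr_suml big_split /= sumr_const card_ord.
  rewrite -mulr_sumr -mulr_suml big_split /= sumr_const card_ord sumrMnl -mulrA; congr (_ * _).
  by rewrite -[_ *+ n.+1]mulr_natl; move: (n.+1%:R) (\sum_(i < n.+1) _) => c1' c2'; field.
have c4 : (fun k => divcurl (dV k) (dV k) - (divcurl (dF k) (dV k) + divcurl (dF k) (dW k))) @ \oo --> divcurl q q.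
  have E0 : divcurl q q = divcurl q q - (0 + 0) by rewrite addr0 subr0.
  by rewrite [X in _ --> X]E0; exact: (cvgB c3 (cvgD c1 c2)).
have c5 : (fun k => \sum_i (2^-1 * \sum_j nrm (pderiv (V k i) j) ^+ 2 + A * Ce * nrm (V k i) ^+ 2)) @ \oo -->
    \sum_i (2^-1 * \sum_j nrm (q i j) ^+ 2 + A * Ce * nrm (p i) ^+ 2).
  apply: (@cvg_sum_seq R _ _ (fun i k => 2^-1 * \sum_j nrm (pderiv (V k i) j) ^+ 2 + A * Ce * nrm (V k i) ^+ 2)
    (fun i => 2^-1 * \sum_j nrm (q i j) ^+ 2 + A * Ce * nrm (p i) ^+ 2)) => i.
  apply: cvgD; apply: cvgM; [exact: cvg_cst| |exact: cvg_cst|].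
    apply: (@cvg_sum_seq R _ _ (fun j k => nrm (pderiv (V k i) j) ^+ 2) (fun j => nrm (q i j) ^+ 2)) => j.
    exact: (cvg_sqr (cvg_normL2 mO (fun k => LdV k i j) (Lq i j) ((cV i).2 j))).
  exact: (cvg_sqr (cvg_normL2 mO (fun k => LV k i) (Lp i) (cV i).1)).
have est : divcurl q q <= \sum_i (2^-1 * \sum_j nrm (q i j) ^+ 2 + A * Ce * nrm (p i) ^+ 2).
  apply: (ler_cvg_to c4 c5); apply: nearW => k; rewrite dec addrK; apply: le_trans (bW k) _.
  rewrite mulr_sumr; apply: ler_sum => i _; apply: le_trans (ler_wpM2l A0 (HCe _ (sV k i))) _.
  rewrite mulrDr !mulrA lerD2r ler_wpM2r//; apply: sumr_ge0 => j _; exact: sqr_ge0.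
(* Symmetry of q up to norm zero turns each product of q_ji and q_ij into a square. *)
have qq : divcurl q q = \sum_i \sum_j nrm (q i j) ^+ 2 - nrm (fun x => \sum_i q i i x) ^+ 2.
  rewrite /divcurl; under eq_bigr do rewrite sumrB; rewrite sumrB; congr (_ - _).
    apply: eq_bigr => i _; apply: eq_bigr => j _; rewrite sqr_normL2; apply/eqP; rewrite -subr_eq0.
    by rewrite -(dotL2Bl mO (Lq j i) (Lq i j) (Lq i j)); apply/eqP; apply: (normL2_dot0 mO (L2B mO (Lq j i) (Lq i j)) (Lq i j)).
  rewrite sqr_normL2 (dotL2_sumr mO) => [|i _|]; [|exact: Lq|by apply: (L2_sum mO) => i _].
  apply: eq_bigr => i _; rewrite (dotL2_suml mO) => [//|j _|]; exact: Lq.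
move: est; rewrite qq big_split /= -!mulr_sumr.
have : 0 <= A * Ce by rewrite mulr_ge0.
have : 0 <= \sum_i nrm (p i) ^+ 2 by apply: sumr_ge0 => i _; exact: sqr_ge0.
have := sqr_ge0 (nrm (fun x => \sum_i q i i x)).
move: (nrm (fun x => _) ^+ 2) (\sum_i nrm (p i) ^+ 2) (\sum_i \sum_j nrm (q i j) ^+ 2) (A * Ce) => D B T a1 D0 B0 a0 H.
by have := mulr_ge0 a0 D0; have := mulr_ge0 a0 B0; nra.
Qed.

End vector_fields.

(** * H^2 functions with zero normal derivative *)

Section second_order.
Context {R : realType} {n : nat}.
Local Notation E := 'rV[R]_n.+1.
Local Notation leb := (lebesgue_rV n.+1).
Variables (Om : set E) (S : {measure set E -> \bar R}).
Hypotheses (oO : open Om) (bO : bounded_set Om) (sO : smooth_bdry Om) (sS : surface_measure Om S).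
Local Notation bd := (bdry Om).
Local Notation dot := (dotL2 leb Om).
Local Notation nrm := (normL2 leb Om).
Local Notation L2O := (L2 leb Om).
Local Notation dotS := (dotL2 S bd).
Local Notation nrmS := (normL2 S bd).
Local Notation L2S := (L2 S bd).
Local Notation mO := (measurable_open oO).
Local Notation mbd := (@measurable_bdry R n Om).
Local Notation wd i u v := (is_wderiv Om [:: i] u v).
Implicit Types (f psi u v w t : E -> R) (p : 'I_n.+1 -> E -> R) (q : 'I_n.+1 -> 'I_n.+1 -> E -> R) (e C M : R).

Variables (N : nat) (a : 'I_N -> E) (r : 'I_N -> R) (zeta : 'I_N -> E -> R).
Hypothesis Hpou : pou (closure Om) (loc Om) a r zeta.
Let Hcone : pou (closure Om) (cone Om) a r zeta := pou_imp (@loc_cone R n Om) Hpou.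
Variable nu : 'I_n.+1 -> E -> R.
Hypotheses (snu : forall k, smooth (nu k)) (nuE : forall x, bd x -> forall k, nu k x = outward_normal Om x ord0 k).

Local Notation H1 := (H1 Om).
Local Notation smO := (smooth_L2 oO bO).
Local Notation smS := (smooth_L2S oO bO sS Hpou).
Local Notation nt0 := (normal_trace0 Om S nu).
Let cnu k := smooth_continuous (snu k).

Definition H2 u p q := H1 u p /\ forall i, H1 (p i) (q i).

Lemma wd2P u p q i j : wd i u (p i) -> wd j (p i) (q i j) <-> is_wderiv Om [:: i; j] u (q i j).
Proof.
move=> /wd1P[_ Hp]; have key phi : test_fun Om phi -> dot u (iter_pderiv [:: i; j] phi) = - dot (p i) (pderiv phi j).
  by move=> tphi; rewrite -Hp//; exact: test_fun_pderiv.
split=> [/wd1P[Lq Hq]|[Lq Hq]].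
  by split=> // phi tphi; rewrite key// Hq// opprK /= sqrrN expr1n mul1r.
apply/wd1P; split=> // phi tphi; apply: oppr_inj; rewrite opprK -key// Hq//=.
by rewrite sqrrN expr1n mul1r.
Qed.

Lemma Hk2P u : Hk Om 2 u <-> exists p q, H2 u p q.
Proof.
split=> [[Lu H]|[p [q [[Lu Hp] Hq]]]].
  have /choice[p Hp] := fun i => H [:: i] isT.
  have /choice[q' Hq] := fun ij : 'I_n.+1 * 'I_n.+1 => H [:: ij.1; ij.2] isT.
  exists p, (fun i j => q' (i, j)); split; first by split.
  move=> i; split=> [|j]; first by have [] := Hp i.
  by apply/(@wd2P u p (fun i j => q' (i, j))) => //; exact: (Hq (i, j)).
split=> // -[_|i [_|j [|//] _]]; first by exists u; split=> // phi _; rewrite /= expr0 mul1r.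
  by exists (p i); exact: Hp.
by exists (q i j); apply/(@wd2P u p q) => //; exact: (Hq i).2.
Qed.

Lemma H2_wderiv u : Hk Om 2 u -> H2 u (fun i => wderiv Om [:: i] u) (fun i j => wderiv Om [:: i; j] u).
Proof.
move=> [Lu H]; have W al : (size al <= 2)%N -> is_wderiv Om al u (wderiv Om al u).
  by move=> /H[v Hv]; apply: (xgetPex (cst 0)); exists v.
split; first by split=> // i; exact: W.
move=> i; split=> [|j]; first by have [] := W [:: i] isT.
by apply/(@wd2P u (fun i => wderiv Om [:: i] u) (fun i j => wderiv Om [:: i; j] u)); exact: W.
Qed.

Lemma H2_uniq u p q p' q' : H2 u p q -> H2 u p' q' ->
  (forall i, nrm (p i \- p' i) = 0) /\ forall i j, nrm (q i j \- q' i j) = 0.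
Proof.
move=> [[Lu Hp] Hq] [[_ Hp'] Hq']; have E i : nrm (p i \- p' i) = 0 := wd_unique oO bO Hpou (Hp i) (Hp' i).
split=> // i j; apply: (wd_unique oO bO Hpou (i := j) (u := p i)); first exact: (Hq i).2.
have /wd1P[Lq H] := (Hq' i).2 j; apply/wd1P; split=> // phi tphi.
have Lphi := test_fun_L2 oO bO (test_fun_pderiv j tphi).
have Lp := H1_L2 (Hq i); have Lp' := H1_L2 (Hq' i).
rewrite -H//; apply/eqP; rewrite -subr_eq0 -(dotL2Bl mO Lp Lp' Lphi); apply/eqP.
exact: (normL2_dot0 mO (L2B mO Lp Lp') Lphi (E i)).
Qed.

(** The derivatives fall on the test function, where they commute. *)
Lemma H2_sym u p q : H2 u p q -> forall i j, nrm (q i j \- q j i) = 0.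
Proof.
move=> [[Lu Hp] Hq] i j; have Lq k l : L2O (q k l) := H1_gradL2 l (Hq k).
apply: (wd_unique0 oO bO Hcone (L2B mO (Lq i j) (Lq j i))) => phi tphi.
rewrite (dotL2Bl mO (Lq i j) (Lq j i) (test_fun_L2 oO bO tphi)).
have sphi : smooth phi by have [] := tphi.
have key k l : dot (q k l) phi = dot u (pderiv (pderiv phi l) k).
  have /(@wd2P u p q k l (Hp k))[_ H] := (Hq k).2 l.
  by have := H phi tphi; rewrite /= sqrrN expr1n mul1r.
by rewrite !key (smooth_pderivC i j sphi) subrr.
Qed.

Lemma H2_laplacian u p q : H2 u p q -> L2O (laplacian Om u) /\ nrm (laplacian Om u \- (fun x => \sum_i q i i x)) = 0.
Proof.
move=> Hu; have Hw : H2 u (fun i => wderiv Om [:: i] u) (fun i j => wderiv Om [:: i; j] u).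
  by apply: H2_wderiv; apply/Hk2P; exists p, q.
have Lq i j : L2O (q i j) := H1_gradL2 j (Hu.2 i).
have Lw i j : L2O (wderiv Om [:: i; j] u) := H1_gradL2 j (Hw.2 i).
have [_ E] := H2_uniq Hw Hu; split; first by apply: (L2_sum mO) => i _.
apply/eqP; rewrite eq_le normL2_ge0 andbT.
rewrite (@eq_normL2 _ _ _ _ _ _ (fun x => \sum_i (wderiv Om [:: i; i] u \- q i i) x)); last first.
  by move=> x _ /=; rewrite sumrB.
apply: le_trans (@normL2_sum _ _ _ leb Om mO _ (index_enum 'I_n.+1) xpredT (fun i => wderiv Om [:: i; i] u \- q i i) (fun i _ => L2B mO (Lw i i) (Lq i i))) _.
by rewrite big1// => i _.
Qed.

Lemma H2B u p q u' p' q' : H2 u p q -> H2 u' p' q' ->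
  H2 (u \- u') (fun i => p i \- p' i) (fun i j => q i j \- q' i j).
Proof. by move=> [Hu Hq] [Hu' Hq']; split=> [|i]; exact: H1B. Qed.

Lemma is_traceB u p u' p' t t' : H1 u p -> H1 u' p' -> is_trace Om S u t -> is_trace Om S u' t' ->
  is_trace Om S (u \- u') (t \- t').
Proof.
move=> Hu Hu' tu tu'; have [Lt [f_ [sf [cf cdf] cft]]] := is_trace_H1 oO bO Hpou tu Hu.
have [Lt' [g_ [sg [cg cdg] cgt]]] := is_trace_H1 oO bO Hpou tu' Hu'.
have Ldf k i := smO (smooth_pderiv i (sf k)); have Ldg k i := smO (smooth_pderiv i (sg k)).
apply: (is_trace_of_cvg oO bO Hpou (H1B oO bO Hu Hu') (L2B mbd Lt Lt') (phi_ := fun k => f_ k \- g_ k)).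
- by move=> k; exact: smoothB.
- split=> [|i]; first exact: (cvg_nrmB oO (fun k => smO (sf k)) (H1_L2 Hu) (fun k => smO (sg k)) (H1_L2 Hu') cf cg).
  rewrite (_ : (fun k => _) = fun k => nrm ((p i \- p' i) \- (pderiv (f_ k) i \- pderiv (g_ k) i))).
    exact: (cvg_nrmB oO (fun k => Ldf k i) (H1_gradL2 i Hu) (fun k => Ldg k i) (H1_gradL2 i Hu') (cdf i) (cdg i)).
  apply/funext => k; apply: eq_normL2 => x _ /=; congr (_ - _).
  by rewrite /pderiv deriveB//; apply: diff_derivable; exact: smooth_differentiable.
- apply: (@squeeze_cvgr _ _ _ _ (cst 0) (fun k => nrmS (t \- f_ k) + nrmS (t' \- g_ k))); last first.
  + by rewrite -[X in _ --> X]addr0; exact: cvgD.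
  + exact: cvg_cst.
  apply: nearW => k; rewrite normL2_ge0 andTb.
  apply: le_trans (normL2B mbd (L2B mbd Lt (smS (sf k))) (L2B mbd Lt' (smS (sg k)))).
  rewrite le_eqVlt; apply/orP; left; apply/eqP; apply: eq_normL2 => x _ /=; ring.
Qed.

Lemma is_trace_L2 u t : is_trace Om S u t -> L2S t. Proof. by case. Qed.

Lemma normal_trace0B p q p' q' : (forall i, H1 (p i) (q i)) -> (forall i, H1 (p' i) (q' i)) ->
  nt0 p -> nt0 p' -> nt0 (fun i => p i \- p' i).
Proof.
move=> Hp Hp' [t [tp t0]] [t' [tp' t'0]]; exists (fun i => t i \- t' i); split=> [i|].
  exact: is_traceB (Hp i) (Hp' i) (tp i) (tp' i).
have [M M0 HM] := normal_component_le S bO snu.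
have [L1 _] := HM t (fun i => is_trace_L2 (tp i)); have [L2' _] := HM t' (fun i => is_trace_L2 (tp' i)).
apply/eqP; rewrite eq_le normL2_ge0 andbT; apply: le_trans (_ : _ <= nrmS (fun x => \sum_i nu i x * t i x) + nrmS (fun x => \sum_i nu i x * t' i x)) _; last by rewrite t0 t'0 addr0.
apply: le_trans (normL2B mbd L1 L2'); rewrite le_eqVlt; apply/orP; left; apply/eqP; apply: eq_normL2 => x _ /=.
by rewrite -sumrB; apply: eq_bigr => i _; rewrite mulrBr.
Qed.

(** H^1 convergence of the fields gives L^2 convergence of their traces by the trace inequality with
    e = 1, hence of the normal components. *)
Lemma normal_trace0_lim (p_ : nat -> 'I_n.+1 -> E -> R) (q_ : nat -> 'I_n.+1 -> 'I_n.+1 -> E -> R) p q :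
  (forall k i, H1 (p_ k i) (q_ k i)) -> (forall i, H1 (p i) (q i)) -> (forall k, nt0 (p_ k)) ->
  (forall i, nrm (p i \- p_ k i) @[k --> \oo] --> 0) ->
  (forall i j, nrm (q i j \- q_ k i j) @[k --> \oo] --> 0) -> nt0 p.
Proof.
move=> Hp_ Hp n0 cp cq; have tp i := traceP oO bO sS Hpou snu nuE (Hp i).
exists (fun i => trace Om S (p i)); split=> //.
have /choice[t Ht] := n0; have tk k i : is_trace Om S (p_ k i) (t k i) by have [] := Ht k.
have [C C0 HC] := is_trace_ineq oO bO sS Hpou snu nuE ltr01; have [M M0 HM] := normal_component_le S bO snu.
have ct i : nrmS (trace Om S (p i) \- t k i) @[k --> \oo] --> 0.
  have c2 : (fun k => nrmS (trace Om S (p i) \- t k i) ^+ 2) @ \oo --> (0 : R).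
    apply: (@squeeze_cvgr _ _ _ _ (cst 0) (fun k => 1 * \sum_j nrm (q i j \- q_ k i j) ^+ 2 + C * nrm (p i \- p_ k i) ^+ 2)).
    - by apply: nearW => k; rewrite sqr_ge0 andTb; exact: HC (Hp i) (Hp_ k i) (tp i) (tk k i).
    - exact: cvg_cst.
    have E0 : (0 : R) = 1 * (\sum_(j < n.+1) 0 ^+ 2) + C * 0 ^+ 2.
      by rewrite expr0n /= mulr0 addr0 big1 ?mulr0.
    rewrite [X in _ --> X]E0; apply: cvgD; apply: cvgM; [exact: cvg_cst| |exact: cvg_cst|exact: (cvg_sqr (cp i))].
    by apply: (@cvg_sum_seq R _ _ (fun j k => nrm (q i j \- q_ k i j) ^+ 2) (fun=> 0 ^+ 2)) => j; exact: (cvg_sqr (cq i j)).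
  rewrite (_ : (fun k => _) = fun k => Num.sqrt (nrmS (trace Om S (p i) \- t k i) ^+ 2)).
    by rewrite -[X in _ --> X]sqrtr0; apply: (cvg_comp _ _ c2); exact: sqrt_continuous.
  by apply/funext => k; rewrite sqrtr_sqr ger0_norm// normL2_ge0.
have Lt i := is_trace_L2 (tp i); have Ltk k i := is_trace_L2 (tk k i).
apply/eqP; rewrite eq_le normL2_ge0 andbT.
have cB : (fun k => M * \sum_i nrmS (trace Om S (p i) \- t k i)) @ \oo --> (0 : R).
  have E0 : (0 : R) = M * \sum_(j < n.+1) 0 by rewrite big1 ?mulr0.
  rewrite [X in _ --> X]E0; apply: cvgM; first exact: cvg_cst.
  exact: (@cvg_sum_seq R _ _ (fun i k => nrmS (trace Om S (p i) \- t k i)) (fun=> 0)).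
apply: (ler_cvg_to (cvg_cst _) cB); apply: nearW => k.
have [L1 _] := HM _ (Ltk k); have [L2' le2] := HM _ (fun i => L2B mbd (Lt i) (Ltk k i)).
apply: le_trans le2; have [_ t0] := Ht k.
rewrite (@eq_normL2 _ _ _ _ _ _ ((fun x => \sum_i nu i x * (trace Om S (p i) \- t k i) x) \+ (fun x => \sum_i nu i x * t k i x))); last first.
  by move=> x _ /=; rewrite -big_split; apply: eq_bigr => i _ /=; ring.
by apply: le_trans (normL2D mbd L2' L1) _; rewrite t0 addr0.
Qed.

Lemma Y12_data u : Y12 Om S u ->
  H2 u (fun i => wderiv Om [:: i] u) (fun i j => wderiv Om [:: i; j] u) /\ nt0 (fun i => wderiv Om [:: i] u).
Proof.
move=> [Hu n0]; have Hw := H2_wderiv Hu; split=> //.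
have tp i := traceP oO bO sS Hpou snu nuE (Hw.2 i).
exists (fun i => trace Om S (wderiv Om [:: i] u)); split=> //.
have [M M0 HM] := normal_component_le S bO snu; have [[mL _] _] := HM _ (fun i => is_trace_L2 (tp i)).
apply: (proj2 (ae_normL2_eq0 mbd mL _)); apply: filterS n0 => x Hx bx; rewrite -[RHS](Hx bx).
by apply: eq_bigr => i _; rewrite nuE// mulrC.
Qed.

(** [Y12] speaks of the selected derivatives and traces. They differ from the given data by
    functions of norm zero, and [is_trace_ineq] shows that the boundary values then agree almost
    everywhere. *)
Lemma Y12_intro u p q : H2 u p q -> nt0 p -> Y12 Om S u.
Proof.
move=> Hu [t [tp t0]]; have Hk : Hk Om 2 u by apply/Hk2P; exists p, q.
have Hw := H2_wderiv Hk; have tw i := traceP oO bO sS Hpou snu nuE (Hw.2 i).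
have [Ep Eq] := H2_uniq Hw Hu; split=> //.
have [C C0 HC] := is_trace_ineq oO bO sS Hpou snu nuE ltr01; have [M M0 HM] := normal_component_le S bO snu.
have E i : nrmS (trace Om S (wderiv Om [:: i] u) \- t i) = 0.
  have := HC _ _ _ _ _ _ (Hw.2 i) (Hu.2 i) (tw i) (tp i).
  rewrite Ep big1 => [|j _]; last by rewrite Eq expr0n.
  by rewrite expr0n /= !mulr0 addr0 => h; apply/eqP; rewrite -sqrf_eq0 eq_le h sqr_ge0.
have Lw i := is_trace_L2 (tw i); have Lt i := is_trace_L2 (tp i).
have [L1 _] := HM _ Lw; have [L2' le2] := HM _ (fun i => L2B mbd (Lw i) (Lt i)); have [L3 _] := HM _ Lt.
have n0 : nrmS (fun x => \sum_i nu i x * trace Om S (wderiv Om [:: i] u) x) = 0.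
  apply/eqP; rewrite eq_le normL2_ge0 andbT.
  rewrite (@eq_normL2 _ _ _ _ _ _ ((fun x => \sum_i nu i x * (trace Om S (wderiv Om [:: i] u) \- t i) x) \+ (fun x => \sum_i nu i x * t i x))); last first.
    by move=> x _ /=; rewrite -big_split; apply: eq_bigr => i _ /=; ring.
  apply: le_trans (normL2D mbd L2' L3) _; rewrite t0 addr0; apply: (le_trans le2).
  by rewrite big1 ?mulr0// => i _; exact: E.
apply: filterS (normL2_eq0_ae mbd L1 n0) => x Hx bx; rewrite -[RHS](Hx bx).
by apply: eq_bigr => i _; rewrite nuE// mulrC.
Qed.

End second_order.

(** * Equilibria *)

Lemma lipschitz_of_derive1 {R : realType} (j : R -> R) (K : R) : (forall s, derivable j s 1) ->
  (forall s, `|derive1 j s| <= K) -> forall s t, `|j s - j t| <= K * `|s - t|.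
Proof.
move=> dj bj; have cj : continuous j.
  by move=> s; apply: differentiable_continuous; exact/derivable1_diffP.
have H s t : s <= t -> `|j t - j s| <= K * `|t - s|.
  move=> st; have [c _ ->] := @MVT_segment R j (derive1 j) s t st
    (fun x _ => DeriveDef (dj x) (esym (derive1E j x))) (continuous_subspaceT cj).
  by rewrite normrM ler_wpM2r.
move=> s t; have [st|/ltW ts] := leP s t; last exact: H.
by rewrite distrC (distrC s); exact: H.
Qed.

Lemma admissibleP {R : realType} (K : R) (j : R -> R) : admissible K j ->
  [/\ forall s, derivable j s 1, forall s, `|j s| <= K, forall s, `|derive1 j s| <= K,
      forall s t, `|j s - j t| <= K * `|s - t|
    & (forall s t, `|derive1 j s - derive1 j t| <= K * `|s - t|) /\ continuous (derive1 j)].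
Proof.
move=> [[d1 d2 _] b _]; have b1 s : `|derive1 j s| <= K.
  by apply: le_trans (b s); rewrite -addrA addrCA lerDl addr_ge0.
split; [exact: d1| |exact: b1| |].
- by move=> s; apply: le_trans (b s); rewrite -addrA lerDl addr_ge0.
- exact: lipschitz_of_derive1.
- split; last by move=> s; apply: differentiable_continuous; exact/derivable1_diffP.
  by apply: lipschitz_of_derive1 => // s; apply: le_trans (b s); rewrite derive1nS derive1n1 lerDr addr_ge0.
Qed.

Lemma sub_add_eq {R : realType} (x y z w x' y' z' w' : R) : x + y = z + w -> x' + y' = z' + w' ->
  x - x' + (y - y') = z - z' + (w - w').
Proof. by move=> E E'; rewrite addrACA -opprD E E' opprD addrACA. Qed.

Lemma le_sub_norm2 {R : realType} (x x' y y' b c : R) : `|x| <= b -> `|x'| <= b -> `|y| <= c -> `|y'| <= c ->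
  x - x' + (y - y') <= 2 * b + 2 * c.
Proof. by rewrite !ler_norml => /andP[? ?] /andP[? ?] /andP[? ?] /andP[? ?]; lra. Qed.

Lemma le_sum_term {R : realType} (I : finType) (F : I -> R) i : (forall j, 0 <= F j) -> F i <= \sum_j F j.
Proof. by move=> F0; rewrite (bigD1 i)//= lerDl sumr_ge0. Qed.

Section equilibria_compactness.
Context {R : realType} {n : nat}.
Local Notation E := 'rV[R]_n.+1.
Local Notation leb := (lebesgue_rV n.+1).
Variables (Om : set E) (S : {measure set E -> \bar R}).
Hypotheses (oO : open Om) (bO : bounded_set Om) (sO : smooth_bdry Om) (sS : surface_measure Om S).
Local Notation bd := (bdry Om).
Local Notation dot := (dotL2 leb Om).
Local Notation nrm := (normL2 leb Om).
Local Notation L2O := (L2 leb Om).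
Local Notation dotS := (dotL2 S bd).
Local Notation mO := (measurable_open oO).
Local Notation wd i u v := (is_wderiv Om [:: i] u v).
Local Notation col e := (Om `&` collar Om e).
Local Notation dotC e := (dotL2 leb (col e)).
Local Notation nrmC e := (normL2 leb (col e)).
Local Notation L2C e := (L2 leb (col e)).
Implicit Types (psi u v w t : E -> R) (p : 'I_n.+1 -> E -> R) (q : 'I_n.+1 -> 'I_n.+1 -> E -> R) (e C M : R).

Variables (N : nat) (a : 'I_N -> E) (r : 'I_N -> R) (zeta : 'I_N -> E -> R).
Hypothesis Hpou : pou (closure Om) (loc Om) a r zeta.
Let Hcone : pou (closure Om) (cone Om) a r zeta := pou_imp (@loc_cone R n Om) Hpou.
Variable nu : 'I_n.+1 -> E -> R.
Hypotheses (snu : forall k, smooth (nu k)) (nuE : forall x, bd x -> forall k, nu k x = outward_normal Om x ord0 k).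

Local Notation H1 := (H1 Om).
Local Notation H2 := (H2 Om).
Local Notation H1sq := (H1sq Om).
Local Notation nt0 := (normal_trace0 Om S nu).
Local Notation Y12 := (Y12 Om S).
Local Notation lap := (laplacian Om).
Local Notation D1 u := (fun i => wderiv Om [:: i] u).
Local Notation D2 u := (fun i j => wderiv Om [:: i; j] u).
Local Notation mC := (measurable_collar oO bO sO).
Local Notation L2_col := (L2_collar oO bO sO).

Variables (f g : R -> R) (K : R).
Hypotheses (K0 : 0 < K) (af : admissible K f) (ag : admissible K g).

Lemma Y12_H2 u : Y12 u -> H2 u (D1 u) (D2 u) /\ nt0 (D1 u).
Proof. exact: (Y12_data oO bO sS Hpou snu nuE). Qed.

Lemma Y12_laplacian_L2 u : Y12 u -> L2O (lap u).
Proof. by move=> /Y12_H2[Hu _]; exact: (H2_laplacian oO bO Hpou Hu).1. Qed.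

Lemma Y12_L2 u : Y12 u -> L2O u.
Proof. by move=> [[]]. Qed.

Lemma nemytskii_H1 j u p : admissible K j -> H1 u p -> H1 (j \o u) (fun i x => derive1 j (u x) * p i x).
Proof.
move=> /admissibleP[dj bj bj1 lj [lj1 cj1]] [Lu Hp].
exact: (wd_chain oO bO Hcone (ltW K0) dj bj bj1 lj lj1 cj1 Lu Hp).
Qed.

Lemma nemytskii_lip j u v : admissible K j -> L2O (j \o u) -> L2O (j \o v) -> L2O u -> L2O v ->
  nrm ((j \o u) \- (j \o v)) <= K * nrm (u \- v).
Proof.
move=> /admissibleP[_ _ _ lj _] Lju Ljv Lu Lv; have LD := L2B mO Lu Lv.
rewrite -(gtr0_norm K0) -(normL2Z mO K LD).
apply: (normL2_mono mO (L2B mO Lju Ljv) (L2Z mO K LD)) => x _ /=.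
by rewrite normrM (gtr0_norm K0).
Qed.

Definition weak_eq e u := forall phi, Y12 phi ->
  dot (lap u) (lap phi) + dot u phi =
  dot (f \o u) phi + (if e == 0 then g_bdry Om S g u phi else g_collar Om g e u phi).

(* Since v = 0, the third equation says exactly that th drops out of the second one. *)
Lemma equilibriaP e u v th : equilibria Om S f g e (u, v, th) <->
  (Y12 u /\ weak_eq e u) /\ [/\ L2O v, L2O th, {ae leb, forall x, Om x -> v x = 0} &
    forall phi, Y12 phi -> dot th (lap phi) = dot th phi].
Proof.
have vd v' phi : L2O v' -> {ae leb, forall x, Om x -> v' x = 0} -> L2O phi -> dot v' phi = 0.
  move=> Lv' v0 Lphi; apply: (normL2_dot0 mO Lv' Lphi).
  by have [mv _] := Lv'; exact: (ae_normL2_eq0 mO mv v0).2.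
split=> [[[Yu Lv Lth] [e1 e2 e3]]|[[Yu We] [Lv Lth v0 Hth]]].
  have v0 : {ae leb, forall x, Om x -> v x = 0}.
    by apply: filterS e1 => x Hx Ox; rewrite -[RHS](Hx Ox) /= addr0.
  have Hth phi : Y12 phi -> dot th (lap phi) = dot th phi.
    move=> Yphi; have Lphi := Y12_L2 Yphi; have Llap := Y12_laplacian_L2 Yphi.
    have := e3 phi Yphi; rewrite /= /sqrtLambda_dual !opprK (vd _ _ Lv v0 Llap) (vd _ _ Lv v0 Lphi) subrr add0r addr0.
    by move=> /eqP; rewrite subr_eq0 => /eqP.
  split=> //; split=> // phi Yphi; have := e2 phi Yphi; rewrite /= /Lambda_dual /sqrtLambda_dual (Hth phi Yphi) /f_Omega /=.
  by move: (dot _ _) (dot _ _) (dot _ _) (dot _ _) (if _ then _ else _) => A B C D F; lra.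
split=> //; split=> [|phi Yphi|phi Yphi].
- by apply: filterS v0 => x Hx Ox; rewrite /= addr0; exact: Hx.
- have := We phi Yphi; rewrite /= /Lambda_dual /sqrtLambda_dual (Hth phi Yphi) /f_Omega /=.
  by move: (dot _ _) (dot _ _) (dot _ _) (dot _ _) (if _ then _ else _) => A B C D F; lra.
have Lphi := Y12_L2 Yphi; have Llap := Y12_laplacian_L2 Yphi.
by rewrite /= /sqrtLambda_dual !opprK (vd _ _ Lv v0 Llap) (vd _ _ Lv v0 Lphi) (Hth phi Yphi) subrr add0r addr0 subrr.
Qed.

(** Since |g| <= K, the constant function K dominates g o u on the collar, and [collar_norm_le]
    makes the functional bounded on H^1 uniformly in e and u. *)
Lemma g_collar_le : exists2 e1 : R, 0 < e1 & exists2 C : R, 0 <= C & forall u p phi s e, H1 u p -> H1 phi s ->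
  0 < e -> e <= e1 -> `|g_collar Om g e u phi| <= C * Num.sqrt (H1sq phi s).
Proof.
have [e1 e10 [C C0 HC]] := collar_norm_le oO bO sO sS Hpou snu nuE; have Hc := H1_smooth oO bO (smooth_cst K : smooth (cst K : E -> R)).
exists e1 => //; exists (C * Num.sqrt (H1sq (cst K) (pderiv (cst K)))) => [|u p phi s e Hu Hphi e0 ee1].
  by rewrite mulr_ge0 ?sqrtr_ge0.
have Lc := (L2_col e0 (H1_L2 Hc)).1; have Lphi := (L2_col e0 (H1_L2 Hphi)).1.
have Lg := (L2_col e0 (H1_L2 (nemytskii_H1 ag Hu))).1.
rewrite -mulrA; apply: le_trans (HC _ _ _ _ e Hc Hphi e0 ee1).
rewrite /g_collar normrM (gtr0_norm (x := e^-1)) ?invr_gt0// ler_wpM2l ?invr_ge0 ?(ltW e0)//.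
apply: le_trans (cauchy_schwarzL2 (mC e0) Lg Lphi) _; rewrite ler_wpM2r ?normL2_ge0//.
apply: (normL2_mono (mC e0) Lg Lc) => x _ /=.
by have [_ bg _ _ _] := admissibleP ag; rewrite (gtr0_norm K0).
Qed.

Lemma nemytskii_dot_le j u p phi : admissible K j -> H1 u p -> L2O phi ->
  `|dot (j \o u) phi| <= nrm (cst K) * nrm phi.
Proof.
move=> aj Hu Lphi; have Lj := H1_L2 (nemytskii_H1 aj Hu); have Lc := smooth_L2 oO bO (smooth_cst K : smooth (cst K : E -> R)).
apply: le_trans (cauchy_schwarzL2 mO Lj Lphi) _; rewrite ler_wpM2r ?normL2_ge0//.
apply: (normL2_mono mO Lj Lc) => x _ /=.
by have [_ bj _ _ _] := admissibleP aj; rewrite (gtr0_norm K0).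
Qed.

(** Green's formula tested with u itself, then Cauchy-Schwarz. This interpolation is what reduces
    H^1 norms to the Laplacian and the L^2 norm. *)
Lemma gradient_le u p q : H2 u p q -> nt0 p ->
  \sum_i nrm (p i) ^+ 2 <= nrm (fun x => \sum_i q i i x) * nrm u.
Proof.
move=> [Hu Hq] n0; have := green oO bO sS Hpou snu nuE Hq n0 Hu.
have LD : L2O (fun x => \sum_i q i i x) by apply: (L2_sum mO) => i _; exact: H1_gradL2 (Hq i).
move=> G; rewrite (eq_bigr (fun i => dot (p i) (p i))) => [|i _]; last by rewrite sqr_normL2.
rewrite -[leLHS]opprK -G; apply: le_trans (cauchy_schwarzL2 mO LD (H1_L2 Hu)).
by rewrite -normrN ler_norm.
Qed.

Lemma equilibria_energy_le : exists2 e1 : R, 0 < e1 & exists2 B : R, 0 < B & forall u e, Y12 u -> weak_eq e u ->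
  0 < e -> e <= e1 -> nrm (lap u) <= B /\ nrm u <= B.
Proof.
have [e1 e10 [C C0 HC]] := g_collar_le.
exists e1 => //; pose B := nrm (cst K) + 2 * C + 1.
have B0 : 0 < B by rewrite ltr_wpDl// addr_ge0 ?normL2_ge0// mulr_ge0.
exists B => // u e Yu We e0 ee1; have [Hu n0] := Y12_H2 Yu.
have Lu := Y12_L2 Yu; have Ll := Y12_laplacian_L2 Yu.
have := We u Yu; rewrite gt_eqF// => eq.
have := nemytskii_dot_le af Hu.1 Lu; have := HC _ _ _ _ _ Hu.1 Hu.1 e0 ee1.
have := gradient_le Hu n0; rewrite -/(lap u) H1sqE.
move: eq; rewrite -!sqr_normL2; have := normL2_ge0 leb Om u; have := normL2_ge0 leb Om (lap u); have := normL2_ge0 leb Om (cst K).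
have : 0 <= \sum_i nrm (wderiv Om [:: i] u) ^+ 2 by apply: sumr_ge0 => i _; exact: sqr_ge0.
rewrite /B; move: (nrm (cst K)) (nrm (lap u)) (nrm u) (\sum_i _) (dot _ _) (g_collar _ _ _ _ _) => k A b s F G s0 k0 A0 b0 E sA hG hF.
(* Here A is the norm of the Laplacian, b that of u, and s <= A b is the squared gradient, so b^2 +
   s <= 4 (A^2 + b^2). *)
have rt : Num.sqrt (b ^+ 2 + s) <= 2 * Num.sqrt (A ^+ 2 + b ^+ 2).
  rewrite -[2 in leRHS](@ger0_norm _ (2 : R))// -sqrtr_sqr -sqrtrM ?sqr_ge0//; apply: ler_wsqrtr.
  have := sqr_ge0 (A - b); nra.
(* z is the energy norm: the equation tested with u gives z^2 <= (k + 2 C) z. The extra 1 in the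
   bound keeps it positive and makes the contradiction strict. *)
pose z := Num.sqrt (A ^+ 2 + b ^+ 2); have z0 : 0 <= z := sqrtr_ge0 _.
have z2 : z ^+ 2 = A ^+ 2 + b ^+ 2 by rewrite sqr_sqrtr// addr_ge0 ?sqr_ge0.
have bz : b <= z by rewrite -ler_sqr ?nnegrE// z2 lerDr sqr_ge0.
have Az : A <= z by rewrite -ler_sqr ?nnegrE// z2 lerDl sqr_ge0.
suff zB : z <= k + 2 * C + 1 by split; [exact: le_trans Az zB|exact: le_trans bz zB].
have zz : z ^+ 2 <= (k + 2 * C) * z.
  rewrite z2 E mulrDl; apply: lerD.
    by apply: le_trans (ler_norm _) (le_trans hF _); rewrite ler_wpM2l.
  by apply: le_trans (ler_norm _) (le_trans hG _); rewrite (mulrC 2) -mulrA ler_wpM2l.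
rewrite leNgt; apply/negP => zB; have : z * (k + 2 * C + 1) <= z * z by rewrite ler_wpM2l// ltW.
have zp : 0 < z by apply: le_lt_trans zB; rewrite addr_ge0// addr_ge0// mulr_ge0.
rewrite -expr2; move=> h; have := le_trans h zz; rewrite mulrC ler_pM2r//; rewrite gerDl ler10//.
Qed.

(** The difference of the equations is tested with u - u'. The parameters may differ, so the collar
    terms are bounded separately by the H^1 norm of the test function, which [gradient_le] and the
    energy bound reduce to the square root of the L^2 distance; [h2_estimate] then covers second
    derivatives. *)
Lemma equilibria_diff_le : exists2 e1 : R, 0 < e1 & exists2 C : R, 0 <= C & forall u u' e e', Y12 u -> Y12 u' ->
  weak_eq e u -> weak_eq e' u' -> 0 < e -> e <= e1 -> 0 < e' -> e' <= e1 ->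
  [/\ forall i, nrm (wderiv Om [:: i] u \- wderiv Om [:: i] u') ^+ 2 <= C * Num.sqrt (nrm (u \- u')) &
      forall i j, nrm (wderiv Om [:: i; j] u \- wderiv Om [:: i; j] u') ^+ 2 <= C * Num.sqrt (nrm (u \- u'))].
Proof.
have [e1 e10 [B B0 HB]] := equilibria_energy_le.
have [e2 e20 [C C0 HC]] := g_collar_le.
have [D D0 HD] := h2_estimate oO bO sO sS Hpou snu nuE.
pose k := nrm (cst K); have k0 : 0 <= k := normL2_ge0 _ _ _.
(* Everything is measured by z = sqrt |u - u'|. Since |u - u'| <= 2 B, a full power is at most sqrt
   (2 B) z. C1 z bounds the squared Laplacian of the difference and C2 z its squared gradient. *)
pose s2B := Num.sqrt (2 * B); have s2B0 : 0 <= s2B := sqrtr_ge0 _.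
pose C1 := 2 * k * s2B + 2 * C * Num.sqrt (4 * B).
have C10 : 0 <= C1 by rewrite addr_ge0// mulr_ge0 ?mulr_ge0// sqrtr_ge0.
pose C2 := 2 * B * s2B; have C20 : 0 <= C2 by rewrite mulr_ge0// mulr_ge0// ltW.
exists (Num.min e1 e2); first by rewrite lt_min e10.
exists (C2 + D * (C1 + C2)) => [|u u' e e' Yu Yu' We We' e0 + e'0 +]; first by rewrite addr_ge0// mulr_ge0// addr_ge0.
rewrite !le_min => /andP[ee1 ee2] /andP[e'e1 e'e2].
have [Hu n0] := Y12_H2 Yu; have [Hu' n0'] := Y12_H2 Yu'.
have HDf := H2B oO bO Hu Hu'; have n0D := normal_trace0B oO bO sS Hpou snu Hu.2 Hu'.2 n0 n0'.
have YD := Y12_intro oO bO sS Hpou snu nuE HDf n0D.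
have Lu := Y12_L2 Yu; have Lu' := Y12_L2 Yu'; have Ll := Y12_laplacian_L2 Yu; have Ll' := Y12_laplacian_L2 Yu'.
have LD := L2B mO Lu Lu'; have LlD := Y12_laplacian_L2 YD.
pose LL x := lap u x - lap u' x; have LLL : L2O LL := L2B mO Ll Ll'.
have LLE : (fun x => \sum_i (wderiv Om [:: i; i] u \- wderiv Om [:: i; i] u') x) = LL.
  by apply/funext => x /=; rewrite sumrB.
have [_ El] := H2_laplacian oO bO Hpou HDf; rewrite LLE in El.
have dl w : L2O w -> dot w (lap (u \- u')) = dot w LL.
  move=> Lw; apply/eqP; rewrite -subr_eq0 -(dotL2Br mO LlD LLL Lw) dotL2C; apply/eqP.
  exact: (normL2_dot0 mO (L2B mO LlD LLL) Lw El).
have [bA bb] := HB _ _ Yu We e0 ee1; have [bA' bb'] := HB _ _ Yu' We' e'0 e'e1.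
have tB : 2 * B = B + B by rewrite mulr_natl mulr2n.
have A2B : nrm LL <= 2 * B by rewrite tB; exact: (le_trans (normL2B mO Ll Ll') (lerD bA bA')).
have b2B : nrm (u \- u') <= 2 * B by rewrite tB; exact: (le_trans (normL2B mO Lu Lu') (lerD bb bb')).
have := We _ YD; have := We' _ YD; rewrite !gt_eqF// !dl// => E2 E1.
have E : nrm LL ^+ 2 + nrm (u \- u') ^+ 2 = dot (f \o u) (u \- u') - dot (f \o u') (u \- u') +
    (g_collar Om g e u (u \- u') - g_collar Om g e' u' (u \- u')).
  rewrite !sqr_normL2 (dotL2Bl mO Ll Ll' LLL) (dotL2Bl mO Lu Lu' LD).
  exact: (sub_add_eq E1 E2).
have F1 := nemytskii_dot_le af Hu.1 LD; have F2 := nemytskii_dot_le af Hu'.1 LD.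
have G1 := HC _ _ _ _ _ Hu.1 HDf.1 e0 ee2; have G2 := HC _ _ _ _ _ Hu'.1 HDf.1 e'0 e'e2.
have gr := gradient_le HDf n0D; rewrite LLE in gr.
have sq0 i : 0 <= nrm (wderiv Om [:: i] u \- wderiv Om [:: i] u') ^+ 2 := sqr_ge0 _.
have hs := HD _ _ HDf.2 n0D (H2_sym oO bO Hpou HDf); rewrite LLE in hs.
pose b := nrm (u \- u'); pose A := nrm LL; pose z := Num.sqrt b.
have z0 : 0 <= z := sqrtr_ge0 _; have b0 : 0 <= b := normL2_ge0 _ _ _; have A0 : 0 <= A := normL2_ge0 _ _ _.
have bz : b <= s2B * z.
  by rewrite -[leLHS]sqr_sqrtr// expr2 ler_wpM2r//; apply: ler_wsqrtr.
have grz : \sum_i nrm (wderiv Om [:: i] u \- wderiv Om [:: i] u') ^+ 2 <= C2 * z.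
  apply: (le_trans gr); apply: le_trans (_ : 2 * B * b <= _); first by rewrite ler_wpM2r.
  by rewrite /C2 -[leRHS]mulrA ler_wpM2l// mulr_ge0// ltW.
have rt : Num.sqrt (H1sq (u \- u') (fun i => wderiv Om [:: i] u \- wderiv Om [:: i] u')) <= Num.sqrt (4 * B) * z.
  rewrite -sqrtrM ?mulr_ge0 ?(ltW B0)//; apply: ler_wsqrtr; rewrite H1sqE -/b.
  apply: le_trans (lerD (lexx _) gr) _; rewrite expr2 -/b -/A -mulrDl ler_wpM2r//.
  by apply: (le_trans (lerD b2B A2B)); rewrite -mulrDl -natrD.
have Az : A ^+ 2 <= C1 * z.
  apply: (@le_trans _ _ (2 * (k * b) + 2 * (C * (Num.sqrt (4 * B) * z)))); last first.
    have -> : C1 * z = 2 * (k * (s2B * z)) + 2 * (C * (Num.sqrt (4 * B) * z)) by rewrite /C1 [LHS]mulrDl -!mulrA.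
    by rewrite lerD2r ler_wpM2l// ler_wpM2l.
  have H3 := ler_wpM2l C0 rt.
  have : A ^+ 2 <= A ^+ 2 + b ^+ 2 by rewrite lerDl sqr_ge0.
  by rewrite {2}/A {2}/b E => /le_trans; apply; exact: (le_sub_norm2 F1 F2 (le_trans G1 H3) (le_trans G2 H3)).
have Cz : 0 <= D * (C1 + C2) * z by rewrite mulr_ge0// mulr_ge0// addr_ge0.
split=> [i|i j]; rewrite mulrDl.
  apply: le_trans (_ : C2 * z <= _); last by rewrite lerDl.
  exact: (le_trans (le_sum_term i sq0) grz).
apply: le_trans (_ : D * (C1 + C2) * z <= _); last by rewrite lerDr mulr_ge0.
apply: le_trans (_ : _ <= D * (A ^+ 2 + \sum_i nrm (wderiv Om [:: i] u \- wderiv Om [:: i] u') ^+ 2)) _.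
  pose F i j := nrm (wderiv Om [:: i; j] u \- wderiv Om [:: i; j] u') ^+ 2.
  have F0 i' j' : 0 <= F i' j' := sqr_ge0 _.
  have S0 i' : 0 <= \sum_j F i' j by apply: sumr_ge0.
  exact: (le_trans (le_sum_term j (F0 i)) (le_trans (le_sum_term i S0) hs)).
by rewrite -mulrA ler_wpM2l// mulrDl lerD.
Qed.

(** In the singular term both the function and the collar vary: g(u_k) is first replaced by g(u)
    with the uniform collar bound, and [collar_cvg] then takes the limit for a fixed function. *)
Lemma weak_eq_lim (eps_ : nat -> R) (u_ : nat -> E -> R) u q : (forall k, 0 < eps_ k) ->
  eps_ k @[k --> \oo] --> 0 -> (forall k, Y12 (u_ k)) -> (forall k, weak_eq (eps_ k) (u_ k)) ->
  H2 u (D1 u) q -> Y12 u -> nrm (u \- u_ k) @[k --> \oo] --> 0 ->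
  (forall i, nrm (wderiv Om [:: i] u \- wderiv Om [:: i] (u_ k)) @[k --> \oo] --> 0) ->
  nrm (lap u \- lap (u_ k)) @[k --> \oo] --> 0 -> weak_eq 0 u.
Proof.
move=> e0 ce Yu_ We Hu Yu cu cp cl phi Yphi; rewrite eqxx.
have [Hphi _] := Y12_H2 Yphi; have Lphi := Y12_L2 Yphi; have Llphi := Y12_laplacian_L2 Yphi.
have Hk k : H2 (u_ k) (D1 (u_ k)) (D2 (u_ k)) by have [] := Y12_H2 (Yu_ k).
have Lu := Y12_L2 Yu; have Lu_ k := Y12_L2 (Yu_ k).
have zz w : L2O w -> nrm (w \- w) @[k --> \oo] --> (0 : R).
  move=> Lw; rewrite (_ : (fun k : nat => _) = cst 0); first exact: cvg_cst.
  by apply/funext => k; rewrite -[RHS](normL2_0 leb mO); apply: eq_normL2 => x _ /=; rewrite subrr.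
have c1 : (fun k => dot (lap (u_ k)) (lap phi) + dot (u_ k) phi) @ \oo --> dot (lap u) (lap phi) + dot u phi.
  apply: cvgD.
    exact: (@cvg_dotL2 _ _ _ leb Om mO (fun k => lap (u_ k)) (fun=> lap phi) _ _ (fun k => Y12_laplacian_L2 (Yu_ k)) (Y12_laplacian_L2 Yu) (fun=> Llphi) Llphi cl (zz _ Llphi)).
  exact: (@cvg_dotL2 _ _ _ leb Om mO u_ (fun=> phi) _ _ Lu_ Lu (fun=> Lphi) Lphi cu (zz _ Lphi)).
have Lf k := H1_L2 (nemytskii_H1 af (Hk k).1); have Lfu := H1_L2 (nemytskii_H1 af Hu.1).
have cf : nrm ((f \o u) \- (f \o u_ k)) @[k --> \oo] --> 0.
  apply: (@squeeze_cvgr _ _ _ _ (cst 0) (fun k => K * nrm (u \- u_ k))).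
  - by apply: nearW => k; rewrite normL2_ge0 andTb; exact: (nemytskii_lip af Lfu (Lf k) Lu (Lu_ k)).
  - exact: cvg_cst.
  - by rewrite -[X in _ --> X](mulr0 K); apply: cvgM => //; exact: cvg_cst.
have c2 : (fun k => dot (f \o u_ k) phi) @ \oo --> dot (f \o u) phi.
  exact: (@cvg_dotL2 _ _ _ leb Om mO (fun k => f \o u_ k) (fun=> phi) _ _ Lf Lfu (fun=> Lphi) Lphi cf (zz _ Lphi)).
have Hgu := nemytskii_H1 ag Hu.1; have Hgk k := nemytskii_H1 ag (Hk k).1.
have c3 := collar_cvg oO bO sO sS Hpou snu nuE Hgu Hphi.1 e0 ce.
have [e1 e10 [C C0 HC]] := collar_norm_le oO bO sO sS Hpou snu nuE.
have HD k := H1B oO bO Hu.1 (Hk k).1.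
have cH : (fun k => K * (C * (Num.sqrt (H1sq (u \- u_ k) (fun i => wderiv Om [:: i] u \- wderiv Om [:: i] (u_ k))) * Num.sqrt (H1sq phi (D1 phi))))) @ \oo --> (0 : R).
  have E0 : (0 : R) = K * (C * (Num.sqrt (0 ^+ 2 + \sum_(i < n.+1) 0 ^+ 2) * Num.sqrt (H1sq phi (D1 phi)))).
    by rewrite expr0n /= big1// addr0 sqrtr0 mul0r !mulr0.
  rewrite [X in _ --> X]E0; apply: cvgM; first exact: cvg_cst.
  apply: cvgM; first exact: cvg_cst.
  apply: cvgM; last exact: cvg_cst.
  apply: (cvg_comp (fun k => H1sq (u \- u_ k) (fun i => wderiv Om [:: i] u \- wderiv Om [:: i] (u_ k))) Num.sqrt); last exact: sqrt_continuous.
  apply: cvgD; first exact: (cvg_sqr cu).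
  apply: (@cvg_sum_seq R _ _ (fun i k => nrm (wderiv Om [:: i] u \- wderiv Om [:: i] (u_ k)) ^+ 2) (fun=> 0 ^+ 2)) => i.
  exact: (cvg_sqr (cp i)).
(* The Lipschitz bound for g is used inside the collar norm, so g(u) - g(u_k) itself need not be
   estimated in H^1. *)
have c4 : (fun k => g_collar Om g (eps_ k) (u_ k) phi - (eps_ k)^-1 * dotC (eps_ k) (g \o u) phi) @ \oo --> (0 : R).
  apply/cvgr0Pnorm_le => d d0.
  have /cvgrPdist_le/(_ _ d0)[N1 _ HN1] := cH; have /cvgrPdist_le/(_ _ e10)[N2 _ HN2] := ce.
  exists (maxn N1 N2) => // k /=; rewrite geq_max => /andP[k1 k2].
  have := HN2 k k2; rewrite sub0r normrN (gtr0_norm (e0 k)) => ee1.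
  have := HN1 k k1; rewrite sub0r normrN => /(le_trans (ler_norm _)); apply: le_trans.
  rewrite /g_collar -mulrBr.
  have Lc w : L2O w -> L2C (eps_ k) w by move=> Lw; exact: (L2_col (e0 k) Lw).1.
  have Lg1 := Lc _ (H1_L2 (Hgk k)); have Lg2 := Lc _ (H1_L2 Hgu); have Lp := Lc _ Lphi; have LD := Lc _ (H1_L2 (HD k)).
  rewrite -(dotL2Bl (mC (e0 k)) Lg1 Lg2 Lp) normrM (gtr0_norm (x := (eps_ k)^-1)) ?invr_gt0//.
  apply: le_trans (ler_wpM2l (ltW K0) (HC _ _ _ _ _ (HD k) Hphi.1 (e0 k) ee1)); rewrite mulrCA ler_wpM2l ?invr_ge0 ?(ltW (e0 k))//.
  apply: le_trans (cauchy_schwarzL2 (mC (e0 k)) (L2B (mC (e0 k)) Lg1 Lg2) Lp) _.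
  rewrite mulrA ler_wpM2r ?normL2_ge0// -[in leRHS](gtr0_norm K0) -(normL2Z (mC (e0 k)) K LD).
  apply: (normL2_mono (mC (e0 k)) (L2B (mC (e0 k)) Lg1 Lg2) (L2Z (mC (e0 k)) K LD)) => x _ /=.
  by have [_ _ _ lg _] := admissibleP ag; rewrite normrM (gtr0_norm K0) [`|u x - _|]distrC.
have c5 : (fun k => dot (f \o u_ k) phi + g_collar Om g (eps_ k) (u_ k) phi) @ \oo --> dot (f \o u) phi + g_bdry Om S g u phi.
  have E5 k : g_collar Om g (eps_ k) (u_ k) phi = (g_collar Om g (eps_ k) (u_ k) phi - (eps_ k)^-1 * dotC (eps_ k) (g \o u) phi) + (eps_ k)^-1 * dotC (eps_ k) (g \o u) phi by rewrite subrK.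
  have c6 : (fun k => g_collar Om g (eps_ k) (u_ k) phi) @ \oo --> g_bdry Om S g u phi.
    have -> : (fun k => g_collar Om g (eps_ k) (u_ k) phi) = fun k => (g_collar Om g (eps_ k) (u_ k) phi - (eps_ k)^-1 * dotC (eps_ k) (g \o u) phi) + (eps_ k)^-1 * dotC (eps_ k) (g \o u) phi.
      by apply/funext => k; exact: E5.
    by rewrite -[X in _ --> X]add0r; exact: (cvgD c4 c3).
  exact: (cvgD c2 c6).
rewrite (_ : (fun k => _) = (fun k => dot (lap (u_ k)) (lap phi) + dot (u_ k) phi)) in c5.
  exact: (cvg_unique _ c1 c5).
by apply/funext => k; have := We k phi Yphi; rewrite gt_eqF// => ->.
Qed.

(** A sequence with vanishing parameters comes arbitrarily close to the limit set. [rellich] gives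
    Cauchy behaviour in L^2 only; [equilibria_diff_le] lifts it to all derivatives up to order
    two. *)
Lemma equilibria_compact : exists2 e1 : R, 0 < e1 & forall (eps_ : nat -> R) (w_ : nat -> @triple R n),
  (forall k, 0 < eps_ k <= e1) -> eps_ k @[k --> \oo] --> 0 ->
  (forall k, equilibria Om S f g (eps_ k) (w_ k)) ->
  forall d : R, 0 < d -> exists k (W : @triple R n), equilibria Om S f g 0 W /\ distX Om (w_ k) W <= d.
Proof.
have [e1 e10 [B B0 HB]] := equilibria_energy_le.
have [e2 e20 [C C0 HC]] := equilibria_diff_le.
exists (Num.min e1 e2) => [|eps_ w_ Heps ceps Hw d d0]; first by rewrite lt_min e10.
have e_gt0 k : 0 < eps_ k by have /andP[] := Heps k.
have e_le1 k : eps_ k <= e1 by have /andP[_] := Heps k; rewrite le_min => /andP[].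
have e_le2 k : eps_ k <= e2 by have /andP[_] := Heps k; rewrite le_min => /andP[].
pose u k := (w_ k).1.1.
have wE k : w_ k = (u k, (w_ k).1.2, (w_ k).2) by rewrite /u; case: (w_ k) => -[].
have Hk k : (Y12 (u k) /\ weak_eq (eps_ k) (u k)) /\ [/\ L2O (w_ k).1.2, L2O (w_ k).2, {ae leb, forall x, Om x -> (w_ k).1.2 x = 0} &
    forall phi, Y12 phi -> dot (w_ k).2 (lap phi) = dot (w_ k).2 phi].
  by apply/equilibriaP; rewrite -wE; exact: Hw.
have Yu k : Y12 (u k) := (Hk k).1.1; have We k : weak_eq (eps_ k) (u k) := (Hk k).1.2.
have Hu k : H2 (u k) (D1 (u k)) (D2 (u k)) by have [] := Y12_H2 (Yu k).
have n0 k : nt0 (D1 (u k)) by have [] := Y12_H2 (Yu k).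
have Lu k := Y12_L2 (Yu k).
have bA k : nrm (lap (u k)) <= B := (HB _ _ (Yu k) (We k) (e_gt0 k) (e_le1 k)).1.
have bu k : nrm (u k) <= B := (HB _ _ (Yu k) (We k) (e_gt0 k) (e_le1 k)).2.
have bp k i : nrm (wderiv Om [:: i] (u k)) <= B.
  rewrite -ler_sqr ?nnegrE ?normL2_ge0 ?(ltW B0)//.
  have sq0 j : 0 <= nrm (wderiv Om [:: j] (u k)) ^+ 2 := sqr_ge0 _.
  apply: le_trans (le_sum_term i sq0) (le_trans (gradient_le (Hu k) (n0 k)) _).
  by rewrite expr2 ler_pM ?normL2_ge0//; exact: bA.
have [sg [sgk cau]] := rellich oO bO Hcone Lu (fun k i => (Hu k).1.2 i) bu bp.
pose U k := u (sg k); have LU k : L2O (U k) := Lu _.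
have Cauchy (F : nat -> E -> R) : (forall k, L2O (F k)) ->
    (forall k l, nrm (F k \- F l) ^+ 2 <= C * Num.sqrt (nrm (U k \- U l))) ->
    exists2 G, L2O G & nrm (G \- F k) @[k --> \oo] --> 0.
  move=> LF HF; apply: (L2_complete mO LF) => e ep.
  (* Chosen so that C sqrt h <= e^2, inverting the square root in the estimate of differences. *)
  pose h := (e ^+ 2 / (C + 1)) ^+ 2; have C1 : 0 < C + 1 by rewrite ltr_wpDl.
  have q0 : 0 < e ^+ 2 / (C + 1) by rewrite divr_gt0// exprn_gt0.
  have h0 : 0 < h by rewrite exprn_gt0.
  have [N0 HN0] := cau _ h0; exists N0 => // M /= NM k l Mk Ml.
  rewrite -ler_sqr ?nnegrE ?normL2_ge0 ?(ltW ep)//; apply: (le_trans (HF k l)).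
  apply: (@le_trans _ _ (C * Num.sqrt h)).
    rewrite ler_wpM2l//; apply: ler_wsqrtr; apply: HN0; [exact: leq_trans NM Mk|exact: leq_trans NM Ml].
  rewrite /h sqrtr_sqr gtr0_norm// mulrCA ler_piMr ?sqr_ge0// ler_pdivrMr// mul1r lerDl//.
have dif k l := HC _ _ _ _ (Yu (sg k)) (Yu (sg l)) (We (sg k)) (We (sg l)) (e_gt0 _) (e_le2 _) (e_gt0 _) (e_le2 _).
have [u0 Lu0 cu0] : exists2 G, L2O G & nrm (G \- U k) @[k --> \oo] --> 0.
  apply: (L2_complete mO LU) => e ep; have [N0 HN0] := cau _ ep; exists N0 => // M /= NM k l Mk Ml.
  by apply: HN0; [exact: leq_trans NM Mk|exact: leq_trans NM Ml].
have Lp k i : L2O (wderiv Om [:: i] (U k)) := H1_gradL2 i (Hu _).1.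
have Lq k i j : L2O (wderiv Om [:: i; j] (U k)) := H1_gradL2 j ((Hu _).2 i).
have /choice[p0 Hp0] : forall i, exists G, L2O G /\ nrm (G \- wderiv Om [:: i] (U k)) @[k --> \oo] --> 0.
  move=> i; have [|G LG cG] := Cauchy (fun k => wderiv Om [:: i] (U k)) (fun k => Lp k i); last by exists G.
  by move=> k l; have [H _] := dif k l; exact: H.
have /choice[q0 Hq0] : forall ij : 'I_n.+1 * 'I_n.+1, exists G, L2O G /\ nrm (G \- wderiv Om [:: ij.1; ij.2] (U k)) @[k --> \oo] --> 0.
  move=> [i j]; have [|G LG cG] := Cauchy (fun k => wderiv Om [:: i; j] (U k)) (fun k => Lq k i j); last by exists G.
  by move=> k l; have [_ H] := dif k l; exact: H.
pose q1 i j := q0 (i, j).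
have Hu0 : H2 u0 p0 q1.
  split; first split=> // i.
    exact: (wd_lim oO bO LU Lu0 (Hp0 i).1 (fun k => (Hu (sg k)).1.2 i) cu0 (Hp0 i).2).
  move=> i; split=> [|j]; first exact: (Hp0 i).1.
  exact: (wd_lim oO bO (fun k => Lp k i) (Hp0 i).1 (Hq0 (i, j)).1 (fun k => ((Hu (sg k)).2 i).2 j) (Hp0 i).2 (Hq0 (i, j)).2).
have nt : nt0 p0.
  have cq0 i j : nrm (q1 i j \- wderiv Om [:: i; j] (U k)) @[k --> \oo] --> 0 := (Hq0 (i, j)).2.
  exact: (@normal_trace0_lim R n Om S oO bO sS N a r zeta Hpou nu snu nuE (fun k => D1 (U k)) (fun k => D2 (U k)) p0 q1
    (fun k i => (Hu (sg k)).2 i) Hu0.2 (fun k => n0 (sg k)) (fun i => (Hp0 i).2) cq0).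
have Y0 : Y12 u0 := Y12_intro oO bO sS Hpou snu nuE Hu0 nt.
have [Hw0 nw0] := Y12_H2 Y0; have [Ep Eq] := H2_uniq oO bO Hpou Hw0 Hu0.
(* The limits [p0] and [q0] agree with the weak derivatives selected for u0 up to norm zero; this
   transfers the convergence to the latter. *)
have tri w w' (F : nat -> E -> R) : L2O w -> L2O w' -> (forall k, L2O (F k)) -> nrm (w' \- w) = 0 ->
    nrm (w \- F k) @[k --> \oo] --> 0 -> nrm (w' \- F k) @[k --> \oo] --> 0.
  move=> Lw Lw' LF E0; apply: cvg_trans; apply: near_eq_cvg; apply: nearW => k; apply/eqP; rewrite eq_le; apply/andP; split.
    by apply: (le_trans (normL2_triangle mO Lw Lw' (LF k))); rewrite normL2_distC E0 add0r.
  by apply: (le_trans (normL2_triangle mO Lw' Lw (LF k))); rewrite E0 add0r.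
have cp i : nrm (wderiv Om [:: i] u0 \- wderiv Om [:: i] (U k)) @[k --> \oo] --> 0.
  exact: (tri _ _ (fun k => wderiv Om [:: i] (U k)) (Hp0 i).1 (H1_gradL2 i Hw0.1) (fun k => Lp k i) (Ep i) (Hp0 i).2).
have cq i j : nrm (wderiv Om [:: i; j] u0 \- wderiv Om [:: i; j] (U k)) @[k --> \oo] --> 0.
  exact: (tri _ _ (fun k => wderiv Om [:: i; j] (U k)) (Hq0 (i, j)).1 (H1_gradL2 j (Hw0.2 i)) (fun k => Lq k i j) (Eq i j) (Hq0 (i, j)).2).
have cl : nrm (lap u0 \- lap (U k)) @[k --> \oo] --> 0.
  apply: (cvg_nrm_sum oO (u_ := fun i k => wderiv Om [:: i; i] (U k)) (u := fun i => wderiv Om [:: i; i] u0)) => //.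
  by move=> i; exact: H1_gradL2 (Hw0.2 i).
have ceps' : eps_ (sg k) @[k --> \oo] --> 0.
  apply/cvgrPdist_le => e ep; have /cvgrPdist_le/(_ _ ep)[N0 _ HN0] := ceps.
  by exists N0 => // k /= Nk; apply: HN0; exact: leq_trans Nk (sgk k).
have We0 : weak_eq 0 u0.
  exact: (weak_eq_lim (fun k => e_gt0 (sg k)) ceps' (fun k => Yu (sg k)) (fun k => We (sg k)) Hw0 Y0 cu0 cp cl).
have cT : (fun k => nrm (lap u0 \- lap (U k)) + nrm (u0 \- U k)) @ \oo --> (0 : R).
  by rewrite -[X in _ --> X]addr0; exact: (cvgD cl cu0).
have /cvgrPdist_le/(_ _ d0)[N0 _ HN0] := cT; have := HN0 N0 (leqnn N0); rewrite sub0r normrN => /(le_trans (ler_norm _)) dN.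
have [_ [Lv Lth v0 Hth]] := Hk (sg N0).
(* The conditions on velocity and temperature do not involve the parameter, so those of [w_ (sg N0)]
   are kept and only the first component contributes to the distance. *)
exists (sg N0), (u0, (w_ (sg N0)).1.2, (w_ (sg N0)).2); split.
  by apply/equilibriaP; split=> //; split.
apply: le_trans dN; rewrite /distX /normX /=.
have z w : nrm (w \- w) = 0.
  by rewrite -[RHS](normL2_0 leb mO); apply: eq_normL2 => x _ /=; rewrite subrr.
rewrite !z !addr0 (normL2_distC _ _ u0) lerD2r /sqrtLambda normL2N.
have HDD := H2B oO bO (Hu (sg N0)) Hw0; have [LlD El] := H2_laplacian oO bO Hpou HDD.
have LlB : L2O (fun x => \sum_i (wderiv Om [:: i; i] (u (sg N0)) \- wderiv Om [:: i; i] u0) x).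
  by apply: (L2_sum mO) => i _; exact: (H1_gradL2 i (HDD.2 i)).
rewrite (normL2_dist0 mO LlD LlB El) normL2_distC le_eqVlt; apply/orP; left; apply/eqP.
by apply: eq_normL2 => x _ /=; rewrite sumrB.
Qed.

End equilibria_compactness.

(** * Upper semicontinuity *)

Section upper_semicontinuity.
Context {R : realType} {n : nat} (Om : set 'rV[R]_n.+1) (S : {measure set 'rV[R]_n.+1 -> \bar R}).
Variables (f g : R -> R) (K : R).

Lemma upper_semicontinuous_equilibria (eps0 : R) : open Om -> bounded_set Om -> smooth_bdry Om ->
  surface_measure Om S -> 0 < K -> admissible K f -> admissible K g ->
  semidistX Om (equilibria Om S f g eps) (equilibria Om S f g 0)
    @[eps --> within `]0, eps0] (nbhs (0 : R))] --> 0%E.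
Proof.
move=> oO bO sO sS K0 af ag.
have [N [a [r [zeta Hpou]]]] := pou_exists (closure_compact bO) (fun x cx => loc_exists oO sO cx).
have [nu [snu nuE]] := normal_extension oO Hpou.
have [e1 e10 HC] := equilibria_compact oO bO sO sS Hpou snu nuE K0 af ag.
have small d : 0 < d -> exists2 s : R, 0 < s & forall e : R, 0 < e < s ->
    (semidistX Om (equilibria Om S f g e) (equilibria Om S f g 0) <= d%:E)%E.
  move=> d0; apply: contrapT => H.
  (* Failure at every threshold gives equilibria with parameters at most 1/(k + 1) that stay farther
     than d from every limit equilibrium, against [equilibria_compact]. *)
  have /choice[ew Hew] : forall k : nat, exists ew : R * @triple R n, [/\ 0 < ew.1 <= e1, ew.1 <= k.+1%:R^-1,
      equilibria Om S f g ew.1 ew.2 & forall w0, equilibria Om S f g 0 w0 -> d < distX Om ew.2 w0].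
    move=> k; apply: contrapT => Hk; apply: H; exists (Num.min e1 k.+1%:R^-1); first by rewrite lt_min e10 /= invr_gt0 ltr0Sn.
    move=> e /andP[ep]; rewrite lt_min => /andP[/ltW ee1 /ltW ek].
    apply: ge_ereal_sup => y /= -[->|[w Ew <-]]; first by rewrite lee_fin ltW.
    rewrite leNgt; apply/negP => dw; apply: Hk; exists (e, w); split => //=; first by rewrite ep.
    move=> w0 Ew0; rewrite -lte_fin; apply: (lt_le_trans dw); apply: ereal_inf_lbound.
    by exists w0.
  have ceps : (ew k).1 @[k --> \oo] --> 0.
    apply: (@squeeze_cvgr _ _ _ _ (cst 0) (fun k => k.+1%:R^-1)); [|exact: cvg_cst|exact: cvg_harmonic].
    by apply: nearW => k; have [/andP[/ltW h1 _] h2 _ _] := Hew k; rewrite h1 h2.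
  have [k [w0 [Ew0 dw0]]] := HC (fun k => (ew k).1) (fun k => (ew k).2)
    (fun k => let: And4 h _ _ _ := Hew k in h) ceps (fun k => let: And4 _ _ h _ := Hew k in h) d d0.
  by have [_ _ _ /(_ w0 Ew0)] := Hew k; rewrite ltNge dw0.
(* Halving d turns the non-strict bound into the strict inequality that defines the
   neighbourhood. *)
move=> A [d /= d0 HA]; have [s s0 Hs] := small (d / 2) (divr_gt0 d0 (ltr0Sn _ _)).
exists s => //= e; rewrite /ball_ /= sub0r normrN => es; rewrite in_itv /= => /andP[e0 _].
have le := Hs e; rewrite e0 -(gtr0_norm e0) es in le; move: (le isT) => {le}; rewrite gtr0_norm//.
(* Nonnegativity comes from the 0 adjoined in the supremum and excludes the value -oo. *)
have : (0 <= semidistX Om (equilibria Om S f g e) (equilibria Om S f g 0))%E.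
  by apply: ereal_sup_ubound; left.
case: (semidistX _ _ _) => [x| |//]; last by rewrite leye_eq.
rewrite !lee_fin => x0 xd; apply: HA; rewrite /ball_ /= sub0r normrN ger0_norm//.
by apply: (le_lt_trans xd); rewrite ltr_pdivrMr// ltr_pMr// ltr1n.
Qed.

End upper_semicontinuity.

Theorem theorem4p5 (R : realType) (Omega : set 'rV[R]_5)
  (S : {measure set 'rV[R]_5 -> \bar R}) (f g : R -> R) (K eps0 : R) :
  open Omega -> bounded_set Omega -> smooth_bdry Omega ->
  surface_measure Omega S ->
  0 < K -> admissible K f -> admissible K g ->
  0 < eps0 ->
  semidistX Omega (equilibria Omega S f g eps) (equilibria Omega S f g 0)
    @[eps --> within `]0, eps0] (nbhs (0 : R))] --> 0%E.
Proof.
by move=> oO bO sO sS K0 af ag _; exact: (upper_semicontinuous_equilibria eps0 oO bO sO sS K0 af ag).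
Qed.
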